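(* Let $N\ge2$. In $\mathcal{D}Y_{\hbar}(\mathfrak{gl}_N)$ the currents $k^{\pm}_i(u)$ $(1\le i\le N)$ and $X^{\pm}_i(u)$ $(1\le i\le N-1)$ satisfy the following relations. 1. $k_{i}^{\pm}(u)k_{j}^{\pm}(v)=k_{j}^{\pm}(v)k_{i}^{\pm}(u)$ for all $i,j$, and $k_{i}^{+}(u)k_{i}^{-}(v)=k_{i}^{-}(v)k_{i}^{+}(u)$ for all $i$. 2. For $i>j$: $\displaystyle \frac{u_{\mp}-v_{\pm}}{u_{\mp}-v_{\pm}+\hbar}\,k_{i}^{\mp}(v)^{-1}k_{j}^{\pm}(u)=\frac{u_{\pm}-v_{\mp}}{u_{\pm}-v_{\mp}+\hbar}\,k_{j}^{\pm}(u)k_{i}^{\mp}(v)^{-1}$. 3. $\displaystyle k_{i}^{\pm}(u)^{-1}X_{i}^{+}(v)k_{i}^{\pm}(u)=\frac{u_{\pm}-v+\hbar}{u_{\pm}-v}X_{i}^{+}(v)$, $\displaystyle\quad k_{i}^{\pm}(u)X_{i}^{-}(v)k_{i}^{\pm}(u)^{-1}=\frac{u_{\mp}-v+\hbar}{u_{\mp}-v}X_{i}^{-}(v)$. 4. $\displaystyle k_{i+1}^{\pm}(u)^{-1}X_{i}^{+}(v)k_{i+1}^{\pm}(u)=\frac{u_{\pm}-v-\hbar}{u_{\pm}-v}X_{i}^{+}(v)$, $\displaystyle\quad k_{i+1}^{\pm}(u)X_{i}^{-}(v)k_{i+1}^{\pm}(u)^{-1}=\frac{u_{\mp}-v-\hbar}{u_{\mp}-v}X_{i}^{-}(v)$.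 5. For $j\ne i,i+1$: $k_{j}^{\pm}(u)^{-1}X_{i}^{+}(v)k_{j}^{\pm}(u)=X_{i}^{+}(v)$ and $k_{j}^{\pm}(u)X_{i}^{-}(v)k_{j}^{\pm}(u)^{-1}=X_{i}^{-}(v)$. 6. $(u-v\mp\hbar)X_{i}^{\pm}(u)X_{i}^{\pm}(v)=(u-v\pm\hbar)X_{i}^{\pm}(v)X_{i}^{\pm}(u)$. 7. $(u-v+\hbar)X_{i}^+(u)X_{i+1}^+(v)=(u-v)X_{i+1}^+(v)X_{i}^+(u)$ and $(u-v)X_{i}^-(u)X_{i+1}^-(v)=(u-v+\hbar)X_{i+1}^-(v)X_{i}^-(u)$. 8. For $|i-j|=1$: $X_{i}^{\pm}(u_1)X_{i}^{\pm}(u_2)X_{j}^{\pm}(v)-2X_{i}^{\pm}(u_1)X_{j}^{\pm}(v)X_{i}^{\pm}(u_2)+X_{j}^{\pm}(v)X_{i}^{\pm}(u_1)X_{i}^{\pm}(u_2)+\{u_1\leftrightarrow u_2\}=0$. 9. For $|i-j|>1$: $X_{i}^{\pm}(u)X_{j}^{\pm}(v)=X_{j}^{\pm}(v)X_{i}^{\pm}(u)$. 10. $[X_{i}^+(u),X_{j}^-(v)]=\hbar\,\delta_{ij}\left\{\delta(u_{-}-v_{+})k_{i+1}^+(u_{-})k_{i}^+(u_{-})^{-1}-\delta(u_{+}-v_{-})k_{i+1}^-(v_{-})k_{i}^-(v_{-})^{-1}\right\}$.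
   Context: Let $\mathcal{A}=\mathbb{C}[[\hbar]]$, let $V$ be a free $\mathcal{A}$-module of rank $N$, $\mathcal{P}\in\mathrm{End}(V\otimes V)$ the permutation $\mathcal{P}(v\otimes w)=w\otimes v$, and $R(u)=\frac{1}{u+\hbar}(uI+\hbar\mathcal{P})$, expanded in nonnegative powers of $\hbar$. $\mathcal{D}Y_{\hbar}(\mathfrak{gl}_N)$ is the topological ($\hbar$-adically complete) algebra over $\mathcal{A}$ generated by $\{t_{ij}^k\mid 1\le i,j\le N,\ k\in\mathbb{Z}\}$ and $c$; with $t_{ij}^{+}(u)=\delta_{ij}-\hbar\sum_{k\ge0}t_{ij}^{k}u^{-k-1}$, $t_{ij}^{-}(u)=\delta_{ij}+\hbar\sum_{k<0}t_{ij}^{k}u^{-k-1}$, $T^{\pm}(u)=(t^{\pm}_{ij}(u))$, the defining relations are $$[T^{\pm}(u),c]=0,\qquad R(u-v)\overset{1}{T^{\pm}}(u)\overset{2}{T^{\pm}}(v)=\overset{2}{T^{\pm}}(v)\overset{1}{T^{\pm}}(u)R(u-v),$$ $$R(u_{-}-v_{+})\overset{1}{T^{+}}(u)\overset{2}{T^{-}}(v)=\overset{2}{T^{-}}(v)\overset{1}{T^{+}}(u)R(u_{+}-v_{-}),$$ where $\overset{1}{T}(u)=T(u)\otimes\mathrm{id}$, $\overset{2}{T}(u)=\mathrm{id}\otimes T(u)$, $u_{\pm}=u\pm\frac14\hbar c$, $v_\pm=v\pm\frac14\hbar c$. Expansion conventions: rational functions are expanded in nonnegative powers of $\hbar$, and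 powers of $(u-v)^{-1}$ multiplying products of a $+$ series in $u$ (resp. a $-$ series in $u$) are expanded in $u^{-1},v$ (resp. $u,v^{-1}$). Gauss decomposition: $T^{\pm}(u)=F^{\pm}(u)\,\mathrm{diag}(k^{\pm}_1(u),\dots,k^{\pm}_N(u))\,E^{\pm}(u)$ with $F^{\pm}(u)$ lower unitriangular with entries $f^{\pm}_{i,j}(u)$ $(i>j)$ and $E^{\pm}(u)$ upper unitriangular with entries $e^{\pm}_{i,j}(u)$ $(i<j)$; all entries lie in $\mathcal{D}Y_{\hbar}(\mathfrak{gl}_N)[[u^{\mp1}]]$. For $1\le i\le N-1$, $$X_{i}^-(u)=f_{i+1,i}^+(u_+)-f_{i+1,i}^-(u_-),\qquad X_{i}^+(u)=e_{i,i+1}^+(u_-)-e_{i,i+1}^-(u_+).$$ $\delta(u-v)=\sum_{k\in\mathbb{Z}}u^{-k-1}v^k$ is the formal delta function; $\delta(u-v+a\hbar)$ is understood by Taylor expansion in $\hbar$. *)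

(* Defs.v *)
From HB Require Import structures.
From mathcomp Require Import all_boot all_order all_algebra.
From mathcomp Require Import generic_quotient ring_quotient.
From mathcomp Require Import boolp classical_sets functions reals.
From mathcomp.real_closed Require Import complex.
From mathcomp.multinomials Require Import monalg.

Set Implicit Arguments.
Unset Strict Implicit.
Unset Printing Implicit Defensive.

Import GRing.Theory.

Local Open Scope ring_scope.

(* [FPS a] is the sum of all [a n * hbar ^ n], over a possibly noncommutative
   coefficient ring with which hbar commutes. *)
Record fps (S : Type) := FPS { fcoef : nat -> S }.

HB.instance Definition _ S := [isNew for @fcoef S].
HB.instance Definition _ (S : choiceType) := [Choice of fps S by <:].

Section FpsRing.
Variable S : pzRingType.
Implicit Types p q r : fps S.

Lemma fpsP p q : (forall n, fcoef p n = fcoef q n) -> p = q.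
Proof. by case: p q => [p] [q] /= pq; congr FPS; apply: funext. Qed.

Definition fps0 : fps S := FPS (fun=> 0).
Definition fpsN p := FPS (fun n => - fcoef p n).
Definition fpsD p q := FPS (fun n => fcoef p n + fcoef q n).
Definition fps1 : fps S := FPS (fun n => (n == 0)%:R).
Definition fpsM p q := FPS (fun n => \sum_(i < n.+1) fcoef p i * fcoef q (n - i)).

Lemma fpsDA : associative fpsD.
Proof. by move=> p q r; apply: fpsP => n /=; rewrite addrA. Qed.

Lemma fpsDC : commutative fpsD.
Proof. by move=> p q; apply: fpsP => n /=; rewrite addrC. Qed.

Lemma fps0D : left_id fps0 fpsD.
Proof. by move=> p; apply: fpsP => n /=; rewrite add0r. Qed.

Lemma fpsND : left_inverse fps0 fpsN fpsD.
Proof. by move=> p; apply: fpsP => n /=; rewrite addNr. Qed.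

HB.instance Definition _ := GRing.isZmodule.Build (fps S) fpsDA fpsDC fps0D fpsND.

Lemma fpsM_rev p q n :
  fcoef (fpsM p q) n = \sum_(i < n.+1) fcoef p (n - i) * fcoef q i.
Proof.
rewrite /= (reindex_inj rev_ord_inj) /=.
by apply: eq_bigr => i _; rewrite subSS subKn // -ltnS.
Qed.

Lemma fpsMA : associative fpsM.
Proof.
move=> p q r; apply: fpsP => n; rewrite [RHS]fpsM_rev.
pose F i j := fcoef p i * (fcoef q (n - i - j) * fcoef r j).
transitivity (\sum_(i < n.+1) \sum_(j < n.+1 | (j <= n - i)%N) F i j).
  apply: eq_bigr => i _; rewrite fpsM_rev big_distrr /=.
  by rewrite (big_ord_narrow_leq (leq_subr _ _)).
rewrite (exchange_big_dep predT) //=; apply: eq_bigr => k _.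
transitivity (\sum_(j < n.+1 | (j <= n - k)%N) F j k).
  apply: eq_bigl => j; rewrite -ltnS -(ltnS j) -!subSn ?leq_ord //.
  by rewrite -subn_gt0 -(subn_gt0 j) -!subnDA addnC.
rewrite (big_ord_narrow_leq (leq_subr _ _)) big_distrl /=.
by apply: eq_bigr => j _; rewrite /F -!subnDA addnC mulrA.
Qed.

Lemma fps1M : left_id fps1 fpsM.
Proof.
move=> p; apply: fpsP => n /=; rewrite big_ord_recl /= mul1r subn0.
by rewrite big1 ?addr0 // => i _; rewrite mul0r.
Qed.

Lemma fpsM1 : right_id fps1 fpsM.
Proof.
move=> p; apply: fpsP => n; rewrite [LHS]fpsM_rev big_ord_recl /= mulr1 subn0.
by rewrite big1 ?addr0 // => i _; rewrite mulr0.
Qed.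

Lemma fpsMDl : left_distributive fpsM +%R.
Proof.
move=> p q r; apply: fpsP => n /=.
by rewrite -big_split; apply: eq_bigr => i _; rewrite mulrDl.
Qed.

Lemma fpsMDr : right_distributive fpsM +%R.
Proof.
move=> p q r; apply: fpsP => n /=.
by rewrite -big_split; apply: eq_bigr => i _; rewrite mulrDr.
Qed.

HB.instance Definition _ :=
  GRing.Zmodule_isPzRing.Build (fps S) fpsMA fps1M fpsM1 fpsMDl fpsMDr.

Definition fpsC (a : S) : fps S := FPS (fun n => if n == 0%N then a else 0).
Definition fpsX : fps S := FPS (fun n => (n == 1)%:R).

End FpsRing.

Section FpsMap.
Variables (S S' : pzRingType) (g : {rmorphism S -> S'}).

Definition fps_map (p : fps S) : fps S' := FPS (fun n => g (fcoef p n)).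

Lemma fps_map_is_zmod_morphism : zmod_morphism fps_map.
Proof. by move=> p q; apply: fpsP => n /=; rewrite rmorphB. Qed.

Lemma fps_map_is_monoid_morphism : monoid_morphism fps_map.
Proof.
split=> [|p q]; apply: fpsP => n /=; first by rewrite rmorph_nat.
by rewrite rmorph_sum; apply: eq_bigr => i _; rewrite rmorphM.
Qed.

HB.instance Definition _ :=
  GRing.isZmodMorphism.Build (fps S) (fps S') fps_map fps_map_is_zmod_morphism.
HB.instance Definition _ :=
  GRing.isMonoidMorphism.Build (fps S) (fps S') fps_map fps_map_is_monoid_morphism.

End FpsMap.

Section HAlgebra.
Variable R : realType.

(* C[[hbar]]; [halg] is the type of associative unital algebras over it. *)
Definition A0 : pzRingType := fps R[i].

Record halg := HAlg {
  hcarrier :> pzRingType;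
  hstr : {rmorphism A0 -> hcarrier};
  hstr_central : forall a x, hstr a * x = x * hstr a }.

Variable B : halg.

Definition hbar : B := hstr B (fpsX _).
Definition scal (z : R[i]) : B := hstr B (fpsC z).

(* [has_hsum x b]: the family [x] is unconditionally summable, with sum [b],
   for the hbar-adic topology of [B]. *)
Definition has_hsum (I : eqType) (x : I -> B) (b : B) : Prop :=
  forall n : nat, exists r0 : seq I, forall r : seq I,
    uniq r -> {subset r0 <= r} ->
    exists y : B, b - \sum_(i <- r) x i = hbar ^+ n * y.

Definition hsum (I : eqType) (x : I -> B) : B :=
  xget 0 [set b | has_hsum x b]%classic.

Record hideal := HIdeal {
  hideal_set :> B -> Prop;
  hideal0 : hideal_set 0;
  hidealB : forall x y, hideal_set x -> hideal_set y -> hideal_set (x - y);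
  hidealMl : forall a x, hideal_set x -> hideal_set (a * x);
  hidealMr : forall a x, hideal_set x -> hideal_set (x * a) }.

(* Closedness in the hbar-adic topology. *)
Definition hclosed (I : set B) : Prop := forall x : B,
  (forall n : nat, exists2 y : B, I y & exists z : B, x = y + hbar ^+ n * z) ->
  I x.

Section Generated.
Variable P : set B.

Definition gen_ideal_set : set B := fun x =>
  forall I : hideal, hclosed I -> (forall y, P y -> I y) -> I x.

Definition gen_ideal : hideal.
Proof.
refine (@HIdeal gen_ideal_set _ _ _ _).
- by move=> I _ _; exact: hideal0.
- by move=> x y Px Py I Ic PI; apply: hidealB; [exact: Px|exact: Py].
- by move=> a x Px I Ic PI; apply: hidealMl; exact: Px.
- by move=> a x Px I Ic PI; apply: hidealMr; exact: Px.
Defined.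

Lemma gen_ideal_closed : hclosed gen_ideal.
Proof.
move=> x xP I Ic PI; apply: (Ic) => n; have [y Iy [z ->]] := xP n.
by exists y; [exact: Iy Ic PI|exists z].
Qed.

Lemma sub_gen_ideal x : P x -> gen_ideal x.
Proof. by move=> Px I _; apply. Qed.

End Generated.

Section Quotient.
Variable I : hideal.

Definition hideal_mem : {pred B} := fun x => `[< I x >].

Lemma hideal_mem_zmod_closed : zmod_closed hideal_mem.
Proof.
split=> [|x y /asboolP Ix /asboolP Iy]; apply/asboolP; first exact: hideal0.
exact: hidealB.
Qed.

HB.instance Definition _ := GRing.isZmodClosed.Build B hideal_mem hideal_mem_zmod_closed.

Definition hquot : Type := Quotient.quot hideal_mem.
HB.instance Definition _ := GRing.Zmodule.on hquot.
Definition hpi (x : B) : hquot := (\pi_(Quotient.quot hideal_mem) x)%qT.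
Definition hrepr (x : hquot) : B := repr (x : Quotient.quot hideal_mem).

Lemma hreprK : cancel hrepr hpi.
Proof. exact: reprK. Qed.

Lemma hpiP x y : hpi x = hpi y <-> I (x - y).
Proof.
split=> [/eqP|Ixy]; first by rewrite -Quotient.idealrBE => /asboolP.
by apply/eqP; rewrite -Quotient.idealrBE; apply/asboolP.
Qed.

Lemma hpi_is_zmod_morphism : zmod_morphism hpi.
Proof. by move=> x y; rewrite /hpi !piE. Qed.

HB.instance Definition _ := GRing.isZmodMorphism.Build B hquot hpi hpi_is_zmod_morphism.

Definition hquot_mul (x y : hquot) : hquot := hpi (hrepr x * hrepr y).

Lemma hpiM x y : hpi (x * y) = hquot_mul (hpi x) (hpi y).
Proof.
apply/hpiP; set x' := hrepr _; set y' := hrepr _.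
have Ix : I (x - x') by apply/hpiP; rewrite hreprK.
have Iy : I (y - y') by apply/hpiP; rewrite hreprK.
have -> : x * y - x' * y' = (x - x') * y - (- (x' * (y - y'))).
  by rewrite opprK mulrBl mulrBr addrA subrK.
apply: hidealB; first exact: hidealMr.
by rewrite -mulNr; exact: hidealMl.
Qed.

Lemma hquot_mulA : associative hquot_mul.
Proof.
by move=> x y z; rewrite -[x]hreprK -[y]hreprK -[z]hreprK -!hpiM mulrA.
Qed.

Lemma hquot_mul1 : left_id (hpi 1) hquot_mul.
Proof. by move=> x; rewrite -[x]hreprK -hpiM mul1r. Qed.

Lemma hquot_mulr1 : right_id (hpi 1) hquot_mul.
Proof. by move=> x; rewrite -[x]hreprK -hpiM mulr1. Qed.

Lemma hquot_mulDl : left_distributive hquot_mul +%R.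
Proof.
move=> x y z; rewrite -[x]hreprK -[y]hreprK -[z]hreprK.
by rewrite -raddfD -!hpiM mulrDl raddfD.
Qed.

Lemma hquot_mulDr : right_distributive hquot_mul +%R.
Proof.
move=> x y z; rewrite -[x]hreprK -[y]hreprK -[z]hreprK.
by rewrite -raddfD -!hpiM mulrDr raddfD.
Qed.

HB.instance Definition _ := GRing.Zmodule_isPzRing.Build hquot
  hquot_mulA hquot_mul1 hquot_mulr1 hquot_mulDl hquot_mulDr.

Lemma hpi_is_monoid_morphism : monoid_morphism hpi.
Proof. by split=> // x y; rewrite hpiM. Qed.

HB.instance Definition _ :=
  GRing.isMonoidMorphism.Build B hquot hpi hpi_is_monoid_morphism.

Lemma hquot_central a (x : hquot) :
  (hpi \o hstr B) a * x = x * (hpi \o hstr B) a.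
Proof. by rewrite -[x]hreprK /= -!rmorphM hstr_central. Qed.

Definition hquot_halg : halg := HAlg hquot_central.

End Quotient.
End HAlgebra.

(* The superscripts + and -. *)
Variant polarity := Pos | Neg.

Section Distributions.
Variables (R : realType) (B : halg R).

(* [E -> B] with [E] a group of exponents is the space of two-sided formal
   distributions: [E := int] for one variable and [E := {ffun 'I_n -> int}]
   for [n] variables; [f d] is the coefficient of the monomial of exponent [d].
   The product is the convolution, each coefficient being an hbar-adic sum. *)
Definition dmul (E : zmodType) (f g : E -> B) : E -> B :=
  fun d => hsum (fun d' : E => f d' * g (d - d')).

Definition dconst (E : zmodType) (b : B) : E -> B :=
  fun d => if d == 0 then b else 0.

Definition dexp (E : zmodType) (f : E -> B) (n : nat) : E -> B :=
  iter n (dmul f) (dconst 1).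

Definition fseries := int -> B.
Definition dist (n : nat) := {ffun 'I_n -> int} -> B.

(* [f] in B[[u^-1]] (for Pos), resp. B[[u]] (for Neg). *)
Definition one_sided (s : polarity) (f : fseries) : Prop :=
  forall m : int, (if s is Pos then 0 < m else m < 0) -> f m = 0.

Definition dinv (s : polarity) (f : fseries) : fseries :=
  xget 0 [set g | [/\ one_sided s g, dmul f g = dconst 1
                    & dmul g f = dconst 1]]%classic.

Definition dderiv (f : fseries) : fseries := fun m => f (m + 1) *~ (m + 1).

(* The Taylor expansion of [f (u + hbar a)]. *)
Definition dshift (a : B) (f : fseries) : fseries := fun m =>
  hsum (fun n : nat =>
    scal B (n`!%:R)^-1 * (hbar B * a) ^+ n * iter n dderiv f m).

(* The one-variable series [f] in the variable [x] among [n] variables. *)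
Definition at_var (n : nat) (f : fseries) (x : 'I_n) : dist n := fun d =>
  if [forall y, (y != x) ==> (d y == 0)] then f (d x) else 0.

Definition u2 : 'I_2 := ord0.
Definition v2 : 'I_2 := ord_max.

(* [u - v + hbar a]. *)
Definition umv (a : B) : dist 2 := fun d =>
  at_var (fun m => (m == 1)%:R) u2 d - at_var (fun m => (m == 1)%:R) v2 d
  + dconst (hbar B * a) d.

(* (u - v)^-1, expanded in u^-1, v (for Pos), resp. in u, v^-1 (for Neg). *)
Definition inv_uv (s : polarity) : dist 2 := fun d =>
  if d u2 + d v2 == - 1 then
    match s with Pos => (0 <= d v2)%R%:R | Neg => - (0 <= d u2)%R%:R end
  else 0.

(* (u - v + hbar a)^-1, expanded in nonnegative powers of hbar. *)
Definition inv_umv (s : polarity) (a : B) : dist 2 := fun d =>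
  hsum (fun n : nat => (- (hbar B * a)) ^+ n * dexp (inv_uv s) n.+1 d).

(* (u - v + hbar a) / (u - v + hbar b). *)
Definition uv_ratio (s : polarity) (a b : B) : dist 2 :=
  dmul (umv a) (inv_umv s b).

(* The Taylor expansion of [delta (u - v + hbar a)], where
   [delta (u - v)] is the sum of all u^(-k-1) v^k. *)
Definition ddelta (a : B) : dist 2 := fun d =>
  dshift a (fun m => (m + d v2 == - 1)%:R) (d u2).

End Distributions.

Notation "f ** g" := (dmul f g) (at level 40, left associativity).
Notation "f '\at' x" := (at_var f x) (at level 35, x at level 8).

(* [u3], [u3'] and [v3] are the variables u_1, u_2 and v. *)
Definition u3 : 'I_3 := ord0.
Definition u3' : 'I_3 := Ordinal (isT : 1 < 3)%N.
Definition v3 : 'I_3 := ord_max.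

(* f(x1) f(x2) g(y) - 2 f(x1) g(y) f(x2) + g(y) f(x1) f(x2). *)
Definition serre (R : realType) (B : halg R) (n : nat) (f g : fseries B)
    (x1 x2 y : 'I_n) : dist B n := fun d =>
  (f \at x1 ** f \at x2 ** g \at y) d
  - (f \at x1 ** g \at y ** f \at x2) d *+ 2
  + (g \at y ** f \at x1 ** f \at x2) d.

Definition sgn_mul (V : zmodType) (s : polarity) (x : V) : V :=
  if s is Pos then x else - x.

Definition opp_pol (s : polarity) : polarity := if s is Pos then Neg else Pos.

Section Relations.
Variables (R : realType) (B : halg R) (N : nat).
Variables (t : 'I_N -> 'I_N -> int -> B) (c : B).

(* hbar^-1 times the shift from [u] to [u_+]. *)
Definition qc : B := scal B 4^-1 * c.

(* [f (u_+)] for [s = Pos] and [f (u_-)] for [s = Neg]. *)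
Definition pm_shift (s : polarity) (f : fseries B) : fseries B :=
  dshift (sgn_mul s qc) f.

Definition Tser (s : polarity) (i j : 'I_N) : fseries B := fun m =>
  (if m == 0 then (i == j)%:R else 0) +
  match s with
  | Pos => if m < 0 then - (hbar B * t i j (- m - 1)) else 0
  | Neg => if 0 <= m then hbar B * t i j (- m - 1) else 0
  end.

(* End (V (x) V) over distributions in [u, v], in the basis [e_i (x) e_j]. *)
Definition endVV := 'I_N * 'I_N -> 'I_N * 'I_N -> dist B 2.

Definition endVV_mul (M M' : endVV) : endVV := fun x y d =>
  \sum_z (M x z ** M' z y) d.

Definition T1 (s : polarity) : endVV := fun x y d =>
  if x.2 == y.2 then (Tser s x.1 y.1 \at u2) d else 0.

Definition T2 (s : polarity) : endVV := fun x y d =>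
  if x.1 == y.1 then (Tser s x.2 y.2 \at v2) d else 0.

(* [R (u - v + hbar a)] where R(x) = (x I + hbar P) / (x + hbar), the denominator
   being expanded according to the sign [s] of the series in [u]. *)
Definition Rmat (s : polarity) (a : B) : endVV := fun x y =>
  inv_umv s (a + 1) ** (fun d =>
    (if x == y then umv a d else 0) +
    (if (x.1 == y.2) && (x.2 == y.1) then dconst (hbar B) d else 0)).

Definition RTT_lhs (s s' : polarity) (a : B) : endVV :=
  endVV_mul (endVV_mul (Rmat s a) (T1 s)) (T2 s').

Definition RTT_rhs (s s' : polarity) (a : B) : endVV :=
  endVV_mul (endVV_mul (T2 s') (T1 s)) (Rmat s a).

(* All coefficients of (left-hand side) - (right-hand side) of the defining
   relations.  In the last one [u_- - v_+ = u - v - hbar c / 2] and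
   [u_+ - v_- = u - v + hbar c / 2].  The powers of hbar that occur in these
   coefficients are not divided out. *)
Inductive relator : B -> Prop :=
| rel_central s i j m : relator (Tser s i j m * c - c * Tser s i j m)
| rel_RTT s x y d : relator (RTT_lhs s s 0 x y d - RTT_rhs s s 0 x y d)
| rel_RTT_mixed x y d :
    relator (RTT_lhs Pos Neg (- (qc *+ 2)) x y d
             - RTT_rhs Pos Neg (qc *+ 2) x y d).

(* [T^s (u) = F diag (k_1, ..., k_N) E], with [F] lower and [E] upper
   unitriangular, all over B[[u^-1]] (Pos) or B[[u]] (Neg). *)
Definition is_gauss (s : polarity) (f : 'I_N -> 'I_N -> fseries B)
    (k : 'I_N -> fseries B) (e : 'I_N -> 'I_N -> fseries B) : Prop :=
  [/\ forall i j, [/\ one_sided s (f i j), one_sided s (k i)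
                     & one_sided s (e i j)],
      forall i j : 'I_N, (i < j)%N -> f i j = 0 /\ e j i = 0,
      forall i, f i i = dconst 1 /\ e i i = dconst 1
    & forall i j m, Tser s i j m = \sum_l ((f i l ** k l) ** e l j) m].

(* The index [i] and its successor in {1..N}, for 1 <= i <= N - 1. *)
Definition ix (i : 'I_N.-1) : 'I_N := widen_ord (leq_pred N) i.

Fact ixS_subproof (i : 'I_N.-1) : (i.+1 < N)%N.
Proof. by rewrite -ltn_predRL ltn_ord. Qed.

Definition ixS (i : 'I_N.-1) : 'I_N := Ordinal (ixS_subproof i).

(* [X Pos i] is X_i^+ and [X Neg i] is X_i^-. *)
Definition X (f e : polarity -> 'I_N -> 'I_N -> fseries B)
    (s : polarity) (i : 'I_N.-1) : fseries B := fun m =>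
  match s with
  | Pos => pm_shift Neg (e Pos (ix i) (ixS i)) m
           - pm_shift Pos (e Neg (ix i) (ixS i)) m
  | Neg => pm_shift Pos (f Pos (ixS i) (ix i)) m
           - pm_shift Neg (f Neg (ixS i) (ix i)) m
  end.

End Relations.

Section DoubleYangian.
Variables (R : realType) (N : nat).

(* [Some (i, j, k)] is the generator t_ij^k, and [None] is c. *)
Definition DYgen := option ('I_N * 'I_N * int).
Definition free_alg : pzRingType := {malg R[i][{fmonom DYgen}]}.

Lemma malgC_central (a : R[i]) (x : free_alg) : malgC a * x = x * malgC a.
Proof.
rewrite [x]monalgE mulr_sumr mulr_suml; apply: eq_bigr => k _.
by rewrite !malgM_def !fgmulUU mul1m mulm1 mulrC.
Qed.

(* The hbar-adic completion of the free C[[hbar]]-algebra on [DYgen]. *)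
Definition hfree_str : {rmorphism A0 R -> fps free_alg} :=
  fps_map (malgC : {rmorphism R[i] -> free_alg}).

Lemma hfree_central a x : hfree_str a * x = x * hfree_str a.
Proof.
apply: fpsP => n; rewrite [RHS]fpsM_rev.
by apply: eq_bigr => i _; exact: malgC_central.
Qed.

Definition hfree : halg R := HAlg hfree_central.

Definition hgen (g : DYgen) : hfree := fpsC (<< fmu g >> : free_alg).

Definition DY_ideal : hideal hfree :=
  gen_ideal (relator (fun i j k => hgen (Some (i, j, k))) (hgen None)).

Definition DY : halg R := hquot_halg DY_ideal.

Definition DYt (i j : 'I_N) (k : int) : DY := hpi DY_ideal (hgen (Some (i, j, k))).
Definition DYc : DY := hpi DY_ideal (hgen None).

End DoubleYangian.

(* Main.v *)
(* The inverse of a matrix that satisfies the RTT relation satisfies it with the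
   two spectral shifts exchanged.  Inverting, restricting to the indices >= m and
   inverting again shows that the Schur complements of T^+(u) and T^-(u) satisfy
   it too, and the first entries of these Schur complements give all relations
   between the half-currents k^+-, e^+-, f^+-.

   As hbar may be a zero divisor in the double Yangian, nothing is ever divided
   by hbar; what is cancelled are the factors u - v + hbar a, which are regular
   because the algebra is hbar-adically separated.  For two half-currents of the
   same sign the remaining defects vanish by restriction to the diagonal u = v.
   Only the coefficients of T^+- are known to commute with c, so one works in
   power series over the centralizer of c; it contains the coefficients of the
   half-currents because T^+- = 1 modulo hbar.

   Shifting v by hbar q turns the factor u - v + hbar a into u - v + hbar (a - q).
   After the shifts in the definition of X_i^+-, the relations for the four
   combinations of signs have the same factors, and their extra terms depend on
   one of the two signs only, so that they cancel in the alternating sum.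

   An identity that involves an expansion of (u - v + hbar a)^-1 is checked after
   multiplication by u - v + hbar a, which is injective on distributions
   supported in a half-plane; delta (u - v + hbar a) is the difference of the two
   expansions of (u - v + hbar a)^-1. *)

Require Import Defs.
From HB Require Import structures.
From mathcomp Require Import all_boot all_order all_algebra.
From mathcomp Require Import boolp classical_sets reals zify.
From mathcomp.real_closed Require Import complex.
From mathcomp.multinomials Require Import monalg.
Set Implicit Arguments.
Unset Strict Implicit.
Unset Printing Implicit Defensive.
Import Order.TTheory GRing.Theory Num.Theory.
Local Open Scope ring_scope.

(** * Identities in noncommutative rings with central elements *)

(** When the signs of the two series differ, the arguments of R on the two sides of the relation
    differ by hbar c. The relation is therefore kept with two independent central elements [al] and
    [be], one for each side, and with [et] for hbar; all consequences are derived for such a triple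
    in an arbitrary ring. Two symmetries carry most of the work. Transposition over the opposite
    ring exchanges [e] with [f] and [al] with [be]. Multiplication by the inverse R-matrices
    exchanges the two series and negates [al] and [be]; combined with the exchange of u and v it
    supplies the pair ([Neg], [Pos]), which is not among the defining relations. Multiplying by u^-1
    or v^-1 for each [Pos] series turns u - v + hbar a into a power series. Its regularity can be
    read off lowest coefficients except for two [Neg] series, where the lowest coefficient is hbar a
    and separatedness takes over. The Serre relations need e_(i,i+1)(u) and e_(i,i+2)(u) to commute
    at one and the same point. This is not an entry of the RTT relation, and it is what the
    restriction to u = v provides. *)

Section NcRing.
Variable S : pzRingType.

Definition central (x : S) := forall y, x * y = y * x.

Fixpoint all_central (cs : seq S) : Prop :=
  if cs is x :: cs' then central x /\ all_central cs' else True.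

Inductive nc_expr :=
  | NcZero | NcOne | NcCentral of nat | NcAtom of nat
  | NcAdd of nc_expr & nc_expr | NcOpp of nc_expr | NcMul of nc_expr & nc_expr.

Variables cs xs : seq S.

Fixpoint nc_eval (e : nc_expr) : S :=
  match e with
  | NcZero => 0
  | NcOne => 1
  | NcCentral i => nth 0 cs i
  | NcAtom i => nth 0 xs i
  | NcAdd e1 e2 => nc_eval e1 + nc_eval e2
  | NcOpp e1 => - nc_eval e1
  | NcMul e1 e2 => nc_eval e1 * nc_eval e2
  end.

(* A monomial is a list of exponents of the central elements and a word in the
   atoms. *)
Definition nc_mono := (seq nat * seq nat)%type.
Definition nc_poly := seq (int * nc_mono).

Fixpoint exps_eval (zs : seq S) (n : seq nat) : S :=
  match zs, n with
  | z :: zs', k :: n' => z ^+ k * exps_eval zs' n'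
  | _, _ => 1
  end.

Fixpoint exps_add (m n : seq nat) : seq nat :=
  match m, n with
  | k :: m', l :: n' => (k + l)%N :: exps_add m' n'
  | [::], _ => n
  | _, [::] => m
  end.

Definition word_eval (w : seq nat) : S := foldr (fun i y => nth 0 xs i * y) 1 w.
Definition mono_eval (m : nc_mono) : S := exps_eval cs m.1 * word_eval m.2.
Definition nc_poly_eval (p : nc_poly) : S :=
  foldr (fun t y => mono_eval t.2 *~ t.1 + y) 0 p.

Fixpoint lexi_lt (s t : seq nat) : bool :=
  match s, t with
  | x :: s', y :: t' => (x < y)%N || (x == y) && lexi_lt s' t'
  | [::], _ :: _ => true
  | _, [::] => false
  end.

Definition mono_lt (m n : nc_mono) : bool :=
  lexi_lt m.2 n.2 || (m.2 == n.2) && lexi_lt m.1 n.1.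

Fixpoint poly_insert (z : int) (m : nc_mono) (p : nc_poly) : nc_poly :=
  if p is (y, n) :: p' then
    if m == n then (if z + y == 0 then p' else (z + y, n) :: p')
    else if mono_lt m n then (z, m) :: p else (y, n) :: poly_insert z m p'
  else [:: (z, m)].

Definition poly_add (p q : nc_poly) : nc_poly :=
  foldr (fun t r => poly_insert t.1 t.2 r) q p.
Definition poly_opp (p : nc_poly) : nc_poly := [seq (- t.1, t.2) | t <- p].
Definition mono_mul (m n : nc_mono) : nc_mono := (exps_add m.1 n.1, m.2 ++ n.2).
Definition poly_mul (p q : nc_poly) : nc_poly :=
  foldr (fun s r => foldr (fun t r' =>
    poly_insert (s.1 * t.1) (mono_mul s.2 t.2) r') r q) [::] p.

Fixpoint nc_norm (e : nc_expr) : nc_poly :=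
  match e with
  | NcZero => [::]
  | NcOne => [:: (1, ([::], [::]))]
  | NcCentral i => [:: (1, (rcons (nseq i 0%N) 1%N, [::]))]
  | NcAtom i => [:: (1, ([::], [:: i]))]
  | NcAdd e1 e2 => poly_add (nc_norm e1) (nc_norm e2)
  | NcOpp e1 => poly_opp (nc_norm e1)
  | NcMul e1 e2 => poly_mul (nc_norm e1) (nc_norm e2)
  end.

Hypothesis csC : all_central cs.

Lemma exps_evalC zs n : all_central zs -> central (exps_eval zs n).
Proof.
elim: zs n => [|z zs IH] [|k n] /=; try by move=> _ y; rewrite mul1r mulr1.
case=> zC /IH zsC y; rewrite -mulrA (zsC n) !mulrA; congr (_ * _).
by apply/commr_sym/commrX => //; apply/commr_sym/zC.
Qed.

Lemma exps_evalD zs m n : all_central zs ->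
  exps_eval zs (exps_add m n) = exps_eval zs m * exps_eval zs n.
Proof.
elim: zs m n => [|z zs IH] [|k m] [|l n] //=; rewrite ?mulr1 ?mul1r //.
case=> zC zsC; rewrite IH // exprD -!mulrA; congr (_ * _).
by rewrite !mulrA; congr (_ * _); rewrite exps_evalC.
Qed.

Lemma exps_eval_unit zs i : all_central zs ->
  exps_eval zs (rcons (nseq i 0%N) 1%N) = if (i < size zs)%N then nth 0 zs i else 1.
Proof.
have e0 zs' : exps_eval zs' [::] = 1 by case: zs'.
elim: zs i => [|z zs IH] [|i] //=; first by rewrite e0 mulr1.
by case=> _ /IH ->; rewrite mul1r ltnS.
Qed.

Lemma word_eval_cat v w : word_eval (v ++ w) = word_eval v * word_eval w.
Proof. by elim: v => [|i v IH] /=; rewrite ?mul1r // IH mulrA. Qed.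

Lemma mono_evalM m n : mono_eval (mono_mul m n) = mono_eval m * mono_eval n.
Proof.
rewrite /mono_eval exps_evalD // word_eval_cat -!mulrA; congr (_ * _).
by rewrite !mulrA; congr (_ * _); rewrite exps_evalC.
Qed.

Lemma poly_insertE z m p :
  nc_poly_eval (poly_insert z m p) = mono_eval m *~ z + nc_poly_eval p.
Proof.
elim: p => [|[y n] p IH] //=; case: eqP => [->|_].
  case: eqP => [zy0|_] /=; rewrite addrA -mulrzDr // zy0 mulr0z add0r //.
by case: ifP => //= _; rewrite IH addrCA.
Qed.

Lemma poly_addE p q : nc_poly_eval (poly_add p q) = nc_poly_eval p + nc_poly_eval q.
Proof.
by elim: p => [|t p IH] /=; rewrite ?add0r // poly_insertE IH addrA.
Qed.

Lemma poly_oppE p : nc_poly_eval (poly_opp p) = - nc_poly_eval p.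
Proof. by elim: p => [|t p IH] /=; rewrite ?oppr0 // IH mulrNz opprD. Qed.

Lemma poly_mulE p q : nc_poly_eval (poly_mul p q) = nc_poly_eval p * nc_poly_eval q.
Proof.
elim: p => [|s p IH] /=; first by rewrite mul0r.
rewrite mulrDl -IH; move: (poly_mul p q) => r.
elim: q {IH} => [|t q IHq] /=; first by rewrite mulr0 add0r.
rewrite poly_insertE IHq mono_evalM mulrDr addrA; congr (_ + _ + _).
by rewrite mulrzAl mulrzAr -mulrzA mulrC.
Qed.

(** An index beyond the list [cs] is read as 0 by [nc_eval], through the default of [nth], but as 1
    by [exps_eval]; this test excludes such indices. *)
Fixpoint nc_wf (e : nc_expr) : bool :=
  match e with
  | NcCentral i => (i < size cs)%N
  | NcAdd e1 e2 | NcMul e1 e2 => nc_wf e1 && nc_wf e2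
  | NcOpp e1 => nc_wf e1
  | _ => true
  end.

Lemma nc_normE e : nc_wf e -> nc_poly_eval (nc_norm e) = nc_eval e.
Proof.
elim: e => //=.
- by move=> _; rewrite /mono_eval /= addr0; case: cs => [|? ?]; rewrite mulr1.
- move=> i ilt; rewrite /mono_eval /= addr0 mulr1 mulr1z exps_eval_unit //.
  by rewrite ilt.
- by move=> i _; rewrite /mono_eval /= addr0 mulr1 mulr1z; case: cs => [|? ?]; rewrite mul1r.
- by move=> e1 IH1 e2 IH2 /andP[/IH1<- /IH2<-]; exact: poly_addE.
- by move=> e1 IH1 /IH1<-; exact: poly_oppE.
- by move=> e1 IH1 e2 IH2 /andP[/IH1<- /IH2<-]; exact: poly_mulE.
Qed.

(** Only soundness of the normal form is proved. Monomials are kept sorted so that equal ones meet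
    and cancel; that the difference is the empty list is then computed in each use. *)
Lemma nc_correct e1 e2 :
  nc_wf (NcAdd e1 e2) && (nc_norm (NcAdd e1 (NcOpp e2)) == [::]) ->
  nc_eval e1 = nc_eval e2.
Proof.
move=> /andP[wf /eqP n0]; apply/eqP; rewrite -subr_eq0.
by rewrite -[_ - _]/(nc_eval (NcAdd e1 (NcOpp e2))) -nc_normE ?n0.
Qed.

End NcRing.

(** The proof [e] is an argument so that a certificate can refer to an equation by name. *)
Definition dif (S : pzRingType) (l r : S) (e : l = r) : S := l - r.

Lemma dif0 (S : pzRingType) (l r : S) (e : l = r) : dif e = 0.
Proof. by rewrite /dif e subrr. Qed.

Lemma eq_by_dif (S : pzRingType) (Z l r : S) : l - r = Z -> Z = 0 -> l = r.
Proof. by move=> <- /eqP; rewrite subr_eq0 => /eqP. Qed.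

Ltac nc_index x l :=
  lazymatch l with
  | x :: _ => constr:(O)
  | _ :: ?l' => let n := nc_index x l' in constr:(n.+1)
  end.

Ltac nc_mem x l :=
  lazymatch l with
  | x :: _ => constr:(true)
  | _ :: ?l' => nc_mem x l'
  | _ => constr:(false)
  end.

Ltac nc_atoms cs xs t :=
  lazymatch t with
  | ?a + ?b => let xs := nc_atoms cs xs a in nc_atoms cs xs b
  | ?a * ?b => let xs := nc_atoms cs xs a in nc_atoms cs xs b
  | - ?a => nc_atoms cs xs a
  | 0 => xs
  | 1 => xs
  | _ => lazymatch nc_mem t cs with
         | true => xs
         | false => lazymatch nc_mem t xs with
                    | true => xs
                    | false => constr:(t :: xs)
                    end
         end
  end.

Ltac nc_reify cs xs t :=
  lazymatch t with
  | ?a + ?b => let a := nc_reify cs xs a in let b := nc_reify cs xs b in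
               constr:(NcAdd a b)
  | ?a * ?b => let a := nc_reify cs xs a in let b := nc_reify cs xs b in
               constr:(NcMul a b)
  | - ?a => let a := nc_reify cs xs a in constr:(NcOpp a)
  | 0 => constr:(NcZero)
  | 1 => constr:(NcOne)
  | _ => lazymatch nc_mem t cs with
         | true => let i := nc_index t cs in constr:(NcCentral i)
         | false => let i := nc_index t xs in constr:(NcAtom i)
         end
  end.

Ltac nc_ring cs :=
  lazymatch goal with
  | |- ?l = ?r :> ?T =>
    let xs := nc_atoms cs (@nil T) l in
    let xs := nc_atoms cs xs r in
    let a := nc_reify cs xs l in
    let b := nc_reify cs xs r in
    refine (@nc_correct _ cs xs _ a b _);
    [by repeat split; assumption | by vm_compute]
  end.

(* Proves [l = r] from the decomposition [e] of [l - r] into multiples of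
   differences [dif H] of the two sides of known equations [H]. *)
Ltac nc_from cs e :=
  apply: (@eq_by_dif _ e); [rewrite /dif; nc_ring cs
    | by rewrite !dif0 ?(mulr0, mul0r, addr0, oppr0)].

(** * Consequences of the RTT relation for one step of Gaussian elimination *)

Definition reg (S : pzRingType) (x : S) := forall y, x * y = 0 -> y = 0.

Lemma regI (S : pzRingType) (x y z : S) : reg x -> x * y = x * z -> y = z.
Proof.
move=> xR /eqP; rewrite -subr_eq0 -mulrBr => /eqP/xR/eqP.
by rewrite subr_eq0 => /eqP.
Qed.

Lemma regM (S : pzRingType) (x y : S) : reg x -> reg y -> reg (x * y).
Proof. by move=> xR yR z; rewrite -mulrA => /xR/yR. Qed.

Lemma linvI (S : pzRingType) (x x' y z : S) : x' * x = 1 -> x * y = x * z -> y = z.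
Proof. by move=> xV e; rewrite -[y]mul1r -[z]mul1r -xV -!mulrA e. Qed.

Lemma rinvI (S : pzRingType) (x x' y z : S) : x * x' = 1 -> y * x = z * x -> y = z.
Proof. by move=> xV e; rewrite -[y]mulr1 -[z]mulr1 -xV !mulrA e. Qed.

(* The relation [R(a) T_1(u) T_2(v) = T_2(v) T_1(u) R(b)] with the denominators
   cleared, [al], [be] and [et] being proportional to a, b and hbar. *)
Definition rtt (S : pzRingType) (al be et : S) (I : Type) (P : I -> Prop)
    (U V : I -> I -> S) := forall i j k l, P i -> P j -> P k -> P l ->
  (be + et) * (al * U i j * V k l + et * U k j * V i l) =
  (al + et) * (be * V k l * U i j + et * V k j * U i l).

(** The list of regular elements is closed under both symmetries: [be - et] and [al - et] are, up to
    sign, what [be + et] and [al + et] become when [al] and [be] are negated. *)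
Record rtt_par (S : pzRingType) (al be et : S) : Prop := RttPar {
  par_al : central al; par_be : central be; par_et : central et;
  par_alR : reg al; par_beR : reg be;
  par_aleR : reg (al + et); par_beeR : reg (be + et);
  par_beNR : reg (be - et); par_alNR : reg (al - et) }.

(** One step of Gaussian elimination: the pivot and its inverse, the row [e] of the upper factor,
    the column [f] of the lower factor, and the Schur complement [w]. *)
Record lu (S : pzRingType) (I : Type) := Lu {
  lu_k : S; lu_ki : S; lu_e : I -> S; lu_f : I -> S; lu_w : I -> I -> S }.

Record lu_step (S : pzRingType) (I : Type) (m : I) (Q : I -> Prop)
    (U : I -> I -> S) (d : lu S I) : Prop := LuStep {
  step_kV : lu_k d * lu_ki d = 1; step_Vk : lu_ki d * lu_k d = 1;
  step_k : U m m = lu_k d;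
  step_e : forall j, Q j -> U m j = lu_k d * lu_e d j;
  step_f : forall i, Q i -> U i m = lu_f d i * lu_k d;
  step_w : forall i j, Q i -> Q j ->
    U i j = lu_w d i j + lu_f d i * lu_k d * lu_e d j }.

Record step_pair (S : pzRingType) (I : Type) (al be et : S) (m : I)
    (P Q : I -> Prop) (U V : I -> I -> S) (du dv : lu S I) : Prop := StepPair {
  pair_par : rtt_par al be et; pair_rtt : rtt al be et P U V;
  pair_m : P m; pair_sub : forall i, Q i -> P i;
  pair_u : lu_step m Q U du; pair_v : lu_step m Q V dv }.

Definition tr (S : pzRingType) (I : Type) (U : I -> I -> S) : I -> I -> S^c :=
  fun i j => U j i.

(** Over the opposite ring the transpose of a product is the product of the transposes in reversed
    order, so the roles of [e] and [f] are exchanged and every relation for [e] yields one for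
    [f]. *)
Definition lu_tr (S : pzRingType) (I : Type) (d : lu S I) : lu S^c I :=
  Lu (lu_k d : S^c) (lu_ki d) (lu_f d) (lu_e d) (tr (lu_w d)).

Section Transpose.
Variables (S : pzRingType) (I : Type).

Lemma centralC (x : S) : central x -> central (x : S^c).
Proof. by move=> xC y; apply: esym; exact: xC. Qed.

Lemma regC (x : S) : central x -> reg x -> reg (x : S^c).
Proof. by move=> xC xR y yx0; apply: xR; rewrite xC; exact: yx0. Qed.

Lemma centralD (x y : S) : central x -> central y -> central (x + y).
Proof. by move=> xC yC z; rewrite mulrDl mulrDr xC yC. Qed.

Lemma centralN (x : S) : central x -> central (- x).
Proof. by move=> xC z; rewrite mulNr mulrN xC. Qed.

Lemma centralM (x y : S) : central x -> central y -> central (x * y).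
Proof. by move=> xC yC z; rewrite -mulrA (yC z) !mulrA (xC z). Qed.

Lemma rtt_parC (al be et : S) :
  rtt_par al be et -> rtt_par (be : S^c) (al : S^c) (et : S^c).
Proof.
case=> alC beC etC alR beR aleR beeR beNR alNR.
split; try exact: centralC; apply: regC => //;
  by repeat (apply: centralD || apply: centralN).
Qed.

(** Transposed and read in the opposite ring, the two sides of the relation change places; hence
    [al] and [be] do so too. *)
Lemma rttC (al be et : S) (P : I -> Prop) (U V : I -> I -> S) :
  rtt_par al be et -> rtt al be et P U V ->
  rtt (be : S^c) (al : S^c) (et : S^c) P (tr U) (tr V).
Proof.
case=> alC beC etC _ _ _ _ _ _ UV i j k l Pi Pj Pk Pl.
have H := UV j i l k Pj Pi Pl Pk.
change ((V l k * (U j i * be) + V l i * (U j k * et)) * (al + et) =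
        (U j i * (V l k * al) + U l i * (V j k * et)) * (be + et)).
nc_from (al :: be :: et :: nil) (- dif H).
Qed.

Lemma lu_stepC (m : I) (Q : I -> Prop) (U : I -> I -> S) (d : lu S I) :
  lu_step m Q U d -> lu_step m Q (tr U) (lu_tr d).
Proof.
case=> kV Vk k_ e_ f_ w_; split=> //= i j Qi Qj.
exact: etrans (w_ _ _ Qj Qi) (congr1 (+%R _) (esym (mulrA _ _ _))).
Qed.

Lemma step_pairC (al be et : S) (m : I) (P Q : I -> Prop) (U V : I -> I -> S)
    (du dv : lu S I) : step_pair al be et m P Q U V du dv ->
  step_pair (be : S^c) (al : S^c) (et : S^c) m P Q (tr U) (tr V) (lu_tr du) (lu_tr dv).
Proof.
case=> par UV Pm QP Ud Vd; split=> //; [exact: rtt_parC | exact: rttC | |];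
  exact: lu_stepC.
Qed.
End Transpose.

Section Step.
Variables (S : pzRingType) (I : Type) (al be et : S) (m : I) (P Q : I -> Prop).
Variables (U V : I -> I -> S) (du dv : lu S I).
Hypothesis UVd : step_pair al be et m P Q U V du dv.

Notation k := (lu_k du).
Notation k' := (lu_ki du).
Notation e := (lu_e du).
Notation f := (lu_f du).
Notation W := (lu_w du).
Notation A := (lu_k dv).
Notation A' := (lu_ki dv).
Notation E := (lu_e dv).
Notation F := (lu_f dv).
Notation W' := (lu_w dv).

Let par := pair_par UVd.
Let UV := pair_rtt UVd.
Let Pm := pair_m UVd.
Let QP := pair_sub UVd.
Let Ud := pair_u UVd.
Let Vd := pair_v UVd.
Let alC := par_al par.
Let beC := par_be par.
Let etC := par_et par.
Let kV := step_kV Ud.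
Let Vk := step_Vk Ud.
Let AV := step_kV Vd.
Let VA := step_Vk Vd.

(** With all four indices equal to [m], both sides of the relation carry the regular factor (al +
    et)(be + et). *)
Lemma step_kk : k * A = A * k.
Proof.
have := UV Pm Pm Pm Pm; rewrite (step_k Ud) (step_k Vd) => H.
apply: (regI (par_aleR par)); apply: (regI (par_beeR par)).
nc_from (al :: be :: et :: nil) (dif H).
Qed.

(** The entry (m, m; m, l), in which [A] can be moved to the left by [step_kk] and cancelled. *)
Lemma step_ke l : Q l -> (be + et) * (k * E l) = be * (E l * k) + et * (k * e l).
Proof.
move=> Ql; have Pl := QP Ql; have := UV Pm Pm Pm Pl.
rewrite (step_k Ud) (step_k Vd) (step_e Ud) // (step_e Vd) // => H.
apply: (regI (par_aleR par)); apply: (linvI VA).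
nc_from (al :: be :: et :: nil)
  (dif H - (al + et) * (be + et) * dif step_kk * E l).
Qed.

Lemma step_ek l : Q l -> be * (e l * A) = A * ((be - et) * e l + et * E l).
Proof.
move=> Ql; have Pl := QP Ql; have := UV Pm Pl Pm Pm.
rewrite (step_k Ud) (step_k Vd) (step_e Ud) // (step_e Vd) // => H.
apply: (regI (par_aleR par)); apply: (regI (par_beeR par)); apply: (linvI Vk).
have K0 := step_ke Ql.
(* [H] enters with the factor [be] because [step_ke] moves [E l] past [k] only after multiplication
   by [be]; the factor be + et that appears on both sides is then cancelled. *)
nc_from (al :: be :: et :: nil)
  (be * dif H - (al + et) * (et * A * dif K0 + (be + et) * dif step_kk * ((be - et) * e l + et * E l))).
Qed.

Lemma step_ee_gen j l : Q j -> Q l ->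
  (be + et) * (be - et) * e j * E l + (be + et) * et * E j * E l =
  be * (be + et) * E l * e j - be * et * e l * e j
  + et * (be + et) * E j * e l - et * et * e j * e l.
Proof.
move=> Qj Ql; have Pl := QP Ql; have Pj := QP Qj; have := UV Pm Pj Pm Pl.
rewrite !(step_e Ud) // !(step_e Vd) // => H.
apply: (regI (par_aleR par)); apply: (linvI Vk); apply: (linvI VA).
have K0l := step_ke Ql; have K0j := step_ke Qj; have K1 := step_ek Qj.
nc_from (al :: be :: et :: nil)
  (be * dif H - (al + et) * ((be + et) * k * dif K1 * E l + be * A * dif K0l * e j
     + et * A * dif K0j * e l
     + dif step_kk * (be + et) * ((be - et) * e j + et * E j) * E l)).
Qed.

(** For equal indices both sides of [step_ee_gen] become multiples of be + et. For distinct indices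
    this fails, and the remainder is the commutator studied in [step_comm_defect]. *)
Lemma step_ee j : Q j ->
  (be - et) * e j * E j - (be + et) * E j * e j = - et * (e j * e j + E j * E j).
Proof.
move=> Qj; apply: (regI (par_beeR par)).
nc_from (al :: be :: et :: nil) (dif (step_ee_gen Qj Qj)).
Qed.

End Step.

Section StepEF.
Variables (S : pzRingType) (I : Type) (al be et : S) (m : I) (P Q : I -> Prop).
Variables (U V : I -> I -> S) (du dv : lu S I).
Hypothesis UVd : step_pair al be et m P Q U V du dv.

Notation k := (lu_k du).
Notation k' := (lu_ki du).
Notation e := (lu_e du).
Notation f := (lu_f du).
Notation W := (lu_w du).
Notation A := (lu_k dv).
Notation A' := (lu_ki dv).
Notation E := (lu_e dv).
Notation F := (lu_f dv).
Notation W' := (lu_w dv).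

Let par := pair_par UVd.
Let UV := pair_rtt UVd.
Let Pm := pair_m UVd.
Let QP := pair_sub UVd.
Let Ud := pair_u UVd.
Let Vd := pair_v UVd.
Let alC := par_al par.
Let beC := par_be par.
Let etC := par_et par.
Let kV := step_kV Ud.
Let Vk := step_Vk Ud.
Let AV := step_kV Vd.
Let VA := step_Vk Vd.

Let kk := step_kk UVd.

Lemma step_kf p : Q p ->
  (al + et) * (F p * k) = al * (k * F p) + et * (f p * k).
Proof.
move=> Qp.
(* This is [step_ke] over the opposite ring; read in the ring itself, all products come in reversed
   order. *)
have H : F p * k * (al + et) = k * F p * al + f p * k * et.
  have H0 := step_ke (step_pairC UVd) Qp.
  exact H0.
nc_from (al :: be :: et :: nil) (dif H).
Qed.

(** In the entry (m, m; p, q) the terms F A E, f k A E and F A k e cancel by the relations of the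
    pivot with [A], [e] and [f]. So the pivot commutes with the Schur complement of the other series
    up to a central ratio, which is the source of the relations between k_i and k_j. *)
Lemma step_kw p q : Q p -> Q q ->
  al * (be + et) * k * W' p q = be * (al + et) * W' p q * k.
Proof.
move=> Qp Qq; have Pp := QP Qp; have Pq := QP Qq; have := UV Pm Pm Pp Pq.
rewrite (step_k Ud) (step_w Vd) // (step_f Ud) // (step_f Vd) // (step_e Ud) // (step_e Vd) // => H.
have K0 := step_ke UVd Qq; have F0 := step_kf Qp.
nc_from (al :: be :: et :: nil)
  (dif H + (be + et) * dif F0 * A * E q - (al + et) * F p * A * dif K0
   - (be + et) * (al + et) * F p * dif kk * E q).
Qed.

(** The source of the commutator of X^+ and X^-: when [l] and [p] are the index after [m], the
    complements are the next pivots, and the right-hand side is a difference of quotients k_(i+1)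
    k_i^-1, one at v and one at u. *)
Lemma step_ef l p : Q l -> Q p ->
  al * be * (e l * F p - F p * e l) =
  et * (al * W' p l * A' - be * k' * W p l).
Proof.
move=> Ql Qp; have Pl := QP Ql; have Pp := QP Qp; have := UV Pm Pl Pp Pm.
rewrite (step_k Ud) (step_k Vd) (step_w Vd Qp Ql) (step_w Ud Qp Ql).
rewrite (step_f Vd Qp) (step_e Ud Ql) => H.
apply: (regI (par_beeR par)); apply: (linvI Vk); apply: (rinvI AV).
have K0 := step_ke UVd Ql; have F0 := step_kf Qp; have K1 := step_ek UVd Ql.
have Qw := step_kw Qp Ql.
nc_from (al :: be :: et :: nil)
  (be * dif H - et * dif Qw - (be + et) * (al + et) * F p * k * dif K1
   + (be + et) * dif F0 * be * e l * A - (al + et) * et * F p * A * dif K0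
   - (be + et) * (al + et) * F p * dif kk * ((be - et) * e l + et * E l)
   + (be + et) * et * be * dif kV * W p l * A
   - (be + et) * et * al * k * W' p l * dif VA).
Qed.

(** From the entry (m, l; p, q), once everything that involves the column [F] is removed. All
    relations between the row [e] of one step and the half-currents of later steps are read off from
    this one by decomposing the complement further. *)
Lemma step_ew l p q : Q l -> Q p -> Q q ->
  be * (e l * W' p q - W' p q * e l) = et * W' p l * (e q - E q).
Proof.
move=> Ql Qp Qq; have Pl := QP Ql; have Pp := QP Qp; have Pq := QP Qq.
have := UV Pm Pl Pp Pq.
rewrite (step_w Vd Qp Qq) (step_w Vd Qp Ql) (step_w Ud Qp Ql).
rewrite !(step_e Ud) // (step_e Vd Qq) => H.
apply: (regI (par_alR par)); apply: (regI (par_beeR par)); apply: (linvI Vk).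
have K0l := step_ke UVd Ql; have K0q := step_ke UVd Qq; have F0 := step_kf Qp; have K1 := step_ek UVd Ql.
have Qw := step_kw Qp Qq; have Ql' := step_kw Qp Ql.
have D := step_ef Ql Qp; have EE := step_ee_gen UVd Ql Qq.
nc_from (al :: be :: et :: nil)
  (be * dif H - (be + et) * k * dif D * A * E q
   + (be + et) * et * be * dif kV * W p l * A * E q
   - et * al * (be + et) * k * W' p l * dif VA * E q
   - be * dif Qw * e l - et * dif Ql' * e q
   - (be + et) * (al + et) * F p * k * dif K1 * E q
   + (be + et) * dif F0 * be * e l * A * E q
   - be * (al + et) * F p * A * dif K0q * e l
   - (al + et) * et * F p * A * dif K0l * e q
   - (al + et) * F p * A * k * dif EE
   - (al + et) * (be + et) * F p * dif kk
     * ((be - et) * e l + et * E l) * E q).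
Qed.
End StepEF.

Section Swap.
Variables (S : pzRingType) (I : Type) (al be et : S).

Lemma regN (x : S) : reg x -> reg (- x).
Proof. by move=> xR y; rewrite mulNr => /eqP; rewrite oppr_eq0 => /eqP/xR. Qed.

Lemma rtt_par_swap : rtt_par al be et -> rtt_par (- al) (- be) et.
Proof.
case=> alC beC etC alR beR aleR beeR beNR alNR.
have N (x y : S) : - x + y = - (x - y) by rewrite opprB addrC.
split; rewrite -?opprD ?N //; (exact: centralN || exact: regN).
Qed.

(** Since (al + et P)(al - et P) is a scalar, al - et P is a multiple of the inverse R-matrix. The
    combination of the four entries below is the relation multiplied by al - et P on one side and be
    - et P on the other. *)
Lemma rtt_swap (P : I -> Prop) (U V : I -> I -> S) :
  rtt_par al be et -> rtt al be et P U V -> rtt (- al) (- be) et P V U.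
Proof.
case=> alC beC etC alR beR aleR beeR beNR alNR UV i j k l Pi Pj Pk Pl.
have H1 := UV k l i j Pk Pl Pi Pj; have H2 := UV i l k j Pi Pl Pk Pj.
have H3 := UV k j i l Pk Pj Pi Pl; have H4 := UV i j k l Pi Pj Pk Pl.
apply: (regI aleR); apply: (regI beeR).
nc_from (al :: be :: et :: nil) (et * be * dif H2 + al * et * dif H3
  - al * be * dif H1 - et * et * dif H4).
Qed.

Lemma step_pair_swap (m : I) (P Q : I -> Prop) (U V : I -> I -> S) (du dv : lu S I) :
  step_pair al be et m P Q U V du dv -> step_pair (- al) (- be) et m P Q V U dv du.
Proof.
by case=> par UV Pm QP Ud Vd; split=> //; [exact: rtt_par_swap | exact: rtt_swap].
Qed.
End Swap.

Section Second.
Variables (S : pzRingType) (I : Type) (al be et : S) (m m1 : I).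
Variables (P Q Q1 : I -> Prop) (U V : I -> I -> S) (du dv dv1 : lu S I).
Hypothesis UVd : step_pair al be et m P Q U V du dv.
Hypotheses (Qm1 : Q m1) (QQ1 : forall i, Q1 i -> Q i).
Hypothesis V1 : lu_step m1 Q1 (lu_w dv) dv1.

Notation e := (lu_e du).
Notation E := (lu_e dv).
Notation A := (lu_k dv1).
Notation A' := (lu_ki dv1).
Notation F := (lu_f dv1).
Notation G := (lu_e dv1).

Let par := pair_par UVd.
Let alC := par_al par.
Let beC := par_be par.
Let etC := par_et par.
Let AV := step_kV V1.
Let VA := step_Vk V1.

(** [step_ew] with all indices equal to [m1], where the complement is the next pivot. *)
Lemma step2_ek : be * (e m1 * A - A * e m1) = et * A * (e m1 - E m1).
Proof. by have := step_ew UVd Qm1 Qm1 Qm1; rewrite !(step_k V1). Qed.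

Lemma step2_eg q : Q1 q ->
  be * (e m1 * G q - G q * e m1) = et * (e q - E q - (e m1 - E m1) * G q).
Proof.
move=> Qq; have := step_ew UVd Qm1 Qm1 (QQ1 Qq).
rewrite (step_e V1 Qq) (step_k V1) => H; apply: (linvI VA).
have K := step2_ek.
nc_from (al :: be :: et :: nil) (dif H - dif K * G q).
Qed.

Lemma step2_zg q : Q1 q ->
  be * (e q * G q - G q * e q) = et * G q * (e q - E q - (e m1 - E m1) * G q).
Proof.
move=> Qq; have := step_ew UVd (QQ1 Qq) Qm1 (QQ1 Qq).
have := step_ew UVd (QQ1 Qq) Qm1 Qm1.
rewrite (step_e V1 Qq) (step_k V1) => H1 H2; apply: (linvI VA).
nc_from (al :: be :: et :: nil) (dif H2 - dif H1 * G q).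
Qed.

Lemma step2_ef p : Q1 p -> e m1 * F p = F p * e m1.
Proof.
move=> Qp; have := step_ew UVd Qm1 (QQ1 Qp) Qm1; rewrite (step_f V1 Qp) => H.
apply: (regI (par_beR par)); apply: (rinvI AV); have K := step2_ek.
nc_from (al :: be :: et :: nil) (dif H - F p * dif K).
Qed.

(** Subtracting F A G from the complement, with the commutation rules for [F] and [A] already known,
    removes the right-hand side of [step_ew]. Thus e_(m,m1) commutes with the complement two steps
    later, and with all half-currents extracted from it. *)
Lemma step2_ew p q : Q1 p -> Q1 q -> e m1 * lu_w dv1 p q = lu_w dv1 p q * e m1.
Proof.
move=> Qp Qq; have := step_ew UVd Qm1 (QQ1 Qp) (QQ1 Qq).
have := step_ew UVd Qm1 Qm1 (QQ1 Qq).
rewrite (step_w V1 Qp Qq) (step_f V1 Qp) (step_k V1) (step_e V1 Qq) => H1 H2.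
apply: (regI (par_beR par)); have C := step2_ef Qp.
nc_from (al :: be :: et :: nil) (dif H2 - F p * dif H1 - be * dif C * A * G q).
Qed.
End Second.

(** * Serre relations between half-currents *)

(* [x] and [X] are the same half-current at two points, and likewise [z], [Z];
   [z] is a quadratic half-current such as [e_(i, i+2)]. *)
Definition quad_rel (S : pzRingType) (b h x z X Z : S) : Prop :=
  [/\ b * (x * X - X * x) = - h * (x - X) * (x - X),
      b * (x * Z - Z * x) = - h * (x - X) * (z - Z)
    & b * (z * X - X * z) = - h * (x - X) * (z - Z)].

Definition cubic_rel (S : pzRingType) (b h x z X Z Y : S) : Prop :=
  quad_rel b h x z X Z /\ b * (x * Y - Y * x) = h * (z - Z - (x - X) * Y).

(** The left-hand side is [x1, [x2, y]] + [x2, [x1, y]]. The cubic relations replace b_i [x_i, y] by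
    h (z_i - z - (x_i - x) y), and the quadratic ones give the commutators of what remains with the
    other x. The point of [y] serves as third point, at which [x] and [z] are taken as well. *)
Lemma serre_half (S : pzRingType) (b1 b2 h x1 z1 x2 z2 x z y : S) :
  central b1 -> central b2 -> central h -> reg b1 -> reg b2 -> reg (b1 - b2) ->
  quad_rel (b1 - b2) h x1 z1 x2 z2 ->
  cubic_rel b1 h x1 z1 x z y -> cubic_rel b2 h x2 z2 x z y ->
  x1 * x2 * y - x1 * y * x2 *+ 2 + y * x1 * x2 +
  (x2 * x1 * y - x2 * y * x1 *+ 2 + y * x2 * x1) = 0.
Proof.
move=> b1C b2C hC b1R b2R b12R [X12 H12 H21] [[X13 H13 _] Y1] [[X23 H23 _] Y2].
apply: b12R; apply: b1R; apply: b2R; rewrite !mulr2n.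
nc_from (b1 :: b2 :: h :: nil)
  ((b1 - b2) * (b1 * (x1 * dif Y2 - dif Y2 * x1) + b2 * (x2 * dif Y1 - dif Y1 * x2))
   + h * b1 * dif H12 - h * (b1 - b2) * dif H13 - h * b1 * dif X12 * y
   + h * (b1 - b2) * dif X13 * y - h * (b1 - b2) * (x2 - x) * dif Y1
   - h * b2 * dif H21 - h * (b1 - b2) * dif H23 + h * b2 * dif X12 * y
   + h * (b1 - b2) * dif X23 * y - h * (b1 - b2) * (x1 - x) * dif Y2).
Qed.

Section QuadE.
Variables (S : pzRingType) (I : Type) (al be et : S) (m : I) (P Q : I -> Prop).

(** [step_ee_gen] arranged so that the obstruction to the quadratic relation is a commutator at one
    single point. *)
Lemma step_comm_defect (U V : I -> I -> S) (du dv : lu S I) j q :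
  step_pair al be et m P Q U V du dv -> Q j -> Q q ->
  (be + et) * (be * (lu_e du j * lu_e dv q - lu_e dv q * lu_e du j)
    + et * (lu_e du j - lu_e dv j) * (lu_e du q - lu_e dv q)) =
  be * et * (lu_e du j * lu_e du q - lu_e du q * lu_e du j).
Proof.
move=> UVd Qj Qq; have [alC beC etC _ _ _ _ _ _] := pair_par UVd.
have H := step_ee_gen UVd Qj Qq.
nc_from (al :: be :: et :: nil) (dif H).
Qed.

Lemma step_comm_rel (U V : I -> I -> S) (du dv : lu S I) j q :
  step_pair al be et m P Q U V du dv -> Q j -> Q q ->
  lu_e du j * lu_e du q = lu_e du q * lu_e du j ->
  be * (lu_e du j * lu_e dv q - lu_e dv q * lu_e du j) =
  - et * (lu_e du j - lu_e dv j) * (lu_e du q - lu_e dv q).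
Proof.
move=> UVd Qj Qq C; apply/eqP; rewrite -subr_eq0 mulNr mulNr opprK; apply/eqP.
apply: (par_beeR (pair_par UVd)).
by rewrite (step_comm_defect UVd Qj Qq) C subrr mulr0.
Qed.
End QuadE.

Section QuadE2.
Variables (S : pzRingType) (I : Type) (al be et : S) (m : I) (P Q : I -> Prop).
Variables (U V : I -> I -> S) (du dv : lu S I).
Hypothesis UVd : step_pair al be et m P Q U V du dv.

Let alC := par_al (pair_par UVd).
Let beC := par_be (pair_par UVd).
Let etC := par_et (pair_par UVd).

Lemma step_quad_rel j q : Q j -> Q q ->
  lu_e du j * lu_e du q = lu_e du q * lu_e du j ->
  lu_e dv j * lu_e dv q = lu_e dv q * lu_e dv j ->
  quad_rel be et (lu_e du j) (lu_e du q) (lu_e dv j) (lu_e dv q).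
Proof.
move=> Qj Qq Cu Cv; have H := step_ee UVd Qj.
have H' := step_comm_rel (step_pair_swap UVd) Qj Qq Cv.
split.
- nc_from (al :: be :: et :: nil) (dif H).
- exact: (step_comm_rel UVd).
- nc_from (al :: be :: et :: nil) (dif H').
Qed.

Variables (m1 : I) (Q1 : I -> Prop) (du1 dv1 : lu S I).
Hypotheses (Qm1 : Q m1) (QQ1 : forall i, Q1 i -> Q i).
Hypothesis UVd1 : step_pair al be et m1 Q Q1 (lu_w du) (lu_w dv) du1 dv1.

(** The corner entry of the inverse of the unitriangular matrix on the indices m, m1, q. It replaces
    e_(m,q) in the Serre relation that contains e_(m1,q) twice. *)
Definition lu_n (d d1 : lu S I) q := lu_e d m1 * lu_e d1 q - lu_e d q.

(** The counterpart of [step_comm_defect] for the entries of the inverse; here the commutator on the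
    right is taken at the second point. *)
Lemma step2_comm_defect q : Q1 q ->
  (be + et) * (be * (lu_n du du1 q * lu_e dv1 q - lu_e dv1 q * lu_n du du1 q)
    + et * (lu_n du du1 q - lu_n dv dv1 q) * (lu_e du1 q - lu_e dv1 q)) =
  be * et * (lu_n dv dv1 q * lu_e dv1 q - lu_e dv1 q * lu_n dv dv1 q).
Proof.
move=> Qq; have V1 := pair_v UVd1.
have EG := step2_eg UVd Qm1 QQ1 V1 Qq; have ZG := step2_zg UVd Qm1 QQ1 V1 Qq.
have GG := step_ee UVd1 Qq; rewrite /lu_n.
nc_from (al :: be :: et :: nil)
  (be * (dif EG * lu_e du1 q + lu_e du m1 * dif GG - dif ZG)
   + et * (dif EG * (lu_e du1 q - lu_e dv1 q) + lu_e du m1 * dif GG)).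
Qed.

Lemma step2_comm_rel q : Q1 q ->
  lu_n dv dv1 q * lu_e dv1 q = lu_e dv1 q * lu_n dv dv1 q ->
  be * (lu_n du du1 q * lu_e dv1 q - lu_e dv1 q * lu_n du du1 q) =
  - et * (lu_n du du1 q - lu_n dv dv1 q) * (lu_e du1 q - lu_e dv1 q).
Proof.
move=> Qq C; apply/eqP; rewrite -subr_eq0 mulNr mulNr opprK; apply/eqP.
apply: (par_beeR (pair_par UVd)).
by rewrite step2_comm_defect // C subrr mulr0.
Qed.

Lemma step_cubic_rel q : Q1 q ->
  quad_rel be et (lu_e du m1) (lu_e du q) (lu_e dv m1) (lu_e dv q) ->
  cubic_rel be et (lu_e du m1) (lu_e du q) (lu_e dv m1) (lu_e dv q) (lu_e dv1 q).
Proof. by move=> Qq qr; split=> //; exact (step2_eg UVd Qm1 QQ1 (pair_v UVd1) Qq). Qed.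
End QuadE2.

Section QuadN.
Variables (S : pzRingType) (I : Type) (al be et : S) (m m1 : I) (P Q Q1 : I -> Prop).
Variables (U V : I -> I -> S) (du dv du1 dv1 : lu S I).
Hypothesis UVd : step_pair al be et m P Q U V du dv.
Hypotheses (Qm1 : Q m1) (QQ1 : forall i, Q1 i -> Q i).
Hypothesis UVd1 : step_pair al be et m1 Q Q1 (lu_w du) (lu_w dv) du1 dv1.

Let alC := par_al (pair_par UVd).
Let beC := par_be (pair_par UVd).
Let etC := par_et (pair_par UVd).
Notation x := (lu_e du1).
Notation X := (lu_e dv1).
Notation n := (lu_n m1 du du1).
Notation N := (lu_n m1 dv dv1).

(* The quadratic half-current [n] is, up to sign, an entry of [E^-1]. *)
Lemma step2_quad_rel q : Q1 q -> n q * x q = x q * n q -> N q * X q = X q * N q ->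
  quad_rel (be : S^c) (- et : S^c) (x q : S^c) (n q) (X q) (N q).
Proof.
move=> Qq Cu Cv; have H := step_ee UVd1 Qq.
have H1 := step2_comm_rel UVd Qm1 QQ1 UVd1 Qq Cv.
have H2 := step2_comm_rel (step_pair_swap UVd) Qm1 QQ1 (step_pair_swap UVd1) Qq Cu.
split.
- change ((X q * x q - x q * X q) * be = (x q - X q) * ((x q - X q) * - - et)).
  nc_from (al :: be :: et :: nil) (- dif H).
- change ((N q * x q - x q * N q) * be = (n q - N q) * ((x q - X q) * - - et)).
  nc_from (al :: be :: et :: nil) (- dif H2).
- change ((X q * n q - n q * X q) * be = (n q - N q) * ((x q - X q) * - - et)).
  nc_from (al :: be :: et :: nil) (- dif H1).
Qed.

(** Now e_(m1,q) is the doubled half-current and e_(m,m1) the single one. Written with [lu_n], the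
    relation [step2_eg] takes the cubic form over the opposite ring with [et] negated. *)
Lemma step2_cubic_rel q : Q1 q ->
  quad_rel (be : S^c) (- et : S^c) (x q : S^c) (n q) (X q) (N q) ->
  cubic_rel (be : S^c) (- et : S^c) (x q : S^c) (n q) (X q) (N q) (lu_e dv m1).
Proof.
move=> Qq qr; split=> //.
have H := step2_eg (step_pair_swap UVd) Qm1 QQ1 (pair_u UVd1) Qq.
change ((lu_e dv m1 * x q - x q * lu_e dv m1) * be =
  (n q - N q - lu_e dv m1 * (x q - X q)) * - et).
rewrite /lu_n; nc_from (al :: be :: et :: nil) (- dif H).
Qed.
End QuadN.

(** * Schur complements satisfy the RTT relation *)

Section Inverse.
Variables (S : pzRingType) (I : finType) (P : pred I).

Definition inv_on (U V : I -> I -> S) :=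
  forall p q, P p -> P q -> \sum_(z | P z) U p z * V z q = (p == q)%:R.

Lemma sum_delta (g : I -> S) y : P y -> \sum_(k | P k) g k * (k == y)%:R = g y.
Proof.
move=> Py; rewrite (bigD1 y) //= eqxx mulr1 big1 ?addr0 // => k /andP[_ /negPf->].
by rewrite mulr0.
Qed.

Lemma contrR U V (g : I -> S) y : inv_on U V -> P y ->
  \sum_(k | P k) \sum_(l | P l) g k * U k l * V l y = g y.
Proof.
move=> UV Py; rewrite -[RHS]sum_delta //; apply: eq_bigr => k Pk.
by rewrite -(UV k y) // mulr_sumr; apply: eq_bigr => l _; rewrite mulrA.
Qed.

Lemma contrL U V (h : I -> S) x : inv_on U V -> P x ->
  \sum_(k | P k) \sum_(l | P l) U x k * (V k l * h l) = h x.
Proof.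
move=> UV Px; rewrite exchange_big /=.
rewrite (eq_bigr (fun l => (x == l)%:R * h l)) => [|l Pl].
  rewrite (bigD1 x) //= eqxx mul1r big1 ?addr0 // => l /andP[_].
  by rewrite eq_sym => /negPf->; rewrite mul0r.
by rewrite -(UV x l) // mulr_suml; apply: eq_bigr => k _; rewrite mulrA.
Qed.

(** The relation is multiplied by U' and V' on the left and by V' and U' on the right, as in [sum4],
    and summed over all inner indices. Each of its four terms collapses by two of the inverse
    identities; as the factors come out in the opposite order, the shifts are exchanged. *)
Lemma inv_rtt (al be et : S) (U V U' V' : I -> I -> S) :
  central al -> central be -> central et -> rtt al be et P U V ->
  inv_on U U' -> inv_on U' U -> inv_on V V' -> inv_on V' V ->
  rtt be al et P V' U'.
Proof.
move=> alC beC etC UV UU' U'U VV' V'V x y p q Px Py Pp Pq.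
pose sum4 (h : I -> I -> I -> I -> S) := \sum_(i | P i) \sum_(j | P j)
  \sum_(k | P k) \sum_(l | P l) U' p i * V' x k * h i j k l * (V' l y * U' j q).
have sum4Z a h : central a -> sum4 (fun i j k l => a * h i j k l) = a * sum4 h.
  move=> aC; rewrite /sum4; do 4![rewrite mulr_sumr; apply: eq_bigr => ? _].
  by nc_ring (a :: nil).
have sum4D h h' : sum4 (fun i j k l => h i j k l + h' i j k l) = sum4 h + sum4 h'.
  rewrite /sum4; do 4![rewrite -big_split; apply: eq_bigr => ? _ /=].
  by rewrite mulrDr mulrDl.
have s1 : sum4 (fun i j k l => U i j * V k l) = U' p q * V' x y.
  rewrite -(contrR (fun i => U' p i * V' x y) UU' Pq).
  apply: eq_bigr => i _; apply: eq_bigr => j _.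
  rewrite -(contrR (fun k => U' p i * V' x k * U i j) VV' Py) mulr_suml.
  by apply: eq_bigr => k _; rewrite mulr_suml; apply: eq_bigr => l _; rewrite !mulrA.
have s2 : sum4 (fun i j k l => U k j * V i l) = U' p y * V' x q.
  rewrite -(contrR (fun k => U' p y * V' x k) UU' Pq).
  rewrite /sum4 exchange_big /=.
  under eq_bigr do rewrite exchange_big /=.
  rewrite exchange_big /=; apply: eq_bigr => k _; apply: eq_bigr => j _.
  rewrite -(contrR (fun i => U' p i * V' x k * U k j) VV' Py) mulr_suml.
  by apply: eq_bigr => i _; rewrite mulr_suml; apply: eq_bigr => l _; rewrite !mulrA.
have s3 : sum4 (fun i j k l => V k l * U i j) = V' x y * U' p q.
  rewrite -(contrL (fun j => V' x y * U' j q) U'U Pp).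
  apply: eq_bigr => i _; apply: eq_bigr => j _.
  have -> : U' p i * (U i j * (V' x y * U' j q)) = U' p i * (U i j * V' x y * U' j q).
    by rewrite !mulrA.
  rewrite -(contrL (fun l => U i j * V' l y * U' j q) V'V Px) mulr_sumr.
  by apply: eq_bigr => k _; rewrite mulr_sumr; apply: eq_bigr => l _; rewrite !mulrA.
have s4 : sum4 (fun i j k l => V k j * U i l) = V' p y * U' x q.
  rewrite -(contrL (fun l => V' l y * U' x q) U'U Pp).
  apply: eq_bigr => i _; rewrite exchange_big /=.
  under eq_bigr do rewrite exchange_big /=.
  rewrite exchange_big /=; apply: eq_bigr => l _.
  have -> : U' p i * (U i l * (V' l y * U' x q)) = U' p i * (U i l * V' l y * U' x q).
    by rewrite !mulrA.
  rewrite -(contrL (fun j => U i l * V' l y * U' j q) V'V Px) mulr_sumr.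
  by apply: eq_bigr => k _; rewrite mulr_sumr; apply: eq_bigr => j _; rewrite !mulrA.
have : sum4 (fun i j k l => (be + et) * (al * (U i j * V k l) + et * (U k j * V i l))) =
       sum4 (fun i j k l => (al + et) * (be * (V k l * U i j) + et * (V k j * U i l))).
  do 4![apply: eq_bigr => ? ?]; congr (_ * _ * _).
  by rewrite !mulrA UV.
rewrite !sum4Z ?sum4D ?sum4Z ?s1 ?s2 ?s3 ?s4 //; try exact: centralD.
by rewrite !mulrA => ->.
Qed.
End Inverse.

Section Unitriangular.
Variables (S : pzRingType) (n : nat) (r : 'I_n -> nat).
Hypothesis r_lt : forall i, (r i < n)%N.

(** The rank [r] is the position for lower triangular matrices and the reversed position for upper
    triangular ones. *)
Definition unitri (M : 'M[S]_n) :=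
  (forall i, M i i = 1) /\ (forall i j, i != j -> (r i <= r j)%N -> M i j = 0).

(** 1 - M has nonzero entries only from a larger rank to a strictly smaller one, and ranks are below
    n. So its n-th power is 0 and the Neumann series is finite. *)
Lemma unitri_inv (M : 'M[S]_n) : unitri M ->
  exists M' : 'M[S]_n, [/\ M *m M' = 1%:M, M' *m M = 1%:M & unitri M'].
Proof.
case=> M1 M0; pose Z : 'M[S]_n := 1%:M - M.
have Z0 i j : (r i <= r j)%N -> Z i j = 0.
  by move=> rij; rewrite !mxE; have [->|ij] := eqVneq i j; rewrite ?M1 ?subrr // M0 // subr0.
pose pw k : 'M[S]_n := iter k (mulmx Z) 1%:M.
have pwC k : Z *m pw k = pw k *m Z.
  by elim: k => [|k IH] /=; rewrite ?mulmx1 ?mul1mx // -mulmxA -IH.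
have pw0 k i j : (r i < r j + k)%N -> pw k i j = 0.
  elim: k i => [|k IH] i rij.
    by rewrite mxE; case: eqP rij => // ->; rewrite addn0 ltnn.
  rewrite /= mxE big1 // => l _; have [ril|rli] := leqP (r i) (r l).
    by rewrite Z0 ?mul0r.
  by rewrite IH ?mulr0 // (leq_trans rli) // -ltnS -addnS.
have pwn : pw n = 0 by apply/matrixP => i j; rewrite pw0 ?mxE // ltn_addl.
have tele m (g : nat -> 'M[S]_n) : \sum_(k < m) (g k - g k.+1) = g 0%N - g m.
  elim: m => [|m IH]; first by rewrite big_ord0 subrr.
  by rewrite big_ord_recr /= IH addrA subrK.
have ME : M = 1%:M - Z by rewrite opprB addrC subrK.
exists (\sum_(k < n) pw k); split.
- transitivity (pw 0%N - pw n); last by rewrite pwn subr0.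
  rewrite -tele mulmx_sumr; apply: eq_bigr => k _.
  by rewrite {1}ME mulmxBl mul1mx.
- transitivity (pw 0%N - pw n); last by rewrite pwn subr0.
  rewrite -tele mulmx_suml; apply: eq_bigr => k _.
  by rewrite {1}ME mulmxBr mulmx1 -pwC.
have n_gt0 (i : 'I_n) : (0 < n)%N by apply: leq_trans (ltn_ord i).
split=> [i|i j ij rij]; rewrite summxE (bigD1 (Ordinal (n_gt0 i))) //= mxE.
  rewrite eqxx big1 ?addr0 // => k k0; apply: pw0.
  by rewrite -{1}[r i]addn0 ltn_add2l lt0n; apply: contraNneq k0 => k0; apply/eqP/val_inj.
rewrite (negPf ij) big1 ?addr0 // => k k0; apply: pw0.
rewrite (leq_ltn_trans rij) // -{1}[r j]addn0 ltn_add2l lt0n.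
by apply: contraNneq k0 => k0; apply/eqP/val_inj.
Qed.
End Unitriangular.

Section GaussMx.
Variables (S : pzRingType) (n : nat).

Record gauss_mx (f : 'I_n -> 'I_n -> S) (k ki : 'I_n -> S) (e : 'I_n -> 'I_n -> S) : Prop :=
  GaussMx {
    gauss_f1 : forall i, f i i = 1; gauss_e1 : forall i, e i i = 1;
    gauss_f0 : forall i j : 'I_n, (i < j)%N -> f i j = 0;
    gauss_e0 : forall i j : 'I_n, (j < i)%N -> e i j = 0;
    gauss_kV : forall i, k i * ki i = 1; gauss_Vk : forall i, ki i * k i = 1 }.

(* The Schur complement of the block of indices below [m] in [F diag(k) E]. *)
Definition schur (f : 'I_n -> 'I_n -> S) (k : 'I_n -> S) (e : 'I_n -> 'I_n -> S)
    (m : nat) (i j : 'I_n) : S :=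
  \sum_(l < n | (m <= l)%N) f i l * k l * e l j.

(** One matrix serves all [m], namely the inverse E^-1 diag(k)^-1 F^-1 of the whole product: its
    block of indices >= m inverts the Schur complement because E^-1 and F^-1 are triangular. *)
Lemma schur_inv f k ki e : gauss_mx f k ki e ->
  exists X : 'I_n -> 'I_n -> S, forall m : nat,
    inv_on (fun i : 'I_n => (m <= i)%N) (schur f k e m) X /\
    inv_on (fun i : 'I_n => (m <= i)%N) X (schur f k e m).
Proof.
case=> f1 e1 f0 e0 kV Vk.
have lt_id (i : 'I_n) : (i < n)%N by [].
have lt_rev (i : 'I_n) : (n - i.+1 < n)%N by rewrite -subSn // subSS leq_subr.
have [] := @unitri_inv S n (@nat_of_ord n) lt_id (\matrix_(i, j) f i j).
  split=> [i|i j ij]; rewrite mxE // leq_eqVlt => /orP[/eqP/val_inj ij'|/f0//].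
  by rewrite ij' eqxx in ij.
move=> F' [FV VF [_ F'0]].
have [] := @unitri_inv S n (fun i : 'I_n => (n - i.+1)%N) lt_rev (\matrix_(i, j) e i j).
  split=> [i|i j ij]; rewrite mxE // leq_sub2lE // ltnS leq_eqVlt.
  by move=> /orP[/eqP/val_inj ij'|/e0//]; rewrite ij' eqxx in ij.
move=> E' [EV VE [_ E'0]].
exists (fun i j => \sum_l E' i l * ki l * F' l j) => m.
have Fz (i l : 'I_n) : (m <= i)%N -> ~~ (m <= l)%N -> F' l i = 0.
  rewrite -ltnNge => mi lm; have li := leq_trans lm mi.
  by rewrite F'0 ?(ltnW li) //; apply: contraTneq li => ->; rewrite ltnn.
have Ez (i l : 'I_n) : (m <= i)%N -> ~~ (m <= l)%N -> E' i l = 0.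
  rewrite -ltnNge => mi lm; have li := leq_trans lm mi.
  rewrite E'0 //; last by rewrite leq_sub2l // ltnS ltnW.
  by apply: contraTneq li => ->; rewrite ltnn.
have inv_mx (A B : 'M[S]_n) (a b : 'I_n -> 'I_n -> S) : A *m B = 1%:M ->
    (forall i j, A i j = a i j) -> (forall i j, B i j = b i j) -> inv_on predT a b.
  move=> AB Aa Bb p q _ _; have /matrixP/(_ p q) := AB; rewrite !mxE => <-.
  by apply: eq_bigr => z _; rewrite Aa Bb.
have eE : inv_on predT e E' by apply: inv_mx EV _ _ => i j; rewrite ?mxE.
have Ee : inv_on predT E' e by apply: inv_mx VE _ _ => i j; rewrite ?mxE.
have fF : inv_on predT f F' by apply: inv_mx FV _ _ => i j; rewrite ?mxE.
have Ff : inv_on predT F' f by apply: inv_mx VF _ _ => i j; rewrite ?mxE.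
split=> p q mp mq.
- rewrite big_mkcond /=.
  transitivity (\sum_z \sum_(l < n | (m <= l)%N) f p l * k l *
      \sum_l' e l z * (E' z l' * (ki l' * F' l' q))).
    apply: eq_bigr => z _; case: ifPn => [_|mz].
      rewrite mulr_suml; apply: eq_bigr => l _; rewrite -mulrA; congr (_ * _).
      by rewrite mulr_sumr; apply: eq_bigr => l' _; rewrite !mulrA.
    rewrite big1 // => l ml; rewrite big1 ?mulr0 // => l' _.
    by rewrite e0 ?mul0r // (leq_trans _ ml) // ltnNge.
  rewrite exchange_big /= -(fF p q) // [RHS](bigID (fun l : 'I_n => (m <= l)%N)) /=.
  rewrite [X in _ = _ + X]big1 ?addr0 => [|l ml]; last by rewrite Fz ?mulr0.
  apply: eq_bigr => l _; rewrite -mulr_sumr (contrL (fun l => ki l * F' l q) eE) //.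
  by rewrite -!mulrA (mulrA (k l)) kV mul1r.
rewrite big_mkcond /=.
transitivity (\sum_z \sum_(l < n | (m <= l)%N) (\sum_l' E' p l' * ki l' * F' l' z * f z l)
    * (k l * e l q)).
  apply: eq_bigr => z _; case: ifPn => [_|mz].
    rewrite mulr_sumr; apply: eq_bigr => l _; rewrite !mulr_suml.
    by apply: eq_bigr => l' _; rewrite !mulrA.
  rewrite big1 // => l ml; rewrite big1 ?mul0r // => l' _.
  by rewrite f0 ?mulr0 // (leq_trans _ ml) // ltnNge.
rewrite exchange_big /= -(Ee p q) // [RHS](bigID (fun l : 'I_n => (m <= l)%N)) /=.
rewrite [X in _ = _ + X]big1 ?addr0 => [|l ml]; last by rewrite Ez ?mul0r.
apply: eq_bigr => l _; rewrite -mulr_suml exchange_big /=.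
rewrite (contrR (fun l => E' p l * ki l) Ff) //.
by rewrite -!mulrA (mulrA (ki l)) Vk mul1r.
Qed.

Lemma schur_rtt (al be et : S) f k ki e f' k' ki' e' :
  rtt_par al be et -> gauss_mx f k ki e -> gauss_mx f' k' ki' e' ->
  rtt al be et (fun=> True) (schur f k e 0) (schur f' k' e' 0) ->
  forall m, rtt al be et (fun i : 'I_n => (m <= i)%N) (schur f k e m) (schur f' k' e' m).
Proof.
move=> par G G' UV m; have [X XP] := schur_inv G; have [Y YP] := schur_inv G'.
case: par => alC beC etC _ _ _ _ _ _.
have UV0 : rtt al be et (fun i : 'I_n => (0 <= i)%N) (schur f k e 0) (schur f' k' e' 0).
  by move=> i j p q _ _ _ _; exact: UV.
have [UX XU] := XP 0%N; have [VY YV] := YP 0%N.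
have XY := inv_rtt alC beC etC UV0 UX XU VY YV.
have XYm : rtt be al et (fun i : 'I_n => (m <= i)%N) Y X.
  by move=> i j p q _ _ _ _; exact: XY.
have [UXm XUm] := XP m; have [VYm YVm] := YP m.
exact: inv_rtt beC alC etC XYm YVm VYm XUm UXm.
Qed.

Definition lu_of f k ki e (m : 'I_n) : lu S 'I_n :=
  Lu (k m) (ki m) (e m) (fun i => f i m) (schur f k e m.+1).

Lemma lu_step_of f k ki e (m : 'I_n) : gauss_mx f k ki e ->
  lu_step m (fun i : 'I_n => (m < i)%N) (schur f k e m) (lu_of f k ki e m).
Proof.
case=> f1 e1 f0 e0 kV Vk.
have sE i j : schur f k e m i j = schur f k e m.+1 i j + f i m * k m * e m j.
  rewrite /schur (bigD1 m) //= addrC; congr (_ + _); apply: eq_bigl => l.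
  by rewrite [RHS]ltn_neqAle eq_sym andbC.
have s0l j : schur f k e m.+1 m j = 0.
  by rewrite /schur big1 // => l ml; rewrite f0 ?mul0r.
have s0r i : schur f k e m.+1 i m = 0.
  by rewrite /schur big1 // => l ml; rewrite e0 ?mulr0.
split=> //= [|j _|i _]; rewrite ?sE ?s0l ?s0r ?add0r ?f1 ?e1 ?mul1r ?mulr1 //.
Qed.

Lemma gauss_pair (al be et : S) f k ki e f' k' ki' e' (m : 'I_n) :
  rtt_par al be et -> gauss_mx f k ki e -> gauss_mx f' k' ki' e' ->
  rtt al be et (fun=> True) (schur f k e 0) (schur f' k' e' 0) ->
  step_pair al be et m (fun i : 'I_n => (m <= i)%N) (fun i : 'I_n => (m < i)%N)
    (schur f k e m) (schur f' k' e' m) (lu_of f k ki e m) (lu_of f' k' ki' e' m).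
Proof.
move=> par G G' UV; split=> //; first exact: schur_rtt par G G' UV m.
- by move=> i; exact: ltnW.
- exact (lu_step_of m G).
exact (lu_step_of m G').
Qed.
End GaussMx.

Definition comm_el (S : pzRingType) (x y : S) := x * y = y * x.

Section GaussExtract.
Variables (S : pzRingType) (n : nat) (f : 'I_n -> 'I_n -> S) (k ki : 'I_n -> S).
Variables (e : 'I_n -> 'I_n -> S).
Hypothesis G : gauss_mx f k ki e.

(** Commutation up to the ratio b / a holds for the pivot, as it is an entry. In the rows k e and
    the columns f k the ratio is used up by [k], so [x] commutes exactly with [e] and [f];
    subtracting f k e, the next complement satisfies the same hypothesis. *)
Lemma schur_extract (a b x : S) (m : nat) : central a -> central b -> reg a -> reg b ->
  (forall p q : 'I_n, (m <= p)%N -> (m <= q)%N ->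
    a * x * schur f k e m p q = b * schur f k e m p q * x) ->
  forall j : 'I_n, (m <= j)%N ->
    a * x * k j = b * k j * x /\
    forall l : 'I_n, (j < l)%N -> comm_el x (e j l) /\ comm_el x (f l j).
Proof.
move=> aC bC aR bR xm j mj.
pose W d := schur f k e (m + d).
have step (d : nat) (o : 'I_n) : o = (m + d)%N :> nat ->
  (forall p q : 'I_n, (m + d <= p)%N -> (m + d <= q)%N -> a * x * W d p q = b * W d p q * x) ->
  [/\ a * x * k o = b * k o * x,
     forall l : 'I_n, (o < l)%N -> comm_el x (e o l) /\ comm_el x (f l o)
   & forall p q : 'I_n, (m + d.+1 <= p)%N -> (m + d.+1 <= q)%N ->
       a * x * W d.+1 p q = b * W d.+1 p q * x].
  move=> od xW; have [kV Vk sk se sf sw] := lu_step_of o G.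
  rewrite od /= in kV Vk sk se sf sw.
  have oo : (m + d <= o)%N by rewrite od.
  have xk : a * x * k o = b * k o * x.
    by have := xW o o oo oo; rewrite /W sk.
  have xe (l : 'I_n) : (o < l)%N -> comm_el x (e o l).
    move=> ol; have ol' : (m + d < l)%N by rewrite -od.
    have := xW o l oo (ltnW ol'); rewrite /W se // => H.
    apply: (regI bR); apply: (linvI Vk).
    nc_from (a :: b :: nil) (dif H - dif xk * e o l).
  have xf (l : 'I_n) : (o < l)%N -> comm_el x (f l o).
    move=> ol; have ol' : (m + d < l)%N by rewrite -od.
    have := xW l o (ltnW ol') oo; rewrite /W sf // => H.
    apply: (regI aR); apply: (rinvI kV).
    nc_from (a :: b :: nil) (dif H - f l o * dif xk).
  split=> // [l ol|p q]; first by split; [exact: xe | exact: xf].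
  rewrite addnS => mp mq.
  have := xW p q (ltnW mp) (ltnW mq); rewrite /W (sw p q mp mq) od => H.
  have Cf : comm_el x (f p o) by apply: xf; rewrite od.
  have Ce : comm_el x (e o q) by apply: xe; rewrite od.
  rewrite addnS; nc_from (a :: b :: nil) (dif H - a * dif Cf * k o * e o q
    - f p o * dif xk * e o q - b * f p o * k o * dif Ce).
have xW d : (m + d <= j)%N -> forall p q : 'I_n, (m + d <= p)%N -> (m + d <= q)%N ->
    a * x * W d p q = b * W d p q * x.
  elim: d => [|d IH] mdj; first by rewrite /W addn0; exact: xm.
  have mdj' : (m + d < j)%N by rewrite -addnS.
  have odn : (m + d < n)%N := ltn_trans mdj' (ltn_ord j).
  by have [] := step d (Ordinal odn) erefl (IH (ltnW mdj')).
have jE : j = (m + (j - m))%N :> nat by rewrite subnKC.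
have [] := step (j - m)%N j jE.
  by apply: xW; rewrite subnKC.
by move=> xk xef _.
Qed.
End GaussExtract.

Section GaussTr.
Variables (S : pzRingType) (n : nat) (f : 'I_n -> 'I_n -> S) (k ki : 'I_n -> S).
Variables (e : 'I_n -> 'I_n -> S).

Lemma gauss_mxC : gauss_mx f k ki e ->
  gauss_mx (tr e) (k : 'I_n -> S^c) (ki : 'I_n -> S^c) (tr f).
Proof. by case=> f1 e1 f0 e0 kV Vk; split=> // i j ij; rewrite /tr ?f0 ?e0. Qed.

Lemma schurC m i j :
  schur (tr e) (k : 'I_n -> S^c) (tr f) m i j = (schur f k e m j i : S^c).
Proof. by apply: eq_bigr => l _; exact (mulrA (f j l) (k l) (e l i)). Qed.
End GaussTr.

Section GaussRel.
Variables (S : pzRingType) (n : nat) (al be et : S).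
Variables (f f' e e' : 'I_n -> 'I_n -> S) (k ki k' ki' : 'I_n -> S).

Record gauss_rtt : Prop := GaussRtt {
  gr_par : rtt_par al be et;
  gr_u : gauss_mx f k ki e; gr_v : gauss_mx f' k' ki' e';
  gr_rtt : rtt al be et (fun=> True) (schur f k e 0) (schur f' k' e' 0) }.
End GaussRel.

Lemma gauss_rttC (S : pzRingType) n (al be et : S) (f f' e e' : 'I_n -> 'I_n -> S)
    (k ki k' ki' : 'I_n -> S) :
  gauss_rtt al be et f f' e e' k ki k' ki' ->
  gauss_rtt (be : S^c) (al : S^c) (et : S^c) (tr e) (tr e') (tr f) (tr f')
    (k : 'I_n -> S^c) ki k' ki'.
Proof.
case=> par Gu Gv UV; split; [exact: rtt_parC | exact: gauss_mxC | exact: gauss_mxC |].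
by move=> i j p q Pi Pj Pp Pq; rewrite !schurC; exact: rttC par UV _ _ _ _ Pi Pj Pp Pq.
Qed.

Lemma gauss_rtt_swap (S : pzRingType) n (al be et : S) (f f' e e' : 'I_n -> 'I_n -> S)
    (k ki k' ki' : 'I_n -> S) :
  gauss_rtt al be et f f' e e' k ki k' ki' ->
  gauss_rtt (- al) (- be) et f' f e' e k' ki' k ki.
Proof.
by case=> par Gu Gv UV; split=> //; [exact: rtt_par_swap | exact: rtt_swap].
Qed.

Section GaussRelE.
Variables (S : pzRingType) (n : nat) (al be et : S).
Variables (f f' e e' : 'I_n -> 'I_n -> S) (k ki k' ki' : 'I_n -> S).
Hypothesis H : gauss_rtt al be et f f' e e' k ki k' ki'.

Let par := gr_par H.
Let alC := par_al par.
Let beC := par_be par.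
Let etC := par_et par.

Lemma rel_pair (m : 'I_n) :
  step_pair al be et m (fun i : 'I_n => (m <= i)%N) (fun i : 'I_n => (m < i)%N)
    (schur f k e m) (schur f' k' e' m) (lu_of f k ki e m) (lu_of f' k' ki' e' m).
Proof. by case: H => p Gu Gv UV; exact: gauss_pair. Qed.

Lemma rel_pair1 (m m1 : 'I_n) : m1 = m.+1 :> nat ->
  step_pair al be et m1 (fun i : 'I_n => (m < i)%N) (fun i : 'I_n => (m1 < i)%N)
    (lu_w (lu_of f k ki e m)) (lu_w (lu_of f' k' ki' e' m))
    (lu_of f k ki e m1) (lu_of f' k' ki' e' m1).
Proof. by move=> mE; have := rel_pair m1; rewrite mE. Qed.

Lemma rel_kk i : comm_el (k i) (k' i).
Proof. exact: step_kk (rel_pair i). Qed.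

Lemma rel_low (m j : 'I_n) : (m < j)%N ->
  al * (be + et) * k m * k' j = be * (al + et) * k' j * k m /\
  forall l : 'I_n, (j < l)%N -> comm_el (k m) (e' j l) /\ comm_el (k m) (f' l j).
Proof.
move=> mj; have aR := regM (par_alR par) (par_beeR par).
have bR := regM (par_beR par) (par_aleR par).
apply: (schur_extract (gr_v H) (m := m.+1)) => //.
- by apply: centralM => //; exact: centralD.
- by apply: centralM => //; exact: centralD.
by move=> p q mp mq; exact (step_kw (rel_pair m) mp mq).
Qed.

Lemma rel_ke (m j : 'I_n) : (m < j)%N ->
  (be + et) * (k m * e' m j) = be * (e' m j * k m) + et * (k m * e m j).
Proof. by move=> mj; exact (step_ke (rel_pair m) mj). Qed.

Lemma rel_ee (m j : 'I_n) : (m < j)%N ->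
  (be - et) * e m j * e' m j - (be + et) * e' m j * e m j =
  - et * (e m j * e m j + e' m j * e' m j).
Proof. by move=> mj; exact (step_ee (rel_pair m) mj). Qed.

Section Next.
Variables (m m1 : 'I_n).
Hypothesis mE : m1 = m.+1 :> nat.

Let mm1 : (m < m1)%N. Proof. by rewrite mE. Qed.
Let m1m (i : 'I_n) : (m1 < i)%N -> (m < i)%N. Proof. exact: ltn_trans. Qed.

Lemma rel_ek1 :
  be * (e m m1 * k' m1 - k' m1 * e m m1) = et * k' m1 * (e m m1 - e' m m1).
Proof. exact (step2_ek (rel_pair m) mm1 (pair_v (rel_pair1 mE))). Qed.

Lemma rel_eg (q : 'I_n) : (m1 < q)%N ->
  be * (e m m1 * e' m1 q - e' m1 q * e m m1) =
  et * (e m q - e' m q - (e m m1 - e' m m1) * e' m1 q).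
Proof.
by move=> mq; exact (step2_eg (rel_pair m) mm1 m1m (pair_v (rel_pair1 mE)) mq).
Qed.

Lemma rel_ef_next (p : 'I_n) : (m1 < p)%N -> comm_el (e m m1) (f' p m1).
Proof.
by move=> mp; exact (step2_ef (rel_pair m) mm1 m1m (pair_v (rel_pair1 mE)) mp).
Qed.

(** [schur_extract] with both central factors equal to 1, applied to the complement two steps
    later. *)
Lemma rel_far (j : 'I_n) : (m1 < j)%N -> comm_el (e m m1) (k' j) /\
  forall l : 'I_n, (j < l)%N -> comm_el (e m m1) (e' j l) /\ comm_el (e m m1) (f' l j).
Proof.
have one1 : central (1 : S) by move=> x; rewrite mul1r mulr1.
have oneR : reg (1 : S) by move=> x; rewrite mul1r.
move=> m1j; have [] := schur_extract (gr_v H) (m := m1.+1) one1 one1 oneR oneR _ m1j (x := e m m1).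
  move=> p q m1p m1q; rewrite !mul1r.
  exact (step2_ew (rel_pair m) mm1 m1m (pair_v (rel_pair1 mE)) m1p m1q).
by rewrite !mul1r.
Qed.

Lemma rel_ef :
  al * be * (e m m1 * f' m1 m - f' m1 m * e m m1) =
  et * (al * k' m1 * ki' m - be * ki m * k m1).
Proof.
have := step_ef (rel_pair m) mm1 mm1.
by rewrite (step_k (pair_v (rel_pair1 mE))) (step_k (pair_u (rel_pair1 mE))).
Qed.

End Next.
End GaussRelE.

(** * Power series in one and two variables *)

Section FpsVar.
Variable S : pzRingType.
Implicit Types (p q : fps S) (a : S).

Lemma fcoefD p q n : fcoef (p + q) n = fcoef p n + fcoef q n. Proof. by []. Qed.
Lemma fcoefN p n : fcoef (- p) n = - fcoef p n. Proof. by []. Qed.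
Lemma fcoefB p q n : fcoef (p - q) n = fcoef p n - fcoef q n. Proof. by []. Qed.
Lemma fcoef0 n : fcoef (0 : fps S) n = 0. Proof. by []. Qed.
Lemma fcoefM p q n : fcoef (p * q) n = \sum_(i < n.+1) fcoef p i * fcoef q (n - i).
Proof. by []. Qed.

Lemma fcoef_sum (I : Type) (r : seq I) (P : pred I) (F : I -> fps S) n :
  fcoef (\sum_(i <- r | P i) F i) n = \sum_(i <- r | P i) fcoef (F i) n.
Proof. by elim/big_rec2: _ => //= i y1 y2 _ <-. Qed.

Lemma fcoefMr p q n : fcoef (p * q) n = \sum_(i < n.+1) fcoef p (n - i) * fcoef q i.
Proof. exact: fpsM_rev. Qed.

Lemma fcoefCM a p n : fcoef (fpsC a * p) n = a * fcoef p n.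
Proof. by rewrite fcoefM big_ord_recl /= subn0 big1 ?addr0 // => i _; rewrite mul0r. Qed.

Lemma fcoefMC a p n : fcoef (p * fpsC a) n = fcoef p n * a.
Proof. by rewrite fcoefMr big_ord_recl /= subn0 big1 ?addr0 // => i _; rewrite mulr0. Qed.

Lemma fcoefXM p n : fcoef (fpsX S * p) n = if n is n'.+1 then fcoef p n' else 0.
Proof.
case: n => [|n]; rewrite fcoefM big_ord_recl /= mul0r add0r ?big_ord0 //.
rewrite big_ord_recl /= mul1r subSS subn0 big1 ?addr0 // => i _.
by rewrite mul0r.
Qed.

Lemma fcoefMX p n : fcoef (p * fpsX S) n = if n is n'.+1 then fcoef p n' else 0.
Proof.
case: n => [|n]; rewrite fcoefMr big_ord_recl /= mulr0 add0r ?big_ord0 //.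
rewrite big_ord_recl /= mulr1 subSS subn0 big1 ?addr0 // => i _.
by rewrite mulr0.
Qed.

Lemma fpsX_central : central (fpsX S).
Proof. by move=> p; apply: fpsP => n; rewrite fcoefXM fcoefMX. Qed.

Lemma fpsC_central a : central a -> central (fpsC a).
Proof. by move=> aC p; apply: fpsP => n; rewrite fcoefCM fcoefMC aC. Qed.

Lemma fpsC_zmod_morphism : zmod_morphism (@fpsC S).
Proof. by move=> a b; apply: fpsP => -[|n] //=; rewrite subrr. Qed.

Lemma fpsC_monoid_morphism : monoid_morphism (@fpsC S).
Proof.
split=> [|a b]; apply: fpsP => n; first by case: n.
by rewrite fcoefCM; case: n => //= n; rewrite mulr0.
Qed.

HB.instance Definition _ :=
  GRing.isZmodMorphism.Build S (fps S) (@fpsC S) fpsC_zmod_morphism.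
HB.instance Definition _ :=
  GRing.isMonoidMorphism.Build S (fps S) (@fpsC S) fpsC_monoid_morphism.

Lemma fpsCD a b : fpsC (a + b) = fpsC a + fpsC b. Proof. exact: rmorphD. Qed.
Lemma fpsCB a b : fpsC (a - b) = fpsC a - fpsC b. Proof. exact: rmorphB. Qed.
Lemma fpsCM a b : fpsC (a * b) = fpsC a * fpsC b. Proof. exact: rmorphM. Qed.
Lemma fpsC1 : fpsC (1 : S) = 1. Proof. exact: rmorph1. Qed.

Lemma regX : reg (fpsX S).
Proof. by move=> p Xp; apply: fpsP => n; have := fcoefXM p n.+1; rewrite Xp. Qed.

Lemma reg_fpsC a : reg a -> reg (fpsC a).
Proof.
move=> aR p ap; apply: fpsP => n; apply: aR; by rewrite -fcoefCM ap.
Qed.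

Lemma reg1 : reg (1 : S).
Proof. by move=> x; rewrite mul1r. Qed.

(* [var_m s] and [var_p s] stand for m and m u, where u = x^-1 and m = x for
   [Pos], u = x and m = 1 for [Neg]. *)
Definition var_m (s : polarity) : fps S := if s is Pos then fpsX S else 1.
Definition var_p (s : polarity) : fps S := if s is Pos then 1 else fpsX S.

Lemma central1 : central (1 : S).
Proof. by move=> x; rewrite mul1r mulr1. Qed.

Lemma var_mR s : reg (var_m s).
Proof. by case: s; [exact: regX | move=> x; rewrite mul1r]. Qed.
End FpsVar.

Lemma var_mC (S : pzRingType) s : central (var_m S s).
Proof. by case: s; [exact: fpsX_central | exact: central1]. Qed.

Lemma var_pC (S : pzRingType) s : central (var_p S s).
Proof. by case: s; [exact: central1 | exact: fpsX_central]. Qed.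

(** A power series is regular when its lowest coefficient is; this coefficient is [p] for [Pos] and
    [- q] for [Neg]. *)
Lemma reg_outer (S : pzRingType) s (p q : S) :
  (s = Pos -> reg p) -> (s = Neg -> reg q) ->
  reg (var_p S s * fpsC p - var_m S s * fpsC q).
Proof.
case: s => /= [/(_ erefl) pR _|_ /(_ erefl) qR] F F0; apply: fpsP => n.
  elim: n => [|n IH]; have := congr1 (fun G => fcoef G _) F0.
    by move=> /(_ 0%N); rewrite mul1r mulrBl -mulrA fcoefB fcoefCM fcoefXM subr0 => /pR.
  move=> /(_ n.+1); rewrite mul1r mulrBl -mulrA fcoefB fcoefCM fcoefXM fcoefCM IH.
  by rewrite mulr0 subr0 => /pR.
elim: n => [|n IH]; have := congr1 (fun G => fcoef G _) F0.
  move=> /(_ 0%N); rewrite mul1r mulrBl -mulrA fcoefB fcoefCM fcoefXM sub0r.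
  by move/eqP; rewrite oppr_eq0 => /eqP/qR.
move=> /(_ n.+1); rewrite mul1r mulrBl -mulrA fcoefB fcoefCM fcoefXM fcoefCM IH.
by rewrite mulr0 sub0r => /eqP; rewrite oppr_eq0 => /eqP/qR.
Qed.

(* The multiple m_1 m_2 (u_1 - u_2 + hb) of a difference of two points. *)
Definition diff_uv (S : pzRingType) (m1 p1 m2 p2 hb : S) : S :=
  p1 * m2 - m1 * p2 + m1 * m2 * hb.

Section TwoVar.
Variables (C : pzRingType) (h : C).
Hypothesis hC : central h.
Hypothesis hsep : forall x : C, (forall n, exists y, x = h ^+ n * y) -> x = 0.

(** Iterating the recursion shows that each F n is divisible by every power of [h]. *)
Lemma sep_chain (b : C) (F : nat -> C) : central b ->
  (forall n, F n = h * b * F n.+1) -> forall n, F n = 0.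
Proof.
move=> bC FS n; apply: hsep => k.
exists (b ^+ k * F (n + k)%N); elim: k => [|k ->]; first by rewrite !expr0 !mul1r addn0.
rewrite FS addnS !exprS; have := @centralM _ h b hC bC => hbC.
have hk : forall y, h ^+ k * y = y * h ^+ k.
  by move=> y; elim: k => [|k IH]; rewrite ?mul1r ?mulr1 // exprS -mulrA IH !mulrA hC.
have bk : forall y, b ^+ k * y = y * b ^+ k.
  by move=> y; elim: k {hk} => [|k IH]; rewrite ?mul1r ?mulr1 // exprS -mulrA IH !mulrA bC.
by nc_ring (h :: b :: h ^+ k :: b ^+ k :: nil).
Qed.

(** For [Neg] the element is X - h b, whose lowest coefficient may be a zero divisor. An element
    annihilated by it has coefficients linked by F_n = h b F_(n+1), so separatedness applies. *)
Lemma reg_inner s (b : C) : central b ->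
  reg (var_p C s - var_m C s * fpsC (h * b)).
Proof.
move=> bC; case: s => /=.
  rewrite -[X in X - _]mulr1 -[X in _ * X - _](rmorph1 (@fpsC C)).
  by apply: (@reg_outer C Pos 1 (h * b)) => // _; exact: reg1.
move=> F; rewrite mul1r mulrBl => F0; apply: fpsP => n.
apply: (@sep_chain b (fcoef F)) n => // n.
have := congr1 (fun G => fcoef G n.+1) F0.
by rewrite fcoefB fcoefXM fcoefCM => /eqP; rewrite subr_eq0 => /eqP.
Qed.

(** u - v + h b, multiplied by u^-1 if [s] is [Pos] and by v^-1 if [s'] is [Pos]; u is the outer
    variable and v the inner one. [eta2] is [h] with the same clearing factors. *)
Definition beta2 (s s' : polarity) (b : C) : fps (fps C) :=
  diff_uv (var_m _ s) (var_p _ s) (fpsC (var_m C s')) (fpsC (var_p C s'))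
    (fpsC (fpsC (h * b))).

Definition eta2 (s s' : polarity) : fps (fps C) :=
  var_m _ s * fpsC (var_m C s') * fpsC (fpsC h).

Lemma beta2_outer s s' b : beta2 s s' b =
  var_p _ s * fpsC (var_m C s')
  - var_m _ s * fpsC (var_p C s' - var_m C s' * fpsC (h * b)).
Proof.
rewrite /beta2 /diff_uv fpsCB (fpsCM (var_m C s')) mulrBr.
by rewrite opprB addrA addrAC mulrA.
Qed.

Lemma beta2R s s' b : central b -> reg (beta2 s s' b).
Proof.
move=> bC; rewrite beta2_outer; apply: reg_outer => _; first exact: var_mR.
exact: reg_inner.
Qed.

Lemma var2C s' : central (fpsC (var_m C s')) /\ central (fpsC (var_p C s')).
Proof. by split; apply: fpsC_central; [exact: var_mC | exact: var_pC]. Qed.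

Lemma const2C (b : C) : central b -> central (fpsC (fpsC b)).
Proof. by move=> bC; do 2!apply: fpsC_central. Qed.

Lemma beta2C s s' b : central b -> central (beta2 s s' b).
Proof.
move=> bC; have [mC pC] := var2C s'.
have hbC := const2C (centralM hC bC).
rewrite /beta2 /diff_uv; repeat first [apply: centralD | apply: centralN |
  apply: centralM]; (done || exact: var_mC || exact: var_pC).
Qed.

Lemma eta2C s s' : central (eta2 s s').
Proof.
have [mC _] := var2C s'; have hC2 := const2C hC.
by rewrite /eta2; repeat apply: centralM => //; exact: var_mC.
Qed.

Lemma beta2_eta s s' b : beta2 s s' b + eta2 s s' = beta2 s s' (b + 1).
Proof. by rewrite /beta2 /eta2 /diff_uv mulrDr mulr1 !fpsCD mulrDr addrA. Qed.

Lemma beta2_etaN s s' b : beta2 s s' b - eta2 s s' = beta2 s s' (b - 1).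
Proof. by rewrite -[b in LHS](subrK 1) -beta2_eta addrK. Qed.

Lemma rtt_par2 s s' (a b : C) : central a -> central b ->
  rtt_par (beta2 s s' a) (beta2 s s' b) (eta2 s s').
Proof.
move=> aC bC; have c1 := @central1 C.
split; rewrite ?beta2_eta ?beta2_etaN; (exact: beta2C || exact: eta2C || apply: beta2R) => //;
  by [exact: centralD | apply: centralD => //; exact: centralN].
Qed.

Lemma fcoef_outer (S : pzRingType) s (p q : S) (F : fps S) n :
  fcoef ((var_p S s * fpsC p - var_m S s * fpsC q) * F) n =
  match s with
  | Pos => p * fcoef F n - if n is n'.+1 then q * fcoef F n' else 0
  | Neg => (if n is n'.+1 then p * fcoef F n' else 0) - q * fcoef F n
  end.
Proof.
by case: s; rewrite /var_p /var_m mul1r mulrBl -mulrA fcoefB fcoefCM fcoefXM;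
  case: n => // n; rewrite fcoefCM.
Qed.

(** A solution would be an expansion of h c(v) / (u - v + h b), which is no power series when both
    variables have the same sign. Formally, the right-hand side lives in a single degree of the
    outer variable; in the other degrees the equation is a recursion that makes the coefficients
    divisible by all powers of the inner variable ([Pos]) or of [h] ([Neg]). *)
Lemma same_sign_eq0 s (b : C) (c : fps C) (Y : fps (fps C)) : central b ->
  beta2 s s b * Y = eta2 s s * fpsC c -> Y = 0.
Proof.
move=> bC; rewrite beta2_outer /eta2 => YE.
have {YE}YE n : fcoef ((var_p _ s * fpsC (var_m C s)
    - var_m _ s * fpsC (var_p C s - var_m C s * fpsC (h * b))) * Y) n =
    fcoef (var_m _ s * fpsC (var_m C s) * fpsC (fpsC h) * fpsC c) n by rewrite YE.
apply: fpsP => n; apply: fpsP => j.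
change (fcoef (fcoef Y n) j = 0).
case: s YE => YE.
  have Y0 : fcoef Y 0 = 0.
    apply: (@regX C); have := YE 0%N; rewrite fcoef_outer subr0 => ->.
    by rewrite -!mulrA fcoefXM.
  case: n => [|n]; first by rewrite Y0.
  have YS i : fcoef Y i.+1 = fpsX C * (fcoef Y i.+2 + fpsC (h * b) * fcoef Y i.+1).
    have := YE i.+2; rewrite fcoef_outer.
    rewrite -!mulrA fcoefXM -!fpsCM [X in _ = X -> _]/= mulrBl /var_p /var_m mul1r => /eqP; rewrite subr_eq0 => /eqP e.
    by rewrite mulrDr e mulrA subrK.
  elim: j n => [|j IH] n; rewrite YS fcoefXM //.
  by rewrite fcoefD fcoefCM !IH mulr0 addr0.
have YS i : fcoef Y i = (fpsX C - fpsC (h * b)) * fcoef Y i.+1.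
  have := YE i.+1; rewrite fcoef_outer.
  rewrite /var_m /var_p !mul1r -!fpsCM [X in _ = X -> _]/=.
  by move/eqP; rewrite subr_eq0 => /eqP.
elim: j n => [|j IH] n.
  apply: (@sep_chain (- b) (fun n => fcoef (fcoef Y n) 0%N)) n; first exact: centralN.
  by move=> n; rewrite YS mulrBl fcoefB fcoefXM fcoefCM sub0r mulrN mulNr.
apply: (@sep_chain (- b) (fun n => fcoef (fcoef Y n) j.+1)) n; first exact: centralN.
by move=> n; rewrite YS mulrBl fcoefB fcoefXM fcoefCM IH sub0r mulrN mulNr.
Qed.
End TwoVar.

(** * Restriction to the diagonal *)

Section Diagonal.
Variable C : pzRingType.
Implicit Types (F G : fps (fps C)) (f g : fps C).

Notation inu := (fps_map (@fpsC C)).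

Definition diag F : fps C := FPS (fun n => \sum_(i < n.+1) fcoef (fcoef F i) (n - i)).

Lemma fcoef_diag F n :
  fcoef (diag F) n = \sum_(i < n.+1) fcoef (fcoef F i) (n - i).
Proof. by []. Qed.

Lemma diagB F G : diag (F - G) = diag F - diag G.
Proof. by apply: fpsP => n; rewrite /= -sumrB; apply: eq_bigr. Qed.

Lemma diag_uv f g : diag (inu f * fpsC g) = f * g.
Proof.
apply: fpsP => n; rewrite [RHS]fcoefM; apply: eq_bigr => i _.
by rewrite fcoefMC fcoefCM.
Qed.

Lemma diag_vu f g : diag (fpsC g * inu f) = g * f.
Proof.
apply: fpsP => n; rewrite [RHS]fcoefMr; apply: eq_bigr => i _.
by rewrite fcoefCM fcoefMC.
Qed.

Lemma diag_diff G f : diag (G * (inu f - fpsC f)) = 0.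
Proof.
rewrite mulrBr diagB; apply/eqP; rewrite subr_eq0; apply/eqP/fpsP => n; rewrite !fcoef_diag.
transitivity (\sum_(i < n.+1) \sum_(a < n.+1 | (a <= i)%N)
    fcoef (fcoef G a) (n - i) * fcoef f (i - a)).
  apply: eq_bigr => i _; rewrite fcoefM /= (big_ord_narrow_leq (leq_ord i)) /=.
  by rewrite fcoef_sum; apply: eq_bigr => a _; rewrite fcoefMC.
rewrite (exchange_big_dep predT) //; apply: eq_bigr => a _.
rewrite fcoefMC fcoefM (reindex_inj rev_ord_inj).
rewrite [RHS](eq_bigr (fun b : 'I_(n - a).+1 => fcoef (fcoef G a) b * fcoef f (n - a - b))) //.
rewrite -(big_ord_narrow_leq (F := fun b => fcoef (fcoef G a) b * fcoef f (n - a - b)) (leq_subr a n)).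
apply: eq_big => [b|b ab]; rewrite /= subSS.
  by rewrite !leq_subRL ?leq_ord // addnC.
by rewrite subKn ?leq_ord // -!subnDA addnC.
Qed.

End Diagonal.

Notation inu := (fps_map (fpsC (S := _))).

Lemma inuB (C : pzRingType) (f g : fps C) : inu (f - g) = inu f - inu g.
Proof. exact: rmorphB. Qed.
Lemma inuM (C : pzRingType) (f g : fps C) : inu (f * g) = inu f * inu g.
Proof. exact: rmorphM. Qed.

Section SameSign.
Variables (C : pzRingType) (h : C).
Hypothesis hC : central h.
Hypothesis hsep : forall x : C, (forall n, exists y, x = h ^+ n * y) -> x = 0.

(** The zero shift is a variable because [dpol s s] reduces to 0 only for a concrete sign. *)
Lemma divided_diff s (b0 : C) (f : fps C) : b0 = 0 ->
  exists D, inu f - fpsC f = beta2 h s s b0 * D.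
Proof.
move=> ->.
(* The divided difference of x^n is the sum of all x^i y^j with i + j + 1 = n. The sign is there
   because for [Pos] the cleared u - v is v^-1 - u^-1. *)
exists (FPS (fun i => FPS (fun j => sgn_mul (opp_pol s) (fcoef f (i + j).+1)))).
rewrite beta2_outer mulr0 raddf0 mulr0 subr0; apply: fpsP => i.
rewrite fcoef_outer; case: s => /=; case: i => [|i]; apply: fpsP => j;
  rewrite ?mul1r ?fcoefB ?fcoef0 ?fcoefXM; case: j => [|j] //=;
  rewrite ?add0r ?addSn ?addn0 ?subr0 ?sub0r ?subrr ?opprK ?addnS ?addNr ?addrN ?oppr0 //.
Qed.

(** Cancelling u - v and applying [same_sign_eq0] gives K = - et L (w(u) - w(v)), which vanishes for
    u = v. In the uses K is a commutator of a series at u with one at v, so that [diag K = 0] means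
    commutation at one point. *)
Lemma diag_eq0 s (b0 b : C) (K L : fps (fps C)) (w c : fps C) : b0 = 0 -> central b ->
  beta2 h s s b * (beta2 h s s b0 * K +
    eta2 h s s * (beta2 h s s b0 * L) * (inu w - fpsC w)) =
  beta2 h s s b0 * eta2 h s s * fpsC c -> diag K = 0.
Proof.
move=> -> bC e; have C0 : central (0 : C) by move=> y; rewrite mul0r mulr0.
have g0C := beta2C hC s s C0; have etC := eta2C hC s s; have gbC := beta2C hC s s bC.
suff -> : K = - eta2 h s s * L * (inu w - fpsC w) by exact: diag_diff.
suff /eqP : K + eta2 h s s * L * (inu w - fpsC w) = 0.
  by rewrite addr_eq0 !mulNr => /eqP.
apply: (same_sign_eq0 hC hsep bC (s := s) (c := c)).
apply: (regI (beta2R hC hsep C0 (s := s) (s' := s))).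
nc_from (beta2 h s s 0 :: beta2 h s s b :: eta2 h s s :: nil) (dif e).
Qed.
End SameSign.

(** * Serre relations for power series *)

Section ConverseMorphism.
Variables (R R' : pzRingType) (g : {rmorphism R -> R'}).

Definition conv_map : R^c -> R'^c := g.

Lemma conv_map_zmod_morphism : zmod_morphism conv_map.
Proof. exact: (rmorphB g). Qed.

Lemma conv_map_monoid_morphism : monoid_morphism conv_map.
Proof. by split=> [|x y]; [exact: (rmorph1 g) | exact (rmorphM g y x)]. Qed.

HB.instance Definition _ :=
  GRing.isZmodMorphism.Build R^c R'^c conv_map conv_map_zmod_morphism.
HB.instance Definition _ :=
  GRing.isMonoidMorphism.Build R^c R'^c conv_map conv_map_monoid_morphism.
End ConverseMorphism.

Lemma quad_rel_map (R R' : pzRingType) (g : {rmorphism R -> R'}) (b h x z X Z : R) :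
  quad_rel b h x z X Z -> quad_rel (g b) (g h) (g x) (g z) (g X) (g Z).
Proof.
by case=> /(congr1 g) e1 /(congr1 g) e2 /(congr1 g) e3; split;
  [move: e1 | move: e2 | move: e3]; rewrite !(rmorphM, rmorphB, rmorphN).
Qed.

Lemma cubic_rel_map (R R' : pzRingType) (g : {rmorphism R -> R'}) (b h x z X Z Y : R) :
  cubic_rel b h x z X Z Y -> cubic_rel (g b) (g h) (g x) (g z) (g X) (g Z) (g Y).
Proof.
case=> /(quad_rel_map g) q /(congr1 g) e; split=> //.
by move: e; rewrite !(rmorphM, rmorphB, rmorphN).
Qed.

Lemma quad_rel_scale (R : pzRingType) (m b h x z X Z : R) : central m ->
  quad_rel b h x z X Z -> quad_rel (m * b) (m * h) x z X Z.
Proof.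
move=> mC [e1 e2 e3].
by split; [nc_from (m :: nil) (m * dif e1) | nc_from (m :: nil) (m * dif e2)
  | nc_from (m :: nil) (m * dif e3)].
Qed.

Lemma cubic_rel_scale (R : pzRingType) (m b h x z X Z Y : R) : central m ->
  cubic_rel b h x z X Z Y -> cubic_rel (m * b) (m * h) x z X Z Y.
Proof.
by move=> mC [q e]; split; [exact: quad_rel_scale | rewrite -!mulrA e].
Qed.

(** The three relations live in different pairs of variables, and each is multiplied by the clearing
    factor of the missing one. Then (u_1 - v) - (u_2 - v) = u_1 - u_2 becomes an identity between
    their coefficients, as [serre_half] requires. *)
Lemma serre_transport (A R : pzRingType) (g12 g13 g23 : {rmorphism A -> R})
    (m1 m2 m3 : R) (b12 b13 b23 h12 h13 h23 : A)
    (x1 z1 x2 z2 x1' z1' x2' z2' x3 z3 x3' z3' y y' : A) :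
  central m1 -> central m2 -> central m3 ->
  central (g13 b13) -> central (g23 b23) -> central (g13 h13) ->
  reg (m1 * g23 b23) -> reg (m2 * g13 b13) -> reg (m3 * g12 b12) ->
  m2 * g13 b13 - m1 * g23 b23 = m3 * g12 b12 ->
  m1 * g23 h23 = m2 * g13 h13 -> m3 * g12 h12 = m2 * g13 h13 ->
  [/\ g12 x1 = g13 x1', g12 z1 = g13 z1', g12 x2 = g23 x2' & g12 z2 = g23 z2'] ->
  [/\ g23 x3' = g13 x3, g23 z3' = g13 z3 & g23 y' = g13 y] ->
  quad_rel b12 h12 x1 z1 x2 z2 -> cubic_rel b13 h13 x1' z1' x3 z3 y ->
  cubic_rel b23 h23 x2' z2' x3' z3' y' ->
  g13 x1' * g23 x2' * g13 y - g13 x1' * g13 y * g23 x2' *+ 2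
    + g13 y * g13 x1' * g23 x2'
  + (g23 x2' * g13 x1' * g13 y - g23 x2' * g13 y * g13 x1' *+ 2
    + g13 y * g23 x2' * g13 x1') = 0.
Proof.
move=> m1C m2C m3C b13C b23C h13C r1 r2 r3 bE h1 h2 [x1E z1E x2E z2E] [x3E z3E yE].
move=> /(quad_rel_map g12)/(quad_rel_scale m3C) q12.
move=> /(cubic_rel_map g13)/(cubic_rel_scale m2C) q13.
move=> /(cubic_rel_map g23)/(cubic_rel_scale m1C) q23.
rewrite -bE h2 x1E z1E x2E z2E in q12; rewrite h1 x3E z3E yE in q23.
by apply: serre_half q12 q13 q23 => //; rewrite ?bE //; exact: centralM.
Qed.

Section Serre3.
Variables (C : pzRingType) (h : C).
Hypothesis hC : central h.
Hypothesis hsep : forall x : C, (forall n, exists y, x = h ^+ n * y) -> x = 0.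

Lemma fps_sep (x : fps C) : (forall n, exists y, x = fpsC h ^+ n * y) -> x = 0.
Proof.
move=> xn; apply: fpsP => i; apply: hsep => n; have [y ->] := xn n.
have -> : fpsC h ^+ n = fpsC (h ^+ n) by rewrite rmorphXn.
by exists (fcoef y i); rewrite fcoefCM.
Qed.

Notation T2 := (fps (fps C)).
Notation T3 := (fps (fps (fps C))).
(** The embeddings of series in two of the variables u_1, u_2, v, of which u_1 is the outermost and
    v the innermost. *)
Definition in12 (F : T2) : T3 := fps_map (fps_map (@fpsC C)) F.
Definition in13 (F : T2) : T3 := fps_map (@fpsC (fps C)) F.
Definition in23 (F : T2) : T3 := fpsC F.
HB.instance Definition _ := GRing.RMorphism.copy in12 (fps_map (fps_map (@fpsC C))).
HB.instance Definition _ := GRing.RMorphism.copy in13 (fps_map (@fpsC (fps C))).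
HB.instance Definition _ := GRing.RMorphism.copy in23 (@fpsC T2).

Lemma in_u f : in12 (inu f) = in13 (inu f). Proof. by apply: fpsP => n; apply: fpsP => -[|i]; rewrite //=; apply: fpsP => -[]. Qed.

Lemma in12_v f : in12 (fpsC f) = in23 (inu f).
Proof. by apply: fpsP => -[|n] //; apply: fpsP => i; apply: fpsP => -[]. Qed.

Lemma in13_v f : in13 (fpsC f) = in23 (fpsC f).
Proof. by apply: fpsP => -[|n] //; apply: fpsP => -[|i]. Qed.

Lemma in12X : in12 (fpsX (fps C)) = fpsX (fps (fps C)).
Proof. by apply: fpsP => n; rewrite /= rmorph_nat. Qed.

Lemma in13X : in13 (fpsX (fps C)) = fpsX (fps (fps C)).
Proof. by apply: fpsP => n; rewrite /= rmorph_nat. Qed.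

Lemma inuX : inu (fpsX C) = fpsX (fps C).
Proof. by apply: fpsP => n; rewrite /= rmorph_nat. Qed.

Lemma in12_m s : in12 (var_m (fps C) s) = var_m (fps (fps C)) s.
Proof. by case: s; rewrite ?rmorph1 // in12X. Qed.
Lemma in12_p s : in12 (var_p (fps C) s) = var_p (fps (fps C)) s.
Proof. by case: s; rewrite ?rmorph1 // in12X. Qed.
Lemma in13_m s : in13 (var_m (fps C) s) = var_m (fps (fps C)) s.
Proof. by case: s; rewrite ?rmorph1 // in13X. Qed.
Lemma in13_p s : in13 (var_p (fps C) s) = var_p (fps (fps C)) s.
Proof. by case: s; rewrite ?rmorph1 // in13X. Qed.
Lemma inu_m s : inu (var_m C s) = var_m (fps C) s.
Proof. by case: s; rewrite ?rmorph1 // inuX. Qed.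
Lemma inu_C (a : C) : inu (fpsC a) = fpsC (fpsC a).
Proof. by apply: fpsP => -[|n] //; apply: fpsP => -[]. Qed.
Lemma inu_p s : inu (var_p C s) = var_p (fps C) s.
Proof. by case: s; rewrite ?rmorph1 // inuX. Qed.

Definition const3 (b : C) : T3 := fpsC (fpsC (fpsC b)).

Notation m1 s := (var_m (fps (fps C)) s).
Notation p1 s := (var_p (fps (fps C)) s).
Notation m2 s := (fpsC (var_m (fps C) s)).
Notation p2 s := (fpsC (var_p (fps C) s)).
Notation m3 s := (fpsC (fpsC (var_m C s))).
Notation p3 s := (fpsC (fpsC (var_p C s))).

Lemma in12_diff s s' b :
  in12 (beta2 h s s' b) = diff_uv (m1 s) (p1 s) (m2 s') (p2 s') (const3 (h * b)).
Proof.
rewrite /beta2 /diff_uv !(rmorphM, rmorphB, rmorphD) /=.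
by rewrite in12_m in12_p !in12_v /in23 !inu_m inu_p !inu_C /const3 !fpsCM.
Qed.

Lemma in13_diff s s' b :
  in13 (beta2 h s s' b) = diff_uv (m1 s) (p1 s) (m3 s') (p3 s') (const3 (h * b)).
Proof.
rewrite /beta2 /diff_uv !(rmorphM, rmorphB, rmorphD) /=.
by rewrite in13_m in13_p !in13_v /in23 /const3 !fpsCM.
Qed.

Lemma in23_diff s s' b :
  in23 (beta2 h s s' b) = diff_uv (m2 s) (p2 s) (m3 s') (p3 s') (const3 (h * b)).
Proof. by rewrite /in23 /beta2 /diff_uv /const3 !(fpsCB, fpsCD) !fpsCM. Qed.

(** [g] is [h] or [- h]; the sign is reversed for the half-currents taken from the inverse
    matrix. *)
Variable g : C.
Hypothesis gC : central g.

Lemma in12_eta s s' : in12 (eta2 g s s') = m1 s * m2 s' * const3 g.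
Proof. by rewrite /eta2 !rmorphM /= in12_m !in12_v /in23 inu_m inu_C. Qed.

Lemma in13_eta s s' : in13 (eta2 g s s') = m1 s * m3 s' * const3 g.
Proof. by rewrite /eta2 !rmorphM /= in13_m !in13_v. Qed.

Lemma in23_eta s s' : in23 (eta2 g s s') = m2 s * m3 s' * const3 g.
Proof. by rewrite /in23 /eta2 !fpsCM. Qed.

Lemma m1C s : central (m1 s). Proof. exact: var_mC. Qed.
Lemma p1C s : central (p1 s). Proof. exact: var_pC. Qed.
Lemma m2C s : central (m2 s). Proof. by apply: fpsC_central; exact: var_mC. Qed.
Lemma p2C s : central (p2 s). Proof. by apply: fpsC_central; exact: var_pC. Qed.
Lemma m3C s : central (m3 s). Proof. by do 2!apply: fpsC_central; exact: var_mC. Qed.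
Lemma p3C s : central (p3 s). Proof. by do 2!apply: fpsC_central; exact: var_pC. Qed.
Lemma const3C b : central b -> central (const3 b).
Proof. by move=> bC; do 3!apply: fpsC_central. Qed.

Lemma diffC (R : pzRingType) (a b c d e : R) : central a -> central b -> central c ->
  central d -> central e -> central (diff_uv a b c d e).
Proof.
move=> aC bC cC dC eC; apply: centralD; last by do 2!apply: centralM => //.
by apply: centralD; [exact: centralM | apply: centralN; exact: centralM].
Qed.

Variables (s1 s2 s3 : polarity) (b12 b13 b23 : C).
Hypotheses (b12C : central b12) (b13C : central b13) (b23C : central b23).
Hypothesis bE : b13 - b23 = b12.

Let g12 := in12 (beta2 h s1 s2 b12).
Let g13 := in13 (beta2 h s1 s3 b13).
Let g23 := in23 (beta2 h s2 s3 b23).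

Lemma g13C : central g13.
Proof.
rewrite /g13 in13_diff; apply: diffC; rewrite ?m1C ?p1C ?m3C ?p3C //;
  try (exact: m1C || exact: p1C || exact: m3C || exact: p3C).
by apply: const3C; exact: centralM.
Qed.

Lemma g23C : central g23.
Proof. by apply: fpsC_central; apply: beta2C. Qed.

Lemma g23R : reg g23.
Proof. by apply: reg_fpsC; apply: beta2R. Qed.

Lemma g13R : reg g13.
Proof.
have in13_outer s a b : in13 (var_p _ s * fpsC a - var_m _ s * fpsC b) =
    var_p _ s * fpsC (fpsC a) - var_m _ s * fpsC (fpsC b).
  by rewrite !(rmorphB, rmorphM) /= in13_m in13_p !in13_v.
rewrite /g13 beta2_outer in13_outer; apply: reg_outer => _; apply: reg_fpsC.
  exact: var_mR.
exact: reg_inner.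
Qed.

Lemma g12R : reg g12.
Proof.
(* The factor in u_1 and u_2 has the same form over the coefficient ring of series in v, which is
   again separated. *)
have -> : g12 = beta2 (fpsC h) s1 s2 (fpsC b12).
  by rewrite /g12 in12_diff /beta2 /diff_uv /const3 -!fpsCM.
apply: (@beta2R (fps C) (fpsC h)) => //; try exact: fpsC_central.
exact: fps_sep.
Qed.

Lemma scaled_diff : m2 s2 * g13 - m1 s1 * g23 = m3 s3 * g12.
Proof.
rewrite /g12 /g13 /g23 in12_diff in13_diff in23_diff -bE /diff_uv.
have -> : const3 (h * (b13 - b23)) = const3 (h * b13) - const3 (h * b23).
  by rewrite /const3 mulrBr !fpsCB.
have c1 := m1C s1; have c2 := m2C s2; have c3 := m3C s3.
have c1' := p1C s1; have c2' := p2C s2; have c3' := p3C s3.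
have hb1 := const3C (centralM hC b13C); have hb2 := const3C (centralM hC b23C).
nc_ring (m1 s1 :: m2 s2 :: m3 s3 :: p1 s1 :: p2 s2 :: p3 s3 ::
  const3 (h * b13) :: const3 (h * b23) :: nil).
Qed.

Lemma scaled_eta23 : m1 s1 * in23 (eta2 g s2 s3) = m2 s2 * in13 (eta2 g s1 s3).
Proof.
rewrite in23_eta in13_eta; have c1 := m1C s1; have c2 := m2C s2.
nc_ring (m1 s1 :: m2 s2 :: nil).
Qed.

Lemma scaled_eta12 : m3 s3 * in12 (eta2 g s1 s2) = m2 s2 * in13 (eta2 g s1 s3).
Proof.
rewrite in12_eta in13_eta; have c1 := m1C s1; have c2 := m2C s2; have c3 := m3C s3.
nc_ring (m1 s1 :: m2 s2 :: m3 s3 :: nil).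
Qed.

Lemma in13_etaC : central (in13 (eta2 g s1 s3)).
Proof.
rewrite in13_eta; apply: centralM; last exact: const3C.
by apply: centralM; [exact: m1C | exact: m3C].
Qed.

Section Coef.
Variables (x1 x2 y : fps C) (i j l : nat).
Notation A1 := (in13 (inu x1)).
Notation A2 := (in23 (inu x2)).
Notation Y := (in13 (fpsC y)).
Notation coef F := (fcoef (fcoef (fcoef F i) j) l).

Let cA1 : fcoef A1 i = fpsC (fpsC (fcoef x1 i)). Proof. by []. Qed.
Let cA2 : fcoef (inu x2) j = fpsC (fcoef x2 j). Proof. by []. Qed.
Let coefE := (fcoefMC, fcoefCM, cA1, cA2).

Lemma coef_xxy : coef (A1 * A2 * Y) = fcoef x1 i * fcoef x2 j * fcoef y l.
Proof. by rewrite in13_v /in23 !coefE -fpsCM fcoefCM. Qed.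
Lemma coef_xxy' : coef (A2 * A1 * Y) = fcoef x2 j * fcoef x1 i * fcoef y l.
Proof. by rewrite in13_v /in23 !coefE -fpsCM fcoefCM. Qed.
Lemma coef_xyx : coef (A1 * Y * A2) = fcoef x1 i * fcoef y l * fcoef x2 j.
Proof. by rewrite in13_v /in23 !coefE -fpsCM fcoefCM fcoefMC fcoefCM. Qed.
Lemma coef_xyx' : coef (A2 * Y * A1) = fcoef x2 j * fcoef y l * fcoef x1 i.
Proof. by rewrite in13_v /in23 -fpsCM fcoefCM cA1 !fcoefMC fcoefCM. Qed.
Lemma coef_yxx : coef (Y * A1 * A2) = fcoef y l * fcoef x1 i * fcoef x2 j.
Proof. by rewrite in13_v /in23 fcoefMC fcoefCM -fpsCM fcoefCM !fcoefMC. Qed.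
Lemma coef_yxx' : coef (Y * A2 * A1) = fcoef y l * fcoef x2 j * fcoef x1 i.
Proof. by rewrite in13_v /in23 -fpsCM fcoefCM cA1 fcoefMC fcoefCM cA2 !fcoefMC. Qed.
End Coef.

Notation serre_coef x1 x2 y i j l :=
  (fcoef x1 i * fcoef x2 j * fcoef y l - fcoef x1 i * fcoef y l * fcoef x2 j *+ 2
   + fcoef y l * fcoef x1 i * fcoef x2 j
   + (fcoef x2 j * fcoef x1 i * fcoef y l - fcoef x2 j * fcoef y l * fcoef x1 i *+ 2
      + fcoef y l * fcoef x2 j * fcoef x1 i)).

Lemma serre3 (x1 z1 x2 z2 x3 z3 y : fps C) :
  quad_rel (beta2 h s1 s2 b12) (eta2 g s1 s2) (inu x1) (inu z1) (fpsC x2) (fpsC z2) ->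
  cubic_rel (beta2 h s1 s3 b13) (eta2 g s1 s3) (inu x1) (inu z1) (fpsC x3) (fpsC z3)
    (fpsC y) ->
  cubic_rel (beta2 h s2 s3 b23) (eta2 g s2 s3) (inu x2) (inu z2) (fpsC x3) (fpsC z3)
    (fpsC y) ->
  forall i j l, serre_coef x1 x2 y i j l = 0.
Proof.
move=> q12 q13 q23 i j l.
have := @serre_transport _ _ in12 in13 in23 (m1 s1) (m2 s2) (m3 s3) _ _ _ _ _ _
  _ _ _ _ _ _ _ _ _ _ _ _ _ _ (m1C s1) (m2C s2) (m3C s3) g13C g23C in13_etaC
  (regM (@var_mR _ s1) g23R) (regM (reg_fpsC (@var_mR _ s2)) g13R)
  (regM (reg_fpsC (reg_fpsC (@var_mR _ s3))) g12R) scaled_diff scaled_eta23 scaled_eta12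
  (And4 (in_u x1) (in_u z1) (in12_v x2) (in12_v z2))
  (And3 (esym (in13_v x3)) (esym (in13_v z3)) (esym (in13_v y))) q12 q13 q23.
move=> /(congr1 (fun F => fcoef (fcoef (fcoef F i) j) l)).
rewrite !mulr2n !(fcoefD, fcoefN).
by rewrite coef_xxy coef_xxy' coef_xyx coef_xyx' coef_yxx coef_yxx'.
Qed.

(** The opposite ring is taken of the ring of power series, not of its coefficients. The embeddings
    and the facts on central and regular elements are therefore carried over to it, and only the
    final coefficients are read in [C]. *)
Lemma serre3C (x1 z1 x2 z2 x3 z3 y : fps C) :
  quad_rel (beta2 h s1 s2 b12 : T2^c) (eta2 g s1 s2 : T2^c)
    (inu x1 : T2^c) (inu z1) (fpsC x2) (fpsC z2) ->
  cubic_rel (beta2 h s1 s3 b13 : T2^c) (eta2 g s1 s3 : T2^c)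
    (inu x1 : T2^c) (inu z1) (fpsC x3) (fpsC z3) (fpsC y) ->
  cubic_rel (beta2 h s2 s3 b23 : T2^c) (eta2 g s2 s3 : T2^c)
    (inu x2 : T2^c) (inu z2) (fpsC x3) (fpsC z3) (fpsC y) ->
  forall i j l, serre_coef x1 x2 y i j l = 0.
Proof.
move=> q12 q13 q23 i j l.
have e1 : (m2 s2 : T3^c) * g13 - (m1 s1 : T3^c) * g23 = (m3 s3 : T3^c) * g12.
  change (g13 * m2 s2 - g23 * m1 s1 = g12 * m3 s3 :> T3).
  by rewrite -(m1C s1) -(m2C s2) -(m3C s3) scaled_diff.
have e2 : (m1 s1 : T3^c) * in23 (eta2 g s2 s3) = (m2 s2 : T3^c) * in13 (eta2 g s1 s3).
  change (in23 (eta2 g s2 s3) * m1 s1 = in13 (eta2 g s1 s3) * m2 s2 :> T3).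
  by rewrite -(m1C s1) -(m2C s2) scaled_eta23.
have e3 : (m3 s3 : T3^c) * in12 (eta2 g s1 s2) = (m2 s2 : T3^c) * in13 (eta2 g s1 s3).
  change (in12 (eta2 g s1 s2) * m3 s3 = in13 (eta2 g s1 s3) * m2 s2 :> T3).
  by rewrite -(m3C s3) -(m2C s2) scaled_eta12.
have R1 := regM (regC (m1C s1) (@var_mR _ s1)) (regC g23C g23R).
have R2 := regM (regC (m2C s2) (reg_fpsC (@var_mR _ s2))) (regC g13C g13R).
have g12C : central g12.
  rewrite /g12 in12_diff; apply: diffC;
    try (exact: m1C || exact: p1C || exact: m2C || exact: p2C).
  by apply: const3C; exact: centralM.
have R3 := regM (regC (m3C s3) (reg_fpsC (reg_fpsC (@var_mR _ s3)))) (regC g12C g12R).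
have := @serre_transport (T2^c) (T3^c) (conv_map in12) (conv_map in13) (conv_map in23)
  (m1 s1 : T3^c) (m2 s2) (m3 s3) _ _ _ _ _ _
  _ _ _ _ _ _ _ _ _ _ _ _ _ _ (centralC (m1C s1)) (centralC (m2C s2))
  (centralC (m3C s3)) (centralC g13C) (centralC g23C) (centralC in13_etaC) R1 R2 R3 e1 e2 e3
  (And4 (in_u x1) (in_u z1) (in12_v x2) (in12_v z2))
  (And3 (esym (in13_v x3)) (esym (in13_v z3)) (esym (in13_v y))) q12 q13 q23.
move=> E.
have {E} : in13 (fpsC y) * (in23 (inu x2) * in13 (inu x1))
    - in23 (inu x2) * (in13 (fpsC y) * in13 (inu x1)) *+ 2
    + in23 (inu x2) * (in13 (inu x1) * in13 (fpsC y))
  + (in13 (fpsC y) * (in13 (inu x1) * in23 (inu x2))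
    - in13 (inu x1) * (in13 (fpsC y) * in23 (inu x2)) *+ 2
    + in13 (inu x1) * (in23 (inu x2) * in13 (fpsC y))) = 0 by exact E.
move=> /(congr1 (fun F => fcoef (fcoef (fcoef F i) j) l)).
rewrite !mulr2n !mulrA !(fcoefD, fcoefN).
rewrite coef_xxy coef_xxy' coef_xyx coef_xyx' coef_yxx coef_yxx'.
change (fcoef (fcoef (fcoef 0 i) j) l) with (0 : C) => E.
nc_from (@nil C) (dif E).
Qed.
End Serre3.

(** * Exchange of the two variables *)

Section ExchangeVars.
Variable C : pzRingType.
Implicit Types F G : fps (fps C).

Definition tr2 F : fps (fps C) := FPS (fun i => FPS (fun j => fcoef (fcoef F j) i)).

Lemma fps2P F G : (forall i j, fcoef (fcoef F i) j = fcoef (fcoef G i) j) -> F = G.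
Proof. by move=> FG; apply: fpsP => i; apply: fpsP => j. Qed.

Lemma fcoef2M F G i j : fcoef (fcoef (F * G) i) j =
  \sum_(a < i.+1) \sum_(b < j.+1) fcoef (fcoef F a) b * fcoef (fcoef G (i - a)) (j - b).
Proof. by rewrite fcoefM fcoef_sum; apply: eq_bigr => a _; rewrite fcoefM. Qed.

Lemma tr2_zmod_morphism : zmod_morphism tr2.
Proof. by move=> F G; apply: fps2P. Qed.

Lemma tr2_monoid_morphism : monoid_morphism tr2.
Proof.
split=> [|F G]; apply: fps2P => i j; first by case: i j => [|i] [|j].
by rewrite [LHS]fcoef2M [RHS]fcoef2M exchange_big.
Qed.

HB.instance Definition _ :=
  GRing.isZmodMorphism.Build (fps (fps C)) (fps (fps C)) tr2 tr2_zmod_morphism.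
HB.instance Definition _ :=
  GRing.isMonoidMorphism.Build (fps (fps C)) (fps (fps C)) tr2 tr2_monoid_morphism.

Lemma tr2_inu f : tr2 (inu f) = fpsC f.
Proof. by apply: fps2P => -[|i] [|j]. Qed.

Lemma tr2_C f : tr2 (fpsC f) = inu f.
Proof. by apply: fps2P => -[|i] [|j]. Qed.

Variable h : C.
Hypothesis hC : central h.

Lemma tr2_eta s s' : tr2 (eta2 h s s') = eta2 h s' s.
Proof.
rewrite /eta2 -!inu_m !rmorphM /= !tr2_inu !tr2_C -inu_C.
by rewrite inu_m var_mC.
Qed.

Lemma tr2_beta s s' b : central b -> tr2 (beta2 h s s' b) = - beta2 h s' s (- b).
Proof.
move=> bC; have := centralM hC bC; rewrite /beta2 /diff_uv mulrN !raddfN /=.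
move: (h * b) => d /const2C dC; rewrite -!inu_m -!inu_p !(rmorphD, rmorphN, rmorphM) /=.
rewrite !tr2_inu !tr2_C inu_C !inu_m !inu_p.
have c1 := @var_mC (fps C) s'; have c2 := @var_pC (fps C) s'.
have [c3 c4] := var2C C s.
nc_ring (var_m (fps C) s' :: var_p (fps C) s' :: fpsC (var_m C s) :: fpsC (var_p C s) ::
  fpsC (fpsC d) :: nil).
Qed.
End ExchangeVars.

Lemma rtt_map (R R' : pzRingType) (g : {rmorphism R -> R'}) (al be et : R) (I : Type)
    (P : I -> Prop) (U V : I -> I -> R) : rtt al be et P U V ->
  rtt (g al) (g be) (g et) P (fun i j => g (U i j)) (fun i j => g (V i j)).
Proof.
move=> UV i j k l Pi Pj Pk Pl; have /(congr1 g) := UV i j k l Pi Pj Pk Pl.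
by rewrite !(rmorphM, rmorphD).
Qed.

Lemma gauss_mx_map (R R' : pzRingType) (g : {rmorphism R -> R'}) n
    (f e : 'I_n -> 'I_n -> R) (k ki : 'I_n -> R) : gauss_mx f k ki e ->
  gauss_mx (fun i j => g (f i j)) (fun i => g (k i)) (fun i => g (ki i)) (fun i j => g (e i j)).
Proof.
case=> f1 e1 f0 e0 kV Vk; split=> [i|i|i j ij|i j ij|i|i].
- by rewrite f1 rmorph1.
- by rewrite e1 rmorph1.
- by rewrite f0 // rmorph0.
- by rewrite e0 // rmorph0.
- by rewrite -rmorphM kV rmorph1.
- by rewrite -rmorphM Vk rmorph1.
Qed.

Lemma schur_map (R R' : pzRingType) (g : {rmorphism R -> R'}) n
    (f e : 'I_n -> 'I_n -> R) (k : 'I_n -> R) m i j :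
  schur (fun i j => g (f i j)) (fun i => g (k i)) (fun i j => g (e i j)) m i j =
  g (schur f k e m i j).
Proof. by rewrite rmorph_sum; apply: eq_bigr => l _; rewrite !rmorphM. Qed.

(** * Coefficients of relations between currents in two variables *)

(** The exponent to which the i-th coefficient belongs. Each multiplication by u - v + h b raises
    the upper bound for the exponents of a [Pos] series by one; [k] counts these multiplications. *)
Definition expo (k : nat) (t : polarity) (i : nat) : int :=
  if t is Pos then k%:Z - i%:Z else i%:Z.

Definition in_range (k : nat) (t : polarity) (m : int) : bool :=
  if t is Pos then m <= k%:Z else 0 <= m.

Lemma expoP k t m : in_range k t m -> exists i, m = expo k t i.
Proof.
case: t => /= mk; last by case: m mk => // i _; exists i.
by exists `|k%:Z - m|%N; rewrite gez0_abs ?subr_ge0 // opprB addrC subrK.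
Qed.

Lemma in_rangeS k t m : in_range k t m -> in_range k.+1 t m.
Proof. by case: t => /=; lia. Qed.

Lemma in_rangeB k t m : in_range k t (m - 1) -> in_range k.+1 t m.
Proof. by case: t => /=; lia. Qed.

Section Pack1.
Variables (S : pzRingType) (k : nat) (t : polarity) (g : int -> S).

Definition pack1 : fps S := FPS (fun i => g (expo k t i)).

Lemma pack1_C a : fpsC a * pack1 = FPS (fun i => a * g (expo k t i)).
Proof. by apply: fpsP => n; rewrite fcoefCM. Qed.
End Pack1.

Section Pack1Shift.
Variables (S : pzRingType) (k : nat) (t : polarity) (g : int -> S).
Hypothesis g0 : forall m, ~~ in_range k t m -> g m = 0.

Lemma pack1_m : var_m S t * pack1 k t g = pack1 k.+1 t g.
Proof.
case: t g0 => h0; rewrite /var_m ?mul1r //; apply: fpsP => n; rewrite fcoefXM.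
case: n => [|n] /=; first by rewrite h0 //=; lia.
by congr (g _); lia.
Qed.

Lemma pack1_p : var_p S t * pack1 k t g = pack1 k.+1 t (fun m => g (m - 1)).
Proof.
case: t g0 => h0; rewrite /var_p ?mul1r; apply: fpsP => n; last rewrite fcoefXM.
  by congr (g _); rewrite /=; lia.
case: n => [|n] /=; first by rewrite h0 //=; lia.
by congr (g _); lia.
Qed.
End Pack1Shift.

Section Pack.
Variables (C : pzRingType) (h : C) (s s' : polarity).

Definition pack (k : nat) (F : int -> int -> C) : fps (fps C) :=
  pack1 k s (fun m => pack1 k s' (F m)).

(** Support in the quadrant of exponents that [pack k] reads; under this condition packing loses
    nothing. *)
Definition orth (k : nat) (F : int -> int -> C) : Prop :=
  forall m n, ~~ (in_range k s m && in_range k s' n) -> F m n = 0.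

(* The effect on coefficients of the multiplication by [u - v + h b]. *)
Definition Lop (b : C) (F : int -> int -> C) : int -> int -> C := fun m n =>
  F (m - 1) n - F m (n - 1) + h * b * F m n.

Definition Hop (F : int -> int -> C) : int -> int -> C := fun m n => h * F m n.

Lemma pack_inj k F G : orth k F -> orth k G -> pack k F = pack k G ->
  forall m n, F m n = G m n.
Proof.
move=> oF oG FG m n; case/boolP: (in_range k s m && in_range k s' n) => [|mn].
  move=> /andP[/expoP[i ->] /expoP[j ->]].
  by have := congr1 (fun H => fcoef (fcoef H i) j) FG.
by rewrite oF ?oG.
Qed.

Lemma packD k F G : pack k F + pack k G = pack k (fun m n => F m n + G m n).
Proof. by []. Qed.

Lemma packN k F : - pack k F = pack k (fun m n => - F m n).
Proof. by []. Qed.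

Lemma packCC k a F : fpsC (fpsC a) * pack k F = pack k (fun m n => a * F m n).
Proof. by rewrite /pack pack1_C; congr FPS; apply: funext => i; rewrite pack1_C. Qed.

Lemma orthZ k a F : orth k F -> orth k (fun m n => a * F m n).
Proof. by move=> oF m n mn; rewrite oF ?mulr0. Qed.

Lemma orthD k F G : orth k F -> orth k G -> orth k (fun m n => F m n + G m n).
Proof. by move=> oF oG m n mn; rewrite oF ?oG ?addr0. Qed.

Lemma orthN k F : orth k F -> orth k (fun m n => - F m n).
Proof. by move=> oF m n mn; rewrite oF ?oppr0. Qed.

Lemma orth_L k b F : orth k F -> orth k.+1 (Lop b F).
Proof.
move=> oF m n mn; rewrite /Lop !oF ?mulr0 ?subrr ?addr0 //; apply: contra mn => /andP[].
- by move=> /in_rangeS -> /in_rangeS.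
- by move=> /in_rangeS -> /in_rangeB.
- by move=> /in_rangeB -> /in_rangeS.
Qed.

Lemma orth_H k F : orth k F -> orth k.+1 (Hop F).
Proof.
move=> oF m n mn; rewrite /Hop oF ?mulr0 //; apply: contra mn => /andP[].
by move=> /in_rangeS -> /in_rangeS.
Qed.

Section Shifts.
Variables (k : nat) (F : int -> int -> C).
Hypothesis oF : orth k F.

Let g0 m : ~~ in_range k s m -> pack1 k s' (F m) = 0.
Proof. by move=> mk; apply: fpsP => j; rewrite /= oF // (negPf mk). Qed.
Let g0' m : ~~ in_range k s m -> pack1 k.+1 s' (F m) = 0.
Proof. by move=> mk; apply: fpsP => j; rewrite /= oF // (negPf mk). Qed.
Let g0'' m : ~~ in_range k s m -> pack1 k.+1 s' (fun n => F m (n - 1)) = 0.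
Proof. by move=> mk; apply: fpsP => j; rewrite /= oF // (negPf mk). Qed.
Let h0 m n : ~~ in_range k s' n -> F m n = 0.
Proof. by move=> nk; apply: oF; rewrite (negPf nk) andbF. Qed.

Lemma pack_mm : var_m _ s * (fpsC (var_m _ s') * pack k F) = pack k.+1 F.
Proof.
rewrite /pack pack1_C -[FPS _]/(pack1 k s (fun m => var_m C s' * pack1 k s' (F m))).
rewrite pack1_m => [|m mk]; last by rewrite g0 ?mulr0.
by congr FPS; apply: funext => i; rewrite pack1_m // => n; exact: h0.
Qed.

Lemma pack_pm : var_p _ s * (fpsC (var_m _ s') * pack k F) =
  pack k.+1 (fun m n => F (m - 1) n).
Proof.
rewrite /pack pack1_C -[FPS _]/(pack1 k s (fun m => var_m C s' * pack1 k s' (F m))).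
rewrite pack1_p => [|m mk]; last by rewrite g0 ?mulr0.
by congr FPS; apply: funext => i; rewrite pack1_m // => n; exact: h0.
Qed.

Lemma pack_mp : var_m _ s * (fpsC (var_p _ s') * pack k F) =
  pack k.+1 (fun m n => F m (n - 1)).
Proof.
rewrite /pack pack1_C -[FPS _]/(pack1 k s (fun m => var_p C s' * pack1 k s' (F m))).
rewrite pack1_m => [|m mk]; last by rewrite g0 ?mulr0.
by congr FPS; apply: funext => i; rewrite pack1_p // => n; exact: h0.
Qed.
End Shifts.

(** The clearing factors contained in [beta2] are exactly the passage from [k] to [k + 1], so the
    coefficients see the uncleared u - v + h b. *)
Lemma pack_beta k b F : central h -> central b -> orth k F ->
  beta2 h s s' b * pack k F = pack k.+1 (Lop b F).
Proof.
move=> hC bC oF; rewrite /beta2 /diff_uv !mulrDl mulNr -!mulrA pack_pm // pack_mp //.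
rewrite packCC pack_mm ?packN ?packD //; exact: orthZ.
Qed.

Lemma pack_eta k F : orth k F -> eta2 h s s' * pack k F = pack k.+1 (Hop F).
Proof. by move=> oF; rewrite /eta2 -!mulrA packCC pack_mm //; exact: orthZ. Qed.
End Pack.

Notation ser := (pack1 0).

Definition unser (S : pzRingType) (s : polarity) (F : fps S) : int -> S :=
  fun m => if in_range 0 s m then fcoef F `|m| else 0.

Definition ranged (S : pzRingType) (s : polarity) (a : int -> S) :=
  forall m, ~~ in_range 0 s m -> a m = 0.

Lemma unser_ranged (S : pzRingType) s (F : fps S) : ranged s (unser s F).
Proof. by move=> m; rewrite /unser => /negPf ->. Qed.

Lemma expo0P s m : in_range 0 s m -> m = expo 0 s `|m|.
Proof. by case: s => /=; lia. Qed.

Lemma in_range_expo0 s i : in_range 0 s (expo 0 s i).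
Proof. by case: s => /=; lia. Qed.

Lemma abs_expo0 s i : `|expo 0 s i|%N = i.
Proof. by case: s => /=; lia. Qed.

Lemma ser_unser (S : pzRingType) s (F : fps S) : ser s (unser s F) = F.
Proof. by apply: fpsP => i; rewrite /= /unser in_range_expo0 abs_expo0. Qed.

Lemma unser_ser (S : pzRingType) s (a : int -> S) : ranged s a -> unser s (ser s a) = a.
Proof.
move=> a0; apply: funext => m; rewrite /unser; case: ifPn => [ms|/a0//].
by rewrite /= -expo0P.
Qed.

Lemma expo_eq0 s i : (expo 0 s i == 0) = (i == 0%N).
Proof. by case: s => /=; lia. Qed.

Section Mono.
Variables (C : pzRingType) (s s' : polarity).

(** The series a(u), and in [vmono] the series b(v), as coefficient families in two variables. *)
Definition umono (a : int -> C) : int -> int -> C := fun m n => if n == 0 then a m else 0.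
Definition vmono (b : int -> C) : int -> int -> C := fun m n => if m == 0 then b n else 0.

(* The coefficients of [a(u) x b(u)] for a constant [x]. *)
Definition conj_conv (a b : int -> C) (x : C) : int -> C := fun m =>
  if in_range 0 s m then
    \sum_(i < `|m|.+1) a (expo 0 s i) * x * b (expo 0 s (`|m| - i)) else 0.

Lemma in_range00 t : in_range 0 t 0. Proof. by case: t. Qed.

Lemma orth_u (a : int -> C) : ranged s a -> orth s s' 0 (umono a).
Proof.
move=> a0 m n; rewrite /umono; case: eqP => // ->.
by rewrite in_range00 andbT => /a0.
Qed.

Lemma orth_v (b : int -> C) : ranged s' b -> orth s s' 0 (vmono b).
Proof.
move=> b0 m n; rewrite /vmono; case: eqP => // ->.
by rewrite in_range00 /= => /b0.
Qed.

Lemma pack_u (a : int -> C) : pack s s' 0 (umono a) = inu (ser s a).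
Proof.
by apply: fps2P => i j; rewrite /= /umono expo_eq0; case: j.
Qed.

Lemma pack_v (b : int -> C) : pack s s' 0 (vmono b) = fpsC (ser s' b).
Proof. by apply: fps2P => i j; rewrite /= /vmono expo_eq0; case: i. Qed.

Lemma orth_uv (a b : int -> C) : ranged s a -> ranged s' b -> orth s s' 0 (fun m n => a m * b n).
Proof.
by move=> a0 b0 m n; rewrite negb_and => /orP[/a0|/b0] ->; rewrite ?mul0r ?mulr0.
Qed.

Lemma orth_vu (a b : int -> C) : ranged s a -> ranged s' b -> orth s s' 0 (fun m n => b n * a m).
Proof.
by move=> a0 b0 m n; rewrite negb_and => /orP[/a0|/b0] ->; rewrite ?mul0r ?mulr0.
Qed.

Lemma pack_uv (a b : int -> C) : pack s s' 0 (fun m n => a m * b n) = inu (ser s a) * fpsC (ser s' b).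
Proof. by apply: fps2P => i j; rewrite fcoefMC fcoefCM. Qed.

Lemma pack_vu (a b : int -> C) : pack s s' 0 (fun m n => b n * a m) = fpsC (ser s' b) * inu (ser s a).
Proof. by apply: fps2P => i j; rewrite fcoefCM fcoefMC. Qed.

Lemma orth_conj (a b x : int -> C) : ranged s' x ->
  orth s s' 0 (fun m n => conj_conv a b (x n) m).
Proof.
move=> x0 m n; rewrite negb_and /conj_conv => /orP[/negPf->//|/x0->].
by case: ifP => // _; rewrite big1 // => i _; rewrite mulr0 mul0r.
Qed.

Lemma pack_conj (a b x : int -> C) : pack s s' 0 (fun m n => conj_conv a b (x n) m) =
  inu (ser s a) * fpsC (ser s' x) * inu (ser s b).
Proof.
apply: fps2P => i j; rewrite fcoefM fcoef_sum [LHS]/= /conj_conv in_range_expo0 abs_expo0.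
apply: eq_bigr => l _.
change (fcoef (inu (ser s b)) (i - l)) with (fpsC (b (expo 0 s (i - l)))).
by rewrite !fcoefMC fcoefCM.
Qed.
End Mono.

Lemma comm_el_coef (C : pzRingType) s s' (a b : int -> C) : ranged s a -> ranged s' b ->
  comm_el (inu (ser s a)) (fpsC (ser s' b)) -> forall m n, comm_el (a m) (b n).
Proof.
move=> a0 b0 e m n; have := pack_inj (orth_uv a0 b0) (orth_vu a0 b0).
by rewrite pack_uv pack_vu => /(_ e m n).
Qed.

Section Currents.
Variables (C : pzRingType) (h q : C) (N : nat).
Hypotheses (hC : central h) (qC : central q).
Hypothesis hsep : forall x : C, (forall n, exists y, x = h ^+ n * y) -> x = 0.
Variables (f e : polarity -> 'I_N -> 'I_N -> int -> C).
Variables (k ki : polarity -> 'I_N -> int -> C).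
Hypotheses (f_r : forall s i j, ranged s (f s i j)) (e_r : forall s i j, ranged s (e s i j)).
Hypotheses (k_r : forall s i, ranged s (k s i)) (ki_r : forall s i, ranged s (ki s i)).

Notation sf s := (fun i j => ser s (f s i j)).
Notation se s := (fun i j => ser s (e s i j)).
Notation sk s := (fun i => ser s (k s i)).
Notation ski s := (fun i => ser s (ki s i)).
Notation Tm s := (schur (sf s) (sk s) (se s) 0).

(** With q = c / 4, u - v + h [dpol] is u_+ - v_- for ([Pos], [Neg]), u_- - v_+ for ([Neg], [Pos]),
    and u - v for equal signs. *)
Definition dpol (s s' : polarity) : C :=
  match s, s' with Pos, Neg => q *+ 2 | Neg, Pos => - (q *+ 2) | _, _ => 0 end.

Hypothesis G : forall s, gauss_mx (sf s) (sk s) (ski s) (se s).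

Notation rtt_ss s s' := (rtt (beta2 h s s' (- dpol s s')) (beta2 h s s' (dpol s s'))
  (eta2 h s s') (fun=> True) (fun i j => inu (Tm s i j)) (fun i j => fpsC (Tm s' i j))).

Hypothesis rtt_same : forall s, rtt_ss s s.
Hypothesis rtt_PN : rtt_ss Pos Neg.

Lemma dpolC s s' : central (dpol s s').
Proof.
have q2C : central (q *+ 2) by rewrite mulr2n; exact: centralD.
by case: s s' => [] []; rewrite /dpol //; try exact: centralN;
  move=> y; rewrite mul0r mulr0.
Qed.

Lemma gauss_rtt_ss s s' : gauss_rtt (beta2 h s s' (- dpol s s')) (beta2 h s s' (dpol s s'))
  (eta2 h s s') (fun i j => inu (sf s i j)) (fun i j => fpsC (sf s' i j))
  (fun i j => inu (se s i j)) (fun i j => fpsC (se s' i j))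
  (fun i => inu (sk s i)) (fun i => inu (ski s i))
  (fun i => fpsC (sk s' i)) (fun i => fpsC (ski s' i)).
Proof.
have dC := dpolC s s'; have dNC := centralN dC.
split; [exact: rtt_par2 | exact: gauss_mx_map | exact: gauss_mx_map |].
move=> i j p r Pi Pj Pp Pr; rewrite !schur_map.
suff : rtt_ss s s' by apply.
case: s s' {dC dNC Pi Pj Pp Pr} => [] [] //.
(* The pair ([Neg], [Pos]): the two series of ([Pos], [Neg]) are exchanged, which negates both
   factors, and the exchange of u and v by [tr2] negates them once more. *)
have sw := rtt_swap (rtt_par2 hC hsep Pos Neg (centralN (dpolC Pos Neg)) (dpolC Pos Neg)) rtt_PN.
have := rtt_map (@tr2 C) sw.
have dC := dpolC Pos Neg.
have t1 := tr2_beta hC Pos Neg dC; have t2 := tr2_beta hC Pos Neg (centralN dC).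
rewrite !rmorphN /= t1 t2 tr2_eta // !opprK => H x y z t Px Py Pz Pt; have := H x y z t Px Py Pz Pt.
by rewrite !tr2_inu !tr2_C.
Qed.

Section PairRel.
Variables s s' : polarity.
Let H := gauss_rtt_ss s s'.
Let HC := gauss_rttC H.
Let HS := gauss_rtt_swap H.
Let HSC := gauss_rttC HS.
Let par := gr_par H.
Let alC := par_al par.
Let beC := par_be par.
Let etC := par_et par.
Let dC := dpolC s s'.
Let dNC := centralN dC.
Notation d := (dpol s s').
Notation al := (beta2 h s s' (- d)).
Notation be := (beta2 h s s' d).
Notation et := (eta2 h s s').
Notation u_ a := (inu (ser s a)).
Notation v_ a := (fpsC (ser s' a)).

Let d1C : central (d + 1). Proof. by apply: centralD => //; exact: central1. Qed.
Let dN1C : central (d - 1).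
Proof. by apply: centralD => //; apply: centralN; exact: central1. Qed.
Let nd1C : central (- d + 1). Proof. by apply: centralD => //; exact: central1. Qed.
Let ndN1C : central (- d - 1).
Proof. by apply: centralD => //; apply: centralN; exact: central1. Qed.

Let packb k0 b F : central b -> orth s s' k0 F ->
  pack s s' k0.+1 (Lop h b F) = beta2 h s s' b * pack s s' k0 F.
Proof. by move=> bC oF; rewrite pack_beta. Qed.

Let packe k0 F : orth s s' k0 F -> pack s s' k0.+1 (Hop h F) = et * pack s s' k0 F.
Proof. by move=> oF; rewrite pack_eta. Qed.

(** [rel_ke] multiplied on the left by k_i(u)^-1. Apart from the conjugate, what remains is a series
    in u alone that does not involve the sign [s']; such terms drop out when the two signs are
    subtracted. *)
Lemma cur_ke (i j : 'I_N) (x y : int) : (i < j)%N ->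
  Lop h (d + 1) (vmono (e s' i j)) x y =
  Lop h d (fun m n => conj_conv s (ki s i) (k s i) (e s' i j n) m) x y
  + Hop h (umono (e s i j)) x y.
Proof.
move=> ij; have oc := orth_conj (s := s) (ki s i) (k s i) (@e_r s' i j).
have oe := orth_u (s' := s') (@e_r s i j); have oe' := orth_v (s := s) (@e_r s' i j).
move: x y; apply: pack_inj.
- exact: orth_L oe'.
- by apply: orthD; [exact: orth_L oc | exact: orth_H oe].
rewrite -packD !packb // packe // pack_conj pack_v pack_u -beta2_eta.
have R := rel_ke H ij; have VK := gauss_Vk (gr_u H) i; have KV := gauss_kV (gr_u H) i.
nc_from (al :: be :: et :: nil) (u_ (ki s i) * dif R
  - dif VK * (be + et) * v_ (e s' i j) + et * dif VK * u_ (e s i j)).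
Qed.

Lemma cur_kf (i j : 'I_N) (x y : int) : (i < j)%N ->
  Lop h (- d + 1) (vmono (f s' j i)) x y =
  Lop h (- d) (fun m n => conj_conv s (k s i) (ki s i) (f s' j i n) m) x y
  + Hop h (umono (f s j i)) x y.
Proof.
move=> ij; have oc := orth_conj (s := s) (k s i) (ki s i) (@f_r s' j i).
have oe := orth_u (s' := s') (@f_r s j i); have oe' := orth_v (s := s) (@f_r s' j i).
move: x y; apply: pack_inj.
- exact: orth_L oe'.
- by apply: orthD; [exact: orth_L oc | exact: orth_H oe].
rewrite -packD !packb // packe // pack_conj pack_v pack_u -beta2_eta.
have R : v_ (f s' j i) * u_ (k s i) * (al + et) =
    u_ (k s i) * v_ (f s' j i) * al + u_ (f s j i) * u_ (k s i) * et.
  exact (rel_ke HC ij).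
have KV := gauss_kV (gr_u H) i.
nc_from (al :: be :: et :: nil) (dif R * u_ (ki s i)
  - (al + et) * v_ (f s' j i) * dif KV + et * u_ (f s j i) * dif KV).
Qed.

Section Next1.
Variables (i i1 : 'I_N).
Hypothesis iE : i1 = i.+1 :> nat.

Lemma cur_k1e (x y : int) :
  Lop h (d - 1) (vmono (e s' i i1)) x y =
  Lop h d (fun m n => conj_conv s (ki s i1) (k s i1) (e s' i i1 n) m) x y
  - Hop h (umono (e s i i1)) x y.
Proof.
have oc := orth_conj (s := s) (ki s i1) (k s i1) (@e_r s' i i1).
have oe := orth_u (s' := s') (@e_r s i i1); have oe' := orth_v (s := s) (@e_r s' i i1).
move: x y; apply: pack_inj.
- exact: orth_L oe'.
- by apply: orthD; [exact: orth_L oc | apply: orthN; exact: orth_H oe].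
rewrite -packD -packN !packb // packe // pack_conj pack_v pack_u -beta2_etaN.
have R := rel_ek1 HS iE; have VK := gauss_Vk (gr_u H) i1.
nc_from (al :: be :: et :: nil) (u_ (ki s i1) * dif R
  - dif VK * (be - et) * v_ (e s' i i1) - et * dif VK * u_ (e s i i1)).
Qed.

Lemma cur_k1f (x y : int) :
  Lop h (- d - 1) (vmono (f s' i1 i)) x y =
  Lop h (- d) (fun m n => conj_conv s (k s i1) (ki s i1) (f s' i1 i n) m) x y
  - Hop h (umono (f s i1 i)) x y.
Proof.
have oc := orth_conj (s := s) (k s i1) (ki s i1) (@f_r s' i1 i).
have oe := orth_u (s' := s') (@f_r s i1 i); have oe' := orth_v (s := s) (@f_r s' i1 i).
move: x y; apply: pack_inj.
- exact: orth_L oe'.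
- by apply: orthD; [exact: orth_L oc | apply: orthN; exact: orth_H oe].
rewrite -packD -packN !packb // packe // pack_conj pack_v pack_u -beta2_etaN.
have R : (u_ (k s i1) * v_ (f s' i1 i) - v_ (f s' i1 i) * u_ (k s i1)) * - al =
    (v_ (f s' i1 i) - u_ (f s i1 i)) * (u_ (k s i1) * et).
  exact (rel_ek1 HSC iE).
have KV := gauss_kV (gr_u H) i1.
nc_from (al :: be :: et :: nil) (dif R * u_ (ki s i1)
  - (al - et) * v_ (f s' i1 i) * dif KV - et * u_ (f s i1 i) * dif KV).
Qed.

Lemma cur_eg (i2 : 'I_N) (x y : int) : (i1 < i2)%N ->
  Lop h (d + 1) (fun m n => e s i i1 m * e s' i1 i2 n) x y =
  Lop h d (fun m n => e s' i1 i2 n * e s i i1 m) x y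
  + Hop h (fun m n => umono (e s i i2) m n +
      vmono (unser s' (se s' i i1 * se s' i1 i2 - se s' i i2)) m n) x y.
Proof.
move=> i12; have o1 := orth_uv (@e_r s i i1) (@e_r s' i1 i2).
have o2 := orth_vu (@e_r s i i1) (@e_r s' i1 i2).
have o3 := orthD (orth_u (s' := s') (@e_r s i i2))
  (orth_v (s := s) (unser_ranged (s := s') (se s' i i1 * se s' i1 i2 - se s' i i2))).
move: x y; apply: pack_inj.
- exact: orth_L o1.
- by apply: orthD; [exact: orth_L o2 | exact: orth_H o3].
rewrite -packD !packb // packe // pack_uv pack_vu -packD pack_u pack_v ser_unser.
rewrite fpsCB fpsCM -beta2_eta; have R := rel_eg H iE i12.
nc_from (al :: be :: et :: nil) (dif R).
Qed.

Lemma cur_fg (i2 : 'I_N) (x y : int) : (i1 < i2)%N ->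
  Lop h (- d) (fun m n => f s i1 i m * f s' i2 i1 n) x y =
  Lop h (- d + 1) (fun m n => f s' i2 i1 n * f s i1 i m) x y
  - Hop h (fun m n => umono (f s i2 i) m n +
      vmono (unser s' (sf s' i2 i1 * sf s' i1 i - sf s' i2 i)) m n) x y.
Proof.
move=> i12; have o1 := orth_uv (@f_r s i1 i) (@f_r s' i2 i1).
have o2 := orth_vu (@f_r s i1 i) (@f_r s' i2 i1).
have o3 := orthD (orth_u (s' := s') (@f_r s i2 i))
  (orth_v (s := s) (unser_ranged (s := s') (sf s' i2 i1 * sf s' i1 i - sf s' i2 i))).
move: x y; apply: pack_inj.
- exact: orth_L o1.
- by apply: orthD; [exact: orth_L o2 | apply: orthN; exact: orth_H o3].
rewrite -packD -packN !packb // packe // pack_uv pack_vu -packD pack_u pack_v ser_unser.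
rewrite fpsCB fpsCM -beta2_eta.
have R : (v_ (f s' i2 i1) * u_ (f s i1 i) - u_ (f s i1 i) * v_ (f s' i2 i1)) * al =
  (u_ (f s i2 i) - v_ (f s' i2 i) - v_ (f s' i2 i1) * (u_ (f s i1 i) - v_ (f s' i1 i))) * et.
  exact (rel_eg HC iE i12).
nc_from (al :: be :: et :: nil) (- dif R).
Qed.

Lemma cur_ef (x y : int) :
  Lop h (- d) (Lop h d (fun m n => e s i i1 m * f s' i1 i n - f s' i1 i n * e s i i1 m)) x y =
  Hop h (fun m n =>
    Lop h (- d) (vmono (unser s' (sk s' i1 * ski s' i))) m n
    - Lop h d (umono (unser s (ski s i * sk s i1))) m n) x y.
Proof.
have o1 := orthD (orth_uv (@e_r s i i1) (@f_r s' i1 i))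
  (orthN (orth_vu (@e_r s i i1) (@f_r s' i1 i))).
have o2 := orth_v (s := s) (unser_ranged (s := s') (sk s' i1 * ski s' i)).
have o3 := orth_u (s' := s') (unser_ranged (s := s) (ski s i * sk s i1)).
have o4 := orthD (orth_L h (- d) o2) (orthN (orth_L h d o3)).
move: x y; apply: pack_inj.
- exact: orth_L (orth_L h d o1).
- exact: orth_H o4.
rewrite packb ?packb //; last exact: orth_L.
rewrite packe // -packD -packN !packb // -packD -packN pack_uv pack_vu pack_u pack_v !ser_unser.
rewrite fpsCM rmorphM /=; have R := rel_ef H iE.
nc_from (al :: be :: et :: nil) (dif R).
Qed.

Lemma cur_far_e (j l : 'I_N) m n : (i1 < j)%N -> (j < l)%N ->
  [/\ comm_el (e s i i1 m) (k s' j n), comm_el (e s i i1 m) (e s' j l n)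
    & comm_el (e s i i1 m) (f s' l j n)].
Proof.
move=> ij jl; have [c1 /(_ l jl) [c2 c3]] := rel_far H iE ij.
by split; move: m n; apply: comm_el_coef.
Qed.

Lemma cur_ef_next (p : 'I_N) m n : (i1 < p)%N -> comm_el (e s i i1 m) (f s' p i1 n).
Proof.
by move=> ip; move: m n; apply: comm_el_coef => //; exact (rel_ef_next H iE ip).
Qed.

Lemma cur_far_f (j l : 'I_N) m n : (i1 < j)%N -> (j < l)%N ->
  [/\ comm_el (f s i1 i m) (k s' j n), comm_el (f s i1 i m) (f s' l j n)
    & comm_el (f s i1 i m) (e s' j l n)].
Proof.
move=> ij jl; have [c1 /(_ l jl) [c2 c3]] := rel_far HC iE ij.
by split; move: m n; apply: comm_el_coef => //; exact: esym.
Qed.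

Lemma cur_far_k (j : 'I_N) m n : (i1 < j)%N ->
  comm_el (e s i i1 m) (k s' j n) /\ comm_el (f s i1 i m) (k s' j n).
Proof.
move=> ij; have [c1 _] := rel_far H iE ij; have [c2 _] := rel_far HC iE ij.
by split; move: m n; apply: comm_el_coef => //; exact: esym.
Qed.

Lemma cur_fe_next (p : 'I_N) m n : (i1 < p)%N -> comm_el (f s i1 i m) (e s' i1 p n).
Proof.
move=> ip; move: m n; apply: comm_el_coef => //.
by apply: esym; exact (rel_ef_next HC iE ip).
Qed.

Lemma cur_ee (x y : int) :
  Lop h (d - 1) (fun m n => e s i i1 m * e s' i i1 n) x y =
  Lop h (d + 1) (fun m n => e s' i i1 n * e s i i1 m) x y
  - Hop h (fun m n => umono (unser s (se s i i1 * se s i i1)) m n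
     + vmono (unser s' (se s' i i1 * se s' i i1)) m n) x y.
Proof.
have o1 := orth_uv (@e_r s i i1) (@e_r s' i i1).
have o2 := orth_vu (@e_r s i i1) (@e_r s' i i1).
have o3 := orthD (orth_u (s' := s') (unser_ranged (s := s) (se s i i1 * se s i i1)))
  (orth_v (s := s) (unser_ranged (s := s') (se s' i i1 * se s' i i1))).
move: x y; apply: pack_inj.
- exact: orth_L o1.
- by apply: orthD; [exact: orth_L o2 | apply: orthN; exact: orth_H o3].
rewrite -packD -packN !packb // packe // pack_uv pack_vu -packD pack_u pack_v !ser_unser.
have ii1 : (i < i1)%N by rewrite iE.
rewrite fpsCM rmorphM /= -beta2_eta -beta2_etaN; have R := rel_ee H ii1.
nc_from (al :: be :: et :: nil) (dif R).
Qed.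

Lemma cur_ff (x y : int) :
  Lop h (- d - 1) (fun m n => f s' i1 i n * f s i1 i m) x y =
  Lop h (- d + 1) (fun m n => f s i1 i m * f s' i1 i n) x y
  - Hop h (fun m n => umono (unser s (sf s i1 i * sf s i1 i)) m n
     + vmono (unser s' (sf s' i1 i * sf s' i1 i)) m n) x y.
Proof.
have o1 := orth_uv (@f_r s i1 i) (@f_r s' i1 i).
have o2 := orth_vu (@f_r s i1 i) (@f_r s' i1 i).
have o3 := orthD (orth_u (s' := s') (unser_ranged (s := s) (sf s i1 i * sf s i1 i)))
  (orth_v (s := s) (unser_ranged (s := s') (sf s' i1 i * sf s' i1 i))).
move: x y; apply: pack_inj.
- exact: orth_L o2.
- by apply: orthD; [exact: orth_L o1 | apply: orthN; exact: orth_H o3].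
rewrite -packD -packN !packb // packe // pack_uv pack_vu -packD pack_u pack_v !ser_unser.
have ii1 : (i < i1)%N by rewrite iE.
rewrite fpsCM rmorphM /= -beta2_eta -beta2_etaN.
have R : v_ (f s' i1 i) * (u_ (f s i1 i) * (al - et)) -
    u_ (f s i1 i) * (v_ (f s' i1 i) * (al + et)) =
    (u_ (f s i1 i) * u_ (f s i1 i) + v_ (f s' i1 i) * v_ (f s' i1 i)) * - et.
  exact (rel_ee HC ii1).
nc_from (al :: be :: et :: nil) (dif R).
Qed.

End Next1.

Lemma cur_kk (i : 'I_N) m n : comm_el (k s i m) (k s' i n).
Proof. by move: m n; apply: comm_el_coef => //; exact (rel_kk H i). Qed.

Lemma cur_k_low (i j : 'I_N) (x y : int) : (i < j)%N ->
  Lop h (- d) (Lop h (d + 1) (fun m n => ki s' j n * k s i m)) x y =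
  Lop h d (Lop h (- d + 1) (fun m n => k s i m * ki s' j n)) x y.
Proof.
move=> ij; have o1 := orth_vu (@k_r s i) (@ki_r s' j).
have o2 := orth_uv (@k_r s i) (@ki_r s' j).
have o3 := orth_L h (d + 1) o1; have o4 := orth_L h (- d + 1) o2.
move: x y; apply: pack_inj; [exact: orth_L o3 | exact: orth_L o4 |].
rewrite !packb // pack_uv pack_vu -!beta2_eta.
have [R _] := rel_low H ij.
have KV := gauss_kV (gr_v H) j; have VK := gauss_Vk (gr_v H) j.
nc_from (al :: be :: et :: nil) (v_ (ki s' j) * dif R * v_ (ki s' j)
  - al * (be + et) * v_ (ki s' j) * u_ (k s i) * dif KV
  + be * (al + et) * dif VK * u_ (k s i) * v_ (ki s' j)).
Qed.

Lemma cur_k_comm (i j l : 'I_N) m n : (i < j)%N -> (j < l)%N ->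
  comm_el (k s i m) (e s' j l n) /\ comm_el (k s i m) (f s' l j n).
Proof.
move=> ij jl; have [_ /(_ l jl) [c1 c2]] := rel_low H ij.
by split; move: m n; apply: comm_el_coef.
Qed.

(** For equal signs [al] and [be] coincide, so the two central factors of [rel_low] are equal and
    can be cancelled. *)
Lemma cur_kk_low (i j : 'I_N) m n : s = s' -> (i < j)%N -> comm_el (k s i m) (k s' j n).
Proof.
move=> ss ij; move: m n; apply: comm_el_coef => //; have [R _] := rel_low H ij.
have d0 : d = 0 by rewrite -ss; case: (s).
have abE : al = be by rewrite d0 oppr0.
rewrite abE in R; rewrite /comm_el.
apply: (regI (par_beR par)); apply: (regI (par_beeR par)).
nc_from (be :: et :: nil) (dif R).
Qed.
End PairRel.

Section Commuting.
Variables (s : polarity) (i i1 i2 : 'I_N).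
Hypotheses (iE : i1 = i.+1 :> nat) (i12 : (i1 < i2)%N).
Let H := gauss_rtt_ss s s.
Let HS := gauss_rtt_swap H.
Let beC := par_be (gr_par H).
Let etC := par_et (gr_par H).
Let d0 : dpol s s = 0. Proof. by case: s. Qed.
Let ii1 : (i < i1)%N. Proof. by rewrite iE. Qed.
Let ii2 : (i < i2)%N. Proof. exact: ltn_trans ii1 i12. Qed.
Let dC (b : C) : central b -> central (dpol s s + b).
Proof. by move=> bC; apply: centralD => //; exact: dpolC. Qed.
Notation be := (beta2 h s s (dpol s s)).
Notation et := (eta2 h s s).

(** The defect relation for the two series at different points has precisely the form treated by
    [diag_eq0], the difference of e_(i,i1) at the two points being u - v times its divided
    difference. *)
Lemma cur_comm_e : comm_el (se s i i1) (se s i i2).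
Proof.
have [D DE] := divided_diff h s (se s i i1) d0.
have C1 : central (dpol s s - 1) by apply: dC; apply: centralN; exact: central1.
(* The swapped pair is used so that the commutator on the right-hand side is a series in v, as
   [diag_eq0] demands. *)
have R := step_comm_defect (rel_pair HS i) ii1 ii2; rewrite /= in R.
have := @diag_eq0 C h hC hsep s (dpol s s) (dpol s s - 1)
  (fpsC (se s i i1) * inu (se s i i2) - inu (se s i i2) * fpsC (se s i i1)) (- D)
  (se s i i2) (se s i i2 * se s i i1 - se s i i1 * se s i i2) d0 C1.
rewrite diagB diag_vu diag_uv mulrN -DE -beta2_etaN fpsCB !fpsCM => E.
by apply/eqP; rewrite -subr_eq0 E //; nc_from (be :: et :: nil) (dif R).
Qed.

Let HC := gauss_rttC H.

Notation nn := (se s i i1 * se s i1 i2 - se s i i2).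

Lemma cur_comm_n : comm_el nn (se s i1 i2).
Proof.
have [D DE] := divided_diff h s nn d0.
have C1 : central (dpol s s + 1) by apply: dC; exact: central1.
have R := step2_comm_defect (rel_pair H i) ii1 (fun j => ltn_trans ii1) (rel_pair1 H iE) i12.
rewrite /lu_n /= -!fpsCM -!fpsCB in R.
have := @diag_eq0 C h hC hsep s (dpol s s) (dpol s s + 1)
  (inu nn * fpsC (se s i1 i2) - fpsC (se s i1 i2) * inu nn) D
  (se s i1 i2) (nn * se s i1 i2 - se s i1 i2 * nn) d0 C1.
rewrite diagB diag_vu diag_uv -DE -beta2_eta inuB inuM => E.
apply/eqP; rewrite -subr_eq0 E //.
rewrite !(fpsCM, fpsCB) /=; rewrite !(fpsCM, fpsCB) in R.
nc_from (be :: et :: nil) (dif R).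
Qed.

Lemma cur_comm_f : comm_el (sf s i2 i) (sf s i1 i).
Proof.
have d0' : - dpol s s = 0 by rewrite d0 oppr0.
have [D DE] := divided_diff h s (sf s i2 i) d0'.
have C1 : central (- dpol s s - 1).
  by rewrite -opprD; apply: centralN; apply: dC; exact: central1.
have alC := par_al (gr_par H).
(* The defect relation over the opposite ring, with its products written out in the ring itself. *)
have R : ((inu (sf s i2 i) * fpsC (sf s i1 i) - fpsC (sf s i1 i) * inu (sf s i2 i))
      * - beta2 h s s (- dpol s s)
    + (fpsC (sf s i2 i) - inu (sf s i2 i)) * ((fpsC (sf s i1 i) - inu (sf s i1 i)) * et))
    * (- beta2 h s s (- dpol s s) + et) =
  (fpsC (sf s i2 i) * fpsC (sf s i1 i) - fpsC (sf s i1 i) * fpsC (sf s i2 i))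
    * (et * - beta2 h s s (- dpol s s)).
  exact (step_comm_defect (rel_pair (gauss_rttC HS) i) ii1 ii2).
have := @diag_eq0 C h hC hsep s (- dpol s s) (- dpol s s - 1)
  (inu (sf s i2 i) * fpsC (sf s i1 i) - fpsC (sf s i1 i) * inu (sf s i2 i)) (- D)
  (sf s i1 i) (sf s i1 i * sf s i2 i - sf s i2 i * sf s i1 i) d0' C1.
rewrite diagB diag_vu diag_uv mulrN -DE -beta2_etaN fpsCB !fpsCM => E.
apply/eqP; rewrite -subr_eq0 E //.
nc_from (beta2 h s s (- dpol s s) :: et :: nil) (dif R).
Qed.

Notation nf := (sf s i2 i1 * sf s i1 i - sf s i2 i).

Lemma cur_comm_nf : comm_el (sf s i2 i1) nf.
Proof.
have d0' : - dpol s s = 0 by rewrite d0 oppr0.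
have [D DE] := divided_diff h s (sf s i2 i1) d0'.
have C1 : central (- dpol s s + 1).
  by apply: centralD; [apply: centralN; exact: dpolC | exact: central1].
have alC := par_al (gr_par H).
have R : ((fpsC (sf s i2 i1) * (inu (sf s i2 i1) * inu (sf s i1 i) - inu (sf s i2 i))
      - (inu (sf s i2 i1) * inu (sf s i1 i) - inu (sf s i2 i)) * fpsC (sf s i2 i1))
      * beta2 h s s (- dpol s s)
    + (inu (sf s i2 i1) - fpsC (sf s i2 i1)) *
      ((inu (sf s i2 i1) * inu (sf s i1 i) - inu (sf s i2 i)
        - (fpsC (sf s i2 i1) * fpsC (sf s i1 i) - fpsC (sf s i2 i))) * et))
    * (beta2 h s s (- dpol s s) + et) =
  (fpsC (sf s i2 i1) * (fpsC (sf s i2 i1) * fpsC (sf s i1 i) - fpsC (sf s i2 i))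
   - (fpsC (sf s i2 i1) * fpsC (sf s i1 i) - fpsC (sf s i2 i)) * fpsC (sf s i2 i1))
    * (et * beta2 h s s (- dpol s s)).
  exact (step2_comm_defect (rel_pair HC i) ii1 (fun j => ltn_trans ii1) (rel_pair1 HC iE) i12).
have := @diag_eq0 C h hC hsep s (- dpol s s) (- dpol s s + 1)
  (fpsC (sf s i2 i1) * inu nf - inu nf * fpsC (sf s i2 i1)) D
  nf (sf s i2 i1 * nf - nf * sf s i2 i1) d0' C1.
rewrite diagB diag_vu diag_uv -DE -beta2_eta => E.
apply/eqP; rewrite -subr_eq0 E // !(inuB, inuM, fpsCB, fpsCM).
nc_from (beta2 h s s (- dpol s s) :: et :: nil) (dif R).
Qed.
End Commuting.

Definition serre_el (a b y : C) : C :=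
  a * b * y - a * y * b *+ 2 + y * a * b + (b * a * y - b * y * a *+ 2 + y * b * a).

Lemma serre_elP s1 s2 s3 (x1 x2 y : int -> C) :
  ranged s1 x1 -> ranged s2 x2 -> ranged s3 y ->
  (forall i j l, serre_el (fcoef (ser s1 x1) i) (fcoef (ser s2 x2) j)
    (fcoef (ser s3 y) l) = 0) ->
  forall l m n, serre_el (x1 l) (x2 m) (y n) = 0.
Proof.
move=> r1 r2 r3 S l m n; rewrite /serre_el.
have Z := (mul0r, mulr0, mul0rn, subr0, addr0).
case/boolP: (in_range 0 s1 l) => [/expoP[l' ->]|/r1 ->]; last by rewrite !Z.
case/boolP: (in_range 0 s2 m) => [/expoP[m' ->]|/r2 ->]; last by rewrite !Z.
case/boolP: (in_range 0 s3 n) => [/expoP[n' ->]|/r3 ->]; last by rewrite !Z.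
exact: S.
Qed.

Section Serre.
Variables (s1 s2 s3 : polarity) (i i1 i2 : 'I_N).
Hypotheses (iE : i1 = i.+1 :> nat) (i12 : (i1 < i2)%N).
Let ii1 : (i < i1)%N. Proof. by rewrite iE. Qed.
Let ii2 : (i < i2)%N. Proof. exact: ltn_trans ii1 i12. Qed.
Let ltt (j : 'I_N) : (i1 < j)%N -> (i < j)%N. Proof. exact: ltn_trans. Qed.

Let dE : dpol s1 s3 - dpol s2 s3 = dpol s1 s2.
Proof. by case: s1 s2 s3 => [] [] []; rewrite /= ?subrr ?subr0 ?sub0r ?opprK. Qed.

Let dNE : - dpol s1 s3 - - dpol s2 s3 = - dpol s1 s2.
Proof. by rewrite -opprD dE. Qed.

Let dNC s s' : central (- dpol s s'). Proof. by apply: centralN; exact: dpolC. Qed.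

Let quad_e s s' : quad_rel (beta2 h s s' (dpol s s')) (eta2 h s s')
  (inu (se s i i1)) (inu (se s i i2)) (fpsC (se s' i i1)) (fpsC (se s' i i2)).
Proof.
apply: (step_quad_rel (rel_pair (gauss_rtt_ss s s') i) ii1 ii2).
  by rewrite /= -!inuM cur_comm_e.
by rewrite /= -!fpsCM cur_comm_e.
Qed.

Lemma cur_serre_e (l m n : int) :
  serre_el (e s1 i i1 l) (e s2 i i1 m) (e s3 i1 i2 n) = 0.
Proof.
have cub s s' := step_cubic_rel (rel_pair (gauss_rtt_ss s s') i) ii1 ltt
  (rel_pair1 (gauss_rtt_ss s s') iE) i12 (quad_e s s').
apply: serre_elP => // a b c.
exact (serre3 hC hsep hC (dpolC s1 s2) (dpolC s1 s3) (dpolC s2 s3) dE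
  (quad_e s1 s2) (cub s1 s3) (cub s2 s3) a b c).
Qed.

Let eta2N s s' : eta2 (- h) s s' = - eta2 h s s'.
Proof. by rewrite /eta2 !raddfN /= mulrN. Qed.

(** Here the second of the two neighbours is doubled. Its quadratic companion is the entry [lu_n] of
    the inverse matrix, for which the relations hold over the opposite ring and with [- h]. *)
Lemma cur_serre_e' (l m n : int) :
  serre_el (e s1 i1 i2 l) (e s2 i1 i2 m) (e s3 i i1 n) = 0.
Proof.
have quad s s' : quad_rel (beta2 h s s' (dpol s s') : (fps (fps C))^c)
    (eta2 (- h) s s' : (fps (fps C))^c)
    (inu (se s i1 i2) : (fps (fps C))^c) (inu (se s i i1 * se s i1 i2 - se s i i2))
    (fpsC (se s' i1 i2)) (fpsC (se s' i i1 * se s' i1 i2 - se s' i i2)).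
  rewrite eta2N inuB inuM fpsCB fpsCM.
  apply: (step2_quad_rel (rel_pair (gauss_rtt_ss s s') i) ii1 ltt
    (rel_pair1 (gauss_rtt_ss s s') iE) i12).
    by rewrite /lu_n /= -!inuM -inuB -!inuM cur_comm_n.
  by rewrite /lu_n /= -!fpsCM -fpsCB -!fpsCM cur_comm_n.
have cub s s' : cubic_rel (beta2 h s s' (dpol s s') : (fps (fps C))^c)
    (eta2 (- h) s s' : (fps (fps C))^c)
    (inu (se s i1 i2) : (fps (fps C))^c) (inu (se s i i1 * se s i1 i2 - se s i i2))
    (fpsC (se s' i1 i2)) (fpsC (se s' i i1 * se s' i1 i2 - se s' i i2)) (fpsC (se s' i i1)).
  have := quad s s'; rewrite eta2N inuB inuM fpsCB fpsCM => Q.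
  exact (step2_cubic_rel (rel_pair (gauss_rtt_ss s s') i) ii1 ltt
    (rel_pair1 (gauss_rtt_ss s s') iE) i12 Q).
apply: serre_elP => // a b c.
exact (serre3C hC hsep (centralN hC) (dpolC s1 s2) (dpolC s1 s3) (dpolC s2 s3) dE
  (quad s1 s2) (cub s1 s3) (cub s2 s3) a b c).
Qed.

Let quad_f s s' : quad_rel (beta2 h s s' (- dpol s s') : (fps (fps C))^c)
  (eta2 h s s' : (fps (fps C))^c) (inu (sf s i1 i) : (fps (fps C))^c) (inu (sf s i2 i))
  (fpsC (sf s' i1 i)) (fpsC (sf s' i2 i)).
Proof.
apply: (step_quad_rel (rel_pair (gauss_rttC (gauss_rtt_ss s s')) i) ii1 ii2).
  change (inu (sf s i2 i) * inu (sf s i1 i) = inu (sf s i1 i) * inu (sf s i2 i)).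
  by rewrite -!inuM cur_comm_f.
change (fpsC (sf s' i2 i) * fpsC (sf s' i1 i) = fpsC (sf s' i1 i) * fpsC (sf s' i2 i)).
by rewrite -!fpsCM cur_comm_f.
Qed.

Lemma cur_serre_f (l m n : int) :
  serre_el (f s1 i1 i l) (f s2 i1 i m) (f s3 i2 i1 n) = 0.
Proof.
have cub s s' := step_cubic_rel (rel_pair (gauss_rttC (gauss_rtt_ss s s')) i) ii1 ltt
  (rel_pair1 (gauss_rttC (gauss_rtt_ss s s')) iE) i12 (quad_f s s').
apply: serre_elP => // a b c.
exact (serre3C hC hsep hC (dNC s1 s2) (dNC s1 s3) (dNC s2 s3) dNE
  (quad_f s1 s2) (cub s1 s3) (cub s2 s3) a b c).
Qed.

(** The opposite ring is taken twice, once for passing from [e] to [f] and once for the inverse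
    matrix. So this case is settled in the ring itself, with [- h]. *)
Lemma cur_serre_f' (l m n : int) :
  serre_el (f s1 i2 i1 l) (f s2 i2 i1 m) (f s3 i1 i n) = 0.
Proof.
have quad s s' : quad_rel (beta2 h s s' (- dpol s s')) (eta2 (- h) s s')
    (inu (sf s i2 i1)) (inu (sf s i2 i1 * sf s i1 i - sf s i2 i))
    (fpsC (sf s' i2 i1)) (fpsC (sf s' i2 i1 * sf s' i1 i - sf s' i2 i)).
  rewrite eta2N inuB inuM fpsCB fpsCM.
  apply: (step2_quad_rel (rel_pair (gauss_rttC (gauss_rtt_ss s s')) i) ii1 ltt
    (rel_pair1 (gauss_rttC (gauss_rtt_ss s s')) iE) i12).
    have := congr1 (fun z => inu z) (cur_comm_nf s iE i12).
    by rewrite inuM inuM inuB inuM => E; exact E.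
  have := congr1 (@fpsC _) (cur_comm_nf s' iE i12).
  by rewrite !fpsCM !fpsCB !fpsCM => E; exact E.
have cub s s' : cubic_rel (beta2 h s s' (- dpol s s')) (eta2 (- h) s s')
    (inu (sf s i2 i1)) (inu (sf s i2 i1 * sf s i1 i - sf s i2 i))
    (fpsC (sf s' i2 i1)) (fpsC (sf s' i2 i1 * sf s' i1 i - sf s' i2 i)) (fpsC (sf s' i1 i)).
  have := quad s s'; rewrite eta2N inuB inuM fpsCB fpsCM => Q.
  exact (step2_cubic_rel (rel_pair (gauss_rttC (gauss_rtt_ss s s')) i) ii1 ltt
    (rel_pair1 (gauss_rttC (gauss_rtt_ss s s')) iE) i12 Q).
apply: serre_elP => // a b c.
exact (serre3 hC hsep (centralN hC) (dNC s1 s2) (dNC s1 s3) (dNC s2 s3) dNE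
  (quad s1 s2) (cub s1 s3) (cub s2 s3) a b c).
Qed.

End Serre.
End Currents.

(** * Sums in the hbar-adic topology *)

Definition hseparated (R : realType) (B : halg R) : Prop :=
  forall x : B, (forall n, exists y, x = hbar B ^+ n * y) -> x = 0.

(* [z n] is the sum of the tail [sum_k hbar^k y_(n+k)]. *)
Definition hcomplete (R : realType) (B : halg R) : Prop :=
  forall y : nat -> B, exists z : nat -> B, forall n, z n = y n + hbar B * z n.+1.

Definition hnull (R : realType) (B : halg R) (I : eqType) (x : I -> B) : Prop :=
  forall n, exists r : seq I, forall i, i \notin r -> exists y, x i = hbar B ^+ n * y.

Section BigSplit.
Variables (V : zmodType) (I : eqType) (x : I -> V).

Lemma sum_sub_split (r R : seq I) : uniq r -> uniq R -> {subset R <= r} ->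
  \sum_(i <- r) x i = \sum_(i <- R) x i + \sum_(i <- r | i \notin R) x i.
Proof.
move=> ur uR Rr; rewrite (bigID (mem R)) /=; congr (_ + _).
rewrite -big_filter; apply: perm_big; apply: uniq_perm => //; first exact: filter_uniq.
by move=> i; rewrite mem_filter; case: (boolP (i \in R)) => [/Rr|].
Qed.
End BigSplit.

Section Hsum.
Variables (R : realType) (B : halg R).
Notation h := (hbar B).

Lemma hbarC : central h. Proof. by move=> x; exact: hstr_central. Qed.

Lemma hbarXC n : central (h ^+ n).
Proof.
by elim: n => [|n IH] x; rewrite ?mul1r ?mulr1 // exprS -mulrA IH !mulrA hbarC.
Qed.

Lemma scalC z : central (scal B z). Proof. by move=> x; exact: hstr_central. Qed.

Hypothesis hsep : hseparated B.

Lemma has_hsum_unique (I : eqType) (x : I -> B) b b' :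
  has_hsum x b -> has_hsum x b' -> b = b'.
Proof.
move=> xb xb'; apply/eqP; rewrite -subr_eq0; apply/eqP/hsep => n.
have [r0 H] := xb n; have [r1 H'] := xb' n.
have [|y e] := H (undup (r0 ++ r1)) (undup_uniq _).
  by move=> i i0; rewrite mem_undup mem_cat i0.
have [|y' e'] := H' (undup (r0 ++ r1)) (undup_uniq _).
  by move=> i i0; rewrite mem_undup mem_cat i0 orbT.
by exists (y - y'); rewrite mulrBr -e -e' opprB addrA subrK.
Qed.

Lemma hsumE (I : eqType) (x : I -> B) b : has_hsum x b -> hsum x = b.
Proof.
move=> xb; apply: (has_hsum_unique _ xb).
exact (@xgetPex _ 0 (fun b => has_hsum x b) (ex_intro _ b xb)).
Qed.

Lemma has_hsum_fin (I : eqType) (x : I -> B) (r : seq I) : uniq r ->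
  (forall i, i \notin r -> x i = 0) -> has_hsum x (\sum_(i <- r) x i).
Proof.
move=> ur x0 n; exists r => r' ur' rr'; exists 0.
rewrite (sum_sub_split x ur' ur rr') [X in _ - (_ + X)]big1 ?addr0 ?subrr ?mulr0 //.
Qed.

Lemma hsum_fin (I : eqType) (x : I -> B) (r : seq I) : uniq r ->
  (forall i, i \notin r -> x i = 0) -> hsum x = \sum_(i <- r) x i.
Proof. by move=> ur x0; apply: hsumE; exact: has_hsum_fin. Qed.

Lemma hsum1 (I : eqType) (x : I -> B) (i : I) :
  (forall j, j != i -> x j = 0) -> hsum x = x i.
Proof.
move=> x0; rewrite (@hsum_fin _ _ [:: i]) ?big_seq1 //.
by move=> j; rewrite inE => /x0.
Qed.

Lemma hsum0 (I : eqType) (x : I -> B) : (forall j, x j = 0) -> hsum x = 0.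
Proof. by move=> x0; rewrite (@hsum_fin _ _ [::]) ?big_nil. Qed.

Lemma has_hsumD (I : eqType) (x y : I -> B) b c : has_hsum x b -> has_hsum y c ->
  has_hsum (fun i => x i + y i) (b + c).
Proof.
move=> xb yc n; have [r0 H] := xb n; have [r1 H'] := yc n.
exists (r0 ++ r1) => r ur rr.
have [|z e] := H r ur; first by move=> i i0; apply: rr; rewrite mem_cat i0.
have [|z' e'] := H' r ur; first by move=> i i0; apply: rr; rewrite mem_cat i0 orbT.
exists (z + z'); rewrite mulrDr -e -e' big_split /=.
by rewrite opprD addrACA.
Qed.

Lemma has_hsumMl (I : eqType) (x : I -> B) b a : has_hsum x b ->
  has_hsum (fun i => a * x i) (a * b).
Proof.
move=> xb n; have [r0 H] := xb n; exists r0 => r ur rr.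
have [z e] := H r ur rr; exists (a * z).
by rewrite -mulr_sumr -mulrBr e !mulrA hbarXC.
Qed.

Lemma has_hsumMr (I : eqType) (x : I -> B) b a : has_hsum x b ->
  has_hsum (fun i => x i * a) (b * a).
Proof.
move=> xb n; have [r0 H] := xb n; exists r0 => r ur rr.
have [z e] := H r ur rr; exists (z * a).
by rewrite -mulr_suml -mulrBl e mulrA.
Qed.

Lemma has_hsumN (I : eqType) (x : I -> B) b : has_hsum x b ->
  has_hsum (fun i => - x i) (- b).
Proof.
move=> /has_hsumMl-/(_ (-1)); rewrite mulN1r; congr has_hsum.
by apply: funext => i; rewrite mulN1r.
Qed.

Lemma has_hsum_reindex (I J : eqType) (p : J -> I) (x : I -> B) b : bijective p ->
  has_hsum x b -> has_hsum (fun j => x (p j)) b.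
Proof.
case=> g pK gK xb n; have [r0 H] := xb n; exists (map g r0) => r ur rr.
have [||z e] := H (map p r).
- by rewrite map_inj_uniq //; exact: can_inj pK.
- move=> i i0; rewrite -(gK i) map_f //; apply: rr; exact: map_f.
by exists z; rewrite -e big_map.
Qed.

Lemma hsum_reindex (I J : eqType) (p : J -> I) (x : I -> B) : bijective p ->
  hsum (fun j => x (p j)) = hsum x.
Proof.
move=> pB; rewrite /hsum; congr xget; apply/seteqP; split=> b /=.
  have [g pK gK] := pB => xb.
  have := has_hsum_reindex (Bijective gK pK) xb.
  by congr has_hsum; apply: funext => i; rewrite gK.
exact: has_hsum_reindex.
Qed.

Lemma has_hsum_dvd (I : eqType) (x : I -> B) b n : has_hsum x b ->
  (forall i, exists y, x i = h ^+ n * y) -> exists y, b = h ^+ n * y.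
Proof.
move=> xb xn; have [r0 H] := xb n.
have [|y e] := H (undup r0) (undup_uniq _); first by move=> i; rewrite mem_undup.
suff [z ez] : exists z, \sum_(i <- undup r0) x i = h ^+ n * z.
  by exists (y + z); rewrite mulrDr -e -ez subrK.
elim: (undup r0) => [|i r [z ez]]; first by exists 0; rewrite big_nil mulr0.
by have [w ew] := xn i; exists (w + z); rewrite big_cons ez ew mulrDr.
Qed.

Lemma sum_dvd (I : eqType) (x : I -> B) (r : seq I) (P : pred I) n :
  (forall i, P i -> exists y, x i = h ^+ n * y) ->
  exists z, \sum_(i <- r | P i) x i = h ^+ n * z.
Proof.
move=> xn; elim: r => [|i r [z ez]]; first by exists 0; rewrite big_nil mulr0.
rewrite big_cons; case: ifPn => Pi; last by exists z.
by have [w ew] := xn i Pi; exists (w + z); rewrite ez ew mulrDr.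
Qed.

Lemma hnull_fin (I : eqType) (x : I -> B) (r : seq I) :
  (forall i, i \notin r -> x i = 0) -> hnull x.
Proof. by move=> x0 n; exists r => i /x0 ->; exists 0; rewrite mulr0. Qed.

Hypothesis hcomp : hcomplete B.

(** Along the increasing finite sets [Q n], outside of which all terms are divisible by h^n,
    consecutive partial sums differ by some h^n y_n; completeness sums these differences. *)
Lemma hnull_sum (I : eqType) (x : I -> B) : hnull x -> exists b, has_hsum x b.
Proof.
move=> /boolp.choice[r rP].
pose Q := fix Q n := undup (if n is n'.+1 then Q n' ++ r n else r 0%N).
have Qu n : uniq (Q n) by case: n => [|n]; exact: undup_uniq.
have Qr n : {subset r n <= Q n}.
  by case: n => [|n] i ir /=; rewrite mem_undup ?mem_cat ?ir ?orbT.
have QS n : {subset Q n <= Q n.+1}.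
  by move=> i iQ; rewrite /= mem_undup mem_cat iQ.
pose S n := \sum_(i <- Q n) x i.
have /boolp.choice[y yE] n : exists y, S n.+1 = S n + h ^+ n * y.
  have [|z ez] := @sum_dvd _ x (Q n.+1) (fun i => i \notin Q n) n.
    by move=> i iQ; apply: rP; apply: contra iQ; exact: Qr.
  by exists z; rewrite /S (sum_sub_split x (Qu n.+1) (Qu n) (@QS n)) ez.
have [z zE] := hcomp y.
have Sz n : S 0%N + z 0%N = S n + h ^+ n * z n.
  elim: n => [|n ->]; first by rewrite mul1r.
  by rewrite yE exprSr -mulrA -addrA -mulrDr -zE.
exists (S 0%N + z 0%N) => n; exists (Q n) => q qu Qq.
have [|w ew] := @sum_dvd _ x q (fun i => i \notin Q n) n.
  by move=> i iQ; apply: rP; apply: contra iQ; exact: Qr.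
exists (z n - w); rewrite (sum_sub_split x qu (Qu n) Qq) ew (Sz n) mulrBr.
by rewrite opprD addrACA subrr add0r.
Qed.

Lemma hsumP (I : eqType) (x : I -> B) : hnull x -> has_hsum x (hsum x).
Proof. by move=> /hnull_sum[b xb]; rewrite (hsumE xb). Qed.

Definition gsum (y : nat -> B) : B := hsum (fun n => h ^+ n * y n).

Lemma gsum_null (y : nat -> B) : hnull (fun n => h ^+ n * y n).
Proof.
move=> n; exists (iota 0 n) => i; rewrite mem_iota add0n /= -leqNgt => ni.
by exists (h ^+ (i - n) * y i); rewrite mulrA -exprD subnKC.
Qed.

Lemma gsumP y : has_hsum (fun n => h ^+ n * y n) (gsum y).
Proof. exact: hsumP (gsum_null y). Qed.

Lemma gsum_tail (y z : nat -> B) : (forall n, z n = y n + h * z n.+1) -> gsum y = z 0%N.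
Proof.
move=> zE; apply: hsumE => n; exists (iota 0 n) => r ur rr.
have Sz m : z 0%N = \sum_(i <- iota 0 m) h ^+ i * y i + h ^+ m * z m.
  elim: m => [|m IH]; first by rewrite big_nil add0r mul1r.
  rewrite IH zE -addn1 iotaD big_cat /= add0n big_seq1 -addrA; congr (_ + _).
  by rewrite mulrDr addn1 exprSr mulrA.
have [|w ew] := @sum_dvd _ (fun i => h ^+ i * y i) r (fun i => i \notin iota 0 n) n.
  move=> i; rewrite mem_iota add0n /= -leqNgt => ni.
  by exists (h ^+ (i - n) * y i); rewrite mulrA -exprD subnKC.
exists (z n - w); rewrite (sum_sub_split _ ur (iota_uniq 0 n) rr) ew (Sz n) mulrBr.
by rewrite opprD addrACA subrr add0r.
Qed.

Lemma gsumS y : gsum y = y 0%N + h * gsum (fun n => y n.+1).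
Proof.
have [z zE] := hcomp y.
by rewrite (gsum_tail zE) zE (@gsum_tail (fun n => y n.+1) (fun n => z n.+1)).
Qed.

Lemma chain_eq0 (D : nat -> B) : (forall n, D n = h * D n.+1) -> D 0%N = 0.
Proof.
move=> DS; apply: hsep => n; exists (D n).
by elim: n => [|n IH]; rewrite ?mul1r // IH DS exprSr mulrA.
Qed.

Lemma gsumD y y' : gsum (fun n => y n + y' n) = gsum y + gsum y'.
Proof.
apply: hsumE; have := has_hsumD (gsumP y) (gsumP y').
by congr has_hsum; apply: funext => n; rewrite mulrDr.
Qed.

Lemma gsumMl a y : gsum (fun n => a * y n) = a * gsum y.
Proof.
apply: hsumE; have := has_hsumMl a (gsumP y).
by congr has_hsum; apply: funext => n; rewrite !mulrA hbarXC.
Qed.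

Lemma gsumMr a y : gsum (fun n => y n * a) = gsum y * a.
Proof.
apply: hsumE; have := has_hsumMr a (gsumP y).
by congr has_hsum; apply: funext => n; rewrite mulrA.
Qed.

Lemma gsum0 : gsum (fun=> 0) = 0.
Proof. by apply: hsum0 => n; rewrite mulr0. Qed.

Lemma gsum_sum (I : Type) (r : seq I) (y : I -> nat -> B) :
  gsum (fun n => \sum_(i <- r) y i n) = \sum_(i <- r) gsum (y i).
Proof.
elim: r => [|i r IH].
  by rewrite big_nil -[RHS]gsum0; congr gsum; apply: funext => n; rewrite big_nil.
rewrite big_cons -IH -gsumD; congr gsum; apply: funext => n.
by rewrite big_cons.
Qed.

(** The Cauchy product without a double series: let D k be the difference of the two sides for the
    sequence [y] shifted by k. Splitting off first terms gives D k = h D (k+1), hence D 0 = 0 by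
    separatedness. *)
Lemma gsumM y y' :
  gsum y * gsum y' = gsum (fun n => \sum_(i < n.+1) y i * y' (n - i)%N).
Proof.
pose c (y : nat -> B) n := \sum_(i < n.+1) y i * y' (n - i)%N.
pose D k := gsum (fun n => y (n + k)%N) * gsum y' - gsum (c (fun n => y (n + k)%N)).
have DS k : D k = h * D k.+1.
  have cS : gsum (c (fun n => y (n + k)%N)) = y k * gsum y'
      + h * gsum (c (fun n => y (n + k.+1)%N)).
    rewrite gsumS {1}/c big_ord_recl big_ord0 addr0 add0n subn0.
    rewrite [gsum y']gsumS mulrDr mulrA -(hbarC (y k)) -!mulrA -addrA; congr (_ + _).
    rewrite -mulrDr; congr (_ * _); rewrite -gsumMl -gsumD.
    congr gsum; apply: funext => n.
    rewrite {1}/c big_ord_recl add0n subn0; congr (_ + _).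
    by apply: eq_bigr => i _; rewrite /= /bump add1n subSS addSnnS.
  rewrite /D cS gsumS mulrDl add0n opprD addrACA subrr add0r mulrBr mulrA.
  by congr (_ * gsum _ * _ - _); apply: funext => n; rewrite addSnnS.
have := chain_eq0 DS; rewrite /D => /eqP; rewrite subr_eq0 => /eqP.
have -> : (fun n => y (n + 0)%N) = y by apply: funext => n; rewrite addn0.
by [].
Qed.
End Hsum.

(** * Formal distributions *)

Section AtVar.
Variables (R : realType) (B : halg R) (n : nat).
Hypothesis hsep : hseparated B.

Definition pt (x : 'I_n) (m : int) : {ffun 'I_n -> int} := [ffun y => if y == x then m else 0].

Lemma ptxx x m : pt x m x = m. Proof. by rewrite ffunE eqxx. Qed.

Lemma at_var_pt (f : fseries B) x m : (f \at x) (pt x m) = f m.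
Proof.
rewrite /at_var; case: ifPn => [_|/negP[]]; first by rewrite ptxx.
by apply/forallP => y; apply/implyP => yx; rewrite ffunE (negPf yx).
Qed.

Lemma at_var_out (f : fseries B) x (d : {ffun 'I_n -> int}) : d != pt x (d x) -> (f \at x) d = 0.
Proof.
rewrite /at_var; case: ifPn => // /forallP d0 /eqP[]; apply/ffunP => y.
by rewrite ffunE; case: eqP => [->//|/eqP yx]; have /implyP/(_ yx)/eqP := d0 y.
Qed.

Lemma dmul_atr (G : dist B n) (g : fseries B) z (d : {ffun 'I_n -> int}) :
  (forall d : {ffun 'I_n -> int}, d z != 0 -> G d = 0) ->
  (G ** g \at z) d = G (d - pt z (d z)) * g (d z).
Proof.
move=> G0; rewrite /dmul (@hsum1 _ _ hsep _ _ (d - pt z (d z))) => [|d' dd'].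
  by rewrite subKr at_var_pt.
have [d'z|/G0->] := eqVneq (d' z) 0; last by rewrite mul0r.
rewrite at_var_out ?mulr0 //; apply: contra dd' => /eqP.
rewrite !ffunE d'z subr0 => <-.
by rewrite subKr.
Qed.

End AtVar.

Notation E2 := {ffun 'I_2 -> int}.

Definition mk2 (m n : int) : E2 := [ffun i => if i == u2 then m else n].

Lemma mk2u m n : mk2 m n u2 = m. Proof. by rewrite ffunE eqxx. Qed.
Lemma mk2v m n : mk2 m n v2 = n. Proof. by rewrite ffunE. Qed.

Lemma ord2 (i : 'I_2) : i = u2 \/ i = v2.
Proof. by case: i => -[|[|//]] p; [left | right]; apply: val_inj. Qed.

Lemma vec2P (d d' : E2) : d u2 = d' u2 -> d v2 = d' v2 -> d = d'.
Proof. by move=> du dv; apply/ffunP => i; case: (ord2 i) => ->. Qed.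

Lemma mk2_eta (d : E2) : d = mk2 (d u2) (d v2).
Proof. by apply: vec2P; rewrite ?mk2u ?mk2v. Qed.

Definition eu : E2 := mk2 1 0.
Definition ev : E2 := mk2 0 1.

Section Dist2.
Variables (R : realType) (B : halg R).
Notation h := (hbar B).
Hypothesis hsep : hseparated B.

Lemma prod_uv (f g : fseries B) d : (f \at u2 ** g \at v2) d = f (d u2) * g (d v2).
Proof.
rewrite dmul_atr // => [|d' d'v].
  congr (_ * _); rewrite -(at_var_pt f u2).
  by congr (at_var f); apply: vec2P; rewrite !ffunE /= ?subrr ?subr0.
by apply: at_var_out; apply: contra d'v => /eqP ->; rewrite !ffunE.
Qed.

Lemma prod_vu (f g : fseries B) d : (g \at v2 ** f \at u2) d = g (d v2) * f (d u2).
Proof.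
rewrite dmul_atr // => [|d' d'v].
  congr (_ * _); rewrite -(at_var_pt g v2).
  by congr (at_var g); apply: vec2P; rewrite !ffunE /= ?subrr ?subr0.
by apply: at_var_out; apply: contra d'v => /eqP ->; rewrite !ffunE.
Qed.

Definition Ld (a : B) (F : dist B 2) : dist B 2 := fun d : E2 =>
  F (d - eu) - F (d - ev) + h * a * F d.

Lemma umvE (a : B) d : umv a d = (d == eu)%:R - (d == ev)%:R + (if d == 0 then h * a else 0).
Proof.
rewrite /umv; congr (_ - _ + _); rewrite /at_var.
- case: ifPn => [/forallP d0|].
    have /implyP/(_ isT)/eqP dv := d0 v2; congr (_%:R); congr (nat_of_bool _).
    apply/eqP/eqP => [du|->]; last by rewrite mk2u.
    by apply: vec2P; rewrite ?mk2u ?mk2v.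
  case: eqP => // -> /negP[]; apply/forallP => y; apply/implyP => yu.
  by case: (ord2 y) yu => ->; rewrite ?eqxx // mk2v.
case: ifPn => [/forallP d0|].
  have /implyP/(_ isT)/eqP du := d0 u2; congr (_%:R); congr (nat_of_bool _).
  apply/eqP/eqP => [dv|->]; last by rewrite mk2v.
  by apply: vec2P; rewrite ?mk2u ?mk2v.
case: eqP => // -> /negP[]; apply/forallP => y; apply/implyP => yu.
by case: (ord2 y) yu => ->; rewrite ?eqxx // mk2u.
Qed.

Lemma e_neq : [/\ eu != ev, eu != 0 & ev != 0].
Proof.
by split; apply/eqP => /ffunP; [move=> /(_ u2)|move=> /(_ u2)|move=> /(_ v2)];
  rewrite !ffunE.
Qed.

Lemma umv_mul (a : B) (F : dist B 2) : umv a ** F = Ld a F.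
Proof.
have [e1 e2 e3] := e_neq.
apply: funext => d; rewrite /dmul (@hsum_fin _ _ hsep _ _ [:: eu; ev; 0]).
- rewrite !big_cons big_nil addr0 !umvE !eqxx (negPf e1) (negPf e2) (negPf e3).
  rewrite [ev == eu]eq_sym (negPf e1) ![0 == _]eq_sym (negPf e2) (negPf e3).
  by rewrite /= mulr0n mulr1n !subr0 !addr0 !mul1r sub0r mulN1r add0r addrA.
- by rewrite /= !inE (negPf e1) (negPf e2) (negPf e3).
move=> d'; rewrite !inE umvE !negb_or => /and3P[/negPf-> /negPf-> /negPf->].
by rewrite subrr addr0 mul0r.
Qed.

Lemma Ld_curry (a : B) (F : int -> int -> B) d :
  Ld a (fun d => F (d u2) (d v2)) d = Lop h a F (d u2) (d v2).
Proof. by rewrite /Ld /Lop !ffunE /= !subr0. Qed.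

Hypothesis hcomp : hcomplete B.

Definition dsummable (f g : dist B 2) := forall d, hnull (fun d' => f d' * g (d - d')).

(** Products of distributions need not be associative. The factor u - v + h a has only three
    monomials, so it can be moved inside as soon as the sums defining f ** g converge. *)
Lemma Ld_mul (a : B) (f g : dist B 2) : dsummable f g ->
  Ld a (f ** g) = Ld a f ** g.
Proof.
move=> S; apply: funext => d; apply: esym; apply: hsumE => //.
have sh e : has_hsum (fun d' => f (d' - e) * g (d - d')) ((f ** g) (d - e)).
  have := @has_hsum_reindex _ _ _ _ (fun d' => d' - e) _ _ _ (hsumP hsep hcomp (S (d - e))).
  have -> : (fun d' => f (d' - e) * g (d - e - (d' - e))) = (fun d' => f (d' - e) * g (d - d')).
    by apply: funext => d'; congr (_ * g _); rewrite opprB addrA subrK.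
  by apply; exists (fun d' => d' + e) => d'; rewrite ?subrK ?addrK.
have h0 := has_hsumMl (h * a) (hsumP hsep hcomp (S d)).
have := has_hsumD (has_hsumD (sh eu) (has_hsumN (sh ev))) h0.
by congr has_hsum; apply: funext => d'; rewrite /Ld !mulrDl mulNr mulrA.
Qed.

Lemma LdD a (F G : dist B 2) : Ld a (fun d => F d + G d) = fun d => Ld a F d + Ld a G d.
Proof. by apply: funext => d; rewrite /Ld mulrDr opprD; nc_ring (@nil B). Qed.

Lemma LdN a (F : dist B 2) : Ld a (fun d => - F d) = fun d => - Ld a F d.
Proof. by apply: funext => d; rewrite /Ld mulrN !opprD. Qed.

Lemma LdB a (F G : dist B 2) : Ld a (fun d => F d - G d) = fun d => Ld a F d - Ld a G d.
Proof. by rewrite LdD LdN. Qed.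

Lemma Ld_comm a b (F : dist B 2) : a * b = b * a -> Ld a (Ld b F) = Ld b (Ld a F).
Proof.
move=> ab; apply: funext => d; rewrite /Ld.
have hC := @hbarC R B.
rewrite -!addrA ![- eu + _]addrC ![- ev - _]addrC.
have -> : d + (- eu - ev) = d + (- ev - eu) by rewrite [- eu - _]addrC.
nc_from (h :: nil) (h * h * dif ab * F d).
Qed.

Definition sgp (s : polarity) (m : int) : int := if s is Pos then m else - m.

Definition half_u (s : polarity) (F : dist B 2) : Prop :=
  exists M : int, forall d : E2, M < sgp s (d u2) -> F d = 0.

(** Induction on the distance from the edge of the half-plane. For [Pos] the equation expresses F at
    exponent m - 1 of u by values at m, which vanish. For [Neg] it leaves F(m, n) = h a F(m, n + 1),
    and separatedness is needed. *)
Lemma Ld_inj s a (F : dist B 2) : half_u s F -> (forall d, Ld a F d = 0) -> forall d, F d = 0.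
Proof.
case=> M F0 L0 d; case: s F0 => /= F0.
  suff H (k : nat) n : F (mk2 (M + 1 - k%:Z) n) = 0.
    have [/F0//|dM] := ltP M (d u2).
    rewrite (mk2_eta d) -(H (absz (M + 1 - d u2)%R) (d v2)); congr F; congr mk2; lia.
  elim: k n => [|k IH] n; first by rewrite F0 // mk2u; lia.
  have := L0 (mk2 (M + 1 - k%:Z) n); rewrite /Ld.
  have -> : mk2 (M + 1 - k%:Z) n - eu = mk2 (M + 1 - k.+1%:Z) n.
    by apply: vec2P; rewrite !ffunE /=; lia.
  have -> : mk2 (M + 1 - k%:Z) n - ev = mk2 (M + 1 - k%:Z) (n - 1).
    by apply: vec2P; rewrite !ffunE /=; lia.
  by rewrite !IH subr0 mulr0 addr0.
suff H (k : nat) n : F (mk2 (- M - 1 + k%:Z) n) = 0.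
  have [/F0//|dM] := ltP M (- d u2).
  rewrite (mk2_eta d) -(H (absz (M + 1 + d u2)%R) (d v2)); congr F; congr mk2; lia.
elim: k n => [|k IH] n; first by rewrite F0 // mk2u; lia.
apply: hsep => j; exists (a ^+ j * F (mk2 (- M - 1 + k.+1%:Z) (n + j%:Z))).
elim: j => [|j ->]; first by rewrite !mul1r addr0.
have := L0 (mk2 (- M - 1 + k.+1%:Z) (n + j.+1%:Z)); rewrite /Ld.
have -> : mk2 (- M - 1 + k.+1%:Z) (n + j.+1%:Z) - eu = mk2 (- M - 1 + k%:Z) (n + j.+1%:Z).
  by apply: vec2P; rewrite !ffunE /=; lia.
have -> : mk2 (- M - 1 + k.+1%:Z) (n + j.+1%:Z) - ev = mk2 (- M - 1 + k.+1%:Z) (n + j%:Z).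
  by apply: vec2P; rewrite !ffunE /=; lia.
rewrite IH sub0r => /eqP; rewrite addrC subr_eq0 => /eqP <-.
have hC := @hbarC R B; have hjC := @hbarXC R B j.
rewrite !exprSr; nc_ring (h :: h ^+ j :: nil).
Qed.

Lemma Ld_inj_v a (F : dist B 2) (M : int) : (forall d : E2, M < d v2 -> F d = 0) ->
  (forall d, Ld a F d = 0) -> forall d, F d = 0.
Proof.
move=> F0 L0 d; suff H (k : nat) m : F (mk2 m (M + 1 - k%:Z)) = 0.
  have [/F0//|dM] := ltP M (d v2).
  rewrite (mk2_eta d) -(H (absz (M + 1 - d v2)%R) (d u2)); congr F; congr mk2; lia.
elim: k m => [|k IH] m; first by rewrite F0 // mk2v; lia.
have := L0 (mk2 m (M + 1 - k%:Z)); rewrite /Ld.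
have -> : mk2 m (M + 1 - k%:Z) - ev = mk2 m (M + 1 - k.+1%:Z).
  by apply: vec2P; rewrite !ffunE /=; lia.
have -> : mk2 m (M + 1 - k%:Z) - eu = mk2 (m - 1) (M + 1 - k%:Z).
  by apply: vec2P; rewrite !ffunE /=; lia.
by rewrite !IH mulr0 addr0 sub0r => /eqP; rewrite oppr_eq0 => /eqP.
Qed.

Definition deg (d : E2) : int := d u2 + d v2.

Definition dlt (d : E2) : B := (d == 0)%:R.

Lemma dconst1E : dconst 1 = dlt :> dist B 2.
Proof. by apply: funext => d; rewrite /dconst /dlt; case: eqP. Qed.

Lemma dlt_mul (F : dist B 2) : dlt ** F = F.
Proof.
apply: funext => d; rewrite /dmul (@hsum1 _ _ hsep _ _ 0) /dlt ?eqxx ?mul1r ?subr0 //.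
by move=> d' /negPf->; rewrite mul0r.
Qed.

Notation iuv := (inv_uv B).

Lemma inv_uv_supp s d : iuv s d != 0 -> deg d = - 1 /\ (if s is Pos then 0 <= d v2 else 0 <= d u2).
Proof.
rewrite /inv_uv /deg; case: ifP => [/eqP -> |_]; last by rewrite eqxx.
by case: s; case: (0 <= _) => //=; rewrite ?oppr0 ?eqxx.
Qed.

Lemma Ld_inv_uv s : Ld 0 (iuv s) = dlt.
Proof.
apply: funext => d; rewrite /Ld mulr0 mul0r addr0 /inv_uv !ffunE /= !subr0 /dlt.
have -> : (d u2 - 1 + d v2 == - 1) = (d u2 + d v2 == 0) by lia.
have -> : (d u2 + (d v2 - 1) == - 1) = (d u2 + d v2 == 0) by lia.
have -> : (d == 0) = (d u2 == 0) && (d v2 == 0).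
  apply/eqP/andP => [->|[/eqP a /eqP b]]; first by rewrite !ffunE.
  by apply: vec2P; rewrite ?a ?b !ffunE.
case: ifPn => [d0|d0]; last by rewrite subrr; case: eqP => //=; case: eqP => //=; lia.
case: s.
  have [v0|v0] := ltP (d v2) 0; last have [v1|v1] := ltP (d v2) 1.
  - have -> : (d v2 == 0) = false by lia.
    have -> : (0 <= d v2 - 1) = false by lia.
    by rewrite andbF subrr.
  - have -> : (d v2 == 0) by lia.
    have -> : (d u2 == 0) by lia.
    have -> : (0 <= d v2 - 1) = false by lia.
    by rewrite subr0.
  have -> : (d v2 == 0) = false by lia.
  have -> : (0 <= d v2 - 1) by lia.
  by rewrite andbF subrr.
have [v0|v0] := ltP (d u2) 0; last have [v1|v1] := ltP (d u2) 1.
- have -> : (d u2 == 0) = false by lia.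
  have -> : (0 <= d u2 - 1) = false by lia.
  by rewrite subrr.
- have -> : (d v2 == 0) by lia.
  have -> : (d u2 == 0) by lia.
  have -> : (0 <= d u2 - 1) = false by lia.
  by rewrite oppr0 sub0r opprK.
have -> : (d u2 == 0) = false by lia.
have -> : (0 <= d u2 - 1) by lia.
by rewrite subrr.
Qed.

Definition box (K : nat) : seq E2 :=
  [seq mk2 (a%:Z - K%:Z) (b%:Z - K%:Z) | a <- iota 0 K.*2.+1, b <- iota 0 K.*2.+1].

Lemma boxP K d : d \notin box K -> (K < `|d u2|)%N \/ (K < `|d v2|)%N.
Proof.
move=> db; have [a|a] := ltnP K `|d u2|; [by left | right].
rewrite ltnNge; apply: contra db => b; apply/allpairsP.
exists (absz (d u2 + K%:Z)%R, absz (d v2 + K%:Z)%R); rewrite !mem_iota; split; cbn [fst snd]; try lia.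
by apply: vec2P; rewrite /= ?mk2u ?mk2v; [move: (d u2) a | move: (d v2) b] => x; clear; lia.
Qed.

Lemma hnull_box (x : E2 -> B) :
  (forall n, exists K : nat, forall d : E2, (K < `|d u2|)%N \/ (K < `|d v2|)%N ->
     exists y, x d = h ^+ n * y) -> hnull x.
Proof.
by move=> xK n; have [K KP] := xK n; exists (box K) => d /boxP; exact: KP.
Qed.

Lemma hnull_box0 (x : E2 -> B) (K : nat) :
  (forall d : E2, (K < `|d u2|)%N \/ (K < `|d v2|)%N -> x d = 0) -> hnull x.
Proof.
by move=> xK; apply: hnull_box => n; exists K => d /xK ->; exists 0; rewrite mulr0.
Qed.

Definition ivp s n : dist B 2 := dexp (iuv s) n.

Lemma ivp_supp s n d : ivp s n d != 0 ->
  deg d = - n%:Z /\ (if s is Pos then 0 <= d v2 else 0 <= d u2).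
Proof.
elim: n d => [|n IH] d.
  rewrite /ivp /= /dconst; case: ifP => [/eqP ->|_]; last by rewrite eqxx.
  by rewrite /deg !ffunE; case: s.
move=> H; apply: contrapT => dn; case/eqP: H; rewrite /ivp /= -/(ivp s n).
apply: hsum0 => // d'; have [->|/inv_uv_supp[e1 e2]] := eqVneq (iuv s d') 0.
  by rewrite mul0r.
have [->|/IH[e3 e4]] := eqVneq (ivp s n (d - d')) 0; first by rewrite mulr0.
case: dn; move: e1 e2 e3 e4; rewrite /deg !ffunE.
by case: s {IH} => /=; move: (d u2) (d v2) (d' u2) (d' v2); clear; lia.
Qed.

Lemma ivp_summable s n : dsummable (iuv s) (ivp s n).
Proof.
move=> d; apply: (@hnull_box0 _ (`|d u2| + `|d v2| + 1)) => d' d'K.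
have [->|/inv_uv_supp[e1 e2]] := eqVneq (iuv s d') 0; first by rewrite mul0r.
have [->|/ivp_supp[e3 e4]] := eqVneq (ivp s n (d - d')) 0; first by rewrite mulr0.
exfalso; move: e1 e2 e3 e4 d'K; rewrite /deg !ffunE.
by case: s => /=; move: (d u2) (d v2) (d' u2) (d' v2); clear; lia.
Qed.

Lemma Ld_ivp s n : Ld 0 (ivp s n.+1) = ivp s n.
Proof.
by rewrite /ivp /= Ld_mul ?Ld_inv_uv ?dlt_mul //; exact: ivp_summable.
Qed.

(** (u - v)^-n is homogeneous of degree - n, so at most one term of the series contributes to a
    given monomial. *)
Lemma inv_umvE s a d : inv_umv s a d =
  if deg d < 0 then (- (h * a)) ^+ `|deg d|.-1 * ivp s `|deg d| d else 0.
Proof.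
rewrite /inv_umv; case: ifPn => d0.
  rewrite (@hsum1 _ _ hsep _ _ `|deg d|.-1); last first.
    move=> n nd; have [->|/ivp_supp[]] := eqVneq (dexp (iuv s) n.+1 d) 0; first by rewrite mulr0.
    by move=> dn _; exfalso; lia.
  by rewrite prednK //; lia.
apply: hsum0 => // n; have [->|/ivp_supp[]] := eqVneq (dexp (iuv s) n.+1 d) 0.
  by rewrite mulr0.
by move=> dn _; exfalso; lia.
Qed.

Lemma Ld_inv s a : Ld a (inv_umv s a) = dlt.
Proof.
apply: funext => d.
have D1 : deg (d - eu) = deg d - 1 by rewrite /deg !ffunE /=; lia.
have D2 : deg (d - ev) = deg d - 1 by rewrite /deg !ffunE /=; lia.
rewrite {1}/Ld !inv_umvE D1 D2.
have dl0 : deg d != 0 -> dlt d = 0.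
  move=> dd; rewrite /dlt (_ : (d == 0) = false) //; apply/eqP => d0; case/eqP: dd; rewrite d0.
  by rewrite /deg !ffunE.
have [d0|d0|d0] := ltgtP (deg d) 0.
- have -> : deg d - 1 < 0 by lia.
  have [k kE] : exists k, `|deg d|%N = k.+1 by exists `|deg d|.-1; lia.
  have -> : absz (deg d - 1)%R = k.+2 by lia.
  rewrite kE /= -mulrBr exprS.
  have := congr1 (fun F => F d) (Ld_ivp s k.+1); rewrite {1}/Ld mulr0 mul0r addr0 => ->.
  by rewrite dl0 ?lt_eqF // -[iuv s ** _]/(ivp s k.+1) !mulNr -!mulrA addNr.
- have -> : (deg d - 1 < 0) = false by lia.
  by rewrite subrr mulr0 addr0 dl0 // gt_eqF.
rewrite d0 /= mulr0 addr0 !mul1r.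
have := congr1 (fun F => F d) (Ld_ivp s 0); rewrite {1}/Ld mulr0 mul0r addr0.
by rewrite -[ivp s 0]/(dconst 1) dconst1E => <-; rewrite -dconst1E.
Qed.

Lemma inv_umv_supp s (a : B) d : inv_umv s a d != 0 ->
  deg d < 0 /\ (if s is Pos then 0 <= d v2 else 0 <= d u2).
Proof.
rewrite inv_umvE; case: ifP => [d0|_]; last by rewrite eqxx.
by have [->|/ivp_supp[] //] := eqVneq (ivp s `|deg d| d) 0; rewrite mulr0 eqxx.
Qed.

Lemma inv_umv_dvd s (a : B) n d : deg d < - n%:Z -> exists y, inv_umv s a d = h ^+ n * y.
Proof.
move=> dn; rewrite inv_umvE; case: ifP => [d0|_]; last by exists 0; rewrite mulr0.
have -> : `|deg d|.-1 = (n + (`|deg d|.-1 - n))%N by lia.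
exists ((-1) ^+ n * a ^+ n * (- (h * a)) ^+ (`|deg d|.-1 - n) * ivp s `|deg d| d).
rewrite exprD !mulrA; congr (_ * _ * _); elim: n {dn} => [|n IH]; first by rewrite !mul1r.
have hC := @hbarC R B; have hnC := @hbarXC R B n.
have sC : central ((- 1) ^+ n : B).
  by elim: n {IH hnC} => [|n IH] x; rewrite ?mul1r ?mulr1 // exprS !mulN1r mulNr IH mulrN.
rewrite exprSr IH ![_ ^+ n.+1]exprSr.
nc_ring (h :: h ^+ n :: (-1) ^+ n :: nil).
Qed.
End Dist2.

Section Dist2.
Variables (R : realType) (B : halg R).
Notation h := (hbar B).
Hypotheses (hsep : hseparated B) (hcomp : hcomplete B).
Implicit Types F G f g : dist B 2.

Definition half_v F : Prop := exists M : int, forall d : E2, M < d v2 -> F d = 0.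

(** An expansion in powers of hbar can have infinitely many terms with a fixed exponent of u; their
    coefficients tend to 0 in the hbar-adic topology. Together with a half-plane bound in u this
    makes products summable. *)
Definition u_null f : Prop := forall (n : nat) (x : int), exists K : nat,
  forall d : E2, d u2 = x -> (K < `|d v2|)%N -> exists y, f d = h ^+ n * y.

Lemma half_uB s F G : half_u s F -> half_u s G -> half_u s (fun d => F d - G d).
Proof.
case=> M F0 [M' G0]; exists (Num.max M M') => d; rewrite gt_max => /andP[/F0 -> /G0 ->].
by rewrite subr0.
Qed.

Lemma half_uM s a F : half_u s F -> half_u s (fun d => a * F d).
Proof. by case=> M F0; exists M => d /F0 ->; rewrite mulr0. Qed.

Lemma half_u_Ld s a F : half_u s F -> half_u s (Ld a F).
Proof.
case=> M F0; exists (M + 1) => d dM; rewrite /Ld !F0 ?mulr0 ?subr0 ?addr0 //;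
  move: dM; rewrite ?ffunE ?mk2u; case: s {F0} => /=; lia.
Qed.

Lemma half_vB F G : half_v F -> half_v G -> half_v (fun d => F d - G d).
Proof.
case=> M F0 [M' G0]; exists (Num.max M M') => d; rewrite gt_max => /andP[/F0 -> /G0 ->].
by rewrite subr0.
Qed.

Lemma half_vM a F : half_v F -> half_v (fun d => a * F d).
Proof. by case=> M F0; exists M => d /F0 ->; rewrite mulr0. Qed.

Lemma half_v_Ld a F : half_v F -> half_v (Ld a F).
Proof.
case=> M F0; exists (M + 1) => d dM; rewrite /Ld !F0 ?mulr0 ?subr0 ?addr0 //;
  move: dM; rewrite ?ffunE ?mk2v /=; lia.
Qed.

Lemma Ld_cancel s a F G : half_u s F -> half_u s G -> Ld a F = Ld a G -> F = G.
Proof.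
move=> hF hG FG; apply: funext => d; apply/eqP; rewrite -subr_eq0; apply/eqP.
apply: (Ld_inj hsep (half_uB hF hG)) => d'.
by rewrite LdB; apply/eqP; rewrite subr_eq0; apply/eqP; exact: (congr1 (fun H => H d') FG).
Qed.

Lemma Ld_cancel_v a F G : half_v F -> half_v G -> Ld a F = Ld a G -> F = G.
Proof.
move=> hF hG FG; apply: funext => d; apply/eqP; rewrite -subr_eq0; apply/eqP.
have [M MP] := half_vB hF hG.
apply: (@Ld_inj_v _ _ a (fun d => F d - G d) M MP) => d'.
by rewrite LdB; apply/eqP; rewrite subr_eq0; apply/eqP; exact: (congr1 (fun H => H d') FG).
Qed.

Lemma half_u_inv s (a : B) : half_u s (inv_umv s a).
Proof.
exists 0 => d d0; apply/eqP; apply: contraTT d0 => /(inv_umv_supp hsep); rewrite /deg.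
by case: s => -[] /=; move: (d u2) (d v2); clear; lia.
Qed.

Lemma u_null_inv s (a : B) : u_null (inv_umv s a).
Proof.
move=> n x; exists (`|x| + n)%N => d du dv.
have [/(inv_umv_dvd hsep)//|dn] := ltP (deg d) (- n%:Z); exists 0; rewrite mulr0.
apply/eqP; apply: contraTT dv => /(inv_umv_supp hsep)[].
by move: dn; rewrite /deg du; move: (d v2); clear; lia.
Qed.

Lemma u_null_Ld a f : u_null f -> u_null (Ld a f).
Proof.
move=> fn n x; have [K KP] := fn n x; have [K' KP'] := fn n (x - 1).
exists (K + K').+1 => d du dv.
have [y1 e1] : exists y, f (d - eu) = h ^+ n * y.
  by apply: KP'; rewrite !ffunE /= ?du //; move: dv; move: (d v2); clear; lia.
have [y2 e2] : exists y, f (d - ev) = h ^+ n * y.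
  by apply: KP; rewrite !ffunE /= ?du ?subr0 //; move: dv; move: (d v2); clear; lia.
have [y3 e3] : exists y, f d = h ^+ n * y.
  by apply: KP; rewrite ?du //; move: dv; move: (d v2); clear; lia.
exists (y1 - y2 + h * a * y3); rewrite /Ld e1 e2 e3 mulrDr mulrBr; congr (_ + _).
by rewrite [LHS]mulrA -(hbarXC n (h * a)) -mulrA.
Qed.

Lemma u_null_unif f : u_null f -> forall (n L : nat), exists K : nat,
  forall d : E2, (`|d u2| <= L)%N -> (K < `|d v2|)%N -> exists y, f d = h ^+ n * y.
Proof.
move=> fn n; elim=> [|L [K KP]].
  have [K KP] := fn n 0; exists K => d du; apply: KP.
  by move: (d u2) du; clear; lia.
have [K1 KP1] := fn n L.+1; have [K2 KP2] := fn n (- L.+1%:Z).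
exists (K + K1 + K2)%N => d du dv.
have [dL|dL] := leqP `|d u2| L.
  by apply: KP => //; move: (d v2) dv; clear; lia.
have [d0|d0] : d u2 = L.+1%:Z \/ d u2 = - L.+1%:Z by move: (d u2) du dL; clear; lia.
  by apply: KP1 => //; move: (d v2) dv; clear; lia.
by apply: KP2 => //; move: (d v2) dv; clear; lia.
Qed.

Lemma u_null_box s f G d n : half_u s f -> u_null f -> half_u s G -> exists r : seq E2,
  forall d', d' \notin r -> (exists y, f d' = h ^+ n * y) \/ G (d - d') = 0.
Proof.
move=> [M f0] fn [M' G0]; have [K KP] := u_null_unif fn n (`|M| + `|M'| + `|d u2|)%N.
exists (box (`|M| + `|M'| + `|d u2| + K)) => d' /boxP dK.
have [d1|d1] := ltP M (sgp s (d' u2)); first by left; exists 0; rewrite f0 // mulr0.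
have [d2|d2] := ltP M' (sgp s ((d - d') u2)); first by right; rewrite G0.
left; apply: KP.
  move: d1 d2; rewrite !ffunE; case: (s) => /=; move: (d u2) (d' u2); clear; lia.
move: d1 d2 dK; rewrite !ffunE; case: (s) => /=; move: (d u2) (d' u2) (d' v2); clear; lia.
Qed.

Lemma u_null_summable s f G : half_u s f -> u_null f -> half_u s G -> dsummable f G.
Proof.
move=> hf nf hG d n; have [r rP] := u_null_box d n hf nf hG; exists r => d' /rP[[y ->]|->].
  by exists (y * G (d - d')); rewrite mulrA.
by exists 0; rewrite !mulr0.
Qed.

Lemma u_null_summabler s f G : half_u s f -> u_null f -> half_u s G -> dsummable G f.
Proof.
move=> hf nf hG d n; have [r rP] := u_null_box d n hf nf hG.
exists [seq d - d' | d' <- r] => d' d'r.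
have /rP : d - d' \notin r by apply: contra d'r => dr; rewrite -(subKr d d'); exact: map_f.
rewrite subKr => -[[y ->]|->]; last by exists 0; rewrite mul0r mulr0.
by exists (G d' * y); rewrite !mulrA hbarXC.
Qed.

Lemma half_u_dmul s f G : half_u s f -> half_u s G -> half_u s (f ** G).
Proof.
move=> [M f0] [M' G0]; exists (M + M') => d dM; apply: hsum0 => // d'.
have [d1|d1] := ltP M (sgp s (d' u2)); first by rewrite f0 // mul0r.
rewrite G0 ?mulr0 //.
move: d1 dM; rewrite !ffunE; case: (s) => /=; move: (d u2) (d' u2); clear; lia.
Qed.

Lemma inv_summable s (a : B) G : half_u s G -> dsummable (inv_umv s a) G.
Proof. exact: u_null_summable (half_u_inv s a) (u_null_inv s a). Qed.

(** The expansion [Neg] has nonnegative exponents of u and negative total degree, hence negative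
    exponents of v. Against a factor bounded above in v only a finite box of exponents
    contributes. *)
Lemma invN_zero (a : B) G (M : int) (d d' : E2) : (forall d : E2, M < d v2 -> G d = 0) ->
  (`|M| + `|d v2| < `|d' u2|)%N \/ (`|M| + `|d v2| < `|d' v2|)%N \/ M < d v2 ->
  inv_umv Neg a d' * G (d - d') = 0.
Proof.
move=> G0 dd; have [d1|d1] := ltP M ((d - d') v2); first by rewrite G0 // mulr0.
have [->|/(inv_umv_supp hsep)[]] := eqVneq (inv_umv Neg a d') 0; first by rewrite mul0r.
move: d1 dd; rewrite /deg !ffunE; move: (d v2) (d' u2) (d' v2); clear; lia.
Qed.

Lemma invN_summable (a : B) G : half_v G -> dsummable (inv_umv Neg a) G.
Proof.
move=> [M G0] d; apply: (@hnull_box0 _ _ _ (`|M| + `|d v2|)) => d' [] dd.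
  by apply: (invN_zero _ G0); left.
by apply: (invN_zero _ G0); right; left.
Qed.

Lemma half_v_invN (a : B) G : half_v G -> half_v (inv_umv Neg a ** G).
Proof.
move=> [M G0]; exists M => d dM; apply: hsum0 => // d'.
by apply: (invN_zero _ G0); right; right.
Qed.

Lemma inv_spec s (a : B) G : dsummable (inv_umv s a) G -> Ld a (inv_umv s a ** G) = G.
Proof. by move=> S; rewrite Ld_mul // Ld_inv // dlt_mul. Qed.

Lemma dlt_summable G : dsummable (@dlt _ B) G.
Proof.
move=> d; apply: (@hnull_box0 _ _ _ 0) => d' dd; rewrite /dlt (_ : (d' == 0) = false) ?mul0r //.
by apply/eqP => d0; move: dd; rewrite d0 !ffunE; lia.
Qed.

Lemma ratio_spec s (a b : B) G : a * b = b * a -> half_u s G ->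
  half_u s (uv_ratio s a b ** G) /\ Ld b (uv_ratio s a b ** G) = Ld a G.
Proof.
move=> ab hG; rewrite /uv_ratio umv_mul //.
have hI := half_u_Ld a (half_u_inv s b); have nI := u_null_Ld a (u_null_inv s b).
split; first exact: half_u_dmul.
rewrite Ld_mul //; last exact: u_null_summable hI nI hG.
rewrite Ld_comm // Ld_inv // -Ld_mul ?dlt_mul //; exact: dlt_summable.
Qed.

(** The product of the expanded ratio with G is the only half-plane solution P of (u - v + h b) P =
    (u - v + h a) G. *)
Lemma ratio_eq s (a b : B) G P : a * b = b * a -> half_u s G -> half_u s P ->
  Ld b P = Ld a G -> P = uv_ratio s a b ** G.
Proof.
move=> ab hG hP e; have [h1 h2] := ratio_spec ab hG.
by apply: (@Ld_cancel s b) => //; rewrite e h2.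
Qed.

(** * Products of series in one and the same variable *)

Lemma one_rangedP s (f : fseries B) : one_sided s f <-> ranged s f.
Proof.
by split=> f0 m ms; apply: f0; move: ms; case: (s) => /=; clear; lia.
Qed.

Definition rng (s : polarity) (m : int) : seq int := [seq expo 0 s i | i <- iota 0 `|m|.+1].

Lemma rng_uniq s m : uniq (rng s m).
Proof.
rewrite map_inj_uniq ?iota_uniq // => i j.
by move=> e; rewrite -(abs_expo0 s i) e abs_expo0.
Qed.

Lemma rng_out s m j (f g : fseries B) : one_sided s f -> one_sided s g -> j \notin rng s m ->
  f j = 0 \/ g (m - j) = 0.
Proof.
move=> /one_rangedP f0 /one_rangedP g0 jr.
case/boolP: (in_range 0 s j) => [js|/f0]; last by left.
case/boolP: (in_range 0 s (m - j)) => [mjs|/g0]; last by right.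
case/mapP: jr; exists `|j|%N; last exact: expo0P.
by rewrite mem_iota; move: js mjs; case: (s) => /=; clear; lia.
Qed.

Lemma dmul_rng s (f g : fseries B) m : one_sided s f -> one_sided s g ->
  (f ** g) m = \sum_(j <- rng s m) f j * g (m - j).
Proof.
move=> f0 g0; apply: hsum_fin => //; first exact: rng_uniq.
by move=> j /(rng_out f0 g0)[]->; rewrite ?mul0r ?mulr0.
Qed.

Lemma dmul_one s (f g : fseries B) : one_sided s f -> one_sided s g -> one_sided s (f ** g).
Proof.
move=> f0 g0; apply/one_rangedP => m ms; apply: hsum0 => // j.
move/one_rangedP: f0 => f0; move/one_rangedP: g0 => g0.
case/boolP: (in_range 0 s j) => [js|/f0->]; last by rewrite mul0r.
rewrite g0 ?mulr0 //; move: js ms; case: (s) => /=; clear; lia.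
Qed.

Lemma ser_dmul s (f g : fseries B) : one_sided s f -> one_sided s g ->
  ser s (f ** g) = ser s f * ser s g.
Proof.
move=> f0 g0; apply: fpsP => i; rewrite fcoefM /= (dmul_rng _ f0 g0) /rng abs_expo0.
rewrite big_map -[iota 0 _]/(index_iota 0 i.+1) big_mkord; apply: eq_bigr => l _.
congr (_ * g _); have := ltn_ord l; case: (s) => /=; clear; lia.
Qed.

Lemma ser_dconst s (b : B) : ser s (dconst b) = fpsC b.
Proof. by apply: fpsP => i; rewrite /= /dconst expo_eq0. Qed.

Lemma dconst_one s (b : B) : one_sided s (dconst b).
Proof. by case: s => m /= m0; rewrite /dconst (_ : (m == 0) = false) //; move: m0; clear; lia. Qed.

Lemma ser_inj s (f g : fseries B) : one_sided s f -> one_sided s g -> ser s f = ser s g -> f = g.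
Proof.
move=> /one_rangedP f0 /one_rangedP g0 fg.
by rewrite -(unser_ser f0) -(unser_ser g0) fg.
Qed.

Lemma dinvE s (f g : fseries B) : one_sided s f -> one_sided s g ->
  ser s f * ser s g = 1 -> ser s g * ser s f = 1 -> dinv s f = g.
Proof.
move=> f0 g0 fg gf; rewrite /dinv; set x := xget _ _.
have [x0 _ x1] : [/\ one_sided s x, f ** x = dconst 1 & x ** f = dconst 1].
  have xP := @xgetPex _ _ [set g | [/\ one_sided s g, f ** g = dconst 1 & g ** f = dconst 1]]%classic.
  apply: xP; exists g; split=> //; apply: (@ser_inj s);
  rewrite ?ser_dmul ?ser_dconst ?fpsC1 ?fg ?gf //;
  solve [exact: dmul_one | exact: dconst_one].
apply: (@ser_inj s) => //.
have {}x1 : ser s x * ser s f = 1 by rewrite -ser_dmul // x1 ser_dconst fpsC1.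
by rewrite -[LHS]mulr1 -fg mulrA x1 mul1r.
Qed.

Lemma at_mul n (x : 'I_n) s (f g : fseries B) : one_sided s f -> one_sided s g ->
  f \at x ** g \at x = (f ** g) \at x.
Proof.
move=> f0 g0; apply: funext => d.
have [dE|dx] := eqVneq d (pt x (d x)); last first.
  rewrite at_var_out //; apply: hsum0 => // d'.
  have [d'E|d'x] := eqVneq d' (pt x (d' x)); last by rewrite at_var_out ?mul0r.
  rewrite [(g \at x) _]at_var_out ?mulr0 //; apply: contra dx => /eqP e.
  apply/eqP; rewrite -[d in LHS](subrK d') e d'E; apply/ffunP => y; rewrite !ffunE eqxx.
  by case: eqP => _; rewrite ?addr0 ?subrK.
rewrite dE at_var_pt (dmul_rng _ f0 g0) /dmul.
have pt_inj : injective (pt x) by move=> a b /(congr1 (fun d : {ffun 'I_n -> int} => d x)); rewrite !ptxx.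
have ptB a b : pt x a - pt x b = pt x (a - b).
  by apply/ffunP => y; rewrite !ffunE; case: eqP; rewrite ?subr0.
rewrite (@hsum_fin _ _ hsep _ _ [seq pt x j | j <- rng s (d x)]).
- by rewrite big_map; apply: eq_bigr => j _; rewrite ptB !at_var_pt.
- by rewrite map_inj_uniq ?rng_uniq.
move=> d' d'r; have [d'E|d'x] := eqVneq d' (pt x (d' x)); last by rewrite at_var_out ?mul0r.
rewrite d'E ptB !at_var_pt; case: (@rng_out s (d x) (d' x) f g) => // [|->|->]; rewrite ?mul0r ?mulr0 //.
by apply: contra d'r; rewrite {2}d'E; exact: map_f.
Qed.

Lemma conj_at s (a b x : fseries B) (d : E2) : one_sided s a -> one_sided s b ->
  (a \at u2 ** x \at v2 ** b \at u2) d = conj_conv s a b (x (d v2)) (d u2).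
Proof.
move=> a0 b0.
transitivity (\sum_(j <- rng s (d u2)) a j * x (d v2) * b (d u2 - j)).
  rewrite [LHS](@hsum_fin _ _ hsep _ _ [seq mk2 j (d v2) | j <- rng s (d u2)]).
  - rewrite big_map; apply: eq_bigr => j _; rewrite prod_uv // mk2u mk2v.
    congr (_ * _); rewrite -(at_var_pt b u2); congr (at_var b).
    by apply: vec2P; rewrite !ffunE /= ?subrr.
  - rewrite map_inj_uniq ?rng_uniq // => i j /(congr1 (fun d : E2 => d u2)).
    by rewrite !mk2u.
  move=> d' d'r; rewrite prod_uv //.
  have [dv|dv] := eqVneq (d' v2) (d v2); last first.
    rewrite [(b \at _) _]at_var_out ?mulr0 //; apply: contra dv => /eqP.
    move=> /(congr1 (fun d : E2 => d v2)); rewrite !ffunE /= => /eqP.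
    by rewrite subr_eq0 eq_sym.
  have -> : d - d' = pt u2 (d u2 - d' u2) by apply: vec2P; rewrite !ffunE /= ?dv ?subrr.
  rewrite at_var_pt; case: (@rng_out s (d u2) (d' u2) a b) => // [|->|->]; rewrite ?mul0r ?mulr0 //.
  by apply: contra d'r; rewrite [d' in X in _ -> X]mk2_eta dv; exact: map_f.
rewrite /conj_conv; case: ifPn => [ds|ds].
  rewrite /rng big_map -[iota 0 _]/(index_iota 0 _.+1) big_mkord; apply: eq_bigr => l _.
  by congr (_ * b _); move: l (ltn_ord l) ds; move: (d u2) => m [l lm] /=; case: (s) => /=; clear; lia.
rewrite big1 // => j _.
move/one_rangedP: a0 => a0; move/one_rangedP: b0 => b0.
case/boolP: (in_range 0 s j) => [js|/a0->]; last by rewrite !mul0r.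
rewrite b0 ?mulr0 //; move: js ds; case: (s) => /=; move: (d u2); clear; lia.
Qed.

Lemma tri_at (f g w : fseries B) (x y z : 'I_3) (d : {ffun 'I_3 -> int}) :
  uniq [:: x; y; z] -> (f \at x ** g \at y ** w \at z) d = f (d x) * g (d y) * w (d z).
Proof.
rewrite /= !inE negb_or => /and3P[/andP[xy xz] yz _].
have f0 (d' : {ffun 'I_3 -> int}) : d' y != 0 -> (f \at x) d' = 0.
  move=> d'y; apply: at_var_out; apply: contra d'y => /eqP ->.
  by rewrite ffunE [y == x]eq_sym (negPf xy).
have xyz t : [|| t == x, t == y | t == z].
  move: xy xz yz; rewrite -!val_eqE.
  by case: x y z t {f0} => [x x3] [y y3] [z z3] [t t3] /=; clear -x3 y3 z3 t3; lia.
rewrite dmul_atr // => [|d' d'z].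
  rewrite dmul_atr //; congr (_ * _ * _).
    rewrite -[RHS](at_var_pt f x); congr (at_var f).
    apply/ffunP => t; rewrite !ffunE.
    case/or3P: (xyz t) => /eqP ->; rewrite ?eqxx ?(negPf xy) ?(negPf xz) ?(negPf yz).
    - by rewrite !subr0.
    - by rewrite [y == x]eq_sym (negPf xy) !subr0 subrr.
    by rewrite [z == x]eq_sym [z == y]eq_sym (negPf xz) (negPf yz) subrr subr0.
  by rewrite !ffunE (negPf yz) subr0.
rewrite dmul_atr // at_var_out ?mul0r //; apply: contra d'z => /eqP.
move=> /(congr1 (fun d : {ffun 'I_3 -> int} => d z)); rewrite !ffunE.
by rewrite [z == x]eq_sym [z == y]eq_sym (negPf xz) (negPf yz) subr0 => ->.
Qed.
End Dist2.

(** * Taylor shifts of the variable by multiples of hbar *)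

Section Shift.
Variables (R : realType) (B : halg R).
Notation h := (hbar B).
Hypotheses (hsep : hseparated B) (hcomp : hcomplete B).
Implicit Types (f g : fseries B) (a x y : B).

(** The n-th derivative divided by n!, the Taylor coefficient that occurs in [dshift]. *)
Definition ddiv (n : nat) f : fseries B := fun m => scal B (n`!%:R)^-1 * iter n (@dderiv _ B) f m.

Lemma scalM z w : scal B (z * w) = scal B z * scal B w.
Proof. by rewrite /scal fpsCM rmorphM. Qed.

Lemma scal1 : scal B 1 = 1.
Proof. by rewrite /scal fpsC1 rmorph1. Qed.

Lemma scal_nat (n : nat) : scal B n%:R = n%:R.
Proof. by rewrite /scal !rmorph_nat. Qed.

Lemma scal_factS n : scal B (n.+1`!%:R)^-1 *+ n.+1 = scal B (n`!%:R)^-1.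
Proof.
rewrite -[LHS]mulr_natr -(scal_nat n.+1) -scalM factS natrM invfM mulrAC mulVf ?mul1r //.
by rewrite pnatr_eq0.
Qed.

Lemma dderivD f g : dderiv (fun m => f m + g m) = fun m => dderiv f m + dderiv g m.
Proof. by apply: funext => m; rewrite /dderiv mulrzDl. Qed.

Lemma dderivMl x f : dderiv (fun m => x * f m) = fun m => x * dderiv f m.
Proof. by apply: funext => m; rewrite /dderiv mulrzAr. Qed.

Lemma dderivMr x f : dderiv (fun m => f m * x) = fun m => dderiv f m * x.
Proof. by apply: funext => m; rewrite /dderiv mulrzAl. Qed.

Lemma ddivMl n x f : ddiv n (fun m => x * f m) = fun m => x * ddiv n f m.
Proof.
apply: funext => m; rewrite /ddiv.
have -> : iter n (@dderiv _ B) (fun m => x * f m) = fun m => x * iter n (@dderiv _ B) f m.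
  by elim: n => //= n ->; rewrite dderivMl.
by rewrite !mulrA scalC.
Qed.

Lemma ddivMr n x f : ddiv n (fun m => f m * x) = fun m => ddiv n f m * x.
Proof.
apply: funext => m; rewrite /ddiv.
have -> : iter n (@dderiv _ B) (fun m => f m * x) = fun m => iter n (@dderiv _ B) f m * x.
  by elim: n => //= n ->; rewrite dderivMr.
by rewrite !mulrA.
Qed.

Lemma ddivD n f g : ddiv n (fun m => f m + g m) = fun m => ddiv n f m + ddiv n g m.
Proof.
apply: funext => m; rewrite /ddiv.
have -> : iter n (@dderiv _ B) (fun m => f m + g m) =
    fun m => iter n (@dderiv _ B) f m + iter n (@dderiv _ B) g m.
  by elim: n => //= n ->; rewrite dderivD.
by rewrite mulrDr.
Qed.

Lemma dderiv_ddiv n f : dderiv (ddiv n f) = fun m => ddiv n.+1 f m *+ n.+1.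
Proof. by rewrite /ddiv dderivMl; apply: funext => m; rewrite -mulrnAl scal_factS. Qed.

Lemma ddiv0 f : ddiv 0 f = f.
Proof. by apply: funext => m; rewrite /ddiv fact0 invr1 scal1 mul1r. Qed.

(** The Leibniz rule for u f(u): the factor u can be differentiated only once. *)
Lemma ddivS_pred n f : ddiv n.+1 (fun m => f (m - 1)) =
  fun m => ddiv n.+1 f (m - 1) + ddiv n f m.
Proof.
suff E : iter n.+1 (@dderiv _ B) (fun m => f (m - 1)) = fun m =>
    iter n.+1 (@dderiv _ B) f (m - 1) + iter n (@dderiv _ B) f m *+ n.+1.
  by apply: funext => m; rewrite /ddiv E mulrDr -(scal_factS n) mulrnAr mulrnAl.
have V g : dderiv (fun m => g (m - 1)) = fun m => dderiv g (m - 1) + g m.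
  apply: funext => m; rewrite /dderiv subrK addrK.
  by rewrite mulrzDr mulr1z.
elim: n => [|n IH]; first exact: V.
rewrite iterS IH dderivD V; apply: funext => m; rewrite -addrA; congr (_ + _).
by rewrite [RHS]mulrS; congr (_ + _); rewrite /= /dderiv; exact: (mulrzAC (m + 1) n.+1%:Z).
Qed.

Lemma dshiftE a f m : dshift a f m = gsum (fun n => a ^+ n * ddiv n f m).
Proof.
congr hsum; apply: funext => n; rewrite exprMn_comm; last exact: hbarC.
by rewrite /ddiv scalC !mulrA.
Qed.

Lemma dshiftD a f g : dshift a (fun m => f m + g m) = fun m => dshift a f m + dshift a g m.
Proof.
apply: funext => m; rewrite !dshiftE -gsumD //; congr gsum; apply: funext => n.
by rewrite ddivD mulrDr.
Qed.

Lemma dshiftMl a x f : a * x = x * a -> dshift a (fun m => x * f m) = fun m => x * dshift a f m.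
Proof.
move=> ax; apply: funext => m; rewrite !dshiftE -gsumMl //; congr gsum; apply: funext => n.
by rewrite ddivMl [LHS]mulrA [RHS]mulrA; congr (_ * _); exact (esym (commrX n (esym ax : GRing.comm x a))).
Qed.

Lemma dshiftMr a x f : dshift a (fun m => f m * x) = fun m => dshift a f m * x.
Proof.
apply: funext => m; rewrite !dshiftE -gsumMr //; congr gsum; apply: funext => n.
by rewrite ddivMr mulrA.
Qed.

Lemma dshiftN a f : dshift a (fun m => - f m) = fun m => - dshift a f m.
Proof.
have -> : (fun m => - f m) = fun m => f m * - 1 by apply: funext => m; rewrite mulrN1.
by rewrite dshiftMr; apply: funext => m; rewrite mulrN1.
Qed.

Lemma dshiftB a f g : dshift a (fun m => f m - g m) = fun m => dshift a f m - dshift a g m.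
Proof. by rewrite dshiftD dshiftN. Qed.

Lemma dshift0 a : dshift a (fun=> 0) = fun=> 0.
Proof.
have := dshiftMr a 0 (fun=> 0); have -> : (fun m : int => 0 * 0 : B) = fun=> 0.
  by apply: funext => m; rewrite mulr0.
by move=> ->; apply: funext => m; rewrite mulr0.
Qed.

Lemma dshift_sum a (I : Type) (r : seq I) (F : I -> fseries B) :
  dshift a (fun m => \sum_(i <- r) F i m) = fun m => \sum_(i <- r) dshift a (F i) m.
Proof.
elim: r => [|i r IH].
  by rewrite -[RHS]/((fun G => G) _); rewrite (_ : (fun m => _) = fun=> 0) ?dshift0;
    apply: funext => m; rewrite big_nil.
have -> : (fun m => \sum_(j <- i :: r) F j m) = fun m => F i m + \sum_(j <- r) F j m.
  by apply: funext => m; rewrite big_cons.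
by rewrite dshiftD IH; apply: funext => m; rewrite big_cons.
Qed.

(** The coefficients [f (m - 1)] are those of u f(u), so this is the substitution rule (u f)(u + h
    a) = (u + h a) f(u + h a). *)
Lemma dshift_pred a f : dshift a (fun m => f (m - 1)) =
  fun m => dshift a f (m - 1) + h * a * dshift a f m.
Proof.
apply: funext => m; rewrite !dshiftE [LHS]gsumS // [gsum (fun n => a ^+ n * ddiv n f (m - 1))]gsumS //.
rewrite !mul1r !ddiv0 -addrA; congr (_ + _).
rewrite -mulrA -[a * gsum _]gsumMl // -mulrDr -gsumD //; congr (_ * gsum _).
by apply: funext => n; rewrite ddivS_pred mulrDr mulrA -exprS.
Qed.

Lemma ddiv_one s n f : one_sided s f -> one_sided s (ddiv n f).
Proof.
move=> f0; suff I0 : one_sided s (iter n (@dderiv _ B) f) by move=> m /I0; rewrite /ddiv => ->; rewrite mulr0.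
elim: n => //= n IH m ms; rewrite /dderiv.
have [->|m0] := eqVneq (m + 1) 0; first by rewrite mulr0z.
rewrite IH ?mul0rz //; move: ms m0; case: (s); clear; lia.
Qed.

Lemma dshift_one s a f : one_sided s f -> one_sided s (dshift a f).
Proof.
move=> f0 m ms; rewrite dshiftE -[RHS](gsum0 hsep); congr gsum; apply: funext => n.
by rewrite (ddiv_one n f0) // mulr0.
Qed.

Lemma dderiv_dconst x : dderiv (dconst x) = fun=> 0.
Proof.
apply: funext => m; rewrite /dderiv /dconst; have [->|_] := eqVneq (m + 1) 0.
  by rewrite mulr0z.
by rewrite mul0rz.
Qed.

Lemma dshift_dconst a x : dshift a (dconst x) = dconst x.
Proof.
apply: funext => m; rewrite dshiftE gsumS // mul1r ddiv0 -[RHS]addr0; congr (_ + _).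
rewrite -[RHS](mulr0 h) -(gsum0 hsep); congr (_ * gsum _); apply: funext => n.
rewrite /ddiv iterSr dderiv_dconst (_ : iter n _ _ = fun=> 0) ?mulr0 //.
by elim: n => //= n ->; apply: funext => j; rewrite /dderiv mul0rz.
Qed.

Lemma natmul_inj n x y : x *+ n.+1 = y *+ n.+1 -> x = y.
Proof.
have K z : scal B (n.+1%:R)^-1 * (z *+ n.+1) = z.
  rewrite -[z *+ _]mulr_natl -(scal_nat n.+1) mulrA -scalM mulVf ?scal1 ?mul1r //.
  by rewrite pnatr_eq0.
by move=> e; rewrite -(K x) e K.
Qed.

Lemma one_sidedMn s n f : one_sided s f -> one_sided s (fun m => f m *+ n).
Proof. by move=> f0 m /f0 ->; rewrite mul0rn. Qed.

Lemma dmulMnl s n f g m : one_sided s f -> one_sided s g ->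
  ((fun m => f m *+ n) ** g) m = (f ** g) m *+ n.
Proof.
move=> f0 g0; rewrite !(dmul_rng hsep (s := s)) //; last exact: one_sidedMn.
by rewrite -sumrMnl; apply: eq_bigr => j _; rewrite mulrnAl.
Qed.

Lemma dmulMnr s n f g m : one_sided s f -> one_sided s g ->
  (f ** (fun m => g m *+ n)) m = (f ** g) m *+ n.
Proof.
move=> f0 g0; rewrite !(dmul_rng hsep (s := s)) //; last exact: one_sidedMn.
by rewrite -sumrMnl; apply: eq_bigr => j _; rewrite mulrnAr.
Qed.

Lemma dderiv_dmul s f g m : one_sided s f -> one_sided s g ->
  dderiv (f ** g) m = (dderiv f ** g) m + (f ** dderiv g) m.
Proof.
move=> f0 g0; have sm (x y : int -> B) : (forall j, f j = 0 \/ g (m + 1 - j) = 0 -> x j * y j = 0 :> B) ->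
    has_hsum (fun j => x j * y j) (hsum (fun j => x j * y j)).
  move=> xy; apply: hsumP => //; apply: (@hnull_fin _ _ _ _ (rng s (m + 1))) => j.
  by move=> /(rng_out f0 g0)/xy.
have e1 : has_hsum (fun j => f j * g (m + 1 - j)) ((f ** g) (m + 1)).
  by apply: (sm f (fun j => g (m + 1 - j))) => j [] ->; rewrite ?mul0r ?mulr0.
have e2 : has_hsum (fun j => f j *~ j * g (m + 1 - j)) ((dderiv f ** g) m).
  have -> : (dderiv f ** g) m = hsum (fun j => f j *~ j * g (m + 1 - j)).
    have b : bijective (fun j : int => j + 1).
      by exists (fun j => j - 1) => j; rewrite ?addrK ?subrK.
    rewrite -(hsum_reindex _ b); congr hsum; apply: funext => j.
    by rewrite /dderiv opprD addrACA subrr addr0.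
  by apply: (sm (fun j => f j *~ j) (fun j => g (m + 1 - j))) => j [] ->; rewrite ?mul0rz ?mul0r ?mulr0.
have e3 : has_hsum (fun j => f j * (g (m + 1 - j) *~ (m + 1 - j))) ((f ** dderiv g) m).
  have -> : (f ** dderiv g) m = hsum (fun j => f j * (g (m + 1 - j) *~ (m + 1 - j))).
    by congr hsum; apply: funext => j; rewrite /dderiv addrAC.
  apply: (sm f (fun j => g (m + 1 - j) *~ (m + 1 - j))) => j [] ->; rewrite ?mul0r //.
  by rewrite mul0rz mulr0.
apply: (has_hsum_unique hsep _ (has_hsumD e2 e3)).
have := has_hsumMr (m + 1)%:~R e1; rewrite mulrzr; congr has_hsum; apply: funext => j.
by rewrite mulrzr mulrzAl mulrzAr -mulrzDr; congr (_ *~ _); rewrite [RHS]addrC subrK.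
Qed.

Lemma dderiv_sum (I : Type) (r : seq I) (F : I -> fseries B) m :
  dderiv (fun m => \sum_(i <- r) F i m) m = \sum_(i <- r) dderiv (F i) m.
Proof. by rewrite /dderiv mulrz_suml. Qed.

(** The Leibniz rule for divided derivatives. Differentiating the n-th identity gives n + 1 times
    the next one, and n + 1 is invertible. *)
Lemma ddiv_dmul s n f g m : one_sided s f -> one_sided s g ->
  ddiv n (f ** g) m = \sum_(i < n.+1) (ddiv i f ** ddiv (n - i) g) m.
Proof.
move=> f0 g0; elim: n m => [|n IH] m; first by rewrite big_ord1 !ddiv0.
apply: (@natmul_inj n); have /(congr1 (fun F => F m)) <- := dderiv_ddiv n (f ** g).
rewrite (funext IH) dderiv_sum.
pose A i := (ddiv i f ** ddiv (n.+1 - i) g) m.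
transitivity (\sum_(i < n.+1) A i.+1 *+ i.+1 + \sum_(i < n.+1) A i *+ (n.+1 - i)).
  rewrite -big_split; apply: eq_bigr => -[i /= i_n] _.
  have fi := ddiv_one i f0; have gi := ddiv_one (n - i) g0.
  rewrite (dderiv_dmul _ fi gi) !dderiv_ddiv /A subSS.
  rewrite (dmulMnl _ _ (ddiv_one i.+1 f0) gi) (dmulMnr _ _ fi (ddiv_one (n - i).+1 g0)).
  by rewrite -subSn // -ltnS.
have -> : \sum_(i < n.+1) A i.+1 *+ i.+1 = \sum_(i < n.+2) A i *+ i.
  by rewrite [RHS]big_ord_recl mulr0n add0r.
have -> : \sum_(i < n.+1) A i *+ (n.+1 - i) = \sum_(i < n.+2) A i *+ (n.+1 - i).
  by rewrite [RHS]big_ord_recr /= subnn mulr0n addr0.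
rewrite -big_split -sumrMnl; apply: eq_bigr => -[i /= i_n] _.
by rewrite -mulrnDr subnKC // -ltnS.
Qed.

Lemma ddiv_comm a n f m : (forall m, a * f m = f m * a) -> a * ddiv n f m = ddiv n f m * a.
Proof.
move=> af; have := ddivMl n a f; rewrite (funext af) ddivMr.
by move=> /(congr1 (fun F => F m)).
Qed.

Lemma dshift_dmul s a f g : one_sided s f -> one_sided s g -> (forall m, a * f m = f m * a) ->
  dshift a (f ** g) = dshift a f ** dshift a g.
Proof.
move=> f0 g0 af; apply: funext => m.
rewrite (dmul_rng hsep m (dshift_one a f0) (dshift_one a g0)) dshiftE.
rewrite (eq_bigr (fun j => gsum (fun n => \sum_(i < n.+1)
    (a ^+ i * ddiv i f j) * (a ^+ (n - i) * ddiv (n - i) g (m - j))))); last first.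
  by move=> j _; rewrite !dshiftE gsumM.
rewrite -gsum_sum //; congr gsum; apply: funext => n.
rewrite (ddiv_dmul n m f0 g0) exchange_big mulr_sumr; apply: eq_bigr => -[i /= i_n] _.
rewrite (dmul_rng hsep m (ddiv_one i f0) (ddiv_one (n - i) g0)) mulr_sumr.
apply: eq_bigr => j _; rewrite -[RHS]mulrA [ddiv i f j * (a ^+ _ * _)]mulrA.
have -> : ddiv i f j * a ^+ (n - i) = a ^+ (n - i) * ddiv i f j.
  exact (commrX _ (esym (ddiv_comm i j af) : GRing.comm _ _)).
by rewrite -[_ * ddiv i f j * _]mulrA [RHS]mulrA -exprD subnKC // -ltnS.
Qed.

Lemma dinv_dshift s a f g : one_sided s f -> one_sided s g -> (forall m, a * f m = f m * a) ->
  (forall m, a * g m = g m * a) -> ser s f * ser s g = 1 -> ser s g * ser s f = 1 ->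
  dinv s (dshift a f) = dshift a g.
Proof.
move=> f0 g0 af ag fg gf; have K (x y : fseries B) : one_sided s x -> one_sided s y ->
    (forall m, a * x m = x m * a) -> ser s x * ser s y = 1 ->
    ser s (dshift a x) * ser s (dshift a y) = 1.
  move=> x0 y0 ax xy; rewrite -(ser_dmul hsep (dshift_one a x0) (dshift_one a y0)).
  rewrite -(dshift_dmul x0 y0 ax).
  have -> : x ** y = dconst 1.
    apply: (@ser_inj _ _ s); [exact: dmul_one | exact: dconst_one |].
    by rewrite ser_dmul // ser_dconst fpsC1.
  by rewrite dshift_dconst ser_dconst fpsC1.
by apply: (dinvE hsep); [exact: dshift_one | exact: dshift_one | exact: K | exact: K].
Qed.

Definition shu a (F : int -> int -> B) : int -> int -> B := fun m n => dshift a (F^~ n) m.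
Definition shv a (F : int -> int -> B) : int -> int -> B := fun m n => dshift a (F m) n.

Lemma shv_Lop a b F : a * b = b * a -> shv a (Lop h b F) = Lop h (b - a) (shv a F).
Proof.
move=> ab; apply: funext => m; apply: funext => n; rewrite /shv /Lop.
rewrite dshiftD dshiftB dshift_pred dshiftMl; last by rewrite -!mulrA -ab mulrA -(hbarC a) mulrA.
rewrite mulrBr mulrBl; nc_ring (@nil B).
Qed.

Lemma shu_Lop a b F : a * b = b * a -> shu a (Lop h b F) = Lop h (b + a) (shu a F).
Proof.
move=> ab; apply: funext => m; apply: funext => n; rewrite /shu /Lop.
rewrite dshiftD dshiftB (dshift_pred _ (F^~ n)) dshiftMl; last first.
  by rewrite -!mulrA -ab mulrA -(hbarC a) mulrA.
rewrite mulrDr mulrDl; nc_ring (@nil B).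
Qed.
End Shift.

(** * The formal delta function as a difference of two expansions *)

Section Delta.
Variables (R : realType) (B : halg R).
Notation h := (hbar B).
Hypotheses (hsep : hseparated B) (hcomp : hcomplete B).
Implicit Types F G : dist B 2.

Definition uderiv F : dist B 2 := fun d : E2 => F (d + eu) *~ (d u2 + 1).

Lemma Ld_uderiv F d : Ld 0 (uderiv F) d = uderiv (Ld 0 F) d - F d.
Proof.
rewrite /uderiv /Ld !mulr0 !mul0r !addr0 addrK !ffunE /= !subr0 subrK.
have e : d u2 - 1 + 1 = d u2 := subrK _ _.
by rewrite e mulrzBl !mulrzDr !mulr1z [d - ev + eu]addrAC [RHS]addrAC addrK.
Qed.

Lemma half_u_ivp s n : half_u s (ivp B s n).
Proof.
exists 0 => d d0; apply/eqP; apply: contraTT d0 => /(ivp_supp hsep); rewrite /deg.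
by case: s => -[] /=; move: (d u2) (d v2); clear; lia.
Qed.

(** Multiplication by u - v reduces the case n + 1 to the case n, by the product rule [Ld_uderiv],
    and is injective on the half-planes concerned. *)
Lemma uderiv_ivp s n : uderiv (ivp B s n) = fun d => - (ivp B s n.+1 d *+ n).
Proof.
elim: n => [|n IH].
  apply: funext => d; rewrite mulr0n oppr0 /uderiv /ivp /= dconst1E /dlt.
  case: eqP => [/(congr1 (fun d : E2 => d u2))|_]; last by rewrite mul0rz.
  by rewrite !ffunE /= => ->; rewrite mulr0z.
apply: (@Ld_cancel _ _ hsep s 0).
- have [M f0] := half_u_ivp s n.+1; exists (M + 1) => d dM; rewrite /uderiv f0 ?mul0rz //.
  by move: dM; rewrite !ffunE /=; case: (s) => /=; move: (d u2); clear; lia.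
- by have [M f0] := half_u_ivp s n.+2; exists M => d /f0 ->; rewrite mul0rn oppr0.
apply: funext => d; rewrite Ld_uderiv Ld_ivp // IH LdN -opprD -mulrSr; congr (- _).
by rewrite -[in LHS](Ld_ivp hsep hcomp s n.+1) /Ld !mulr0 !mul0r !addr0 mulrnBl.
Qed.

Lemma ivp1 s : ivp B s 1 = inv_uv B s.
Proof.
apply: funext => d; rewrite /ivp /= dconst1E /dmul (@hsum1 _ _ hsep _ _ d).
  by rewrite /dlt subrr eqxx mulr1.
by move=> d' dd; rewrite /dlt subr_eq0 eq_sym (negPf dd) mulr0.
Qed.

Lemma inv_uv_delta (d : E2) : inv_uv B Pos d - inv_uv B Neg d = (d u2 + d v2 == - 1)%:R.
Proof.
rewrite /inv_uv; case: ifPn => [/eqP e|_]; last by rewrite subrr.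
rewrite opprK; have [u0|u0] := leP 0 (d u2); last first.
  have -> : 0 <= d v2 by move: e u0; move: (d u2) (d v2); clear; lia.
  by rewrite addr0.
have -> : (0 <= d v2) = false by move: e u0; move: (d u2) (d v2); clear; lia.
by rewrite add0r.
Qed.

Lemma ddiv_delta n (d : E2) : ddiv n (fun m => (m + d v2 == - 1)%:R) (d u2) =
  (-1) ^+ n * (ivp B Pos n.+1 d - ivp B Neg n.+1 d).
Proof.
elim: n d => [|n IH] d; first by rewrite ddiv0 mul1r !ivp1 inv_uv_delta.
apply: (@natmul_inj _ _ n); set D : fseries B := fun m => _.
have /(congr1 (fun F : int -> B => F (d u2))) <- := dderiv_ddiv n D.
have := IH (d + eu); rewrite !ffunE /= addr0 -/D /dderiv => ->.
rewrite exprS mulN1r -mulrzAr -mulrnAr mulNr -mulrN; congr (_ * _).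
have P := congr1 (fun F => F d) (uderiv_ivp Pos n.+1).
have N := congr1 (fun F => F d) (uderiv_ivp Neg n.+1).
by rewrite mulrzBl; move: P N; rewrite /uderiv => -> ->; rewrite mulrnBl opprB addrC opprK.
Qed.

(** Term by term in hbar: the n-th divided derivative of delta is (-1)^n times the difference of the
    two expansions of (u - v)^(-n-1). *)
Lemma ddelta_inv (a : B) : ddelta a = fun d => inv_umv Pos a d - inv_umv Neg a d.
Proof.
apply: funext => d; transitivity (hsum (fun n => (- (h * a)) ^+ n *
    (ivp B Pos n.+1 d - ivp B Neg n.+1 d))).
  congr hsum; apply: funext => n; rewrite scalC -mulrA.
  rewrite -[scal _ _ * _]/(ddiv n (fun m => (m + d v2 == - 1)%:R) (d u2)) ddiv_delta.
  by rewrite mulrA -exprMn_comm ?mulrN1 //; rewrite /GRing.comm mulN1r mulrN1.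
rewrite !(inv_umvE hsep); case: ifPn => d0.
  rewrite (@hsum1 _ _ hsep _ _ `|deg d|.-1) ?prednK ?mulrBr // => [|n nd].
    by move: d0; clear; lia.
  have Z s : ivp B s n.+1 d = 0.
    apply/eqP; apply: contraTT nd => /(ivp_supp hsep)[]; move: (deg d) d0 => x; clear; lia.
  by rewrite !Z subrr mulr0.
rewrite subrr; apply: hsum0 => // n.
have Z s : ivp B s n.+1 d = 0.
  apply/eqP; apply: contraTT d0 => /(ivp_supp hsep)[]; move: (deg d) => x; clear; lia.
by rewrite !Z subrr mulr0.
Qed.

Lemma dmulBl F G H d : dsummable F H -> dsummable G H ->
  ((fun d => F d - G d) ** H) d = (F ** H) d - (G ** H) d.
Proof.
move=> FH GH; apply: hsumE => //.
have := has_hsumD (hsumP hsep hcomp (FH d)) (has_hsumN (hsumP hsep hcomp (GH d))).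
by congr has_hsum; apply: funext => d'; rewrite mulrBl.
Qed.
End Delta.

(** * From half-currents to currents *)

Section Pieces.
Variables (R : realType) (B : halg R).
Notation h := (hbar B).
Hypotheses (hsep : hseparated B) (hcomp : hcomplete B).
Implicit Types (x y p r : fseries B) (F G : int -> int -> B).

Notation "F =2' G" := (forall m n : int, F m n = G m n) (at level 70).

Lemma dshift_comm ka la x : comm_el ka la -> (forall m, comm_el la (x m)) ->
  forall m, comm_el la (dshift ka x m).
Proof.
move=> kl lx m; have := dshiftMl hsep hcomp x kl; rewrite (funext lx) dshiftMr //.
by move=> /(congr1 (fun F : int -> B => F m)) /esym.
Qed.

Lemma LopD b F G m n : Lop h b (fun m n => F m n + G m n) m n = Lop h b F m n + Lop h b G m n.
Proof. by rewrite /Lop mulrDr; nc_ring (@nil B). Qed.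

Lemma LopN b F m n : Lop h b (fun m n => - F m n) m n = - Lop h b F m n.
Proof. by rewrite /Lop mulrN !opprD. Qed.

Lemma LopB b F G m n : Lop h b (fun m n => F m n - G m n) m n = Lop h b F m n - Lop h b G m n.
Proof. by rewrite LopD LopN. Qed.

Lemma shvD ka F G : shv ka (fun m n => F m n + G m n) = fun m n => shv ka F m n + shv ka G m n.
Proof. by apply: funext => m; rewrite /shv dshiftD. Qed.

Lemma shuD ka F G : shu ka (fun m n => F m n + G m n) = fun m n => shu ka F m n + shu ka G m n.
Proof. by apply: funext => m; apply: funext => n; rewrite /shu dshiftD. Qed.

Lemma shv_umono ka y : shv ka (umono y) = umono y.
Proof. by apply: funext => m; apply: (dshift_dconst hsep hcomp). Qed.

Lemma shu_vmono ka y : shu ka (vmono y) = vmono y.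
Proof.
apply: funext => m; apply: funext => n.
exact: (congr1 (fun F : int -> B => F m) (dshift_dconst hsep hcomp ka (y n))).
Qed.

Lemma shv_vmono ka y : shv ka (vmono y) = vmono (dshift ka y).
Proof.
apply: funext => m; rewrite /shv /vmono; case: (m == 0) => //.
exact: dshift0.
Qed.

Lemma shu_umono ka y : shu ka (umono y) = umono (dshift ka y).
Proof.
apply: funext => m; apply: funext => n; rewrite /shu /umono; case: (n == 0) => //.
by rewrite dshift0.
Qed.

Lemma shv_conj ka s a b x : (forall m, comm_el ka (a m)) ->
  shv ka (fun m n => conj_conv s a b (x n) m) = fun m n => conj_conv s a b (dshift ka x n) m.
Proof.
move=> ka_a; apply: funext => m; apply: funext => n; rewrite /shv /conj_conv.
case: ifP => _; last by rewrite dshift0.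
rewrite dshift_sum //; apply: eq_bigr => i _; rewrite dshiftMr // dshiftMl //.
exact: ka_a.
Qed.

Lemma conj_piece s (ka d r : B) (a b : int -> B) x y :
  comm_el ka d -> comm_el ka r -> (forall m, comm_el ka (a m)) ->
  (Lop h (d + r) (vmono x) =2' fun m n =>
    Lop h d (fun m n => conj_conv s a b (x n) m) m n + umono y m n) ->
  Lop h (d - ka + r) (vmono (dshift ka x)) =2' fun m n =>
    Lop h (d - ka) (fun m n => conj_conv s a b (dshift ka x n) m) m n + umono y m n.
Proof.
move=> kd kr ka_a E m n.
have {E} : shv ka (Lop h (d + r) (vmono x)) = shv ka (fun m n =>
    Lop h d (fun m n => conj_conv s a b (x n) m) m n + umono y m n).
  by congr shv; apply: funext => i; apply: funext => j.
rewrite (shvD ka (Lop h d _) (umono y)) !shv_Lop //; last by rewrite mulrDr mulrDl kd kr.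
rewrite shv_vmono shv_umono shv_conj // => /(congr1 (fun F => F m n)).
by rewrite addrAC.
Qed.

Lemma conj_sum s (be r : B) (a b : int -> B) x1 x2 y X : X = (fun m => x1 m - x2 m) ->
  (Lop h (be + r) (vmono x1) =2' fun m n =>
    Lop h be (fun m n => conj_conv s a b (x1 n) m) m n + umono y m n) ->
  (Lop h (be + r) (vmono x2) =2' fun m n =>
    Lop h be (fun m n => conj_conv s a b (x2 n) m) m n + umono y m n) ->
  Lop h (be + r) (vmono X) =2' Lop h be (fun m n => conj_conv s a b (X n) m).
Proof.
move=> -> E1 E2 m n.
have -> : vmono (fun m => x1 m - x2 m) = fun m n => vmono x1 m n - vmono x2 m n.
  by apply: funext => i; apply: funext => j; rewrite /vmono; case: eqP; rewrite ?subrr.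
have -> : (fun m n => conj_conv s a b (x1 n - x2 n) m) =
    fun m n => conj_conv s a b (x1 n) m - conj_conv s a b (x2 n) m.
  apply: funext => i; apply: funext => j; rewrite /conj_conv; case: ifP; rewrite ?subr0 //.
  by rewrite -sumrB => _; apply: eq_bigr => l _; rewrite mulrBr mulrBl.
by rewrite !LopB E1 E2 /= opprD addrACA subrr addr0.
Qed.

Lemma vmono_at x (d : E2) : (x \at v2) d = vmono x (d u2) (d v2).
Proof.
rewrite /vmono; case: eqP => du.
  rewrite -[RHS](at_var_pt x v2); congr (at_var x).
  by apply: vec2P; rewrite !ffunE ?eqxx.
apply: at_var_out; apply/eqP => /(congr1 (fun d : E2 => d u2)).
by rewrite !ffunE.
Qed.

Lemma umono_at x (d : E2) : (x \at u2) d = umono x (d u2) (d v2).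
Proof.
rewrite /umono; case: eqP => dv.
  rewrite -[RHS](at_var_pt x u2); congr (at_var x).
  by apply: vec2P; rewrite !ffunE ?eqxx.
apply: at_var_out; apply/eqP => /(congr1 (fun d : E2 => d v2)).
by rewrite !ffunE.
Qed.

Lemma half_u_vmono s x : half_u s (x \at v2).
Proof.
exists 0 => d du; rewrite vmono_at /vmono (_ : (d u2 == 0) = false) //.
by move: du; case: (s) => /=; move: (d u2); clear; lia.
Qed.

Lemma half_u_umono s x : one_sided s x -> half_u s (x \at u2).
Proof.
move=> x0; exists 0 => d du; rewrite umono_at /umono; case: ifP => // _; apply: x0.
by move: du; case: (s) => /=; move: (d u2); clear; lia.
Qed.

Lemma conj_ratio s (be r : B) (a b X : fseries B) : comm_el be r -> one_sided s a -> one_sided s b ->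
  (Lop h (be + r) (vmono X) =2' Lop h be (fun m n => conj_conv s a b (X n) m)) ->
  a \at u2 ** X \at v2 ** b \at u2 = uv_ratio s (be + r) be ** X \at v2.
Proof.
move=> br a0 b0 E; have P : a \at u2 ** X \at v2 ** b \at u2 =
    fun d : E2 => conj_conv s a b (X (d v2)) (d u2).
  by apply: funext => d; exact: conj_at.
apply: ratio_eq => //; first by rewrite mulrDl mulrDr br.
- exact: half_u_vmono.
- rewrite P; exists 0 => d du; rewrite /conj_conv ifF //.
  by move: du; case: (s) => /=; move: (d u2); clear; lia.
rewrite P; apply: funext => d.
rewrite (Ld_curry _ (fun m n => conj_conv s a b (X n) m)) -E -Ld_curry; congr (Ld _ _ d).
by apply: funext => d'; rewrite vmono_at.
Qed.

Lemma shvu_xy ka la x y : comm_el ka la -> (forall m, comm_el la (x m)) ->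
  shv la (shu ka (fun m n => x m * y n)) = fun m n => dshift ka x m * dshift la y n.
Proof.
move=> kl lx; apply: funext => i; apply: funext => j; rewrite /shv.
transitivity (dshift la (fun n => dshift ka x i * y n) j).
  by congr (dshift la _ j); apply: funext => l; rewrite /shu dshiftMr.
by rewrite dshiftMl //; exact: dshift_comm.
Qed.

Lemma shvu_yx ka la x y : (forall m, comm_el ka (y m)) ->
  shv la (shu ka (fun m n => y n * x m)) = fun m n => dshift la y n * dshift ka x m.
Proof.
move=> ky; apply: funext => i; apply: funext => j; rewrite /shv.
transitivity (dshift la (fun n => y n * dshift ka x i) j); last by rewrite dshiftMr.
congr (dshift la _ j); apply: funext => l; rewrite /shu dshiftMl //.
exact: ky.
Qed.

Lemma quad_piece ka la b1 b2 x y p r :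
  comm_el ka la -> comm_el ka b1 -> comm_el ka b2 -> comm_el la b1 -> comm_el la b2 ->
  (forall m, comm_el la (x m)) -> (forall m, comm_el ka (y m)) ->
  (Lop h b1 (fun m n => x m * y n) =2' fun m n =>
    Lop h b2 (fun m n => y n * x m) m n + (umono p m n + vmono r m n)) ->
  Lop h (b1 + ka - la) (fun m n => dshift ka x m * dshift la y n) =2' fun m n =>
    Lop h (b2 + ka - la) (fun m n => dshift la y n * dshift ka x m) m n
    + (umono (dshift ka p) m n + vmono (dshift la r) m n).
Proof.
move=> kl kb1 kb2 lb1 lb2 lx ky E m n.
have {E} : shv la (shu ka (Lop h b1 (fun m n => x m * y n))) = shv la (shu ka (fun m n =>
    Lop h b2 (fun m n => y n * x m) m n + (umono p m n + vmono r m n))).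
  by congr (shv _ (shu _ _)); apply: funext => i; apply: funext => j.
have lkb b : comm_el la b -> la * (b + ka) = (b + ka) * la.
  by move=> lb; rewrite mulrDr mulrDl lb kl.
rewrite (shuD ka (Lop h b2 (fun m n => y n * x m)) (fun m n => umono p m n + vmono r m n)).
rewrite (shuD ka (umono p) (vmono r)) !shu_Lop // shu_umono shu_vmono.
rewrite (shvD la (Lop h (b2 + ka) _) (fun m n => umono (dshift ka p) m n + vmono r m n)).
rewrite (shvD la (umono (dshift ka p)) (vmono r)) shv_umono shv_vmono !shv_Lop //; try exact: lkb.
rewrite shvu_xy // shvu_yx //.
by move=> /(congr1 (fun F => F m n)).
Qed.

Lemma quad_sum b1 b2 (x y p r : polarity -> fseries B) X Y :
  X = (fun m => x Pos m - x Neg m) -> Y = (fun m => y Pos m - y Neg m) ->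
  (forall s s', Lop h b1 (fun m n => x s m * y s' n) =2' fun m n =>
    Lop h b2 (fun m n => y s' n * x s m) m n + (umono (p s) m n + vmono (r s') m n)) ->
  umv b1 ** (X \at u2 ** Y \at v2) = umv b2 ** (Y \at v2 ** X \at u2).
Proof.
move=> -> -> E; rewrite !umv_mul //; apply: funext => d.
have K (b : B) (F G : int -> int -> B) : (forall m n, F m n = G m n) -> Lop h b F = Lop h b G.
  by move=> FG; congr Lop; apply: funext => i; apply: funext => j.
transitivity (Lop h b1 (fun m n => (x Pos m - x Neg m) * (y Pos n - y Neg n)) (d u2) (d v2)).
  by rewrite -Ld_curry; congr Ld; apply: funext => d'; rewrite prod_uv.
transitivity (Lop h b2 (fun m n => (y Pos n - y Neg n) * (x Pos m - x Neg m)) (d u2) (d v2)); last first.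
  by rewrite -Ld_curry; congr Ld; apply: funext => d'; rewrite prod_vu.
rewrite (K _ _ (fun m n => (x Pos m * y Pos n - x Pos m * y Neg n)
    - (x Neg m * y Pos n - x Neg m * y Neg n))); last by move=> m n; rewrite mulrBl !mulrBr.
rewrite [RHS](congr1 (fun F => F (d u2) (d v2)) (K _ _ (fun m n => (y Pos n * x Pos m - y Neg n * x Pos m)
    - (y Pos n * x Neg m - y Neg n * x Neg m)) _)); last first.
  by move=> m n; rewrite mulrBr !mulrBl.
rewrite !LopB !E; nc_ring (@nil B).
Qed.

Lemma comm_el_shift (ka b : B) x : (forall m, comm_el (x m) b) -> comm_el ka b ->
  forall m, comm_el (dshift ka x m) b.
Proof. by move=> xb kb m; apply/esym; apply: dshift_comm => // n; exact (esym (xb n)). Qed.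

Lemma comm_cur (x y : polarity -> fseries B) X Y :
  X = (fun m => x Pos m - x Neg m) -> Y = (fun m => y Pos m - y Neg m) ->
  (forall s s' m n, comm_el (x s m) (y s' n)) -> forall m n, comm_el (X m) (Y n).
Proof.
by move=> -> -> E m n; rewrite /comm_el !mulrBl !mulrBr !E; nc_ring (@nil B).
Qed.

Lemma serre_shift1 (ka b y : B) x : comm_el ka b -> comm_el ka y ->
  (forall m, serre_el (x m) b y = 0) -> forall m, serre_el (dshift ka x m) b y = 0.
Proof.
move=> kb ky E m; transitivity (dshift ka (fun m => serre_el (x m) b y) m); last first.
  by rewrite (funext E) dshift0.
rewrite /serre_el.
have [by1 by2] : comm_el ka (b * y) /\ comm_el ka (y * b).
  by split; rewrite /comm_el mulrA ?kb ?ky -mulrA ?kb ?ky mulrA.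
have S z w : comm_el ka z -> forall m, z * dshift ka x m * w = dshift ka (fun m => z * x m * w) m.
  by move=> kz n; rewrite dshiftMr // dshiftMl.
have k1 : comm_el ka (1 : B) by rewrite /comm_el mul1r mulr1.
have e1 := S 1 (b * y) k1 m; have e2 := S 1 (y * b) k1 m; have e3 := S y b ky m.
have e4 := S b y kb m; have e5 := S (b * y) 1 by1 m; have e6 := S (y * b) 1 by2 m.
(* Every monomial is padded to the form z * x * w, so that the single rule [S] moves all constants
   inside the shift. *)
transitivity (1 * dshift ka x m * (b * y) - (1 * dshift ka x m * (y * b) + 1 * dshift ka x m * (y * b))
  + y * dshift ka x m * b + (b * dshift ka x m * y - (b * y * dshift ka x m * 1 + b * y * dshift ka x m * 1)
  + y * b * dshift ka x m * 1)); first by rewrite !mulr2n; nc_ring (@nil B).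
rewrite e1 e2 e3 e4 e5 e6.
have aD (F G : fseries B) n : dshift ka F n + dshift ka G n = dshift ka (fun m => F m + G m) n by rewrite dshiftD.
have aB (F G : fseries B) n : dshift ka F n - dshift ka G n = dshift ka (fun m => F m - G m) n by rewrite dshiftB.
rewrite !(aD, aB); congr (dshift ka _ m); apply: funext => j.
rewrite !mulr2n; nc_ring (@nil B).
Qed.

Lemma serre_shift3 (ka a b : B) x : comm_el ka a -> comm_el ka b ->
  (forall m, serre_el a b (x m) = 0) -> forall m, serre_el a b (dshift ka x m) = 0.
Proof.
move=> kb ky E m; transitivity (dshift ka (fun m => serre_el a b (x m)) m); last first.
  by rewrite (funext E) dshift0.
have [by1 by2] : comm_el ka (a * b) /\ comm_el ka (b * a).
  by split; rewrite /comm_el mulrA ?kb ?ky -mulrA ?kb ?ky mulrA.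
have S z w : comm_el ka z -> forall m, z * dshift ka x m * w = dshift ka (fun m => z * x m * w) m.
  by move=> kz n; rewrite dshiftMr // dshiftMl.
have k1 : comm_el ka (1 : B) by rewrite /comm_el mul1r mulr1.
have e1 := S (a * b) 1 by1 m; have e2 := S a b kb m; have e3 := S 1 (a * b) k1 m.
have e4 := S (b * a) 1 by2 m; have e5 := S b a ky m; have e6 := S 1 (b * a) k1 m.
transitivity (a * b * dshift ka x m * 1 - (a * dshift ka x m * b + a * dshift ka x m * b)
  + 1 * dshift ka x m * (a * b) + (b * a * dshift ka x m * 1 - (b * dshift ka x m * a + b * dshift ka x m * a)
  + 1 * dshift ka x m * (b * a))); first by rewrite /serre_el !mulr2n; nc_ring (@nil B).
rewrite e1 e2 e3 e4 e5 e6.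
have aD (F G : fseries B) n : dshift ka F n + dshift ka G n = dshift ka (fun m => F m + G m) n by rewrite dshiftD.
have aB (F G : fseries B) n : dshift ka F n - dshift ka G n = dshift ka (fun m => F m - G m) n by rewrite dshiftB.
rewrite !(aD, aB); congr (dshift ka _ m); apply: funext => j.
by rewrite /serre_el !mulr2n; nc_ring (@nil B).
Qed.

Lemma serre_elC (a b y : B) : serre_el a b y = serre_el b a y.
Proof. by rewrite /serre_el addrC. Qed.

Lemma serre_cur (ka la : polarity -> B) (x y : polarity -> fseries B) X Y :
  X = (fun m => dshift (ka Pos) (x Pos) m - dshift (ka Neg) (x Neg) m) ->
  Y = (fun m => dshift (la Pos) (y Pos) m - dshift (la Neg) (y Neg) m) ->
  (forall s s', comm_el (ka s) (ka s')) -> (forall s s', comm_el (la s) (ka s')) ->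
  (forall s s' m, comm_el (ka s) (x s' m)) -> (forall s s' m, comm_el (ka s) (y s' m)) ->
  (forall s s' m, comm_el (la s) (x s' m)) ->
  (forall s1 s2 s3 l m n, serre_el (x s1 l) (x s2 m) (y s3 n) = 0) ->
  forall d, serre X Y u3 u3' v3 d + serre X Y u3' u3 v3 d = 0.
Proof.
move=> XE YE kk lk kx ky lx E d.
have S s1 s2 s3 l m n :
    serre_el (dshift (ka s1) (x s1) l) (dshift (ka s2) (x s2) m) (dshift (la s3) (y s3) n) = 0.
  have c1 s t l' : comm_el (ka t) (dshift (ka s) (x s) l') by apply: dshift_comm; auto.
  have c2 s t l' : comm_el (la t) (dshift (ka s) (x s) l').
    exact (dshift_comm (esym (lk t s)) (lx t s) l').
  (* The shifts are removed one variable at a time; the symmetry in the two doubled arguments lets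
     [serre_shift1] serve both. *)
  apply: serre_shift3 => // {}n; apply: serre_shift1 => // {}l; rewrite serre_elC.
  apply: serre_shift1 => // {}m; rewrite serre_elC; exact: E.
rewrite /serre !tri_at //.
rewrite -[LHS]/(serre_el (X (d u3)) (X (d u3')) (Y (d v3))) XE YE.
set x1 := fun s => dshift (ka s) (x s) (d u3); set x2 := fun s => dshift (ka s) (x s) (d u3').
set y1 := fun s => dshift (la s) (y s) (d v3).
have S' s1 s2 s3 : serre_el (x1 s1) (x2 s2) (y1 s3) = 0 by exact: S.
transitivity (
  serre_el (x1 Pos) (x2 Pos) (y1 Pos) - serre_el (x1 Pos) (x2 Pos) (y1 Neg)
  - serre_el (x1 Pos) (x2 Neg) (y1 Pos) + serre_el (x1 Pos) (x2 Neg) (y1 Neg)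
  - serre_el (x1 Neg) (x2 Pos) (y1 Pos) + serre_el (x1 Neg) (x2 Pos) (y1 Neg)
  + serre_el (x1 Neg) (x2 Neg) (y1 Pos) - serre_el (x1 Neg) (x2 Neg) (y1 Neg)); last first.
  by rewrite !S' !subr0 !addr0.
rewrite -/(x1 Pos) -/(x1 Neg) -/(x2 Pos) -/(x2 Neg) -/(y1 Pos) -/(y1 Neg).
move: (x1 Pos) (x1 Neg) (x2 Pos) (x2 Neg) (y1 Pos) (y1 Neg) => a a' b b' z z'.
rewrite /serre_el !mulr2n; nc_ring (@nil B).
Qed.

(** * The commutator of [X^+] and [X^-] *)

Section EF.
Variables (q : B) (e f k : polarity -> fseries B).
Hypotheses (qe : forall s m, comm_el q (e s m)) (qf : forall s m, comm_el q (f s m)).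
Hypotheses (eo : forall s, one_sided s (e s)) (fo : forall s, one_sided s (f s)).
Hypothesis ko : forall s, one_sided s (k s).

Notation dB s s' := (match s, s' with Pos, Neg => q *+ 2 | Neg, Pos => - (q *+ 2) | _, _ => 0 end).

Hypothesis ef : forall s s', Lop h (- dB s s') (Lop h (dB s s')
    (fun m n => e s m * f s' n - f s' n * e s m)) =2'
  (fun m n => h * (Lop h (- dB s s') (vmono (k s')) m n - Lop h (dB s s') (umono (k s)) m n)).

Let es s := dshift (sgn_mul (opp_pol s) q) (e s).
Let fs s := dshift (sgn_mul s q) (f s).
Let ku s := dshift (sgn_mul (opp_pol s) q) (k s).
Let kv s := dshift (sgn_mul s q) (k s).
Let tw s := - sgn_mul s (q *+ 2).
Let C s s' : dist B 2 := fun d : E2 => es s (d u2) * fs s' (d v2) - fs s' (d v2) * es s (d u2).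

Let twC s s' : comm_el (tw s) (tw s').
Proof. by case: s s' => [] []; rewrite /comm_el /tw /= ?opprK ?mulrN ?mulNr. Qed.

(** After the shifts each of the two factors depends on one sign only. Hence the term in v needs
    division by the factor of [s'] alone, and the term in u by that of [s] alone. *)
Lemma ef_shift s s' : Ld (tw s) (Ld (tw s') (C s s')) =
  fun d => h * (Ld (tw s) (kv s' \at v2) d - Ld (tw s') (ku s \at u2) d).
Proof.
pose ka := sgn_mul (opp_pol s) q; pose la := sgn_mul s' q; pose d0 : B := dB s s'.
have kl : comm_el ka la by rewrite /ka /la; case: (s) (s') => [] []; rewrite /comm_el /= ?mulrN ?mulNr.
have q2 : comm_el q (q *+ 2) by rewrite /comm_el mulr2n mulrDl mulrDr.
have sg (x : B) t : comm_el q x -> comm_el (sgn_mul t q) x.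
  by case: t; rewrite /comm_el //= mulNr mulrN => ->.
have qd : comm_el q d0.
  by rewrite /d0; case: (s) (s') => [] []; rewrite /comm_el ?mulr0 ?mul0r // ?mulrN ?mulNr q2.
have kd : comm_el ka d0 by exact: sg.
have ld : comm_el la d0 by exact: sg.
have kx m : comm_el la (e s m) by apply: sg; exact: qe.
have ky m : comm_el ka (f s' m) by apply: sg; exact: qf.
have comN (x y : B) : comm_el x y -> comm_el x (- y) by rewrite /comm_el mulrN mulNr => ->.
have comD (x y z : B) : comm_el x y -> comm_el x z -> comm_el x (y + z).
  by rewrite /comm_el mulrDr mulrDl => -> ->.
have t1 : d0 + ka - la = tw s'.
  rewrite /d0 /ka /la /tw; case: (s) (s') => [] [] /=; rewrite ?mulr2n; nc_ring (@nil B).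
have t2 : - d0 + ka - la = tw s.
  rewrite /d0 /ka /la /tw; case: (s) (s') => [] [] /=; rewrite ?mulr2n; nc_ring (@nil B).
have cLop b F : comm_el la b -> shv la (Lop h b F) = Lop h (b - la) (shv la F) by exact: shv_Lop.
have cLopu b F : comm_el ka b -> shu ka (Lop h b F) = Lop h (b + ka) (shu ka F) by exact: shu_Lop.
have L1 b F : comm_el ka b -> comm_el la b ->
    shv la (shu ka (Lop h b F)) = Lop h (b + ka - la) (shv la (shu ka F)).
  by move=> kb lb; rewrite cLopu // cLop //; apply: comD => //; exact: esym.
have E : shv la (shu ka (Lop h (- d0) (Lop h d0 (fun m n => e s m * f s' n - f s' n * e s m)))) =
    shv la (shu ka (fun m n => h * (Lop h (- d0) (vmono (k s')) m n - Lop h d0 (umono (k s)) m n))).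
  by congr (shv _ (shu _ _)); apply: funext => i; apply: funext => j; exact: ef.
have shB F G : shv la (shu ka (fun m n => F m n - G m n)) =
    fun m n => shv la (shu ka F) m n - shv la (shu ka G) m n.
  apply: funext => m; apply: funext => n.
  transitivity (dshift la (fun j => shu ka F m j - shu ka G m j) n); last by rewrite dshiftB.
  by congr (dshift la _ n); apply: funext => j; rewrite /shu dshiftB.
have shM F : shv la (shu ka (fun m n => h * F m n)) = fun m n => h * shv la (shu ka F) m n.
  apply: funext => m; apply: funext => n.
  transitivity (dshift la (fun j => h * shu ka F m j) n).
    congr (dshift la _ n); apply: funext => j; rewrite /shu dshiftMl //.
    exact (esym (hbarC ka)).
  rewrite dshiftMl //; exact (esym (hbarC la)).
move: E; rewrite !L1 //; try exact: comN.
rewrite shM (shB (fun m n => e s m * f s' n) (fun m n => f s' n * e s m)) shvu_xy // shvu_yx //.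
rewrite (shB (Lop h (- d0) (vmono (k s'))) (Lop h d0 (umono (k s)))) !L1 //; try exact: comN.
rewrite shu_vmono shv_vmono shu_umono shv_umono t1 t2 => E; apply: funext => d.
have LL b F : Ld b (fun d : E2 => F (d u2) (d v2)) = fun d : E2 => Lop h b F (d u2) (d v2).
  by apply: funext => d'; exact: Ld_curry.
rewrite (funext (vmono_at (kv s'))) (funext (umono_at (ku s))).
rewrite (LL _ (vmono (kv s'))) (LL _ (umono (ku s))).
rewrite (LL _ (fun m n => es s m * fs s' n - fs s' n * es s m)) LL.
by move: E => /(congr1 (fun F => F (d u2) (d v2))).
Qed.

(** [K] stands for a class of half-plane distributions, bounded in u or in v, on which u - v + h a
    is injective, and [t] for the direction in which the quotients are expanded. *)
Lemma ef_solve (K : dist B 2 -> Prop) t s s' :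
  (forall a (F G : dist B 2), K F -> K G -> Ld a F = Ld a G -> F = G) ->
  (forall a (F : dist B 2), K F -> K (Ld a F)) ->
  (forall F G : dist B 2, K F -> K G -> K (fun d => F d - G d)) -> (forall F : dist B 2, K F -> K (fun d => h * F d)) ->
  K (C s s') -> dsummable (inv_umv t (tw s')) (kv s' \at v2) ->
  dsummable (inv_umv t (tw s)) (ku s \at u2) ->
  K (inv_umv t (tw s') ** kv s' \at v2) -> K (inv_umv t (tw s) ** ku s \at u2) ->
  C s s' = fun d => h * ((inv_umv t (tw s') ** kv s' \at v2) d - (inv_umv t (tw s) ** ku s \at u2) d).
Proof.
move=> Kinj KL KB KM KC Sv Su Kv Ku; have KR := KM _ (KB _ _ Kv Ku).
apply: (Kinj (tw s')) => //; apply: (Kinj (tw s)); try exact: KL.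
rewrite ef_shift; have LM a (F : dist B 2) : Ld a (fun d => h * F d) = fun d => h * Ld a F d.
  by apply: funext => d; rewrite /Ld; have hC := @hbarC R B; nc_ring (h :: nil).
rewrite !LM LdB [Ld (tw s) (fun d => _ - _)]LdB.
have -> : Ld (tw s) (Ld (tw s') (inv_umv t (tw s) ** ku s \at u2)) = Ld (tw s') (ku s \at u2).
  rewrite Ld_comm; first by rewrite inv_spec.
  exact (twC s s').
by rewrite [Ld (tw s') (inv_umv t (tw s') ** _)]inv_spec.
Qed.

Let ku_half s : half_u s (ku s \at u2).
Proof. by apply: half_u_umono; exact: dshift_one. Qed.

Let C_half s s' : half_u s (C s s').
Proof.
exists 0 => d du; rewrite /C; have -> : es s (d u2) = 0; last by rewrite mul0r mulr0 subr0.
apply: (dshift_one hsep _ (@eo s)); move: du; case: (s) => /=; move: (d u2); clear; lia.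
Qed.

Lemma ef_half s s' :
  C s s' = fun d => h * ((inv_umv s (tw s') ** kv s' \at v2) d - (inv_umv s (tw s) ** ku s \at u2) d).
Proof.
apply: (@ef_solve (half_u s)).
- by move=> a F G; exact: Ld_cancel.
- by move=> a F; exact: half_u_Ld.
- by move=> F G; exact: half_uB.
- by move=> F; exact: half_uM.
- exact: C_half.
- by apply: inv_summable => //; exact: half_u_vmono.
- by apply: inv_summable => //; exact: ku_half.
- by apply: half_u_dmul => //; solve [exact: half_u_inv | exact: half_u_vmono].
- by apply: half_u_dmul => //; exact: half_u_inv.
Qed.

Let half_v_ku s : half_v (ku s \at u2).
Proof.
exists 0 => d dv; rewrite umono_at /umono (_ : (d v2 == 0) = false) //.
by move: dv; move: (d v2); clear; lia.
Qed.

Let half_v_kv : half_v (kv Pos \at v2).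
Proof.
exists 0 => d dv; rewrite vmono_at /vmono; case: ifP => // _.
exact: (dshift_one hsep _ (@ko Pos)).
Qed.

(** Two [Pos] half-currents are bounded above in v as well, which permits the expansion [Neg]. With
    this choice the terms in [kv Pos] and [ku Neg] cancel in the alternating sum over the signs,
    while [ku Pos] and [kv Neg] occur with both expansions of the same factor, that is, with a delta
    function. *)
Lemma ef_PP : C Pos Pos = fun d => h * ((inv_umv Neg (tw Pos) ** kv Pos \at v2) d
  - (inv_umv Neg (tw Pos) ** ku Pos \at u2) d).
Proof.
apply: (@ef_solve (@half_v R B) Neg Pos Pos).
- by move=> a F G; exact: Ld_cancel_v.
- by move=> a F; exact: half_v_Ld.
- by move=> F G; exact: half_vB.
- by move=> F; exact: half_vM.
- exists 0 => d dv; rewrite /C; have -> : fs Pos (d v2) = 0; last by rewrite mul0r mulr0 subr0.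
  exact: (dshift_one hsep _ (@fo Pos)).
- exact: invN_summable.
- exact: invN_summable.
- exact: half_v_invN.
- exact: half_v_invN.
Qed.

Lemma ef_cur Xp Xm d : Xp = (fun m => es Pos m - es Neg m) -> Xm = (fun m => fs Pos m - fs Neg m) ->
  (Xp \at u2 ** Xm \at v2) d - (Xm \at v2 ** Xp \at u2) d =
  h * ((ddelta (- (q *+ 2)) ** ku Pos \at u2) d - (ddelta (q *+ 2) ** kv Neg \at v2) d).
Proof.
move=> -> ->; rewrite prod_uv // prod_vu //.
transitivity (C Pos Pos d - C Pos Neg d - C Neg Pos d + C Neg Neg d).
  rewrite /C; move: (es Pos _) (es Neg _) (fs Pos _) (fs Neg _) => a a' b b'.
  nc_ring (@nil B).
have E s s' := congr1 (fun F : dist B 2 => F d) (ef_half s s').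
rewrite (congr1 (fun F : dist B 2 => F d) ef_PP) !E.
have -> : q *+ 2 = tw Neg by rewrite /tw /= opprK.
have -> : - (tw Neg) = tw Pos by rewrite /tw /= opprK.
rewrite !(ddelta_inv hsep hcomp) !dmulBl //.
- by have hC := @hbarC R B; nc_ring (h :: nil).
- by apply: inv_summable => //; exact: half_u_vmono.
- by apply: inv_summable => //; exact: half_u_vmono.
- by apply: inv_summable => //; exact: ku_half.
- by apply: invN_summable.
Qed.
End EF.
End Pieces.

(** * Transport of coefficient identities along a ring morphism *)

Section Transport.
Variables (C B : pzRingType) (v : {rmorphism C -> B}) (h : C).
Notation hB := (v h).
Implicit Types (F : int -> int -> C) (a b x : int -> C).

Definition vmap1 a : int -> B := fun m => v (a m).
Definition vmap2 F : int -> int -> B := fun m n => v (F m n).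

Lemma v_Lop (b : C) F m n : v (Lop h b F m n) = Lop hB (v b) (vmap2 F) m n.
Proof. by rewrite /Lop rmorphD rmorphB !rmorphM. Qed.

Lemma vmap2_umono a : vmap2 (umono a) = umono (vmap1 a).
Proof.
by apply: funext => m; apply: funext => n; rewrite /vmap2 /umono; case: eqP; rewrite ?rmorph0.
Qed.

Lemma vmap2_vmono a : vmap2 (vmono a) = vmono (vmap1 a).
Proof.
by apply: funext => m; apply: funext => n; rewrite /vmap2 /vmono; case: eqP; rewrite ?rmorph0.
Qed.

Lemma vmap2_uv a b : vmap2 (fun m n => a m * b n) = fun m n => vmap1 a m * vmap1 b n.
Proof. by apply: funext => m; apply: funext => n; rewrite /vmap2 rmorphM. Qed.

Lemma vmap2_vu a b : vmap2 (fun m n => b n * a m) = fun m n => vmap1 b n * vmap1 a m.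
Proof. by apply: funext => m; apply: funext => n; rewrite /vmap2 rmorphM. Qed.

Lemma vmap2_conj s a b x : vmap2 (fun m n => conj_conv s a b (x n) m) =
  fun m n => conj_conv s (vmap1 a) (vmap1 b) (vmap1 x n) m.
Proof.
apply: funext => m; apply: funext => n; rewrite /vmap2 /conj_conv; case: ifP => _; last exact: rmorph0.
by rewrite rmorph_sum; apply: eq_bigr => i _; rewrite !rmorphM.
Qed.

Lemma umonoM (y : B) (a : int -> B) m n : y * umono a m n = umono (fun m => y * a m) m n.
Proof. by rewrite /umono; case: eqP; rewrite ?mulr0. Qed.

Lemma vmonoM (y : B) (a : int -> B) m n : y * vmono a m n = vmono (fun m => y * a m) m n.
Proof. by rewrite /vmono; case: eqP; rewrite ?mulr0. Qed.

Lemma v_dpol (q : C) s s' : v (dpol q s s') = dpol (v q) s s'.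
Proof. by case: s s' => [] []; rewrite /dpol ?rmorphN ?rmorphMn ?rmorph0. Qed.

Lemma vmap1_unser s (P : fps C) : vmap1 (unser s P) = unser s (fps_map v P).
Proof. by apply: funext => m; rewrite /vmap1 /unser; case: ifP => _; rewrite ?rmorph0. Qed.

Lemma v_serre (x y z : C) : v (serre_el x y z) = serre_el (v x) (v y) (v z).
Proof. by rewrite /serre_el !(rmorphD, rmorphN, rmorphMn, rmorphM). Qed.

Lemma v_comm (x y : C) : comm_el x y -> comm_el (v x) (v y).
Proof. by rewrite /comm_el -!rmorphM => ->. Qed.
End Transport.

Section TransportedCurrents.
Variables (C B : pzRingType) (v : {rmorphism C -> B}) (h q : C) (N : nat).
Hypotheses (hC : central h) (qC : central q).
Hypothesis hsep : forall x : C, (forall n, exists y, x = h ^+ n * y) -> x = 0.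
Variables (f e : polarity -> 'I_N -> 'I_N -> int -> C).
Variables (k ki : polarity -> 'I_N -> int -> C).
Hypotheses (f_r : forall s i j, ranged s (f s i j)) (e_r : forall s i j, ranged s (e s i j)).
Hypotheses (k_r : forall s i, ranged s (k s i)) (ki_r : forall s i, ranged s (ki s i)).

Notation sf s := (fun i j => ser s (f s i j)).
Notation se s := (fun i j => ser s (e s i j)).
Notation sk s := (fun i => ser s (k s i)).
Notation ski s := (fun i => ser s (ki s i)).
Notation Tm s := (schur (sf s) (sk s) (se s) 0).

Hypothesis G : forall s, gauss_mx (sf s) (sk s) (ski s) (se s).

Notation rtt_ss s s' := (rtt (beta2 h s s' (- dpol q s s')) (beta2 h s s' (dpol q s s'))
  (eta2 h s s') (fun=> True) (fun i j => inu (Tm s i j)) (fun i j => fpsC (Tm s' i j))).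

Hypothesis rtt_same : forall s, rtt_ss s s.
Hypothesis rtt_PN : rtt_ss Pos Neg.

Notation hB := (v h).
Notation d s s' := (dpol (v q) s s').
Notation fB s i j := (vmap1 v (f s i j)).
Notation eB s i j := (vmap1 v (e s i j)).
Notation kB s i := (vmap1 v (k s i)).
Notation kiB s i := (vmap1 v (ki s i)).

Lemma map_cur_ke s s' (i j : 'I_N) m n : (i < j)%N ->
  Lop hB (d s s' + 1) (vmono (eB s' i j)) m n =
  Lop hB (d s s') (fun m n => conj_conv s (kiB s i) (kB s i) (eB s' i j n) m) m n
  + umono (fun m => hB * eB s i j m) m n.
Proof.
move=> ij; have E := cur_ke hC qC hsep e_r G rtt_same rtt_PN s s' m n ij.
transitivity (v (Lop h (dpol q s s' + 1) (vmono (e s' i j)) m n)).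
  by rewrite v_Lop vmap2_vmono (rmorphD v (dpol q s s')) rmorph1 v_dpol.
rewrite E [LHS](rmorphD v) v_Lop vmap2_conj v_dpol; congr (_ + _).
by rewrite /Hop rmorphM -umonoM -vmap2_umono.
Qed.

Lemma map_cur_kf s s' (i j : 'I_N) m n : (i < j)%N ->
  Lop hB (- d s s' + 1) (vmono (fB s' j i)) m n =
  Lop hB (- d s s') (fun m n => conj_conv s (kB s i) (kiB s i) (fB s' j i n) m) m n
  + umono (fun m => hB * fB s j i m) m n.
Proof.
move=> ij; have E := cur_kf hC qC hsep f_r G rtt_same rtt_PN s s' m n ij.
transitivity (v (Lop h (- dpol q s s' + 1) (vmono (f s' j i)) m n)).
  by rewrite v_Lop vmap2_vmono (rmorphD v (- dpol q s s')) rmorph1 rmorphN v_dpol.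
rewrite E [LHS](rmorphD v) v_Lop vmap2_conj rmorphN v_dpol; congr (_ + _).
by rewrite /Hop rmorphM -umonoM -vmap2_umono.
Qed.

Section Next.
Variables (i i1 : 'I_N).
Hypothesis iE : i1 = i.+1 :> nat.

Lemma map_cur_k1e s s' m n : Lop hB (d s s' - 1) (vmono (eB s' i i1)) m n =
  Lop hB (d s s') (fun m n => conj_conv s (kiB s i1) (kB s i1) (eB s' i i1 n) m) m n
  + umono (fun m => - hB * eB s i i1 m) m n.
Proof.
have E := cur_k1e hC qC hsep e_r G rtt_same rtt_PN s s' iE m n.
transitivity (v (Lop h (dpol q s s' - 1) (vmono (e s' i i1)) m n)).
  by rewrite v_Lop vmap2_vmono (rmorphB v (dpol q s s')) rmorph1 v_dpol.
rewrite E [LHS](rmorphB v) v_Lop vmap2_conj v_dpol; congr (_ + _).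
by rewrite /Hop rmorphM -umonoM -vmap2_umono mulNr.
Qed.

Lemma map_cur_k1f s s' m n : Lop hB (- d s s' - 1) (vmono (fB s' i1 i)) m n =
  Lop hB (- d s s') (fun m n => conj_conv s (kB s i1) (kiB s i1) (fB s' i1 i n) m) m n
  + umono (fun m => - hB * fB s i1 i m) m n.
Proof.
have E := cur_k1f hC qC hsep f_r G rtt_same rtt_PN s s' iE m n.
transitivity (v (Lop h (- dpol q s s' - 1) (vmono (f s' i1 i)) m n)).
  by rewrite v_Lop vmap2_vmono (rmorphB v (- dpol q s s')) rmorph1 rmorphN v_dpol.
rewrite E [LHS](rmorphB v) v_Lop vmap2_conj rmorphN v_dpol; congr (_ + _).
by rewrite /Hop rmorphM -umonoM -vmap2_umono mulNr.
Qed.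

Lemma map_cur_ee s s' m n :
  Lop hB (d s s' - 1) (fun m n => eB s i i1 m * eB s' i i1 n) m n =
  Lop hB (d s s' + 1) (fun m n => eB s' i i1 n * eB s i i1 m) m n
  + (umono (fun m => - hB * vmap1 v (unser s (se s i i1 * se s i i1)) m) m n
     + vmono (fun m => - hB * vmap1 v (unser s' (se s' i i1 * se s' i i1)) m) m n).
Proof.
have E := cur_ee hC qC hsep e_r G rtt_same rtt_PN s s' iE m n.
transitivity (v (Lop h (dpol q s s' - 1) (fun m n => e s i i1 m * e s' i i1 n) m n)).
  by rewrite v_Lop vmap2_uv (rmorphB v (dpol q s s')) rmorph1 v_dpol.
rewrite E [LHS](rmorphB v) v_Lop vmap2_vu (rmorphD v (dpol q s s')) rmorph1 v_dpol; congr (_ + _).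
by rewrite /Hop rmorphM rmorphD -umonoM -vmonoM -vmap2_umono -vmap2_vmono -mulrDr mulNr.
Qed.

Lemma map_cur_ff s s' m n :
  Lop hB (- d s s' + 1) (fun m n => fB s i1 i m * fB s' i1 i n) m n =
  Lop hB (- d s s' - 1) (fun m n => fB s' i1 i n * fB s i1 i m) m n
  + (umono (fun m => hB * vmap1 v (unser s (sf s i1 i * sf s i1 i)) m) m n
     + vmono (fun m => hB * vmap1 v (unser s' (sf s' i1 i * sf s' i1 i)) m) m n).
Proof.
have E := cur_ff hC qC hsep f_r G rtt_same rtt_PN s s' iE m n.
have -> : Lop hB (- d s s' - 1) (fun m n => fB s' i1 i n * fB s i1 i m) m n =
    v (Lop h (- dpol q s s' - 1) (fun m n => f s' i1 i n * f s i1 i m) m n).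
  by rewrite v_Lop vmap2_vu (rmorphB v (- dpol q s s')) rmorph1 rmorphN v_dpol.
rewrite E [in RHS](rmorphB v) [in RHS]v_Lop vmap2_uv (rmorphD v (- dpol q s s')) rmorph1 rmorphN v_dpol.
by rewrite /Hop rmorphM rmorphD -umonoM -vmonoM -vmap2_umono -vmap2_vmono -mulrDr subrK.
Qed.

Lemma map_cur_eg (i2 : 'I_N) s s' m n : (i1 < i2)%N ->
  Lop hB (d s s' + 1) (fun m n => eB s i i1 m * eB s' i1 i2 n) m n =
  Lop hB (d s s') (fun m n => eB s' i1 i2 n * eB s i i1 m) m n
  + (umono (fun m => hB * eB s i i2 m) m n
     + vmono (fun m => hB * vmap1 v (unser s' (se s' i i1 * se s' i1 i2 - se s' i i2)) m) m n).
Proof.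
move=> i12; have E := cur_eg hC qC hsep e_r G rtt_same rtt_PN s s' iE m n i12.
transitivity (v (Lop h (dpol q s s' + 1) (fun m n => e s i i1 m * e s' i1 i2 n) m n)).
  by rewrite v_Lop vmap2_uv (rmorphD v (dpol q s s')) rmorph1 v_dpol.
rewrite E [LHS](rmorphD v) v_Lop vmap2_vu v_dpol; congr (_ + _).
by rewrite /Hop rmorphM rmorphD -umonoM -vmonoM -vmap2_umono -vmap2_vmono -mulrDr.
Qed.

Lemma map_cur_fg (i2 : 'I_N) s s' m n : (i1 < i2)%N ->
  Lop hB (- d s s') (fun m n => fB s i1 i m * fB s' i2 i1 n) m n =
  Lop hB (- d s s' + 1) (fun m n => fB s' i2 i1 n * fB s i1 i m) m n
  + (umono (fun m => - hB * fB s i2 i m) m n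
     + vmono (fun m => - hB * vmap1 v (unser s' (sf s' i2 i1 * sf s' i1 i - sf s' i2 i)) m) m n).
Proof.
move=> i12; have E := cur_fg hC qC hsep f_r G rtt_same rtt_PN s s' iE m n i12.
transitivity (v (Lop h (- dpol q s s') (fun m n => f s i1 i m * f s' i2 i1 n) m n)).
  by rewrite v_Lop vmap2_uv rmorphN v_dpol.
rewrite E [LHS](rmorphB v) v_Lop vmap2_vu (rmorphD v (- dpol q s s')) rmorph1 rmorphN v_dpol; congr (_ + _).
by rewrite /Hop rmorphM rmorphD -umonoM -vmonoM -vmap2_umono -vmap2_vmono -mulrDr mulNr.
Qed.

Lemma map_cur_ef s s' m n :
  Lop hB (- d s s') (Lop hB (d s s')
    (fun m n => eB s i i1 m * fB s' i1 i n - fB s' i1 i n * eB s i i1 m)) m n =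
  hB * (Lop hB (- d s s') (vmono (vmap1 v (unser s' (sk s' i1 * ski s' i)))) m n
    - Lop hB (d s s') (umono (vmap1 v (unser s (sk s i1 * ski s i)))) m n).
Proof.
(* [cur_ef] has the quotient at u in the order k_i^-1 k_(i+1) and the one at v in the order k_(i+1)
   k_i^-1; the second order is the one wanted in both. *)
have KK : ski s i * sk s i1 = sk s i1 * ski s i.
  have ii1 : (i < i1)%N by rewrite iE.
  have kk : comm_el (sk s i1) (sk s i).
    apply: fpsP => j; rewrite fcoefM fcoefMr; apply: eq_bigr => l _.
    exact (esym (cur_kk_low hC qC hsep k_r G rtt_same rtt_PN _ _ (erefl s) ii1)).
  have kV := gauss_kV (G s) i; have Vk := gauss_Vk (G s) i.
  rewrite -[LHS]mulr1 -kV -!mulrA; rewrite [sk s i1 * (sk s i * _)]mulrA kk.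
  by rewrite -mulrA [ski s i * (sk s i * _)]mulrA Vk mul1r.
have E := cur_ef hC qC hsep f_r e_r G rtt_same rtt_PN s s' iE m n.
have vmap2L b F : vmap2 v (Lop h b F) = Lop hB (v b) (vmap2 v F).
  by apply: funext => m'; apply: funext => n'; exact: v_Lop.
transitivity (v (Lop h (- dpol q s s') (Lop h (dpol q s s')
    (fun m n => e s i i1 m * f s' i1 i n - f s' i1 i n * e s i i1 m)) m n)).
  rewrite v_Lop vmap2L rmorphN v_dpol; congr (Lop hB _ (Lop _ _ _) m n).
  by apply: funext => m'; apply: funext => n'; rewrite /vmap2 rmorphB !rmorphM.
rewrite E KK /Hop rmorphM rmorphB !v_Lop vmap2_vmono vmap2_umono rmorphN v_dpol.
by [].
Qed.
End Next.

Lemma map_cur_k_low s s' (i j : 'I_N) m n : (i < j)%N ->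
  Lop hB (- d s s') (Lop hB (d s s' + 1) (fun m n => kiB s' j n * kB s i m)) m n =
  Lop hB (d s s') (Lop hB (- d s s' + 1) (fun m n => kB s i m * kiB s' j n)) m n.
Proof.
move=> ij; have E := cur_k_low hC qC hsep k_r ki_r G rtt_same rtt_PN s s' m n ij.
have vmap2L b F : vmap2 v (Lop h b F) = Lop hB (v b) (vmap2 v F).
  by apply: funext => m'; apply: funext => n'; exact: v_Lop.
have := congr1 v E; rewrite !v_Lop !vmap2L vmap2_uv vmap2_vu.
by rewrite (rmorphD v (dpol q s s')) (rmorphD v (- dpol q s s')) rmorph1 rmorphN v_dpol.
Qed.
End TransportedCurrents.

(** * The double Yangian is separated and complete *)

Section Complete.
Variables (R : realType) (N : nat).

Lemma hbar_free : hbar (hfree R N) = fpsX _.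
Proof.
apply: fpsP => n /=; case: (n == 1)%N; [exact: (rmorph1 (malgC : {rmorphism R[i] -> _})) |].
exact: (rmorph0 (malgC : {rmorphism R[i] -> _})).
Qed.

Lemma hfree_sep : hseparated (hfree R N).
Proof.
move=> x xh; apply: fpsP => i; have [y ->] := xh i.+1.
rewrite hbar_free [RHS]/=; have H n (z : fps (free_alg R N)) : (i < n)%N -> fcoef (fpsX _ ^+ n * z) i = 0.
  elim: n i {xh} z => // n IH [|i] z ni; rewrite exprS -mulrA fcoefXM //=.
  exact: IH.
exact: H.
Qed.

Lemma hfree_comp : hcomplete (hfree R N).
Proof.
move=> y; exists (fun n => FPS (fun i => \sum_(k < i.+1) fcoef (y (n + k)%N) (i - k))) => n.
rewrite hbar_free; apply: fpsP => i; rewrite fcoefD fcoefXM /=.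
case: i => [|i]; first by rewrite big_ord1 addn0 addr0.
rewrite big_ord_recl addn0 subn0; congr (_ + _); apply: eq_bigr => k _.
by rewrite /= /bump add1n subSS addnS.
Qed.

Section Quotient.
Variables (B : halg R) (I : hideal B).
Hypothesis Ic : hclosed I.

Lemma hpi_hbar : hpi I (hbar B) = hbar (hquot_halg I). Proof. by []. Qed.

(** A class divisible by h^n has a representative in I modulo h^n; if this holds for all n,
    closedness of I puts the representative into I. *)
Lemma hquot_sep : hseparated (hquot_halg I).
Proof.
move=> x xh; rewrite -[x]hreprK -[RHS](rmorph0 (hpi I)); apply/hpiP; rewrite subr0.
apply: Ic => n; have [y yE] := xh n.
exists (hrepr x - hbar B ^+ n * hrepr y).
  apply/hpiP; rewrite hreprK yE rmorphM rmorphXn /= hreprK hpi_hbar.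
  by [].
by exists (hrepr y); rewrite subrK.
Qed.

Lemma hquot_comp : hcomplete B -> hcomplete (hquot_halg I).
Proof.
move=> Bc y; have [z zE] := Bc (fun n => hrepr (y n)).
exists (fun n => hpi I (z n)) => n.
rewrite -hpi_hbar -rmorphM -[y n in RHS]hreprK -rmorphD.
by rewrite -zE.
Qed.
End Quotient.

Lemma DY_sep : hseparated (DY R N).
Proof. by apply: hquot_sep; exact: gen_ideal_closed. Qed.

Lemma DY_comp : hcomplete (DY R N).
Proof. by apply: hquot_comp; exact: hfree_comp. Qed.
End Complete.

(** * Right multiplication by linear factors and convergence of products *)

Section RightMult.
Variables (R : realType) (B : halg R).
Notation h := (hbar B).
Hypotheses (hsep : hseparated B) (hcomp : hcomplete B).
Implicit Types (F G f g : dist B 2).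

(** Right multiplication by u - v + h a. In the free algebra the generator c does not commute with
    the others, so the R-matrix on the right of the RTT relation has to be cleared from the
    right. *)
Definition Rd (a : B) F : dist B 2 := fun d : E2 => F (d - eu) - F (d - ev) + F d * (h * a).

Lemma mul_umv (a : B) F : F ** umv a = Rd a F.
Proof.
have [e1 e2 e3] := e_neq.
apply: funext => d; rewrite /dmul (@hsum_fin _ _ hsep _ _ [:: d - eu; d - ev; d]).
- rewrite !big_cons big_nil addr0 !subKr subrr !umvE !eqxx (negPf e1) (negPf e2) (negPf e3).
  rewrite [ev == eu]eq_sym (negPf e1) ![0 == _]eq_sym (negPf e2) (negPf e3).
  by rewrite /= mulr0n mulr1n !subr0 !addr0 !mulr1 sub0r mulrN1 add0r addrA.
- rewrite /= !inE negb_or !andbT (inj_eq (addrI d)) (inj_eq oppr_inj) (negPf e1) /=.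
  have dN e : e != 0 -> (d - e == d) = false.
    by move=> e0; rewrite -subr_eq0 addrAC subrr sub0r oppr_eq0; exact/negbTE.
  by rewrite !dN.
move=> d'; rewrite !inE umvE !negb_or => /and3P[n1 n2 n3].
have n e : d' != d - e -> (d - d' == e) = false.
  by move=> /eqP d'e; apply/eqP => ee; apply: d'e; rewrite -ee subKr.
rewrite (n _ n1) (n _ n2) (_ : (d - d' == 0) = false); last first.
  by apply: n; rewrite subr0.
by rewrite subrr addr0 mulr0.
Qed.

Lemma mul_dconst (a : B) F : F ** dconst a = fun d => F d * a.
Proof.
apply: funext => d; rewrite /dmul (@hsum1 _ _ hsep _ _ d) /dconst ?subrr ?eqxx //.
by move=> d' dd; rewrite subr_eq0 eq_sym (negPf dd) mulr0.
Qed.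

Lemma dconst_mul (a : B) F : dconst a ** F = fun d => a * F d.
Proof.
apply: funext => d; rewrite /dmul (@hsum1 _ _ hsep _ _ 0) /dconst ?subr0 ?eqxx //.
by move=> d' /negPf ->; rewrite mul0r.
Qed.

Lemma Rd_mul (a : B) f g : dsummable f g -> Rd a (f ** g) = f ** Rd a g.
Proof.
move=> S; apply: funext => d; apply: esym; apply: hsumE => //.
have sh e : has_hsum (fun d' => f d' * g (d - d' - e)) ((f ** g) (d - e)).
  have := hsumP hsep hcomp (S (d - e)); congr has_hsum; apply: funext => d'.
  by rewrite addrAC.
have h0 := has_hsumMr (h * a) (hsumP hsep hcomp (S d)).
have := has_hsumD (has_hsumD (sh eu) (has_hsumN (sh ev))) h0.
by congr has_hsum; apply: funext => d'; rewrite /Rd [RHS]mulrDr mulrBr [in RHS]mulrA.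
Qed.

Lemma hsum_comm (I : eqType) (x : I -> B) c : hnull x -> (forall i, comm_el c (x i)) ->
  comm_el c (hsum x).
Proof.
move=> x0 cx; have xs := hsumP hsep hcomp x0.
apply: (has_hsum_unique hsep (has_hsumMl c xs)).
by have := has_hsumMr c xs; congr has_hsum; apply: funext => i; exact (esym (cx i)).
Qed.

(** The coefficients come from integers by products and convergent sums, and commutation passes to
    sums by their uniqueness. *)
Lemma central_ivp s n d : central (ivp B s n d).
Proof.
have nat_central (b : bool) : central (b%:R : B).
  by case: b => x; rewrite ?mulr1 ?mul1r ?mulr0 ?mul0r.
elim: n d => [|n IH] d.
  by rewrite /ivp /= dconst1E; exact: nat_central.
move=> x; apply/esym; rewrite /ivp /=; apply: hsum_comm; first exact: ivp_summable.
move=> d'; rewrite /comm_el mulrA.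
have -> : x * inv_uv B s d' = inv_uv B s d' * x.
  rewrite /inv_uv; case: ifP => _; last by rewrite mul0r mulr0.
  by case: s {IH}; rewrite ?mulrN ?mulNr nat_central.
by rewrite -mulrA -[x * _](IH (d - d')) mulrA.
Qed.

Lemma Rd_inv s (a : B) : Rd a (inv_umv s a) = @dlt _ B.
Proof.
rewrite -(Ld_inv hsep hcomp s a); apply: funext => d; rewrite /Rd /Ld; congr (_ + _).
rewrite inv_umvE //; case: ifP => _; last by rewrite mul0r mulr0.
rewrite -[LHS]mulrA (central_ivp s `|deg d| d) [LHS]mulrA [RHS]mulrA; congr (_ * _).
have c : GRing.comm (h * a) (- (h * a)) by rewrite /GRing.comm mulrN mulNr.
exact (esym (commrX _ c)).
Qed.

Lemma Rd_comm a b F : comm_el a b -> Rd a (Rd b F) = Rd b (Rd a F).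
Proof.
move=> ab; apply: funext => d; rewrite /Rd; have hC := @hbarC R B.
rewrite -!addrA ![- eu + _]addrC ![- ev - _]addrC.
have -> : d + (- eu - ev) = d + (- ev - eu) by rewrite [- eu - _]addrC.
nc_from (h :: nil) (- (h * h * F d * dif ab)).
Qed.

Definition conv_u s f : Prop := half_u s f /\ u_null f.

Definition cnd (b : bool) F : dist B 2 := fun d => if b then F d else 0.

Lemma half_uD s F G : half_u s F -> half_u s G -> half_u s (fun d => F d + G d).
Proof.
case=> M F0 [M' G0]; exists (Num.max M M') => d; rewrite gt_max => /andP[/F0 -> /G0 ->].
by rewrite addr0.
Qed.

Lemma half_u_Rd s a F : half_u s F -> half_u s (Rd a F).
Proof.
case=> M F0; exists (M + 1) => d dM; rewrite /Rd !F0 ?mul0r ?subr0 ?addr0 //;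
  move: dM; rewrite ?ffunE ?mk2u; case: s {F0} => /=; lia.
Qed.

Lemma half_u_cnd s b F : half_u s F -> half_u s (cnd b F).
Proof. by case=> M F0; exists M => d /F0; rewrite /cnd => ->; case: b. Qed.

Lemma half_u_sum s (I : Type) (r : seq I) (F : I -> dist B 2) :
  (forall i, half_u s (F i)) -> half_u s (fun d => \sum_(i <- r) F i d).
Proof.
move=> hF; elim: r => [|i r IH]; first by exists 0 => d _; rewrite big_nil.
have [M P] := half_uD (hF i) IH; exists M => d /P; by rewrite big_cons.
Qed.

Lemma u_nullD f g : u_null f -> u_null g -> u_null (fun d => f d + g d).
Proof.
move=> fn gn n x; have [K KP] := fn n x; have [K' KP'] := gn n x.
exists (K + K')%N => d du dv.
have [|y ->] := KP d du; first exact: leq_ltn_trans (leq_addr _ _) dv.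
have [|y' ->] := KP' d du; first exact: leq_ltn_trans (leq_addl _ _) dv.
by exists (y + y'); rewrite mulrDr.
Qed.

Lemma u_null0 : u_null (fun=> 0 : B).
Proof. by move=> n x; exists 0%N => d _ _; exists 0; rewrite mulr0. Qed.

Lemma u_nullMl a f : u_null f -> u_null (fun d => a * f d).
Proof.
move=> fn n x; have [K KP] := fn n x; exists K => d du dv; have [y ->] := KP d du dv.
by exists (a * y); rewrite !mulrA hbarXC.
Qed.

Lemma u_nullMr a f : u_null f -> u_null (fun d => f d * a).
Proof.
move=> fn n x; have [K KP] := fn n x; exists K => d du dv; have [y ->] := KP d du dv.
by exists (y * a); rewrite mulrA.
Qed.

Lemma u_null_Rd a f : u_null f -> u_null (Rd a f).
Proof.
move=> fn; have e : Rd a f = fun d => (Ld 0 f d) + f d * (h * a).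
  by apply: funext => d; rewrite /Rd /Ld mulr0 mul0r addr0.
by rewrite e; apply: u_nullD; [exact: u_null_Ld | exact: u_nullMr].
Qed.

Lemma u_null_cnd b f : u_null f -> u_null (cnd b f).
Proof. by case: b => // _; exact: u_null0. Qed.

Lemma u_null_sum (I : Type) (r : seq I) (F : I -> dist B 2) :
  (forall i, u_null (F i)) -> u_null (fun d => \sum_(i <- r) F i d).
Proof.
move=> hF; elim: r => [|i r IH] n x; first by exists 0%N => d _ _; exists 0; rewrite big_nil mulr0.
have [K KP] := u_nullD (hF i) IH n x; exists K => d du dv.
by rewrite big_cons; exact: KP.
Qed.

Lemma u_null_at (g : fseries B) : u_null (g \at u2).
Proof.
move=> n x; exists 0%N => d du dv; exists 0; rewrite umono_at /umono mulr0.
by case: eqP => // d0; move: dv; rewrite d0.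
Qed.

Lemma u_null_dmul s f (g : fseries B) : conv_u s f -> one_sided s g -> u_null (f ** g \at u2).
Proof.
move=> [hf nf] g0 n x; have hg := half_u_umono g0; have [M f0] := hf.
have [K KP] := u_null_unif nf n (`|M| + `|x|)%N; exists K => d du dv.
have S := u_null_summable hf nf hg d.
apply: (has_hsum_dvd (hsumP hsep hcomp S)) => d'.
have [d1|d1] := ltP M (sgp s (d' u2)); first by exists 0; rewrite f0 // mul0r mulr0.
rewrite umono_at /umono; case: eqP => [e|_]; last by exists 0; rewrite !mulr0.
have [gz|gz] := ltP 0 (sgp s ((d - d') u2)).
  exists 0; rewrite g0 ?mulr0 //; move: gz; case: (s) => /=; move: ((d - d') u2); clear; lia.
have [||y ->] := KP d'; last by exists (y * g ((d - d') u2)); rewrite mulrA.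
  move: d1 gz; rewrite !ffunE du; case: (s) => /=; move: (d' u2); clear; lia.
by move: e; rewrite !ffunE => /eqP; rewrite subr_eq0 => /eqP <-.
Qed.

Lemma conv_u_dmul s f (g : fseries B) : conv_u s f -> one_sided s g -> conv_u s (f ** g \at u2).
Proof.
move=> cf g0; split; last exact: u_null_dmul cf g0.
by apply: half_u_dmul => //; [case: cf | exact: half_u_umono].
Qed.

Lemma dmulDr f F G d : dsummable f F -> dsummable f G ->
  (f ** (fun d => F d + G d)) d = (f ** F) d + (f ** G) d.
Proof.
move=> FH GH; apply: hsumE => //.
have := has_hsumD (hsumP hsep hcomp (FH d)) (hsumP hsep hcomp (GH d)).
by congr has_hsum; apply: funext => d'; rewrite mulrDr.
Qed.

Lemma dmulDl F G f d : dsummable F f -> dsummable G f ->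
  ((fun d => F d + G d) ** f) d = (F ** f) d + (G ** f) d.
Proof.
move=> FH GH; apply: hsumE => //.
have := has_hsumD (hsumP hsep hcomp (FH d)) (hsumP hsep hcomp (GH d)).
by congr has_hsum; apply: funext => d'; rewrite mulrDl.
Qed.

Lemma dmul_cndr f b F : f ** cnd b F = cnd b (f ** F).
Proof.
by case: b => //; apply: funext => d; apply: hsum0 => // d'; rewrite /cnd mulr0.
Qed.

Lemma dmul_cndl f b F : cnd b F ** f = cnd b (F ** f).
Proof.
by case: b => //; apply: funext => d; apply: hsum0 => // d'; rewrite /cnd mul0r.
Qed.

Lemma Rd_cnd a b F : Rd a (cnd b F) = cnd b (Rd a F).
Proof. by case: b => //; apply: funext => d; rewrite /Rd /cnd mul0r subrr addr0. Qed.

Lemma Ld_sum a (I : Type) (r : seq I) (F : I -> dist B 2) :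
  Ld a (fun d => \sum_(i <- r) F i d) = fun d => \sum_(i <- r) Ld a (F i) d.
Proof. by apply: funext => d; rewrite /Ld mulr_sumr -sumrB -big_split. Qed.

Lemma Rd_sum a (I : Type) (r : seq I) (F : I -> dist B 2) :
  Rd a (fun d => \sum_(i <- r) F i d) = fun d => \sum_(i <- r) Rd a (F i) d.
Proof. by apply: funext => d; rewrite /Rd mulr_suml -sumrB -big_split. Qed.

Lemma RdD a F G : Rd a (fun d => F d + G d) = fun d => Rd a F d + Rd a G d.
Proof. by apply: funext => d; rewrite /Rd mulrDl; nc_ring (@nil B). Qed.

Lemma RdMr a F : Rd a (fun d => F d * h) = fun d => Rd a F d * h.
Proof. by apply: funext => d; rewrite /Rd; have hC := @hbarC R B; nc_ring (h :: nil). Qed.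

Lemma half_u_umv s (a : B) : half_u s (umv a).
Proof.
exists 1 => d du; have dn (e : E2) : e u2 = 0 \/ e u2 = 1 -> (d == e) = false.
  by move=> e01; apply/eqP => de; move: du; rewrite de; case: e01 => ->; case: (s).
rewrite umvE !dn ?subrr ?addr0 ?mk2u ?ffunE //; by [left | right].
Qed.

Lemma half_u_dconst s (a : B) : half_u s (dconst a).
Proof.
exists 0 => d du; rewrite /dconst (_ : (d == 0) = false) //.
by apply/eqP => d0; move: du; rewrite d0 ffunE; case: s.
Qed.
End RightMult.

(** * The RTT relation with cleared denominators *)

Section RTT.
Variables (R : realType) (B : halg R) (N : nat).
Notation h := (hbar B).
Hypotheses (hsep : hseparated B) (hcomp : hcomplete B).
Variables (t : 'I_N -> 'I_N -> int -> B) (s s' : polarity).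
Notation T := (Tser t s).
Notation T' := (Tser t s').
Implicit Types x y z w : 'I_N * 'I_N.

Lemma Tser_one s0 i j : one_sided s0 (Tser t s0 i j).
Proof.
case: s0 => m /= m0; rewrite /Tser (_ : (m == 0) = false) ?add0r.
- by rewrite ltNge ltW.
- by move: m0; clear; lia.
- by rewrite leNgt m0.
by move: m0; clear; lia.
Qed.

Definition swp x := (x.2, x.1).

(** The numerator of R(u - v + h a); the denominator is u - v + h (a + 1). *)
Definition Kmat (a : B) x y : dist B 2 := fun d =>
  cnd (x == y) (umv a) d + cnd ((x.1 == y.2) && (x.2 == y.1)) (dconst h) d.

Lemma half_u_K (a : B) x y : half_u s (Kmat a x y).
Proof.
by apply: half_uD; apply: half_u_cnd; [exact: half_u_umv | exact: half_u_dconst].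
Qed.

Lemma RmatE (a : B) x y : Rmat s a x y = fun d => cnd (x == y) (Rd a (inv_umv s (a + 1))) d +
  cnd ((x.1 == y.2) && (x.2 == y.1)) (fun d => inv_umv s (a + 1) d * h) d.
Proof.
apply: funext => d; rewrite -[Rmat _ _ _ _ _]/((inv_umv s (a + 1) ** Kmat a x y) d).
rewrite dmulDr //; last first.
- by apply: inv_summable => //; apply: half_u_cnd; exact: half_u_dconst.
- by apply: inv_summable => //; apply: half_u_cnd; exact: half_u_umv.
by rewrite !dmul_cndr // mul_umv // mul_dconst.
Qed.

Lemma Ld_Rmat (a : B) x y : Ld (a + 1) (Rmat s a x y) = Kmat a x y.
Proof. by apply: inv_spec => //; apply: inv_summable => //; exact: half_u_K. Qed.

Lemma Rd_Rmat (b : B) x y : Rd (b + 1) (Rmat s b x y) = Kmat b x y.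
Proof.
rewrite RmatE RdD !Rd_cnd RdMr Rd_comm ?Rd_inv //; last by rewrite /comm_el mulrDl mulrDr mul1r mulr1.
rewrite -mul_umv // dlt_mul //; apply: funext => d; congr (_ + cnd _ _ d); apply: funext => d'.
by rewrite /dlt /dconst; case: eqP => _; rewrite ?mul1r ?mul0r.
Qed.

Lemma conv_u_Rmat (a : B) x y : conv_u s (Rmat s a x y).
Proof.
rewrite RmatE; have hi := half_u_inv hsep s (a + 1); have ni := u_null_inv hsep s (a + 1).
split.
  apply: half_uD; apply: half_u_cnd; first exact: half_u_Rd.
  by case: hi => M H; exists M => d /H ->; rewrite mul0r.
by apply: u_nullD; apply: u_null_cnd; [exact: u_null_Rd | exact: u_nullMr].
Qed.

Lemma T1E x y : T1 t s x y = cnd (x.2 == y.2) (T x.1 y.1 \at u2). Proof. by []. Qed.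
Lemma T2E x y : T2 t s' x y = cnd (x.1 == y.1) (T' x.2 y.2 \at v2). Proof. by []. Qed.

Lemma half_u_T1 x y : half_u s (T1 t s x y).
Proof. by apply: half_u_cnd; apply: half_u_umono; exact: Tser_one. Qed.

Lemma u_null_T1 x y : u_null (T1 t s x y).
Proof. by apply: u_null_cnd; exact: u_null_at. Qed.

Lemma half_u_T2 x y : half_u s (T2 t s' x y).
Proof. by apply: half_u_cnd; exact: half_u_vmono. Qed.

Lemma sum_T12 x y (d : E2) : \sum_z (T1 t s x z ** T2 t s' z y) d =
  T x.1 y.1 (d u2) * T' x.2 y.2 (d v2).
Proof.
rewrite (bigD1 (y.1, x.2)) //= T1E T2E !dmul_cndl // !dmul_cndr // /cnd !eqxx /= prod_uv //.
rewrite big1 ?addr0 // => -[z1 z2]; rewrite xpair_eqE T1E T2E !dmul_cndl // !dmul_cndr // /cnd /=.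
by case: (eqVneq x.2 z2) => [<-|_]; case: (eqVneq z1 y.1) => [e|_]; rewrite ?eqxx ?andbF ?if_same.
Qed.

Lemma sum_T21 x y (d : E2) : \sum_z (T2 t s' x z ** T1 t s z y) d =
  T' x.2 y.2 (d v2) * T x.1 y.1 (d u2).
Proof.
rewrite (bigD1 (x.1, y.2)) //= T1E T2E !dmul_cndl // !dmul_cndr // /cnd !eqxx /= prod_vu //.
rewrite big1 ?addr0 // => -[z1 z2]; rewrite xpair_eqE T1E T2E !dmul_cndl // !dmul_cndr // /cnd /=.
by case: (eqVneq x.1 z1) => [<-|_]; case: (eqVneq z2 y.2) => [e|_]; rewrite ?eqxx ?andbF ?if_same.
Qed.

Lemma sum_K x (F G : 'I_N * 'I_N -> dist B 2) (d : E2) :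
  \sum_w (cnd (x == w) (F w) d + cnd ((x.1 == w.2) && (x.2 == w.1)) (G w) d) =
  F x d + G (swp x) d.
Proof.
rewrite big_split /=; congr (_ + _).
  rewrite (bigD1 x) //= /cnd eqxx big1 ?addr0 // => w.
  by rewrite eq_sym => /negPf ->.
rewrite (bigD1 (swp x)) //= /cnd !eqxx big1 ?addr0 // => w.
case: w => w1 w2; rewrite xpair_eqE /= => wx; case: ifP => // /andP[/eqP e1 /eqP e2].
by rewrite e1 e2 !eqxx in wx.
Qed.

Lemma u_null_umv (a : B) : u_null (umv a).
Proof.
move=> n x; exists 1%N => d du dv; exists 0; rewrite mulr0.
have dn (e : E2) : e v2 = 0 \/ e v2 = 1 -> (d == e) = false.
  by move=> e01; apply/eqP => de; move: dv; rewrite de; case: e01 => ->.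
rewrite umvE !dn ?subrr ?addr0 ?mk2v ?ffunE //; by [left | right].
Qed.

Lemma u_null_dconst (a : B) : u_null (@dconst _ B _ a).
Proof.
move=> n x; exists 0%N => d du dv; exists 0; rewrite mulr0 /dconst.
by case: ifP => // /eqP d0; move: dv; rewrite d0 ffunE.
Qed.

Lemma dmulMl a (f g : dist B 2) d : dsummable f g -> ((fun d => a * f d) ** g) d = a * (f ** g) d.
Proof.
move=> S; apply: hsumE => //; have := has_hsumMl a (hsumP hsep hcomp (S d)).
by congr has_hsum; apply: funext => d'; rewrite mulrA.
Qed.

Lemma conv_u_RT (a : B) x w z : conv_u s (Rmat s a x w ** T1 t s w z).
Proof.
rewrite T1E dmul_cndr //.
have [c1 c2] := conv_u_dmul hsep hcomp (conv_u_Rmat a x w) (@Tser_one s w.1 z.1).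
by split; [exact: half_u_cnd | exact: u_null_cnd].
Qed.

(** The denominator passes through the two products by [Ld_mul] and turns R into its numerator. The
    sums over intermediate indices then keep one term from the identity and one from the
    permutation, which exchanges the two row indices. *)
Lemma RTT_lhs_L (a : B) x y : Ld (a + 1) (RTT_lhs t s s' a x y) = fun d : E2 =>
  Ld a (fun d : E2 => T x.1 y.1 (d u2) * T' x.2 y.2 (d v2)) d
  + h * (T x.2 y.1 (d u2) * T' x.1 y.2 (d v2)).
Proof.
pose G z : dist B 2 := fun d => \sum_w (Rmat s a x w ** T1 t s w z) d.
have cG z : conv_u s (G z).
  split; [apply: half_u_sum | apply: u_null_sum] => w;
    by have [] := conv_u_RT a x w z.
have LG z : Ld (a + 1) (G z) = fun d => Ld a (T1 t s x z) d + h * T1 t s (swp x) z d.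
  rewrite /G Ld_sum; apply: funext => d.
  rewrite -(sum_K x (fun w => Ld a (T1 t s w z)) (fun w d => h * T1 t s w z d)).
  apply: eq_bigr => w _; have [c1 c2] := conv_u_Rmat a x w.
  rewrite Ld_mul //; last by apply: (u_null_summable c1 c2); exact: half_u_T1.
  rewrite Ld_Rmat dmulDl //.
  - by rewrite !dmul_cndl // umv_mul // dconst_mul.
  - exact (u_null_summable (half_u_cnd _ (half_u_umv s a)) (u_null_cnd _ (u_null_umv a)) (half_u_T1 w z)).
  exact (u_null_summable (half_u_cnd _ (half_u_dconst s h)) (u_null_cnd _ (u_null_dconst h)) (half_u_T1 w z)).
have TT z z' : dsummable (T1 t s z' z) (T2 t s' z y).
  exact: u_null_summable (half_u_T1 z' z) (u_null_T1 z' z) (half_u_T2 z y).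
rewrite Ld_sum; apply: funext => d.
transitivity (\sum_z (Ld a (T1 t s x z ** T2 t s' z y) d + h * (T1 t s (swp x) z ** T2 t s' z y) d)).
  apply: eq_bigr => z _; have [c1 c2] := cG z.
  rewrite -[endVV_mul _ _ _ _]/(G z) Ld_mul //; last exact: u_null_summable c1 c2 (half_u_T2 z y).
  rewrite LG dmulDl //.
  - by rewrite dmulMl // -Ld_mul.
  - exact (u_null_summable (half_u_Ld a (half_u_T1 x z)) (u_null_Ld a (u_null_T1 x z)) (half_u_T2 z y)).
  exact (u_null_summable (half_uM h (half_u_T1 (swp x) z)) (u_nullMl h (u_null_T1 (swp x) z)) (half_u_T2 z y)).
rewrite big_split /= -mulr_sumr sum_T12; congr (_ + _).
rewrite -[LHS](congr1 (fun F : dist B 2 => F d) (Ld_sum a _ (fun z => T1 t s x z ** T2 t s' z y))).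
by congr (Ld a _ d); apply: funext => d'; exact: sum_T12.
Qed.

Lemma RTT_rhs_R (b : B) x y : Rd (b + 1) (RTT_rhs t s s' b x y) = fun d : E2 =>
  Rd b (fun d : E2 => T' x.2 y.2 (d v2) * T x.1 y.1 (d u2)) d
  + T' x.2 y.1 (d v2) * T x.1 y.2 (d u2) * h.
Proof.
pose G z : dist B 2 := fun d => T' x.2 z.2 (d v2) * T x.1 z.1 (d u2).
have GE z : endVV_mul (T2 t s') (T1 t s) x z = G z by apply: funext => d; exact: sum_T21.
have hG z : half_u s (G z).
  exists 0 => d du; rewrite /G (@Tser_one s) ?mulr0 //.
  by move: du; case: (s) => /=; move: (d u2); clear; lia.
rewrite Rd_sum; apply: funext => d.
have yE z : ((z.1 == y.2) && (z.2 == y.1)) = ((y.1 == z.2) && (y.2 == z.1)).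
  by rewrite andbC ![_ == y.1]eq_sym ![_ == y.2]eq_sym.
transitivity (\sum_z (cnd (y == z) (Rd b (G z)) d
    + cnd ((y.1 == z.2) && (y.2 == z.1)) (fun d => G z d * h) d)).
  apply: eq_bigr => z _; rewrite GE; have [c1 c2] := conv_u_Rmat b z y.
  rewrite Rd_mul //; last exact: u_null_summabler c1 c2 (hG z).
  rewrite Rd_Rmat dmulDr //.
  - by rewrite !dmul_cndr // mul_umv // mul_dconst // yE [z == y]eq_sym.
  - exact (u_null_summabler (half_u_cnd _ (half_u_umv s b)) (u_null_cnd _ (u_null_umv b)) (hG z)).
  exact (u_null_summabler (half_u_cnd _ (half_u_dconst s h)) (u_null_cnd _ (u_null_dconst h)) (hG z)).
by rewrite sum_K.
Qed.
End RTT.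

(** * Gauss decompositions that are trivial modulo hbar *)

Section GaussModH.
Variables (S : pzRingType) (h g : S) (n : nat).
Hypothesis hC : central h.
Hypothesis geom : forall y, exists z, (1 + h * y) * z = 1 /\ z * (1 + h * y) = 1.
Variables (f e : 'I_n -> 'I_n -> S) (k : 'I_n -> S).
Hypotheses (f1 : forall i, f i i = 1) (e1 : forall i, e i i = 1).
Hypotheses (f0 : forall i j : 'I_n, (i < j)%N -> f i j = 0).
Hypotheses (e0 : forall i j : 'I_n, (j < i)%N -> e i j = 0).
Notation M i j := (\sum_l f i l * k l * e l j).
Hypothesis Mg : forall i j, comm_el g (M i j).
Hypothesis M1 : forall i j, exists y, M i j - (i == j)%:R = h * y.

Definition dvh (x : S) := exists y, x = h * y.

Lemma dvhD x y : dvh x -> dvh y -> dvh (x + y).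
Proof. by case=> a -> [b ->]; exists (a + b); rewrite mulrDr. Qed.

Lemma dvhN x : dvh x -> dvh (- x).
Proof. by case=> a ->; exists (- a); rewrite mulrN. Qed.

Lemma dvhMl a x : dvh x -> dvh (a * x).
Proof. by case=> y ->; exists (a * y); rewrite mulrA -hC mulrA. Qed.

Lemma dvhMr a x : dvh x -> dvh (x * a).
Proof. by case=> y ->; exists (y * a); rewrite mulrA. Qed.

Lemma dvh_sum (P : pred 'I_n) (F : 'I_n -> S) :
  (forall i, P i -> dvh (F i)) -> dvh (\sum_(i | P i) F i).
Proof.
move=> H; elim/big_rec: _ => [|i x Pi]; first by exists 0; rewrite mulr0.
by apply: dvhD; exact: H.
Qed.

Lemma comm_elD x y z : comm_el x y -> comm_el x z -> comm_el x (y + z :> S).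
Proof. by rewrite /comm_el mulrDr mulrDl => -> ->. Qed.

Lemma comm_elN x y : comm_el x y -> comm_el x (- y :> S).
Proof. by rewrite /comm_el mulrN mulNr => ->. Qed.

Lemma comm_elM x y z : comm_el x y -> comm_el x z -> comm_el x (y * z :> S).
Proof. by rewrite /comm_el mulrA => ->; rewrite -mulrA => ->; rewrite mulrA. Qed.

Lemma comm_el0 x : comm_el x (0 : S). Proof. by rewrite /comm_el mulr0 mul0r. Qed.
Lemma comm_el1 x : comm_el x (1 : S). Proof. by rewrite /comm_el mulr1 mul1r. Qed.

Lemma comm_el_sum x (P : pred 'I_n) (F : 'I_n -> S) :
  (forall i, P i -> comm_el x (F i)) -> comm_el x (\sum_(i | P i) F i).
Proof.
move=> H; elim/big_rec: _ => [|i y Pi]; first exact: comm_el0.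
by apply: comm_elD; exact: H.
Qed.

Lemma comm_el_inv x y z : y * z = 1 -> z * y = 1 -> comm_el x y -> comm_el x (z : S).
Proof.
move=> yz zy xy; rewrite /comm_el -[LHS]mul1r -zy -mulrA [y * _]mulrA -xy.
by rewrite -!mulrA yz mulr1.
Qed.

Record gauss_good (l : 'I_n) : Prop := GaussGood {
  good_k : comm_el g (k l); good_k1 : dvh (k l - 1);
  good_f : forall j, comm_el g (f j l); good_f1 : forall j, j != l -> dvh (f j l);
  good_e : forall j, comm_el g (e l j); good_e1 : forall j, j != l -> dvh (e l j);
  good_inv : exists z, k l * z = 1 /\ z * k l = 1 }.

(** [is_gauss] does not postulate that [k] is invertible. By induction on the pivot, the Schur
    complement inherits from M that it commutes with [g] and is 1 modulo [h] where needed; so the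
    pivot is 1 + h y, invertible by [geom], and [e] and [f] are recovered by dividing its row and
    column by it. *)
Lemma gauss_goodP l : gauss_good l.
Proof.
move: {2}(l : nat) (erefl (l : nat)) => m; elim/ltn_ind: m l => m IH o om.
have {}IH (l : 'I_n) : (l < o)%N -> gauss_good l by move=> lo; apply: (IH l) => //; rewrite -om.
(* The Schur complement after the pivots before [o]; by triangularity only l = o contributes to its
   row and column of index [o]. *)
pose A i j := M i j - \sum_(l : 'I_n | (l < o)%N) f i l * k l * e l j.
have AE i j : (i == o) || (j == o) -> A i j = f i o * k o * e o j.
  move=> ij; rewrite /A (bigID (fun l : 'I_n => (l < o)%N)) /= [LHS]addrAC subrr add0r.
  rewrite (bigD1 o) ?ltnn //= big1 ?addr0 // => l /andP[lo lo'].
  have ol : (o < l)%N by rewrite ltn_neqAle leqNgt lo eq_sym andbT.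
  by case/orP: ij => /eqP ->; [rewrite f0 // !mul0r | rewrite e0 // mulr0].
have Ag i j : comm_el g (A i j).
  apply: comm_elD => //; apply: comm_elN; apply: comm_el_sum => l /IH [kg _ fg _ eg _ _].
  by apply: comm_elM => //; exact: comm_elM.
have A1 i j : (i == o) || (j == o) -> dvh (A i j - (i == j)%:R).
  move=> ij; rewrite /A addrAC; apply: dvhD; first exact: M1.
  apply: dvhN; apply: dvh_sum => l lo; have [_ _ _ fh _ eh _] := IH l lo.
  have ol : o != l by apply/eqP => ol; rewrite ol ltnn in lo.
  case/orP: ij => /eqP ->; first by do 2!apply: dvhMr; exact: fh.
  by apply: dvhMl; exact: eh.
have Ao : A o o = k o by rewrite AE ?eqxx // f1 e1 mul1r mulr1.
have ko1 : dvh (k o - 1) by have := A1 o o; rewrite Ao eqxx; apply.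
have [z [kz zk]] : exists z, k o * z = 1 /\ z * k o = 1.
  have [y yE] := ko1; have [z zE] := geom y.
  by exists z; rewrite -[k o](subrK 1) yE addrC.
have kg : comm_el g (k o) by rewrite -Ao.
have zg := comm_el_inv kz zk kg.
have eE j : e o j = z * A o j by rewrite AE ?eqxx // f1 mul1r mulrA zk mul1r.
have fE j : f j o = A j o * z by rewrite AE ?eqxx ?orbT // e1 mulr1 -mulrA kz mulr1.
split=> //; last by exists z.
- by move=> j; rewrite fE; apply: comm_elM.
- move=> j jo; rewrite fE; apply: dvhMr.
  by have := A1 j o; rewrite eqxx orbT (negPf jo) subr0; apply.
- by move=> j; rewrite eE; apply: comm_elM.
move=> j jo; rewrite eE; apply: dvhMl.
by have := A1 o j; rewrite eqxx [o == j]eq_sym (negPf jo) subr0; apply.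
Qed.
End GaussModH.

Section Geom.
Variables (R : realType) (B : halg R).
Notation h := (hbar B).
Hypotheses (hsep : hseparated B) (hcomp : hcomplete B).

(** Completeness, applied to each coefficient, yields the tails z n of the series of (- h y)^n.
    Separatedness gives z 1 = - y z 0 = - z 0 y, and substituting into z 0 = 1 + h z 1 shows that z
    0 is inverse on both sides. *)
Lemma fps_geom (y : fps B) : exists z, (1 + fpsC h * y) * z = 1 /\ z * (1 + fpsC h * y) = 1.
Proof.
have hC : central (fpsC h) := fpsC_central (@hbarC R B).
have sep (D : nat -> fps B) : (forall n, D n = fpsC h * D n.+1) -> D 0%N = 0.
  move=> DS; apply: fpsP => i; apply: (chain_eq0 hsep (D := fun n => fcoef (D n) i)) => n.
  by rewrite {1}DS fcoefCM.
have [z zE] : exists z : nat -> fps B, forall n, z n = (- y) ^+ n + fpsC h * z n.+1.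
  have /boolp.choice[z zE] := fun i => hcomp (fun n => fcoef ((- y) ^+ n) i).
  exists (fun n => FPS (fun i => z i n)) => n; apply: fpsP => i.
  by rewrite fcoefD fcoefCM /= zE.
have e1 : z 1%N = - y * z 0%N.
  apply/eqP; rewrite -subr_eq0; apply/eqP; apply: (sep (fun n => z n.+1 - - y * z n)) => n.
  have a := zE n; have b := zE n.+1; rewrite exprS in b.
  nc_from (fpsC h :: nil) (dif b + y * dif a).
have e2 : z 1%N = z 0%N * - y.
  apply/eqP; rewrite -subr_eq0; apply/eqP; apply: (sep (fun n => z n.+1 - z n * - y)) => n.
  have a := zE n; have b := zE n.+1; rewrite exprSr in b.
  nc_from (fpsC h :: nil) (dif b + dif a * y).
have z0 := zE 0%N; rewrite expr0 in z0.
by exists (z 0%N); split; [rewrite e1 in z0 | rewrite e2 in z0];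
  nc_from (fpsC h :: nil) (dif z0).
Qed.
End Geom.

(** * The centralizer of an element *)

Section Centralizer.
Variables (B : pzRingType) (c : B).

Definition centp : {pred B} := fun x => `[< comm_el c x >].

Lemma centp_subring : subring_closed centp.
Proof.
split=> [|x y /asboolP cx /asboolP cy|x y /asboolP cx /asboolP cy]; apply/asboolP.
- exact: comm_el1.
- by apply: comm_elD => //; exact: comm_elN.
exact: comm_elM.
Qed.

HB.instance Definition _ := GRing.isSubringClosed.Build B centp centp_subring.

Record cent := Cent { cent_val : B; _ : cent_val \in centp }.
HB.instance Definition _ := [isSub for cent_val].
HB.instance Definition _ := [Choice of cent by <:].
HB.instance Definition _ := GRing.SubChoice_isSubPzRing.Build B centp cent centp_subring.

End Centralizer.

(** * The RTT relations of the double Yangian on coefficients *)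

Lemma rtt_ser (C : pzRingType) (h d : C) N (T T' : 'I_N -> 'I_N -> int -> C) s s' :
  central h -> central d ->
  (forall i j, ranged s (T i j)) -> (forall i j, ranged s' (T' i j)) ->
  (forall i j k l m n,
    Lop h (d + 1) (fun m n => Lop h (- d) (fun m n => T i j m * T' k l n) m n
      + Hop h (fun m n => T k j m * T' i l n) m n) m n =
    Lop h (- d + 1) (fun m n => Lop h d (fun m n => T' k l n * T i j m) m n
      + Hop h (fun m n => T' k j n * T i l m) m n) m n) ->
  rtt (beta2 h s s' (- d)) (beta2 h s s' d) (eta2 h s s') (fun=> True)
    (fun i j => inu (ser s (T i j))) (fun i j => fpsC (ser s' (T' i j))).
Proof.
move=> hC dC r r' E i j k l _ _ _ _.
have dNC := centralN dC; have d1C := centralD dC (@central1 C).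
have dN1C := centralD dNC (@central1 C).
have P z x y : z * inu (ser s x) * fpsC (ser s' y) = z * pack s s' 0 (fun m n => x m * y n).
  by rewrite -mulrA -pack_uv.
have Q z x y : z * fpsC (ser s' y) * inu (ser s x) = z * pack s s' 0 (fun m n => y n * x m).
  by rewrite -mulrA -pack_vu.
rewrite !beta2_eta !P !Q.
have o1 := orth_uv (r i j) (r' k l); have o2 := orth_uv (r k j) (r' i l).
have o3 := orth_vu (r i j) (r' k l); have o4 := orth_vu (r i l) (r' k j).
rewrite !pack_beta // !pack_eta // !packD.
rewrite !pack_beta //; try by apply: orthD; [exact: orth_L | exact: orth_H].
congr pack; apply: funext => m; apply: funext => n; exact: E.
Qed.

Lemma Rd_LdC (R : realType) (B' : halg R) (a b : B') (F : dist B' 2) : Rd b (Ld a F) = Ld a (Rd b F).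
Proof.
apply: funext => d; rewrite /Rd /Ld; have hC := @hbarC _ B'.
rewrite -!addrA ![- eu + _]addrC ![- ev - _]addrC.
have -> : d + (- eu - ev) = d + (- ev - eu) by rewrite [- eu - _]addrC.
nc_ring (hbar B' :: nil).
Qed.

Lemma Rd_Ld (R : realType) (B' : halg R) (b : B') (F : dist B' 2) :
  (forall d, comm_el b (F d)) -> Rd b F = Ld b F.
Proof.
by move=> bF; apply: funext => d; rewrite /Rd /Ld mulrA -hbarC -!mulrA bF.
Qed.

Section QuotientMap.
Variables (R : realType) (B : halg R) (I : hideal B).
Notation Q := (hquot_halg I).
Notation pi x := (hpi I x : Q).

Lemma piD x y : pi (x + y) = pi x + pi y. Proof. exact: (rmorphD (hpi I)). Qed.
Lemma piN x : pi (- x) = - pi x. Proof. exact: (rmorphN (hpi I)). Qed.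
Lemma piB x y : pi (x - y) = pi x - pi y. Proof. exact: (rmorphB (hpi I)). Qed.
Lemma piM x y : pi (x * y) = pi x * pi y. Proof. exact: (rmorphM (hpi I)). Qed.
Lemma pi0 : pi 0 = 0. Proof. exact: (rmorph0 (hpi I)). Qed.
Lemma pi1 : pi 1 = 1. Proof. exact: (rmorph1 (hpi I)). Qed.

Lemma pi_Ld a (F : dist B 2) d : pi (Ld a F d) = Ld (pi a) (fun d => pi (F d)) d.
Proof. by rewrite /Ld piD piB !piM. Qed.

Lemma pi_Rd a (F : dist B 2) d : pi (Rd a F d) = Rd (pi a) (fun d => pi (F d)) d.
Proof. by rewrite /Rd piD piB !piM. Qed.

Lemma pi_Tser N (t : 'I_N -> 'I_N -> int -> B) s i j m :
  pi (Tser t s i j m) = Tser (fun i j k => pi (t i j k)) s i j m.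
Proof.
rewrite /Tser piD; congr (_ + _).
  by case: (m == 0); rewrite ?pi0 //; case: (i == j); [exact: pi1 | exact: pi0].
by case: s; case: ifP => _; rewrite ?pi0 // ?piN piM.
Qed.

Lemma ideal_zero x : I x -> pi x = 0.
Proof. by move=> Ix; rewrite -pi0; apply/hpiP; rewrite subr0. Qed.

Variables (N : nat) (t : 'I_N -> 'I_N -> int -> B).
Notation T := (Tser (fun i j k => pi (t i j k))).
Notation h := (hbar Q).

Lemma quot_comm (c : B) s i j m : I (Tser t s i j m * c - c * Tser t s i j m) ->
  comm_el (pi c) (T s i j m).
Proof.
move=> /ideal_zero; rewrite piB !piM pi_Tser => /eqP.
by rewrite subr_eq0 => /eqP.
Qed.

Hypotheses (hsep : hseparated B) (hcomp : hcomplete B).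

(** Denominators are cleared before the projection, which is not assumed to respect infinite sums.
    Clearing one on the left and one on the right replaces the relators by finite combinations of
    them, which still vanish in the quotient; there [b] commutes with T, and right multiplication
    becomes left multiplication. *)
Lemma quot_pair s s' (a b : B) :
  (forall x y d, I (RTT_lhs t s s' a x y d - RTT_rhs t s s' b x y d)) ->
  comm_el (pi b) (pi a) -> (forall s i j m, comm_el (pi b) (T s i j m)) ->
  forall i j k l m n,
    Lop h (pi b + 1) (fun m n => Lop h (pi a) (fun m n => T s i j m * T s' k l n) m n
      + Hop h (fun m n => T s k j m * T s' i l n) m n) m n =
    Lop h (pi a + 1) (fun m n => Lop h (pi b) (fun m n => T s' k l n * T s i j m) m n
      + Hop h (fun m n => T s' k j n * T s i l m) m n) m n.
Proof.
move=> rel ba bT i j k l m n.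
have L := RTT_lhs_L hsep hcomp t s s' a (i, k) (j, l).
have Rr := RTT_rhs_R hsep hcomp t s s' b (i, k) (j, l).
have bb : comm_el (pi b) (h) by exact (esym (hbarC (pi b))).
pose X := fun d => RTT_lhs t s s' a (i, k) (j, l) d - RTT_rhs t s s' b (i, k) (j, l) d.
have X0 : (fun d => pi (X d)) = fun=> 0 by apply: funext => d; apply: ideal_zero; exact: rel.
have Z : Rd (pi b + 1) (Ld (pi a + 1) (fun=> 0 : Q)) = fun=> 0.
  by apply: funext => d; rewrite /Rd /Ld !(mulr0, mul0r, subrr, addr0).
have E d : pi (Rd (b + 1) (Ld (a + 1) X) d) = 0.
  rewrite pi_Rd piD pi1.
  have -> : (fun d => pi (Ld (a + 1) X d)) = Ld (pi a + 1) (fun=> 0).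
    by apply: funext => d'; rewrite pi_Ld piD pi1 X0.
  by rewrite Z.
have XE : Rd (b + 1) (Ld (a + 1) X) = fun d =>
    Rd (b + 1) (Ld (a + 1) (RTT_lhs t s s' a (i, k) (j, l))) d
    - Ld (a + 1) (Rd (b + 1) (RTT_rhs t s s' b (i, k) (j, l))) d.
  rewrite -Rd_LdC /X LdB; apply: funext => d; rewrite /Rd mulrBl.
  nc_ring (@nil B).
have := E (mk2 m n); rewrite XE L Rr piB pi_Rd pi_Ld !piD !pi1 => /eqP.
rewrite subr_eq0 => /eqP.
have -> : (fun d : E2 => pi (Ld a (fun d : E2 => (Tser t) s i j (d u2) * (Tser t) s' k l (d v2)) d
    + hbar B * ((Tser t) s k j (d u2) * (Tser t) s' i l (d v2)))) =
  fun d : E2 => Lop h (pi a) (fun m n => T s i j m * T s' k l n) (d u2) (d v2)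
      + h * (T s k j (d u2) * T s' i l (d v2)).
  apply: funext => d; rewrite piD pi_Ld -Ld_curry !piM !pi_Tser; congr (_ + _).
  by congr (Ld _ _ d); apply: funext => d'; rewrite piM !pi_Tser.
have -> : (fun d : E2 => pi (Rd b (fun d : E2 => (Tser t) s' k l (d v2) * (Tser t) s i j (d u2)) d
    + (Tser t) s' k j (d v2) * (Tser t) s i l (d u2) * hbar B)) =
  fun d : E2 => Lop h (pi b) (fun m n => T s' k l n * T s i j m) (d u2) (d v2)
      + h * (T s' k j (d v2) * T s i l (d u2)).
  apply: funext => d; rewrite piD pi_Rd -Ld_curry !piM !pi_Tser -hbarC; congr (_ + _).
  rewrite -Rd_Ld; last by move=> d'; exact: comm_elM.
  by congr (Rd _ _ d); apply: funext => d'; rewrite piM !pi_Tser.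
rewrite Rd_Ld; last first.
  move=> d; rewrite /Lop.
  have cc := (comm_elM, comm_elD, comm_elN, comm_el1).
  have b1 x : comm_el (pi b) x -> comm_el (pi b + 1) x.
    by rewrite /comm_el mulrDl mulrDr mul1r mulr1 => ->.
  apply: b1; do !apply: comm_elD; try apply: comm_elN; do ?apply: comm_elM => //.
rewrite (Ld_curry _ (fun m n => Lop h (pi a) (fun m n => T s i j m * T s' k l n) m n
      + h * (T s k j m * T s' i l n))).
rewrite (Ld_curry _ (fun m n => Lop h (pi b) (fun m n => T s' k l n * T s i j m) m n
      + h * (T s' k j n * T s i l m))).
by rewrite mk2u mk2v.
Qed.
End QuotientMap.

(** * The relations for currents with coefficients in the centralizer of c *)

Section ConjRel.
Variables (R : realType) (B : halg R).
Notation h := (hbar B).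
Hypotheses (hsep : hseparated B) (hcomp : hcomplete B).

Lemma conj_rel s (be r : B) (a b : fseries B) (D ka : polarity -> B)
    (x : polarity -> fseries B) (y X : fseries B) : comm_el be r ->
  one_sided s a -> one_sided s b ->
  X = (fun m => dshift (ka Pos) (x Pos) m - dshift (ka Neg) (x Neg) m) ->
  (forall s', D s' - ka s' = be) ->
  (forall s', comm_el (ka s') (D s')) -> (forall s', comm_el (ka s') r) ->
  (forall s' m, comm_el (ka s') (a m)) ->
  (forall s' m n, Lop h (D s' + r) (vmono (x s')) m n =
    Lop h (D s') (fun m n => conj_conv s a b (x s' n) m) m n + umono y m n) ->
  a \at u2 ** X \at v2 ** b \at u2 = uv_ratio s (be + r) be ** X \at v2.
Proof.
move=> br a0 b0 XE Dk kD kr ka_a E; apply: conj_ratio => //.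
have P s' := conj_piece hsep hcomp (kD s') (kr s') (ka_a s') (E s').
have P1 := P Pos; have P2 := P Neg; rewrite !Dk in P1 P2.
exact: (conj_sum XE P1 P2).
Qed.

Lemma conj_comm s (a b X : fseries B) : one_sided s a -> one_sided s b ->
  ser s a * ser s b = 1 -> (forall m n, comm_el (b m) (X n)) ->
  a \at u2 ** X \at v2 ** b \at u2 = X \at v2.
Proof.
move=> a0 b0 ab bX; apply: funext => d; rewrite (conj_at hsep X d a0 b0) vmono_at /conj_conv.
case: ifPn => [ds|ds].
  transitivity (fcoef (ser s a * ser s b) `|d u2| * X (d v2)).
    rewrite fcoefM mulr_suml; apply: eq_bigr => i _.
    by rewrite -!mulrA; congr (_ * _); exact/esym/bX.
  rewrite ab /= /vmono; have -> : (`|d u2|%N == 0%N) = (d u2 == 0) by rewrite absz_eq0.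
  by case: eqP; rewrite ?mul1r ?mul0r.
rewrite /vmono; case: eqP => // d0; move: ds; rewrite d0; by case: (s).
Qed.
End ConjRel.

Section Relations.
Variables (R : realType) (B : halg R).
Hypotheses (hsepB : hseparated B) (hcompB : hcomplete B).
Variables (C : pzRingType) (v : {rmorphism C -> B}) (h q : C) (N : nat).
Hypotheses (hC : central h) (qC : central q).
Hypothesis hsep : forall x : C, (forall n, exists y, x = h ^+ n * y) -> x = 0.
Variables (f e : polarity -> 'I_N -> 'I_N -> int -> C).
Variables (k ki : polarity -> 'I_N -> int -> C).
Hypotheses (f_r : forall s i j, ranged s (f s i j)) (e_r : forall s i j, ranged s (e s i j)).
Hypotheses (k_r : forall s i, ranged s (k s i)) (ki_r : forall s i, ranged s (ki s i)).

Notation sf s := (fun i j => ser s (f s i j)).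
Notation se s := (fun i j => ser s (e s i j)).
Notation sk s := (fun i => ser s (k s i)).
Notation ski s := (fun i => ser s (ki s i)).
Notation Tm s := (schur (sf s) (sk s) (se s) 0).

Hypothesis G : forall s, gauss_mx (sf s) (sk s) (ski s) (se s).

Notation rtt_ss s s' := (rtt (beta2 h s s' (- dpol q s s')) (beta2 h s s' (dpol q s s'))
  (eta2 h s s') (fun=> True) (fun i j => inu (Tm s i j)) (fun i j => fpsC (Tm s' i j))).

Hypothesis rtt_same : forall s, rtt_ss s s.
Hypothesis rtt_PN : rtt_ss Pos Neg.

Variable c : B.
Hypotheses (vh : v h = hbar B) (vq : v q = qc c).

Notation d s s' := (dpol (v q) s s').
Definition fB s i j : fseries B := vmap1 v (f s i j).
Definition eB s i j : fseries B := vmap1 v (e s i j).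
Definition kB s i : fseries B := vmap1 v (k s i).
Definition kiB s i : fseries B := vmap1 v (ki s i).
Notation X := (X c fB eB).
Notation qs s := (sgn_mul s (v q)).

Lemma vmap1_one s a : ranged s a -> one_sided s (vmap1 v a : fseries B).
Proof. by move=> a0; apply/one_rangedP => m ms; rewrite /vmap1 a0 ?rmorph0. Qed.

Lemma fB_one s i j : one_sided s (fB s i j). Proof. exact: vmap1_one. Qed.
Lemma eB_one s i j : one_sided s (eB s i j). Proof. exact: vmap1_one. Qed.
Lemma kB_one s i : one_sided s (kB s i). Proof. exact: vmap1_one. Qed.
Lemma kiB_one s i : one_sided s (kiB s i). Proof. exact: vmap1_one. Qed.

Lemma qs_comm s x : comm_el (qs s) (v x).
Proof.
have qx : v q * v x = v x * v q by rewrite -!rmorphM qC.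
by case: s; rewrite /comm_el /= ?mulNr ?mulrN qx.
Qed.

Lemma qsE s : qs s = v (sgn_mul s q). Proof. by case: s; rewrite //= rmorphN. Qed.

Lemma qs_dpol s s1 s2 : comm_el (qs s) (d s1 s2). Proof. by rewrite -v_dpol; exact: qs_comm. Qed.

Lemma qs_dpolN s s1 s2 : comm_el (qs s) (- d s1 s2).
Proof. by rewrite -v_dpol -rmorphN; exact: qs_comm. Qed.

Lemma qs_comm1 s : comm_el (qs s) 1. Proof. by rewrite -(rmorph1 v); exact: qs_comm. Qed.

Lemma qs_commN1 s : comm_el (qs s) (- 1). Proof. by rewrite -(rmorph1 v) -rmorphN; exact: qs_comm. Qed.

Lemma vmap1_ser s (a : int -> C) : ser s (vmap1 v a) = fps_map v (ser s a). Proof. by []. Qed.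

Lemma kB_mulV s i : ser s (kB s i) * ser s (kiB s i) = 1.
Proof. by rewrite !vmap1_ser -rmorphM (gauss_kV (G s) i) rmorph1. Qed.

Lemma kiB_mulV s i : ser s (kiB s i) * ser s (kB s i) = 1.
Proof. by rewrite !vmap1_ser -rmorphM (gauss_Vk (G s) i) rmorph1. Qed.

Lemma X_Pos i : X Pos i = fun m =>
  dshift (qs (opp_pol Pos)) (eB Pos (ix i) (ixS i)) m
  - dshift (qs (opp_pol Neg)) (eB Neg (ix i) (ixS i)) m.
Proof. by rewrite vq. Qed.

Lemma X_Neg i : X Neg i = fun m =>
  dshift (qs Pos) (fB Pos (ixS i) (ix i)) m - dshift (qs Neg) (fB Neg (ixS i) (ix i)) m.
Proof. by rewrite vq. Qed.

Lemma ixSE (i : 'I_N.-1) : ixS i = (ix i).+1 :> nat. Proof. by []. Qed.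
Lemma ix_lt (i : 'I_N.-1) : (ix i < ixS i)%N. Proof. by []. Qed.

Lemma dpol_shift_e s s' : d s s' - qs (opp_pol s') = qs s.
Proof. case: s s' => [] [] /=; rewrite ?mulr2n; nc_ring (@nil B). Qed.

Lemma dpol_shift_f s s' : - d s s' - qs s' = - qs s.
Proof. case: s s' => [] [] /=; rewrite ?mulr2n; nc_ring (@nil B). Qed.

Lemma comm_1 (x : B) : comm_el x 1. Proof. by rewrite /comm_el mulr1 mul1r. Qed.
Lemma comm_N1 (x : B) : comm_el x (- 1). Proof. by rewrite /comm_el mulrN1 mulN1r. Qed.

Lemma k_commute s i j : kB s i \at u2 ** kB s j \at v2 = kB s j \at v2 ** kB s i \at u2.
Proof.
apply: funext => d; rewrite prod_uv // prod_vu //; apply: (@v_comm _ _ v).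
have [ij|ji|ij] := ltngtP i j.
- exact: (cur_kk_low hC qC hsep k_r G rtt_same rtt_PN).
- apply/esym; exact (cur_kk_low hC qC hsep k_r G rtt_same rtt_PN _ _ (erefl s) ji).
have -> : j = i by exact/esym/val_inj.
exact: (cur_kk hC qC hsep k_r G rtt_same rtt_PN).
Qed.

Lemma k_opposite_diag i : kB Pos i \at u2 ** kB Neg i \at v2 = kB Neg i \at v2 ** kB Pos i \at u2.
Proof.
apply: funext => d; rewrite prod_uv // prod_vu //; apply: (@v_comm _ _ v).
exact: (cur_kk hC qC hsep k_r G rtt_same rtt_PN).
Qed.

(** Both sides are bounded in u, so both denominators can be multiplied back by [Ld_cancel]. The
    linear factors commute with each other, and [map_cur_k_low] remains. *)
Lemma k_opposite s (i j : 'I_N) (qq := sgn_mul s (qc c *+ 2)) : (j < i)%N ->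
  uv_ratio s (- qq) (- qq + 1) ** (kiB (opp_pol s) i \at v2 ** kB s j \at u2) =
  uv_ratio s qq (qq + 1) ** (kB s j \at u2 ** kiB (opp_pol s) i \at v2).
Proof.
move=> ji; set F := kiB _ _ \at v2 ** _; set H := _ ** kiB _ _ \at v2.
have qqE : qq = d s (opp_pol s) by rewrite /qq -vq; case: (s).
have FE : F = fun d : E2 => kiB (opp_pol s) i (d v2) * kB s j (d u2).
  by apply: funext => d; exact: prod_vu.
have HE : H = fun d : E2 => kB s j (d u2) * kiB (opp_pol s) i (d v2).
  by apply: funext => d; exact: prod_uv.
have kz (d : E2) : 0 < sgp s (d u2) -> kB s j (d u2) = 0.
  by move=> du; apply: (@kB_one s j); move: du; case: (s) => /=; move: (d u2); clear; lia.
have hF : half_u s F by exists 0 => d /kz; rewrite FE => ->; rewrite mulr0.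
have hH : half_u s H by exists 0 => d /kz; rewrite HE => ->; rewrite mul0r.
have c1 (x : B) : x * (x + 1) = (x + 1) * x by rewrite mulrDr mulrDl mulr1 mul1r.
have [hU LU] := ratio_spec hsepB hcompB (c1 (- qq)) hF.
have [hV LV] := ratio_spec hsepB hcompB (c1 qq) hH.
have cc (x y : B) : x * y = y * x -> (x + 1) * y = y * (x + 1).
  by rewrite mulrDl mulrDr mul1r mulr1 => ->.
have cN : - qq * qq = qq * - qq by rewrite mulrN mulNr.
apply: (@Ld_cancel _ _ hsepB s (- qq + 1)) => //; rewrite LU.
apply: (@Ld_cancel _ _ hsepB s (qq + 1)); try exact: half_u_Ld.
rewrite [RHS]Ld_comm ?LV; last by apply: (cc _ _); apply/esym; apply: (cc _ _); exact/esym.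
rewrite Ld_comm; last by apply: (cc _ _); exact/esym.
rewrite [RHS]Ld_comm; last by apply: (cc _ _).
rewrite FE HE; have LL b K : Ld b (fun d : E2 => K (d u2) (d v2)) = fun d : E2 => Lop (hbar B) b K (d u2) (d v2).
  by apply: funext => d'; exact: Ld_curry.
rewrite (LL _ (fun m n => kiB (opp_pol s) i n * kB s j m)) LL.
rewrite (LL _ (fun m n => kB s j m * kiB (opp_pol s) i n)) LL.
apply: funext => d0; rewrite qqE -vh.
exact: (map_cur_k_low v hC qC hsep k_r ki_r G rtt_same rtt_PN s (opp_pol s) _ _ ji).
Qed.

Lemma X_conj_k s i :
  kiB s (ix i) \at u2 ** X Pos i \at v2 ** kB s (ix i) \at u2 =
    uv_ratio s (qs s + 1) (qs s) ** X Pos i \at v2 /\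
  kB s (ix i) \at u2 ** X Neg i \at v2 ** kiB s (ix i) \at u2 =
    uv_ratio s (- qs s + 1) (- qs s) ** X Neg i \at v2.
Proof.
split.
  apply: (conj_rel hsepB hcompB (D := fun s' => d s s') (comm_1 _) (@kiB_one s _) (@kB_one s _) (X_Pos i) (dpol_shift_e s)
    (y := fun m => v h * eB s (ix i) (ixS i) m)) => [s'|s'|s' m|s' m n].
  - exact: (qs_dpol (opp_pol s')).
  - exact: (qs_comm1 (opp_pol s')).
  - exact: (qs_comm (opp_pol s')).
  by rewrite -vh; exact: (map_cur_ke v hC qC hsep e_r G rtt_same rtt_PN s s' m n (ix_lt i)).
apply: (conj_rel hsepB hcompB (D := fun s' => - d s s') (comm_1 _) (@kB_one s _) (@kiB_one s _) (X_Neg i) (dpol_shift_f s)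
  (y := fun m => v h * fB s (ixS i) (ix i) m)) => [s'|s'|s' m|s' m n].
- exact: qs_dpolN.
- exact: qs_comm1.
- exact: qs_comm.
by rewrite -vh; exact: (map_cur_kf v hC qC hsep f_r G rtt_same rtt_PN s s' m n (ix_lt i)).
Qed.

Lemma X_conj_kS s i :
  kiB s (ixS i) \at u2 ** X Pos i \at v2 ** kB s (ixS i) \at u2 =
    uv_ratio s (qs s - 1) (qs s) ** X Pos i \at v2 /\
  kB s (ixS i) \at u2 ** X Neg i \at v2 ** kiB s (ixS i) \at u2 =
    uv_ratio s (- qs s - 1) (- qs s) ** X Neg i \at v2.
Proof.
split.
  apply: (conj_rel hsepB hcompB (D := fun s' => d s s') (comm_N1 _) (@kiB_one s _) (@kB_one s _) (X_Pos i) (dpol_shift_e s)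
    (y := fun m => - v h * eB s (ix i) (ixS i) m)) => [s'|s'|s' m|s' m n].
  - exact: (qs_dpol (opp_pol s')).
  - exact: (qs_commN1 (opp_pol s')).
  - exact: (qs_comm (opp_pol s')).
  by rewrite -vh; exact: (map_cur_k1e v hC qC hsep e_r G rtt_same rtt_PN (ixSE i) s s' m n).
apply: (conj_rel hsepB hcompB (D := fun s' => - d s s') (comm_N1 _) (@kB_one s _) (@kiB_one s _) (X_Neg i) (dpol_shift_f s)
  (y := fun m => - v h * fB s (ixS i) (ix i) m)) => [s'|s'|s' m|s' m n].
- exact: qs_dpolN.
- exact: qs_commN1.
- exact: qs_comm.
by rewrite -vh; exact: (map_cur_k1f v hC qC hsep f_r G rtt_same rtt_PN (ixSE i) s s' m n).
Qed.

Lemma ix_neq (i : 'I_N.-1) (j : 'I_N) : j != ix i -> j != ixS i -> (j < ix i)%N \/ (ixS i < j)%N.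
Proof. by rewrite -!val_eqE /=; case: j i => [j jN] [i iN] /=; clear; lia. Qed.

Lemma X_conj_far s i j : j != ix i -> j != ixS i ->
  kiB s j \at u2 ** X Pos i \at v2 ** kB s j \at u2 = X Pos i \at v2 /\
  kB s j \at u2 ** X Neg i \at v2 ** kiB s j \at u2 = X Neg i \at v2.
Proof.
move=> ji jS.
have cke s' m n : comm_el (k s j m) (e s' (ix i) (ixS i) n) /\ comm_el (k s j m) (f s' (ixS i) (ix i) n).
  case: (ix_neq ji jS) => jlt.
    exact: (cur_k_comm hC qC hsep f_r e_r k_r G rtt_same rtt_PN).
  have [a b] := cur_far_k hC qC hsep f_r e_r k_r G rtt_same rtt_PN s' s (ixSE i) n m jlt.
  by split; exact/esym.
have cX m n : comm_el (kB s j m) (X Pos i n) /\ comm_el (kB s j m) (X Neg i n).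
  rewrite X_Pos X_Neg; split; apply: comm_elD; try apply: comm_elN; apply: (dshift_comm hsepB hcompB);
    try exact: qs_comm; move=> n'; apply: (@v_comm _ _ v); first [exact: (proj1 (cke _ _ _)) | exact: (proj2 (cke _ _ _))].
split.
  apply: (conj_comm hsepB (@kiB_one s j) (@kB_one s j) (kiB_mulV s j)) => m n; exact: (proj1 (cX m n)).
apply: (conj_comm hsepB (@kB_one s j) (@kiB_one s j) (kB_mulV s j)) => m n.
(* Commutation is known for the coefficients of k. A coefficient of the current, viewed as a
   constant series, commutes with the series k and hence with its inverse. *)
have cki : forall n, comm_el (ser s (kB s j)) (fpsC (X Neg i n)).
  by move=> n'; apply: fpsP => l; rewrite fcoefMC fcoefCM; exact: (proj2 (cX _ _)).
have := comm_el_inv (kB_mulV s j) (kiB_mulV s j) (esym (cki n)).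
move=> /(congr1 (fun P => fcoef P `|m|)); rewrite fcoefMC fcoefCM /= => E.
case/boolP: (in_range 0 s m) => ms; first by rewrite /comm_el (expo0P ms) E.
have /one_rangedP-/(_ m ms) -> := @kiB_one s j.
by rewrite /comm_el mul0r mulr0.
Qed.

Lemma dpol_shift_ee s s' (r : B) : d s s' + r + qs (opp_pol s) - qs (opp_pol s') = r.
Proof. case: s s' => [] [] /=; rewrite ?mulr2n; nc_ring (@nil B). Qed.

Lemma dpol_shift_ff s s' (r : B) : - d s s' + r + qs s - qs s' = r.
Proof. case: s s' => [] [] /=; rewrite ?mulr2n; nc_ring (@nil B). Qed.

Lemma qs_comm_qs s s' : comm_el (qs s) (qs s').
Proof. by rewrite (qsE s'); exact: qs_comm. Qed.

Lemma quad_e (i j : 'I_N.-1) (r1 r2 : C) (p r : polarity -> fseries B) :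
  (forall s s' m n,
    Lop (v h) (d s s' + v r1) (fun m n => eB s (ix i) (ixS i) m * eB s' (ix j) (ixS j) n) m n =
    Lop (v h) (d s s' + v r2) (fun m n => eB s' (ix j) (ixS j) n * eB s (ix i) (ixS i) m) m n
    + (umono (p s) m n + vmono (r s') m n)) ->
  umv (v r1) ** (X Pos i \at u2 ** X Pos j \at v2) = umv (v r2) ** (X Pos j \at v2 ** X Pos i \at u2).
Proof.
move=> E; pose sh s (x : fseries B) : fseries B := dshift (qs (opp_pol s)) x.
refine (@quad_sum _ _ hsepB (v r1) (v r2) (fun s => sh s (eB s (ix i) (ixS i)))
  (fun s => sh s (eB s (ix j) (ixS j))) (fun s => sh s (p s)) (fun s => sh s (r s))
  _ _ (X_Pos i) (X_Pos j) _) => s s' m n.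
have qdr t a : comm_el (qs t) (d s s' + v a) by apply: comm_elD; [exact: qs_dpol | exact: qs_comm].
have := E s s'; rewrite vh => {}E.
have := quad_piece hsepB hcompB (qs_comm_qs (opp_pol s) (opp_pol s')) (qdr _ _) (qdr _ _) (qdr _ _) (qdr _ _)
  (fun m => qs_comm _ _) (fun m => qs_comm _ _) E m n.
by rewrite !dpol_shift_ee.
Qed.

Lemma quad_f (i j : 'I_N.-1) (r1 r2 : C) (p r : polarity -> fseries B) :
  (forall s s' m n,
    Lop (v h) (- d s s' + v r1) (fun m n => fB s (ixS i) (ix i) m * fB s' (ixS j) (ix j) n) m n =
    Lop (v h) (- d s s' + v r2) (fun m n => fB s' (ixS j) (ix j) n * fB s (ixS i) (ix i) m) m n
    + (umono (p s) m n + vmono (r s') m n)) ->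
  umv (v r1) ** (X Neg i \at u2 ** X Neg j \at v2) = umv (v r2) ** (X Neg j \at v2 ** X Neg i \at u2).
Proof.
move=> E; pose sh s (x : fseries B) : fseries B := dshift (qs s) x.
refine (@quad_sum _ _ hsepB (v r1) (v r2) (fun s => sh s (fB s (ixS i) (ix i)))
  (fun s => sh s (fB s (ixS j) (ix j))) (fun s => sh s (p s)) (fun s => sh s (r s))
  _ _ (X_Neg i) (X_Neg j) _) => s s' m n.
have qdr t a : comm_el (qs t) (- d s s' + v a) by apply: comm_elD; [exact: qs_dpolN | exact: qs_comm].
have := E s s'; rewrite vh => {}E.
have := quad_piece hsepB hcompB (qs_comm_qs s s') (qdr _ _) (qdr _ _) (qdr _ _) (qdr _ _)
  (fun m => qs_comm _ _) (fun m => qs_comm _ _) E m n.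
by rewrite !dpol_shift_ff.
Qed.

Lemma X_quadratic s i : umv (- sgn_mul s 1) ** (X s i \at u2 ** X s i \at v2) =
  umv (sgn_mul s 1) ** (X s i \at v2 ** X s i \at u2).
Proof.
have vN1 : v (- 1) = - 1 by rewrite rmorphN rmorph1.
case: s => /=; rewrite ?opprK -vN1 -(rmorph1 v).
  apply: (quad_e (p := fun s => fun m => - v h * vmap1 v (unser s (se s (ix i) (ixS i) * se s (ix i) (ixS i))) m)
    (r := fun s => fun m => - v h * vmap1 v (unser s (se s (ix i) (ixS i) * se s (ix i) (ixS i))) m)) => s s' m n.
  rewrite vN1 rmorph1; exact: (map_cur_ee v hC qC hsep e_r G rtt_same rtt_PN (ixSE i) s s' m n).
apply: (quad_f (p := fun s => fun m => v h * vmap1 v (unser s (sf s (ixS i) (ix i) * sf s (ixS i) (ix i))) m)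
  (r := fun s => fun m => v h * vmap1 v (unser s (sf s (ixS i) (ix i) * sf s (ixS i) (ix i))) m)) => s s' m n.
rewrite vN1 rmorph1; exact: (map_cur_ff v hC qC hsep f_r G rtt_same rtt_PN (ixSE i) s s' m n).
Qed.

Lemma ixS_ix (i j : 'I_N.-1) : j = i.+1 :> nat -> ixS i = ix j.
Proof. by move=> ij; apply: val_inj; rewrite /= ij. Qed.

Lemma X_adjacent (i j : 'I_N.-1) : j = i.+1 :> nat ->
  umv 1 ** (X Pos i \at u2 ** X Pos j \at v2) = umv 0 ** (X Pos j \at v2 ** X Pos i \at u2) /\
  umv 0 ** (X Neg i \at u2 ** X Neg j \at v2) = umv 1 ** (X Neg j \at v2 ** X Neg i \at u2).
Proof.
move=> /ixS_ix ij; rewrite -(rmorph1 v) -(rmorph0 v).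
have lt : (ixS i < ixS j)%N by rewrite ij.
split.
  apply: (quad_e (p := fun s => fun m => v h * eB s (ix i) (ixS j) m)
    (r := fun s => fun m => v h * vmap1 v (unser s (se s (ix i) (ixS i) * se s (ixS i) (ixS j)
      - se s (ix i) (ixS j))) m)) => s s' m n.
  rewrite rmorph1 rmorph0 addr0 -ij.
  exact: (map_cur_eg v hC qC hsep e_r G rtt_same rtt_PN (ixSE i) s s' m n lt).
apply: (quad_f (p := fun s => fun m => - v h * fB s (ixS j) (ix i) m)
  (r := fun s => fun m => - v h * vmap1 v (unser s (sf s (ixS j) (ixS i) * sf s (ixS i) (ix i)
    - sf s (ixS j) (ix i))) m)) => s s' m n.
rewrite rmorph1 rmorph0 addr0 -ij.
exact: (map_cur_fg v hC qC hsep f_r G rtt_same rtt_PN (ixSE i) s s' m n lt).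
Qed.

Lemma absz1_cases (i j : 'I_N.-1) : `|i%:Z - j%:Z| = 1 -> j = i.+1 :> nat \/ i = j.+1 :> nat.
Proof. by case: i j => [i iN] [j jN] /=; clear; lia. Qed.

Lemma absz2_cases (i j : 'I_N.-1) : 1 < `|i%:Z - j%:Z| -> (i.+1 < j)%N \/ (j.+1 < i)%N.
Proof. by case: i j => [i iN] [j jN] /=; clear; lia. Qed.

Lemma X_serre s (i j : 'I_N.-1) : `|i%:Z - j%:Z| = 1 -> forall d,
  serre (X s i) (X s j) u3 u3' v3 d + serre (X s i) (X s j) u3' u3 v3 d = 0.
Proof.
move=> /absz1_cases ij; case: s.
  apply: (serre_cur hsepB hcompB (X_Pos i) (X_Pos j)
      (ka := fun s => qs (opp_pol s)) (la := fun s => qs (opp_pol s))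
      (x := fun s => eB s (ix i) (ixS i)) (y := fun s => eB s (ix j) (ixS j)));
    try (by move=> s s'; exact: qs_comm_qs); try (by move=> s s' m; exact: qs_comm).
  move=> s1 s2 s3 l m n; rewrite -v_serre -(rmorph0 v); congr (v _).
  case: ij => ij.
    have lt : (ixS i < ixS j)%N by rewrite /= ij.
    rewrite -(ixS_ix ij); exact: (cur_serre_e hC qC hsep e_r G rtt_same rtt_PN).
  have lt : (ixS j < ixS i)%N by rewrite /= ij.
  rewrite -(ixS_ix ij); exact: (cur_serre_e' hC qC hsep e_r G rtt_same rtt_PN).
apply: (serre_cur hsepB hcompB (X_Neg i) (X_Neg j)
    (ka := fun s => qs s) (la := fun s => qs s)
    (x := fun s => fB s (ixS i) (ix i)) (y := fun s => fB s (ixS j) (ix j)));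
  try (by move=> s s'; exact: qs_comm_qs); try (by move=> s s' m; exact: qs_comm).
move=> s1 s2 s3 l m n; rewrite -v_serre -(rmorph0 v); congr (v _).
case: ij => ij.
  have lt : (ixS i < ixS j)%N by rewrite /= ij.
  rewrite -(ixS_ix ij); exact: (cur_serre_f hC qC hsep f_r G rtt_same rtt_PN).
have lt : (ixS j < ixS i)%N by rewrite /= ij.
rewrite -(ixS_ix ij); exact: (cur_serre_f' hC qC hsep f_r G rtt_same rtt_PN).
Qed.

Lemma cur_comm (x y : polarity -> int -> C) (ka la : polarity -> polarity) A A' :
  A = (fun m => dshift (qs (ka Pos)) (vmap1 v (x Pos)) m - dshift (qs (ka Neg)) (vmap1 v (x Neg)) m) ->
  A' = (fun m => dshift (qs (la Pos)) (vmap1 v (y Pos)) m - dshift (qs (la Neg)) (vmap1 v (y Neg)) m) ->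
  (forall s s' m n, comm_el (x s m) (y s' n)) -> forall m n, comm_el (A m) (A' n).
Proof.
move=> AE AE' xy; apply: (comm_cur AE AE' (x := fun s => dshift (qs (ka s)) (vmap1 v (x s)))
  (y := fun s => dshift (qs (la s)) (vmap1 v (y s)))) => s s' m n.
apply: (dshift_comm hsepB hcompB) => [|{}n].
  by apply: (dshift_comm hsepB hcompB) => [|m']; [exact: qs_comm_qs | exact: qs_comm].
by apply: (comm_el_shift hsepB hcompB) => [m'|]; [apply: (@v_comm _ _ v) | exact: qs_comm].
Qed.

Lemma X_far s (i j : 'I_N.-1) : 1 < `|i%:Z - j%:Z| -> X s i \at u2 ** X s j \at v2 = X s j \at v2 ** X s i \at u2.
Proof.
move=> /absz2_cases ij; apply: funext => d0; rewrite prod_uv // prod_vu //.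
have far (a b : 'I_N.-1) : (a.+1 < b)%N -> (ixS a < ix b)%N /\ (ix b < ixS b)%N by [].
case: s.
  apply: (cur_comm (x := fun s => e s (ix i) (ixS i)) (y := fun s => e s (ix j) (ixS j))
    (ka := opp_pol) (la := opp_pol) (X_Pos i) (X_Pos j)) => s s' m n.
  case: ij => /far[l1 l2].
    by have [] := cur_far_e hC qC hsep f_r e_r k_r G rtt_same rtt_PN s s' (ixSE i) m n l1 l2.
  by apply/esym; have [] := cur_far_e hC qC hsep f_r e_r k_r G rtt_same rtt_PN s' s (ixSE j) n m l1 l2.
apply: (cur_comm (x := fun s => f s (ixS i) (ix i)) (y := fun s => f s (ixS j) (ix j))
  (ka := id) (la := id) (X_Neg i) (X_Neg j)) => s s' m n.
case: ij => /far[l1 l2].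
  by have [] := cur_far_f hC qC hsep f_r e_r k_r G rtt_same rtt_PN s s' (ixSE i) m n l1 l2.
by apply/esym; have [] := cur_far_f hC qC hsep f_r e_r k_r G rtt_same rtt_PN s' s (ixSE j) n m l1 l2.
Qed.

Lemma ef_far (i j : 'I_N.-1) m n : i != j -> comm_el (X Pos i m) (X Neg j n).
Proof.
move=> ij; move: m n; apply: (cur_comm (x := fun s => e s (ix i) (ixS i)) (y := fun s => f s (ixS j) (ix j))
  (ka := opp_pol) (la := id) (X_Pos i) (X_Neg j)) => s s' m n.
have far (a b : 'I_N.-1) : (a.+1 < b)%N -> (ixS a < ix b)%N /\ (ix b < ixS b)%N by [].
have [lt|lt|eq] := ltngtP i j; last by case/eqP: ij; exact: val_inj.
  have [lt'|eq] := ltnP i.+1 j.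
    have [l1 l2] := far _ _ lt'.
    by have [] := cur_far_e hC qC hsep f_r e_r k_r G rtt_same rtt_PN s s' (ixSE i) m n l1 l2.
  have ji : j = i.+1 :> nat by apply/eqP; rewrite eqn_leq eq.
  have l : (ixS i < ixS j)%N by rewrite /= ji.
  rewrite -(ixS_ix ji); exact (cur_ef_next hC qC hsep f_r e_r G rtt_same rtt_PN s s' (ixSE i) m n l).
have [lt'|eq] := ltnP j.+1 i.
  have [l1 l2] := far _ _ lt'.
  by apply/esym; have [] := cur_far_f hC qC hsep f_r e_r k_r G rtt_same rtt_PN s' s (ixSE j) n m l1 l2.
have ji : i = j.+1 :> nat by apply/eqP; rewrite eqn_leq eq.
have l : (ixS j < ixS i)%N by rewrite /= ji.
rewrite -(ixS_ix ji); apply/esym.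
exact (cur_fe_next hC qC hsep f_r e_r G rtt_same rtt_PN s' s (ixSE j) n m l).
Qed.

(** The shift is multiplicative and respects inverses because its amount commutes with all
    coefficients. So the quotient of shifted series is the shift of k_(i+1) k_i^-1, the form
    produced by [ef_cur]. *)
Lemma k_prod s0 s i n (x : 'I_n) :
  pm_shift c s0 (kB s (ixS i)) \at x ** dinv s (pm_shift c s0 (kB s (ix i))) \at x =
  dshift (qs s0) (vmap1 v (unser s (sk s (ixS i) * ski s (ix i)))) \at x.
Proof.
rewrite /pm_shift -vq.
rewrite (dinv_dshift hsepB hcompB (@kB_one s _) (@kiB_one s _) (fun m => qs_comm s0 _) (fun m => qs_comm s0 _) (kB_mulV s _) (kiB_mulV s _)).
rewrite (at_mul hsepB _ (dshift_one hsepB _ (@kB_one s _)) (dshift_one hsepB _ (@kiB_one s _))).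
rewrite -(dshift_dmul hsepB hcompB (@kB_one s _) (@kiB_one s _) (fun m => qs_comm s0 _)).
congr (dshift _ _ \at x); rewrite vmap1_unser.
have -> : fps_map v (sk s (ixS i) * ski s (ix i)) = ser s (kB s (ixS i)) * ser s (kiB s (ix i)).
  exact: (rmorphM (fps_map v)).
rewrite -(ser_dmul hsepB (@kB_one s _) (@kiB_one s _)).
apply/esym; apply: unser_ser; apply/one_rangedP; exact: (dmul_one hsepB (@kB_one s _) (@kiB_one s _)).
Qed.

Lemma X_commutator i j d : (X Pos i \at u2 ** X Neg j \at v2) d - (X Neg j \at v2 ** X Pos i \at u2) d =
  if i == j then hbar B *
    ((ddelta (- (qc c *+ 2)) ** (pm_shift c Neg (kB Pos (ixS i)) \at u2
        ** dinv Pos (pm_shift c Neg (kB Pos (ix i))) \at u2)) d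
     - (ddelta (qc c *+ 2) ** (pm_shift c Neg (kB Neg (ixS i)) \at v2
        ** dinv Neg (pm_shift c Neg (kB Neg (ix i))) \at v2)) d)
  else 0.
Proof.
case: eqP => [<-|/eqP ij]; last first.
  by rewrite prod_uv // prod_vu // (ef_far _ _ ij) subrr.
rewrite !k_prod -vq.
apply: (ef_cur hsepB hcompB (q := v q) (e := fun s => eB s (ix i) (ixS i)) (f := fun s => fB s (ixS i) (ix i))
  (k := fun s => vmap1 v (unser s (sk s (ixS i) * ski s (ix i))))) => //.
- by move=> s m; exact: (qs_comm Pos).
- by move=> s m; exact: (qs_comm Pos).
- by move=> s; exact: eB_one.
- by move=> s; exact: fB_one.
- by move=> s; apply: vmap1_one; exact: unser_ranged.
- move=> s s' m n; rewrite -vh.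
  exact: (map_cur_ef v hC qC hsep f_r e_r k_r G rtt_same rtt_PN (ixSE i) s s' m n).
- exact: X_Pos.
exact: X_Neg.
Qed.
End Relations.

Lemma fps_map_inj (S S' : pzRingType) (v : {rmorphism S -> S'}) :
  injective v -> injective (fps_map v).
Proof.
move=> vi p p' e; apply: fpsP => n; apply: vi.
exact: (congr1 (fun P => fcoef P n) e).
Qed.

(** * Gauss decompositions in a separated and complete algebra *)

Section Assembly.
Variables (R : realType) (B : halg R) (N : nat).
Hypotheses (hsep : hseparated B) (hcomp : hcomplete B).
Variables (t : 'I_N -> 'I_N -> int -> B) (c : B).
Notation h := (hbar B).
Notation T := (Tser t).
Notation q := (qc c).

Definition pair_rel s s' (d : B) := forall i j k l m n,
  Lop h (d + 1) (fun m n => Lop h (- d) (fun m n => T s i j m * T s' k l n) m n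
    + Hop h (fun m n => T s k j m * T s' i l n) m n) m n =
  Lop h (- d + 1) (fun m n => Lop h d (fun m n => T s' k l n * T s i j m) m n
    + Hop h (fun m n => T s' k j n * T s i l m) m n) m n.

Hypothesis cT : forall s i j m, comm_el c (T s i j m).
Hypothesis rel_same : forall s, pair_rel s s 0.
Hypothesis rel_PN : pair_rel Pos Neg (q *+ 2).

Variables (f e : polarity -> 'I_N -> 'I_N -> fseries B) (k : polarity -> 'I_N -> fseries B).
Hypothesis gauss : forall s, is_gauss t s (f s) (k s) (e s).

Lemma gauss_f_one s i j : one_sided s (f s i j). Proof. by have [/(_ i j)[]] := gauss s. Qed.
Lemma gauss_e_one s i j : one_sided s (e s i j). Proof. by have [/(_ i j)[]] := gauss s. Qed.
Lemma gauss_k_one s i : one_sided s (k s i). Proof. by have [/(_ i i)[]] := gauss s. Qed.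

Lemma ser_T s i j : \sum_l ser s (f s i l) * ser s (k s l) * ser s (e s l j) = ser s (T s i j).
Proof.
have [_ _ _ E] := gauss s.
apply: fpsP => n; rewrite fcoef_sum [RHS]/= E; apply: eq_bigr => l _.
have o1 := dmul_one hsep (@gauss_f_one s i l) (@gauss_k_one s l).
by rewrite -(ser_dmul hsep (@gauss_f_one s i l) (@gauss_k_one s l)) -(ser_dmul hsep o1 (@gauss_e_one s l j)).
Qed.

Lemma ser_comm s (x : fseries B) : one_sided s x ->
  comm_el (fpsC c) (ser s x) <-> forall m, comm_el c (x m).
Proof.
move=> /one_rangedP x0; split=> [E m|E].
  case/boolP: (in_range 0 s m) => [/expo0P->|/x0->]; last exact: comm_el0.
  by have := congr1 (fun P => fcoef P `|m|) E; rewrite fcoefCM fcoefMC.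
by apply: fpsP => n; rewrite fcoefCM fcoefMC; exact: E.
Qed.

Lemma ser_T1 s i j : exists y, ser s (T s i j) - (i == j)%:R = fpsC h * y.
Proof.
(* The cofactor is read off from [Tser], which carries its factor hbar explicitly; nothing is
   divided by hbar. *)
exists (FPS (fun n => let m := expo 0 s n in
  match s with Pos => if m < 0 then - t i j (- m - 1) else 0 | Neg => t i j (- m - 1) end)).
apply: fpsP => n; rewrite fcoefCM fcoefB /= /Tser expo_eq0.
have -> : fcoef ((i == j)%:R : fps B) n = if n == 0%N then (i == j)%:R else 0.
  by case: (i == j); case: n.
rewrite addrAC subrr add0r; case: (s) => /=; last by [].
by case: ifP => _; rewrite ?mulrN ?mulr0.
Qed.

Lemma gauss_goodT s l : gauss_good (fpsC h) (fpsC c) (fun i j => ser s (f s i j))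
  (fun i j => ser s (e s i j)) (fun i => ser s (k s i)) l.
Proof.
have [_ g0 g1 _] := gauss s.
apply: gauss_goodP => [||i|i|i j ij|i j ji|i j|i j].
- exact: fpsC_central (@hbarC R B).
- exact: fps_geom.
- by have [-> _] := g1 i; rewrite ser_dconst fpsC1.
- by have [_ ->] := g1 i; rewrite ser_dconst fpsC1.
- by have [-> _] := g0 i j ij; apply: fpsP.
- by have [_ ->] := g0 j i ji; apply: fpsP.
- by rewrite ser_T; apply/ser_comm; [exact: Tser_one | exact: cT].
by rewrite ser_T; exact: ser_T1.
Qed.

Lemma gauss_f_comm s i j m : comm_el c (f s i j m).
Proof. by move: m; apply/(ser_comm (@gauss_f_one s i j)); exact: (good_f (gauss_goodT s j) i). Qed.
Lemma gauss_e_comm s i j m : comm_el c (e s i j m).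
Proof. by move: m; apply/(ser_comm (@gauss_e_one s i j)); exact: (good_e (gauss_goodT s i) j). Qed.
Lemma gauss_k_comm s i m : comm_el c (k s i m).
Proof. by move: m; apply/(ser_comm (@gauss_k_one s i)); exact: (good_k (gauss_goodT s i)). Qed.

Lemma k_inv : exists ki : polarity -> 'I_N -> fseries B, forall s i,
  [/\ one_sided s (ki s i), ser s (k s i) * ser s (ki s i) = 1, ser s (ki s i) * ser s (k s i) = 1
    & forall m, comm_el c (ki s i m)].
Proof.
have /boolp.choice[z zP] : forall x : polarity * 'I_N, exists z,
    ser x.1 (k x.1 x.2) * z = 1 /\ z * ser x.1 (k x.1 x.2) = 1.
  by move=> [s i]; exact: (good_inv (gauss_goodT s i)).
exists (fun s i => unser s (z (s, i))) => s i; have [z1 z2] := zP (s, i).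
have o : one_sided s (unser s (z (s, i))) by apply/one_rangedP; exact: unser_ranged.
split; rewrite ?ser_unser //.
apply/(ser_comm o); rewrite ser_unser; apply: (comm_el_inv z1 z2).
exact: (good_k (gauss_goodT s i)).
Qed.

Definition cent_lift (x : fseries B) (xc : forall m, comm_el c (x m)) : int -> cent c :=
  fun m => Cent (asboolT (xc m)).

Notation v := (val : {rmorphism cent c -> B}).

Lemma v_inj : injective (fps_map v). Proof. exact/fps_map_inj/val_inj. Qed.

Lemma comm_c_h : comm_el c h. Proof. exact (esym (hbarC c)). Qed.

Lemma comm_c_q : comm_el c q.
Proof. by rewrite /qc; apply: comm_elM; [exact (esym (scalC _ c)) | ]. Qed.

Definition cent_h : cent c := Cent (asboolT comm_c_h).
Definition cent_q : cent c := Cent (asboolT comm_c_q).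

Lemma cent_hC : central cent_h.
Proof. by move=> x; apply: val_inj; rewrite !rmorphM; exact: hbarC. Qed.

Lemma cent_qC : central cent_q.
Proof.
move=> x; apply: val_inj; rewrite !rmorphM; apply/esym; apply: comm_elM.
  exact (esym (scalC _ (val x))).
exact (esym (asboolW (valP x))).
Qed.

Lemma cent_sep : forall x : cent c, (forall n, exists y, x = cent_h ^+ n * y) -> x = 0.
Proof.
move=> x xh; apply: val_inj; rewrite rmorph0; apply: hsep => n; have [y ->] := xh n.
by exists (val y); rewrite rmorphM rmorphXn.
Qed.

Lemma lift_ranged s x (xc : forall m, comm_el c (x m)) : one_sided s x -> ranged s (cent_lift xc).
Proof. by move=> /one_rangedP x0 m /x0 xm; apply: val_inj; rewrite rmorph0. Qed.

Notation fC s i j := (cent_lift (gauss_f_comm s i j)).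
Notation eC s i j := (cent_lift (gauss_e_comm s i j)).
Notation kC s i := (cent_lift (gauss_k_comm s i)).
Notation TC s i j := (cent_lift (cT s i j)).

Lemma schur_T s i j : schur (fun i j => ser s (fC s i j)) (fun i => ser s (kC s i))
  (fun i j => ser s (eC s i j)) 0 i j = ser s (TC s i j).
Proof.
apply: v_inj; rewrite rmorph_sum -[RHS]/(ser s (T s i j)) -ser_T.
by apply: eq_bigr => l _; rewrite !rmorphM.
Qed.

(** The relation is an identity between coefficients in [B]; the inclusion of the centralizer is
    injective, so it holds there, and there hbar and q are central. *)
Lemma cent_rtt s s' : pair_rel s s' (dpol q s s') ->
  rtt (beta2 cent_h s s' (- dpol cent_q s s')) (beta2 cent_h s s' (dpol cent_q s s')) (eta2 cent_h s s') (fun=> True)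
    (fun i j => inu (schur (fun i j => ser s (fC s i j)) (fun i => ser s (kC s i))
      (fun i j => ser s (eC s i j)) 0 i j))
    (fun i j => fpsC (schur (fun i j => ser s' (fC s' i j)) (fun i => ser s' (kC s' i))
      (fun i j => ser s' (eC s' i j)) 0 i j)).
Proof.
move=> E; rewrite (_ : (fun i j => inu _) = fun i j => inu (ser s (TC s i j))); last first.
  by apply: funext => i; apply: funext => j; rewrite schur_T.
rewrite (_ : (fun i j => fpsC _) = fun i j => fpsC (ser s' (TC s' i j))); last first.
  by apply: funext => i; apply: funext => j; rewrite schur_T.
apply: rtt_ser => [|||| i j k0 l m n]; first exact: cent_hC.
- exact: (dpolC cent_qC).
- by move=> i j; apply: lift_ranged; exact: Tser_one.
- by move=> i j; apply: lift_ranged; exact: Tser_one.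
apply: val_inj; rewrite !(v_Lop v).
have P (b : cent c) (F G : int -> int -> cent c) :
    vmap2 v (fun m n => Lop cent_h b F m n + Hop cent_h G m n) =
    fun m n => Lop h (v b) (vmap2 v F) m n + Hop h (vmap2 v G) m n.
  by apply: funext => m'; apply: funext => n'; rewrite /vmap2 (rmorphD v) v_Lop /Hop rmorphM.
rewrite !P // !vmap2_uv !vmap2_vu !(rmorphD v, rmorphN v, rmorph1 v) v_dpol.
exact: E.
Qed.

Lemma rel_ss s : pair_rel s s (dpol q s s).
Proof. by case: s; exact: rel_same. Qed.

(** Stated for any separated and complete algebra with a family [t] and an element [c] that satisfy
    the cleared relations; the double Yangian enters only as an instance. *)
Lemma gauss_relations :
  let X := X c f e in
  let kinv s i := dinv s (k s i) in
  let q s := sgn_mul s (qc c) in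
  let qq s := sgn_mul s (qc c *+ 2) in
  (forall (s : polarity) (i j : 'I_N),
     k s i \at u2 ** k s j \at v2 = k s j \at v2 ** k s i \at u2) /\
  (forall i : 'I_N,
     k Pos i \at u2 ** k Neg i \at v2 = k Neg i \at v2 ** k Pos i \at u2) /\
  (forall (s : polarity) (i j : 'I_N), (j < i)%N ->
     uv_ratio s (- qq s) (- qq s + 1)
       ** (kinv (opp_pol s) i \at v2 ** k s j \at u2) =
     uv_ratio s (qq s) (qq s + 1)
       ** (k s j \at u2 ** kinv (opp_pol s) i \at v2)) /\
  (forall (s : polarity) (i : 'I_N.-1),
     kinv s (ix i) \at u2 ** X Pos i \at v2 ** k s (ix i) \at u2 =
       uv_ratio s (q s + 1) (q s) ** X Pos i \at v2 /\
     k s (ix i) \at u2 ** X Neg i \at v2 ** kinv s (ix i) \at u2 =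
       uv_ratio s (- q s + 1) (- q s) ** X Neg i \at v2) /\
  (forall (s : polarity) (i : 'I_N.-1),
     kinv s (ixS i) \at u2 ** X Pos i \at v2 ** k s (ixS i) \at u2 =
       uv_ratio s (q s - 1) (q s) ** X Pos i \at v2 /\
     k s (ixS i) \at u2 ** X Neg i \at v2 ** kinv s (ixS i) \at u2 =
       uv_ratio s (- q s - 1) (- q s) ** X Neg i \at v2) /\
  (forall (s : polarity) (i : 'I_N.-1) (j : 'I_N), j != ix i -> j != ixS i ->
     kinv s j \at u2 ** X Pos i \at v2 ** k s j \at u2 = X Pos i \at v2 /\
     k s j \at u2 ** X Neg i \at v2 ** kinv s j \at u2 = X Neg i \at v2) /\
  (forall (s : polarity) (i : 'I_N.-1),
     umv (- sgn_mul s 1) ** (X s i \at u2 ** X s i \at v2) =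
     umv (sgn_mul s 1) ** (X s i \at v2 ** X s i \at u2)) /\
  (forall i j : 'I_N.-1, (j = i.+1 :> nat) ->
     umv 1 ** (X Pos i \at u2 ** X Pos j \at v2) =
       umv 0 ** (X Pos j \at v2 ** X Pos i \at u2) /\
     umv 0 ** (X Neg i \at u2 ** X Neg j \at v2) =
       umv 1 ** (X Neg j \at v2 ** X Neg i \at u2)) /\
  (forall (s : polarity) (i j : 'I_N.-1), `|i%:Z - j%:Z| = 1 ->
     forall d,
     serre (X s i) (X s j) u3 u3' v3 d + serre (X s i) (X s j) u3' u3 v3 d = 0) /\
  (forall (s : polarity) (i j : 'I_N.-1), 1 < `|i%:Z - j%:Z| ->
     X s i \at u2 ** X s j \at v2 = X s j \at v2 ** X s i \at u2) /\
  (forall (i j : 'I_N.-1) d,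
     (X Pos i \at u2 ** X Neg j \at v2) d
       - (X Neg j \at v2 ** X Pos i \at u2) d =
     if i == j then
       hbar (B) *
         ((ddelta (- qq Pos)
             ** (pm_shift c Neg (k Pos (ixS i)) \at u2
                 ** dinv Pos (pm_shift c Neg (k Pos (ix i))) \at u2)) d
          - (ddelta (qq Pos)
               ** (pm_shift c Neg (k Neg (ixS i)) \at v2
                   ** dinv Neg (pm_shift c Neg (k Neg (ix i))) \at v2)) d)
     else 0).
Proof.
lazy zeta.
have [ki kiP] := k_inv.
have ki1 s i : one_sided s (ki s i) by have [] := kiP s i.
have kic s i m : comm_el c (ki s i m) by have [] := kiP s i.
pose kiC s i := cent_lift (kic s i).
have G s : gauss_mx (fun i j => ser s (fC s i j)) (fun i => ser s (kC s i))
    (fun i => ser s (kiC s i)) (fun i j => ser s (eC s i j)).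
  have [_ g0 g1 _] := gauss s; have [i1 i2] := (fun i => let: And4 _ a _ _ := kiP s i in a,
    fun i => let: And4 _ _ a _ := kiP s i in a).
  split=> [i|i|i j ij|i j ij|i|i]; apply: v_inj.
  - rewrite rmorph1 -[LHS]/(ser s (f s i i)); have [-> _] := g1 i.
    by rewrite ser_dconst fpsC1.
  - rewrite rmorph1 -[LHS]/(ser s (e s i i)); have [_ ->] := g1 i.
    by rewrite ser_dconst fpsC1.
  - rewrite rmorph0 -[LHS]/(ser s (f s i j)); have [-> _] := g0 i j ij.
    exact: fpsP.
  - rewrite rmorph0 -[LHS]/(ser s (e s i j)); have [_ ->] := g0 j i ij.
    exact: fpsP.
  - by rewrite rmorphM rmorph1; exact: i1.
  by rewrite rmorphM rmorph1; exact: i2.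
have fr s i j := lift_ranged (gauss_f_comm s i j) (@gauss_f_one s i j).
have er s i j := lift_ranged (gauss_e_comm s i j) (@gauss_e_one s i j).
have kr s i := lift_ranged (gauss_k_comm s i) (@gauss_k_one s i).
have kir s i := lift_ranged (kic s i) (@ki1 s i).
have rs s := cent_rtt (rel_ss s).
have rPN := @cent_rtt Pos Neg rel_PN.
have vh : v cent_h = h by [].
have vq : v cent_q = q by [].
have kinvE s i : dinv s (k s i) = ki s i.
  by have [_ a b _] := kiP s i; exact: (dinvE hsep (@gauss_k_one s i) (@ki1 s i) a b).
refine (conj _ (conj _ (conj _ (conj _ (conj _ (conj _ (conj _ (conj _ (conj _ (conj _ _)))))))))).
- move=> s i j; exact: (k_commute hsep v cent_hC cent_qC cent_sep kr G rs rPN s i j).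
- move=> i; exact: (k_opposite_diag hsep v cent_hC cent_qC cent_sep kr G rs rPN i).
- move=> s i j ji; rewrite kinvE.
  exact: (k_opposite hsep hcomp cent_hC cent_qC cent_sep kr kir G rs rPN vh vq s ji).
- move=> s i; rewrite kinvE -vq.
  exact: (X_conj_k hsep hcomp cent_hC cent_qC cent_sep fr er kr kir G rs rPN vh vq s i).
- move=> s i; rewrite kinvE -vq.
  exact: (X_conj_kS hsep hcomp cent_hC cent_qC cent_sep fr er kr kir G rs rPN vh vq s i).
- move=> s i j ji jS; rewrite kinvE.
  exact: (X_conj_far hsep hcomp cent_hC cent_qC cent_sep fr er kr kir G rs rPN vq s ji jS).
- move=> s i; exact: (X_quadratic hsep hcomp cent_hC cent_qC cent_sep fr er G rs rPN vh vq s i).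
- move=> i j ij; exact: (X_adjacent hsep hcomp cent_hC cent_qC cent_sep fr er G rs rPN vh vq ij).
- move=> s i j ij; exact: (X_serre hsep hcomp cent_hC cent_qC cent_sep fr er G rs rPN vq s ij).
- move=> s i j ij; exact: (X_far hsep hcomp cent_hC cent_qC cent_sep fr er kr G rs rPN vq s ij).
move=> i j d; exact: (X_commutator hsep hcomp cent_hC cent_qC cent_sep fr er kr kir G rs rPN vh vq i j d).
Qed.
End Assembly.

(** * The defining relations in the quotient *)

Section QuotientPair.
Variables (R : realType) (B : halg R) (I : hideal B) (N : nat).
Hypotheses (hsep : hseparated B) (hcomp : hcomplete B).
Variables (t : 'I_N -> 'I_N -> int -> B) (c : B).
Notation pi x := (hpi I x : hquot_halg I).
Notation tq := (fun i j k => pi (t i j k)).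

Lemma quot_pair_rel s s' (b : B) :
  (forall x y d, I (RTT_lhs t s s' (- b) x y d - RTT_rhs t s s' b x y d)) ->
  (forall s i j m, comm_el (pi b) (Tser tq s i j m)) -> pair_rel tq s s' (pi b).
Proof.
move=> rel bT; have bb : comm_el (pi b) (pi (- b)) by rewrite piN /comm_el mulrN mulNr.
by have := quot_pair hsep hcomp rel bb bT; rewrite piN.
Qed.

Hypothesis rel_c : forall x, relator t c x -> I x.

Lemma quot_cT s i j m : comm_el (pi c) (Tser tq s i j m).
Proof. by apply: quot_comm; apply: rel_c; exact: rel_central. Qed.

Lemma quot_same s : pair_rel tq s s 0.
Proof.
have rel x y d : I (RTT_lhs t s s (- 0) x y d - RTT_rhs t s s 0 x y d).
  by rewrite oppr0; apply: rel_c; exact: rel_RTT.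
have := quot_pair_rel rel; rewrite pi0; apply=> s' i j m.
by rewrite /comm_el mul0r mulr0.
Qed.

Lemma pi_qc : pi (qc c *+ 2) = qc (pi c) *+ 2.
Proof. by rewrite !mulr2n piD; congr (_ + _); rewrite piM. Qed.

Lemma quot_PN : pair_rel tq Pos Neg (qc (pi c) *+ 2).
Proof.
rewrite -pi_qc; apply: quot_pair_rel => [x y d|s i j m].
  by apply: rel_c; exact: rel_RTT_mixed.
have qT : comm_el (qc (pi c)) (Tser tq s i j m).
  apply/esym; apply: comm_elM; [exact (esym (scalC _ _)) | exact (esym (quot_cT s i j m))].
by rewrite pi_qc mulr2n; apply/esym; apply: comm_elD; exact: esym.
Qed.
End QuotientPair.

Theorem theorem3p3 (R : realType) (N : nat) (hN : (2 <= N)%N)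
    (f e : polarity -> 'I_N -> 'I_N -> fseries (DY R N))
    (k : polarity -> 'I_N -> fseries (DY R N))
    (gauss : forall s, is_gauss (@DYt R N) s (f s) (k s) (e s)) :
  let c := DYc R N in
  let X := X c f e in
  let kinv s i := dinv s (k s i) in
  (* u_(+-) = u + hbar * q (+-) and u_(+-) - v_(-+) = u - v + hbar * qq (+-) *)
  let q s := sgn_mul s (qc c) in
  let qq s := sgn_mul s (qc c *+ 2) in
  (forall (s : polarity) (i j : 'I_N),
     k s i \at u2 ** k s j \at v2 = k s j \at v2 ** k s i \at u2) /\
  (forall i : 'I_N,
     k Pos i \at u2 ** k Neg i \at v2 = k Neg i \at v2 ** k Pos i \at u2) /\
  (forall (s : polarity) (i j : 'I_N), (j < i)%N ->
     uv_ratio s (- qq s) (- qq s + 1)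
       ** (kinv (opp_pol s) i \at v2 ** k s j \at u2) =
     uv_ratio s (qq s) (qq s + 1)
       ** (k s j \at u2 ** kinv (opp_pol s) i \at v2)) /\
  (forall (s : polarity) (i : 'I_N.-1),
     kinv s (ix i) \at u2 ** X Pos i \at v2 ** k s (ix i) \at u2 =
       uv_ratio s (q s + 1) (q s) ** X Pos i \at v2 /\
     k s (ix i) \at u2 ** X Neg i \at v2 ** kinv s (ix i) \at u2 =
       uv_ratio s (- q s + 1) (- q s) ** X Neg i \at v2) /\
  (forall (s : polarity) (i : 'I_N.-1),
     kinv s (ixS i) \at u2 ** X Pos i \at v2 ** k s (ixS i) \at u2 =
       uv_ratio s (q s - 1) (q s) ** X Pos i \at v2 /\
     k s (ixS i) \at u2 ** X Neg i \at v2 ** kinv s (ixS i) \at u2 =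
       uv_ratio s (- q s - 1) (- q s) ** X Neg i \at v2) /\
  (forall (s : polarity) (i : 'I_N.-1) (j : 'I_N), j != ix i -> j != ixS i ->
     kinv s j \at u2 ** X Pos i \at v2 ** k s j \at u2 = X Pos i \at v2 /\
     k s j \at u2 ** X Neg i \at v2 ** kinv s j \at u2 = X Neg i \at v2) /\
  (forall (s : polarity) (i : 'I_N.-1),
     umv (- sgn_mul s 1) ** (X s i \at u2 ** X s i \at v2) =
     umv (sgn_mul s 1) ** (X s i \at v2 ** X s i \at u2)) /\
  (forall i j : 'I_N.-1, (j = i.+1 :> nat) ->
     umv 1 ** (X Pos i \at u2 ** X Pos j \at v2) =
       umv 0 ** (X Pos j \at v2 ** X Pos i \at u2) /\
     umv 0 ** (X Neg i \at u2 ** X Neg j \at v2) =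
       umv 1 ** (X Neg j \at v2 ** X Neg i \at u2)) /\
  (forall (s : polarity) (i j : 'I_N.-1), `|i%:Z - j%:Z| = 1 ->
     forall d,
     serre (X s i) (X s j) u3 u3' v3 d + serre (X s i) (X s j) u3' u3 v3 d = 0) /\
  (forall (s : polarity) (i j : 'I_N.-1), 1 < `|i%:Z - j%:Z| ->
     X s i \at u2 ** X s j \at v2 = X s j \at v2 ** X s i \at u2) /\
  (forall (i j : 'I_N.-1) d,
     (X Pos i \at u2 ** X Neg j \at v2) d
       - (X Neg j \at v2 ** X Pos i \at u2) d =
     if i == j then
       hbar (DY R N) *
         ((ddelta (- qq Pos)
             ** (pm_shift c Neg (k Pos (ixS i)) \at u2
                 ** dinv Pos (pm_shift c Neg (k Pos (ix i))) \at u2)) d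
          - (ddelta (qq Pos)
               ** (pm_shift c Neg (k Neg (ixS i)) \at v2
                   ** dinv Neg (pm_shift c Neg (k Neg (ix i))) \at v2)) d)
     else 0).
Proof.
have rel := @sub_gen_ideal R (hfree R N) (relator (fun i j k => hgen R (Some (i, j, k))) (hgen R None)).
have fs := @hfree_sep R N; have fc := @hfree_comp R N.
exact: (gauss_relations (@DY_sep R N) (@DY_comp R N)
  (quot_cT rel) (quot_same fs fc rel) (quot_PN fs fc rel) gauss).
Qed.
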